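(* Assume that the exponential family model $V(\cdot;\boldsymbol\theta)=\boldsymbol\theta^T\boldsymbol v(\cdot)$, $\boldsymbol\theta\in\boldsymbol\Theta$, satisfies: [Mod] there are constants $K\ge 0$, $D\ge 0$, $\kappa_i^{(\sup)}\ge 0$ and $k_i\in\mathbb N$ ($i=1,\dots,p$) such that for all $\boldsymbol\theta\in\boldsymbol\Theta$ and all $(m,\varphi)\in\mathbb M\times\Omega_f$: (stability) $V(0^m|\varphi;\boldsymbol\theta)\ge -K$; (locality) $V(0^m|\varphi;\boldsymbol\theta)=V(0^m|\varphi_{\mathcal B(0,D)};\boldsymbol\theta)$; (integrability) $v_i(0^m|\varphi)\le \kappa_i^{(\sup)}|\varphi_{\mathcal B(0,D)}|^{k_i}$ for $i=1,\dots,p$; [Ident] there exist $\ell\ge p$, events $A_1,\dots,A_\ell$ of $\Omega$ and events $A_1^{\mathrm m},\dots,A_\ell^{\mathrm m}$ in $\mathcal M$ such that the $\ell$ events $B_j:=A_j^{\mathrm m}\times A_j$ are disjoint, satisfy $\lambda^{\mathrm m}\otimes P_{\boldsymbol\theta^\star}(B_j)>0$, and for all $((m_1,\varphi_1),\dots,(m_\ell,\varphi_\ell))\in B_1\times\cdots\times B_\ell$ the $\ell\times p$ matrix with entries $v_j(0^{m_i}|\varphi_i)$ ($i=1,\dots,\ell$, $j=1,\dots,p$) is injective. Then, for $P_{\boldsymbol\theta^\star}$-almost every $\varphi$, the maximum pseudolikelihood estimate $\widehat{\boldsymbol\theta}_n(\varphi)$ converges to $\boldsymbol\theta^\star$ as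 $n\to+\infty$.
   Context: **Configurations.** $(\mathbb M,\mathcal M,\lambda^{\mathrm m})$ is a probability space of marks, $\mathbb S=\mathbb R^2\times\mathbb M$, $\lambda^2$ is Lebesgue measure on $\mathbb R^2$, $\mu=\lambda^2\otimes\lambda^{\mathrm m}$, $\mathcal B_b^2$ is the set of bounded Borel sets of $\mathbb R^2$, and $|\Lambda|=\lambda^2(\Lambda)$ for a Borel set $\Lambda\subset\mathbb R^2$. Write $x^m=(x,m)$. $\widetilde\Omega$ is the set of locally finite configurations of marked points $\varphi=\{x_i^{m_i}\}_{i\in I}$ ($I\subset\mathbb N$), identified with counting measures $\sum_{i}\delta_{x_i^{m_i}}$ on $\mathbb S$, with the $\sigma$-algebra $\mathcal F$ generated by the counts of points in bounded sets. $|\varphi|$ is the number of points of $\varphi$, $\widetilde\Omega_f$ the set of finite configurations, $\varphi_\Lambda$ the restriction of $\varphi$ to $\Lambda\times\mathbb M$, $\widetilde\Omega_\Lambda$ the configurations in $\Lambda\times\mathbb M$. $\Lambda^c$ is the complement of $\Lambda$ in $\mathbb R^2$ and $\mathcal F_{\Lambda^c}$ is the $\sigma$-algebra generated by $\varphi\mapsto\varphi_{\Lambda^c}$. $\mathcal B(x,r)$ is the ball of $\mathbb R^2$ with center $x$ and radius $r$. **Energy.** $\boldsymbol\Theta\subset\mathbb R^p$ is compact. For finite configurations the energy is translation invariant and of exponential family form $V(\varphi;\boldsymbol\theta)=\boldsymbol\theta^T\boldsymbol v(\varphi)$, with $\boldsymbol v=(v_1,\dots,v_p)$ the vector of sufficient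 statistics. The local energy is $V(\psi|\varphi;\boldsymbol\theta)=V(\psi\cup\varphi;\boldsymbol\theta)-V(\varphi;\boldsymbol\theta)$; for $\psi=\{x^m\}$ it is written $V(x^m|\varphi;\boldsymbol\theta)=\boldsymbol\theta^T\boldsymbol v(x^m|\varphi)$ with $\boldsymbol v(x^m|\varphi)=(v_1(x^m|\varphi),\dots,v_p(x^m|\varphi)):=\boldsymbol v(\varphi\cup\{x^m\})-\boldsymbol v(\varphi)$. For infinite $\varphi$ these quantities are understood via locality: $\boldsymbol v(x^m|\varphi)=\boldsymbol v(x^m|\varphi_{\mathcal B(x,D)})$ and likewise for $V$; $V(\psi|\varphi;\boldsymbol\theta)$ with $\psi$ finite is obtained by adding the points of $\psi$ one at a time. **Gibbs measures.** For $\Lambda\in\mathcal B_b^2$, $Q_\Lambda$ is the law on $\Lambda\times\mathbb M$ of the Poisson process with intensity measure $\mu$. The local specification is $$\Pi_\Lambda(\varphi,F)=\Big\{\tfrac1{Z_\Lambda(\varphi)}\int_{\widetilde\Omega_\Lambda}e^{-V(\psi|\varphi_{\Lambda^c};\boldsymbol\theta)}1_F(\psi\cup\varphi_{\Lambda^c})Q_\Lambda(d\psi)\Big\}1_{R_\Lambda}(\varphi),\quad Z_\Lambda(\varphi)=\int_{\widetilde\Omega_\Lambda}e^{-V(\psi|\varphi_{\Lambda^c};\boldsymbol\theta)}Q_\Lambda(d\psi),$$ with $R_\Lambda=\{\varphi\in\widetilde\Omega:0<Z_\Lambda(\varphi)<+\infty\}$. The admissible configurations are $\Omega=\bigcap_{\Lambda\in\mathcal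 B_b^2}R_\Lambda$, and $\Omega_f=\Omega\cap\widetilde\Omega_f$. A Gibbs measure is a probability measure $P$ with $P(F|\mathcal F_{\Lambda^c})(\varphi)=\Pi_\Lambda(\varphi,F)$ for $P$-a.e. $\varphi$, for all $\Lambda\in\mathcal B_b^2$ and $F\in\mathcal F$ (DLR equations). **Data and estimator.** The true parameter $\boldsymbol\theta^\star$ is an interior point of $\boldsymbol\Theta$, and $P_{\boldsymbol\theta^\star}$ is a stationary Gibbs measure for the energy $V(\cdot;\boldsymbol\theta^\star)$. The process is observed in $\Lambda_n\oplus D^\vee=\bigcup_{x\in\Lambda_n}\mathcal B(x,D^\vee)$ for some $D^\vee\ge D$, where, for a fixed $\widetilde D>0$, $\Lambda_n=\bigcup_{i\in I_n}\Delta_i(\widetilde D)$ with $I_n=\{i\in\mathbb Z^2:\max(|i_1|,|i_2|)\le n\}$ and $\Delta_i(d)=\{z\in\mathbb R^2: d(i_j-\tfrac12)\le z_j\le d(i_j+\tfrac12),\ j=1,2\}$. The log-pseudolikelihood is $$LPL_\Lambda(\varphi;\boldsymbol\theta)=-\int_{\Lambda\times\mathbb M}e^{-V(x^m|\varphi;\boldsymbol\theta)}\mu(dx^m)-\sum_{x^m\in\varphi_\Lambda}V(x^m|\varphi\setminus x^m;\boldsymbol\theta),$$ and the maximum pseudolikelihood estimate is $\widehat{\boldsymbol\theta}_n(\varphi)=\arg\max_{\boldsymbol\theta\in\boldsymbol\Theta}LPL_{\Lambda_n}(\varphi;\boldsymbol\theta)$ (a maximizer over $\boldsymbol\Theta$).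 *)

(* Defs.v *)
From HB Require Import structures.
From mathcomp Require Import all_boot all_order all_algebra finmap.
From mathcomp Require Import all_classical all_reals all_analysis.
From mathcomp Require Import measurable_realfun.
From mathcomp Require Import ring lra.
Import Order.TTheory GRing.Theory Num.Theory numFieldNormedType.Exports.

Set Implicit Arguments.
Unset Strict Implicit.
Unset Printing Implicit Defensive.

Local Open Scope classical_set_scope.
Local Open Scope ring_scope.

Notation plane R := (measurableTypeR R * measurableTypeR R)%type.

Section plane.
Context {R : realType}.
Implicit Types (x y : plane R) (r : R) (L : set (plane R)).

Definition origin : plane R := (0 : R, 0 : R).

Definition shift x y : plane R := ((y.1 : R) + x.1, (y.2 : R) + x.2).

(* The closed Euclidean ball: the norm of the library on a product is the
   maximum norm. *)
Definition eball x r : set (plane R) :=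
  [set y | Num.sqrt (((y.1 : R) - x.1) ^+ 2 + ((y.2 : R) - x.2) ^+ 2) <= r].

Definition bounded_borel L := measurable L /\ exists r, L `<=` eball origin r.

Definition lebesgue2 : {measure set (plane R) -> \bar R} :=
  (@lebesgue_measure R \x @lebesgue_measure R)%E.

(* The closed square of centre d i and side d. *)
Definition cell (d : R) (i : int * int) : set (plane R) :=
  [set z : plane R |
    d * (i.1%:~R - 2^-1) <= (z.1 : R) <= d * (i.1%:~R + 2^-1) /\
    d * (i.2%:~R - 2^-1) <= (z.2 : R) <= d * (i.2%:~R + 2^-1)].

Definition window (d : R) (n : nat) : set (plane R) :=
  \bigcup_(i in [set i : int * int | Num.max `|i.1| `|i.2| <= n%:Z]) cell d i.

End plane.

Section config.
Context {R : realType} {dM : measure_display} {M : measurableType dM}.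

Local Notation mpoint := (plane R * M)%type.

Definition locally_finite (A : set mpoint) :=
  forall r, finite_set (A `&` (eball origin r `*` setT)).

(* Configurations are locally finite sets of marked points, so they are simple
   point measures.  This excludes nothing: the intensity measure has no atoms,
   hence a Gibbs measure gives mass zero to multiple points. *)
Record config : Type := Config { pts : set mpoint ; _ : locally_finite pts }.

Lemma pts_locally_finite (phi : config) : locally_finite (pts phi).
Proof. by case: phi. Qed.

Implicit Types (phi psi : config) (L : set (plane R)) (B : set mpoint).

Lemma locally_finite_sub (A B : set mpoint) :
  A `<=` B -> locally_finite B -> locally_finite A.
Proof. by move=> AB fB r; apply: sub_finite_set (fB r); exact: setSI. Qed.

Lemma locally_finiteU (A B : set mpoint) :
  locally_finite A -> locally_finite B -> locally_finite (A `|` B).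
Proof. by move=> fA fB r; rewrite setIUl finite_setU; split. Qed.

Lemma finite_locally_finite (A : set mpoint) : finite_set A -> locally_finite A.
Proof. by move=> fA r; exact: sub_finite_set fA. Qed.

Definition cempty : config := Config (finite_locally_finite (@finite_set0 _)).

Definition csingle (z : mpoint) : config :=
  Config (finite_locally_finite (finite_set1 z)).

Definition cunion psi phi : config :=
  Config (locally_finiteU (@pts_locally_finite psi) (@pts_locally_finite phi)).

Lemma locally_finite_restr phi L : locally_finite (pts phi `&` (L `*` setT)).
Proof.
by apply: locally_finite_sub (@pts_locally_finite phi); exact: subIsetl.
Qed.

Definition restr L phi : config := Config (@locally_finite_restr phi L).

Lemma locally_finite_remove phi (z : mpoint) :
  locally_finite (pts phi `\` [set z]).
Proof.
by apply: locally_finite_sub (@pts_locally_finite phi); exact: subDsetl.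
Qed.

Definition cremove phi z : config := Config (@locally_finite_remove phi z).

Definition mshift (a : plane R) (z : mpoint) : mpoint := (shift a z.1, z.2).

Lemma eball_shift (a x : plane R) (r : R) : eball origin r (shift a x) ->
  eball origin (r + (`|a.1 : R| + `|a.2 : R|)) x.
Proof.
case: a x => a1 a2 [x1 x2]; rewrite /eball /shift /origin /= !subr0 => h.
set s := Num.sqrt _ in h.
have s0 : 0 <= s by exact: sqrtr_ge0.
have sE : s ^+ 2 = (x1 + a1) ^+ 2 + (x2 + a2) ^+ 2.
  by rewrite sqr_sqrtr// addr_ge0// sqr_ge0.
set t := `|a1| + `|a2|.
have t0 : 0 <= t by rewrite addr_ge0.
apply: (@le_trans _ _ (s + t)); last by rewrite lerD2r.
rewrite -[leRHS](@ger0_norm _ (s + t)) ?addr_ge0// -sqrtr_sqr.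
apply: ler_wsqrtr.
have u0 : `|x1 + a1| <= s.
  by rewrite -[s]ger0_norm// -sqrtr_sqr -sqrtr_sqr ler_wsqrtr// sE lerDl sqr_ge0.
have w0 : `|x2 + a2| <= s.
  by rewrite -[s]ger0_norm// -sqrtr_sqr -sqrtr_sqr ler_wsqrtr// sE lerDr sqr_ge0.
have ha1 : - ((x1 + a1) * a1) <= s * `|a1|.
  by apply: le_trans (ler_norm _) _; rewrite normrN normrM ler_wpM2r.
have ha2 : - ((x2 + a2) * a2) <= s * `|a2|.
  by apply: le_trans (ler_norm _) _; rewrite normrN normrM ler_wpM2r.
have n1 : `|a1| ^+ 2 = a1 ^+ 2 by rewrite -normrX ger0_norm// sqr_ge0.
have n2 : `|a2| ^+ 2 = a2 ^+ 2 by rewrite -normrX ger0_norm// sqr_ge0.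
have n3 : 0 <= `|a1| * `|a2| by rewrite mulr_ge0.
have -> : x1 ^+ 2 + x2 ^+ 2 = s ^+ 2 + 2 * (- ((x1 + a1) * a1))
    + 2 * (- ((x2 + a2) * a2)) + `|a1| ^+ 2 + `|a2| ^+ 2.
  by rewrite sE n1 n2; ring.
have -> : (s + t) ^+ 2 = s ^+ 2 + 2 * (s * `|a1|) + 2 * (s * `|a2|)
    + `|a1| ^+ 2 + `|a2| ^+ 2 + 2 * (`|a1| * `|a2|) by rewrite /t; ring.
lra.
Qed.

Lemma locally_finite_translate phi (a : plane R) :
  locally_finite (mshift a @` pts phi).
Proof.
move=> r; apply: (@sub_finite_set _ _ (mshift a @`
   (pts phi `&` (eball origin (r + (`|a.1 : R| + `|a.2 : R|)) `*` setT)))).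
  move=> _ [[z phiz <-]] [/= zr _]; exists z => //; split=> //; split=> //.
  exact: eball_shift zr.
by apply: finite_image; exact: pts_locally_finite.
Qed.

Definition translate (a : plane R) phi : config :=
  Config (@locally_finite_translate phi a).

Definition npts phi B : nat := #|` fset_set (pts phi `&` B)|.

Definition config_events : set (set config) :=
  <<s [set A | exists B k, [/\ measurable B,
         exists r, B `<=` eball origin r `*` setT &
         A = [set phi | npts phi B = k]] ] >>.

HB.instance Definition _ := gen_eqMixin config.
HB.instance Definition _ := gen_choiceMixin config.
HB.instance Definition _ := isPointed.Build config cempty.

Let config_events0 : config_events set0.
Proof. exact: sigma_algebra0. Qed.

Let config_eventsC A : config_events A -> config_events (~` A).
Proof. exact: sigma_algebraC. Qed.

Let config_eventsU (F : (set config)^nat) :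
  (forall i, config_events (F i)) -> config_events (\bigcup_i F i).
Proof. exact: sigma_algebra_bigcup. Qed.

Definition config_display : measure_display.
Proof. by constructor. Qed.

HB.instance Definition _ := @isMeasurable.Build config_display config
  config_events config_events0 config_eventsC config_eventsU.

Definition finite_config : set config := [set phi | finite_set (pts phi)].

Definition configs_in L : set config :=
  [set phi | pts phi `<=` L `*` setT].

End config.
Arguments config R {dM} M.

Section gibbs.
Context {R : realType} {dM : measure_display} {M : measurableType dM}.
Variables (lm : probability M R) (p : nat) (v : config R M -> 'rV[R]_p).
Implicit Types (phi psi : config R M) (L : set (plane R)) (theta : 'rV[R]_p).

Definition intensity : {measure set (plane R * M) -> \bar R} :=
  (@lebesgue2 R \x lm)%E.

(* The law of the Poisson process on L x M.  Intersecting with L x M in the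
   rates also says that there is no point outside L x M.  The probability mass
   function is written out because poisson_pmf is not one at rate 0. *)
Definition poisson_law L (Q : probability (config R M) R) :=
  forall n (B : 'I_n -> set (plane R * M)) (k : 'I_n -> nat),
    (forall i, measurable (B i)) ->
    (forall i, exists r, B i `<=` eball origin r `*` setT) ->
    trivIset setT B ->
    let rate i := fine (intensity (B i `&` (L `*` setT))) in
    Q (\bigcap_(i in setT) [set phi | npts phi (B i) = k i]) =
      (\prod_(i < n) (rate i ^+ k i / (k i)`!%:R * expR (- rate i)))%:E.

(* v, energy, local_stat and local_energy are only meaningful on finite
   configurations: the values of v elsewhere are never used. *)
Definition energy theta phi : R := \sum_(i < p) theta ord0 i * v phi ord0 i.

Definition local_stat psi phi : 'rV[R]_p := v (cunion psi phi) - v phi.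

Definition local_energy theta psi phi : R :=
  energy theta (cunion psi phi) - energy theta phi.

(* The part of phi seen from psi, for an energy of range D.  For infinite phi
   only the points within distance D of psi enter the increments obtained by
   adding the points of psi one at a time; phi is thus replaced by this finite
   configuration, for which the increments telescope to local_energy.  For psi
   reduced to one point x this is the restriction of phi to the ball of centre x
   and radius D. *)
Definition halo (D : R) psi : set (plane R) :=
  \bigcup_(z in pts psi) eball z.1 D.

Definition visible (D : R) psi phi : config R M :=
  if `[< finite_config phi >] then phi else restr (halo D psi) phi.

Definition stat_given D psi phi : 'rV[R]_p :=
  local_stat psi (visible D psi phi).

Definition energy_given D theta psi phi : R :=
  local_energy theta psi (visible D psi phi).

Section specification.
Variables (Q : set (plane R) -> probability (config R M) R).
Variables (D : R) (theta : 'rV[R]_p).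

Definition boltzmann L phi psi : R :=
  expR (- energy_given D theta psi (restr (~` L) phi)).

Definition partition_function L phi : \bar R :=
  (\int[Q L]_(psi in configs_in L) (boltzmann L phi psi)%:E)%E.

Definition regular L : set (config R M) :=
  [set phi | (0 < partition_function L phi < +oo)%E].

Definition specification L phi (F : set (config R M)) : \bar R :=
  ((((fine (partition_function L phi))^-1)%:E *
    \int[Q L]_(psi in configs_in L)
      (boltzmann L phi psi * \1_F (cunion psi (restr (~` L) phi)))%:E) *
   (\1_(regular L) phi)%:E)%E.

Definition admissible : set (config R M) :=
  [set phi | forall L, bounded_borel L -> regular L phi].

Definition outside_events L : set (set (config R M)) :=
  g_sigma_algebra_preimage (restr (~` L)).

Definition cond_prob (P : probability (config R M) R)
    (G : set (set (config R M))) (F : set (config R M))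
    (g : config R M -> \bar R) :=
  (forall B : set (\bar R), measurable B -> G (g @^-1` B)) /\
  (forall A, G A -> (\int[P]_(phi in A) g phi = P (F `&` A))%E).

Definition gibbs (P : probability (config R M) R) :=
  forall L F, bounded_borel L -> measurable F ->
    exists g, cond_prob P (outside_events L) F g /\
      {ae P, forall phi, g phi = specification L phi F}.

End specification.

Definition stationary (P : probability (config R M) R) :=
  forall a (F : set (config R M)), measurable F ->
    P (translate a @^-1` F) = P F.

Definition translation_invariant (Theta : set 'rV[R]_p) :=
  forall theta a phi, Theta theta -> finite_config phi ->
    energy theta (translate a phi) = energy theta phi.

Definition at_origin (m : M) : config R M := csingle (origin, m).

Definition model_condition (Theta : set 'rV[R]_p) (Adm : set (config R M))
    (D : R) :=
  exists (K : R) (kappa : 'I_p -> R) (k : 'I_p -> nat),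
    [/\ 0 <= K, forall i, 0 <= kappa i &
    forall theta m phi, Theta theta -> Adm phi -> finite_config phi ->
      [/\ - K <= local_energy theta (at_origin m) phi,
          local_energy theta (at_origin m) phi =
            local_energy theta (at_origin m) (restr (eball origin D) phi) &
          forall i, local_stat (at_origin m) phi ord0 i <=
            kappa i * (npts phi (eball origin D `*` setT))%:R ^+ k i]].

Definition identifiability (Adm : set (config R M)) (D : R)
    (P : probability (config R M) R) :=
  exists l (A : 'I_l -> set (config R M)) (Am : 'I_l -> set M),
    [/\ (p <= l)%N,
        (forall j, [/\ measurable (A j), A j `<=` Adm & measurable (Am j)]),
        trivIset setT (fun j => Am j `*` A j),
        (forall j, (0 < (lm \x P) (Am j `*` A j))%E) &
        forall (m : 'I_l -> M) (phi : 'I_l -> config R M),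
          (forall i, (Am i `*` A i) (m i, phi i)) ->
          injective (fun y : 'cV[R]_p =>
            (\matrix_(i < l, j < p)
               stat_given D (at_origin (m i)) (phi i) ord0 j) *m y)].

Definition log_pseudolikelihood D L phi theta : \bar R :=
  (- (\int[intensity]_(z in L `*` setT)
        (expR (- energy_given D theta (csingle z) phi))%:E)
   - (\sum_(z \in pts (restr L phi))
        energy_given D theta (csingle z) (cremove phi z))%:E)%E.

Definition maximizes_lpl (Theta : set 'rV[R]_p) D L phi theta :=
  Theta theta /\ forall theta', Theta theta' ->
    (log_pseudolikelihood D L phi theta' <= log_pseudolikelihood D L phi theta)%E.

End gibbs.

(* Main.v *)
Require Import Defs.
From HB Require Import structures.
From mathcomp Require Import all_boot all_order all_algebra finmap.
From mathcomp Require Import all_classical all_reals all_analysis.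
From mathcomp Require Import measurable_realfun.
From mathcomp Require Import ring lra zify.
Import Order.TTheory GRing.Theory Num.Theory numFieldNormedType.Exports.

(** The idea is that of the classical consistency proofs for minimum contrast
    estimators. Write [theta = thetastar + delta] and let [s] be the increment
    of the sufficient statistics at a marked point. The convexity gap
    [expR (- x) - 1 + x], taken at [x = dot delta s], is bounded below by a
    square as long as [delta] is bounded (expR_quad_lower). Comparing the
    pseudolikelihood at [theta] and at [thetastar], cell by cell, therefore
    leaves two terms: a linear one, [delta] times the sum over the cells of the
    innovations, that is of the observed increments minus their conditional
    expectations; and a quadratic one, the integral over the cells of the
    square of a damped version of [dot delta s] (cell_energy_lower, lpl_cells).
    For a maximizer the quadratic term is at most the linear one
    (maximizer_bound). The averages of the innovations tend to zero, and the
    averages of the quadratic term stay above a quadratic form [floor_quad] in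
    [delta] that is positive away from zero by identifiability; since the
    parameter set is compact, [delta] tends to zero (compact_cvg_to_zero).

    The Gibbs measure is stationary but possibly not ergodic, so the averages
    are not compared with expectations: each one is compared with the average
    of conditional expectations given the outside of a window. The differences
    are uncorrelated at distant cells, so the second moment of their mean over a
    square of side [n] is of order [n ^- 2], which is summable: the means tend
    to zero almost surely (square_lln, cell_lln). For the innovations the
    conditional expectation is given by the equation of Georgii, Nguyen and
    Zessin (gnz), a consequence of the DLR equations and of the
    Slivnyak--Mecke formula (mecke). For the quadratic term the conditional
    expectation is bounded below by a constant: the annulus around the cell is
    resampled empty with a density bounded below, and then the outside has no
    influence (floor_weight, resample_lower). Identifiability, which speaks of
    marks at the origin, is moved to the whole cell by stationarity and shows
    that this constant is positive (degenerate_direction, floor_quad_gt0).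

    Stability and locality are only assumed for finite admissible
    configurations, whereas they are applied to finite parts of an infinite
    typical configuration. That almost every configuration has all its finite
    parts admissible (P_tame) is the other half of the proof. Almost surely the
    configuration is infinite (P_infinite), by recurrence under translations;
    then the energy given the outside only involves a halo. Resampling a
    subregion of a window whose surroundings are empty must preserve the finite
    volume law on that window, and this forces the energy to be local, almost
    surely (ae_local). Hence a finite part of an admissible configuration of
    the support has finite partition functions (Adm_tame). Identifiability
    provides admissible configurations with positive probability, and a last
    recurrence argument extends the conclusion to almost every configuration
    (patch_tame). The stationary translates and the positivity of the Poisson
    probabilities of empty regions carry these steps. *)

Set Implicit Arguments.
Unset Strict Implicit.
Unset Printing Implicit Defensive.

Local Open Scope classical_set_scope.
Local Open Scope ring_scope.
Local Notation shift := Defs.shift.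

(** * Integration of nonnegative functions *)

Section nonneg_induction.
Context d (T : measurableType d) (R : realType).
Local Open Scope ereal_scope.
Import HBNNSimple.

(** The monotone class argument for functions: a property of nonnegative
    measurable functions is checked on indicators and extended by linearity
    and monotone limits. *)
Lemma ge0_measurable_ind (Pr : (T -> \bar R) -> Prop) :
  (forall A, measurable A -> Pr (fun x => (\1_A x)%:E)) ->
  (forall (f g : T -> \bar R) (c : R), (0 <= c)%R ->
     (forall x, 0 <= f x) -> (forall x, 0 <= g x) ->
     measurable_fun setT f -> measurable_fun setT g ->
     Pr f -> Pr g -> Pr (fun x => c%:E * f x + g x)) ->
  (forall u : (T -> \bar R)^nat, (forall n x, 0 <= u n x) ->
     (forall n, measurable_fun setT (u n)) ->
     (forall x, nondecreasing_seq (u ^~ x)) ->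
     (forall n, Pr (u n)) -> Pr (fun x => limn (u ^~ x))) ->
  forall f, measurable_fun setT f -> (forall x, 0 <= f x) -> Pr f.
Proof.
move=> Pi Pl Pc f mf f0.
pose g := nnsfun_approx measurableT mf.
have -> : f = fun x => limn (fun n => (g n x)%:E).
  by apply/funext => x; apply/esym/cvg_lim => //; exact: cvg_nnsfun_approx.
apply: (Pc (fun n x => (g n x)%:E)).
- by move=> n x; rewrite lee_fin.
- by move=> n; exact/measurable_EFinP.
- by move=> x m n mn; rewrite lee_fin; exact/lefP/nd_nnsfun_approx.
move=> n; move: (g n) => {g} h.
have -> : (fun x => (h x)%:E) = (fun x => \sum_(r <- fset_set (range h))
    (r * \1_(h @^-1` [set r]) x)%:E).
  apply/funext => x; rewrite fimfunE fsbig_finite//= sumEFin.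
  by [].
have : forall r : R, r \in (fset_set (range h) : seq R) -> (0 <= r)%R.
  by move=> r; rewrite in_fset_set// inE => -[x _ <-].
elim: (fset_set (range h) : seq R) => [_|r s ih rs].
  under eq_fun do rewrite big_nil.
  have := Pi set0 measurable0.
  by under eq_fun do rewrite indic0.
have -> : (fun x => \sum_(i <- r :: s) (i * \1_(h @^-1` [set i]) x)%:E) =
  (fun x => r%:E * (\1_(h @^-1` [set r]) x)%:E +
     \sum_(i <- s) (i * \1_(h @^-1` [set i]) x)%:E).
  by apply/funext => x; rewrite big_cons EFinM.
have s0 : forall i, i \in s -> (0 <= i)%R.
  by move=> i ins; apply: rs; rewrite inE ins orbT.
apply: Pl => //.
- by apply: rs; rewrite inE eqxx.
- by move=> x; rewrite big_seq; apply: sume_ge0 => i /s0 i0; rewrite lee_fin mulr_ge0.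
- exact/measurable_EFinP/measurable_indic.
- apply: emeasurable_sum => i; apply/measurable_EFinP.
  by apply: measurable_funM => //.
- exact: Pi.
- exact: ih.
Qed.

End nonneg_induction.

Section integral_formulas.
Local Open Scope ereal_scope.
Context d d' (T : measurableType d) (Y : measurableType d') (R : realType).

Lemma ge0_integral_density (m : {measure set T -> \bar R})
    (q : {measure set Y -> \bar R}) (w : Y -> R) (u : Y -> T) :
  measurable_fun setT w -> (forall y, (0 <= w y)%R) -> measurable_fun setT u ->
  (forall A, measurable A -> m A = \int[q]_y ((w y)%:E * (\1_A (u y))%:E)) ->
  forall f, measurable_fun setT f -> (forall x, 0 <= f x) ->
  \int[m]_x f x = \int[q]_y ((w y)%:E * f (u y)).
Proof.
move=> mw w0 mu mE.
have mwf (f : T -> \bar R) : measurable_fun setT f ->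
    measurable_fun setT (fun y => (w y)%:E * f (u y)).
  by move=> mf; apply: emeasurable_funM; [exact/measurable_EFinP|exact: measurableT_comp].
apply: ge0_measurable_ind.
- by move=> A mA; rewrite integral_indic// setIT mE.
- move=> f g c c0 f0 g0 mf mg fE gE.
  rewrite ge0_integralD//; last 2 first.
    by move=> x _; rewrite mule_ge0.
    exact: measurable_funeM.
  rewrite ge0_integralZl_EFin// fE gE.
  rewrite -ge0_integralZl_EFin//; last 2 first.
    by move=> y _; rewrite mule_ge0// lee_fin.
    exact: mwf.
  rewrite -ge0_integralD//; last 4 first.
    by move=> y _; rewrite !mule_ge0// lee_fin.
    by apply: measurable_funeM; exact: mwf.
    by move=> y _; rewrite mule_ge0// lee_fin.
    exact: mwf.
  apply: eq_integral => y _; rewrite ge0_muleDr ?mule_ge0//.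
  by rewrite muleCA.
- move=> v v0 mv ndv vE; rewrite monotone_convergence//.
  under eq_fun do rewrite vE.
  rewrite -monotone_convergence//; last 3 first.
    by move=> n; exact: mwf.
    by move=> n y _; rewrite mule_ge0// lee_fin.
    by move=> y _ n m' nm; rewrite lee_wpmul2l ?lee_fin// ndv.
  apply: eq_integral => y _.
  by rewrite limeMl//; apply: ereal_nondecreasing_is_cvgn => n m' nm; exact: ndv.
Qed.


Lemma ge0_integral_mixture (m : {measure set T -> \bar R})
    (q : {measure set Y -> \bar R}) (k : Y -> {measure set T -> \bar R}) :
  (forall A, measurable A -> measurable_fun setT (fun y => k y A)) ->
  (forall A, measurable A -> m A = \int[q]_y k y A) ->
  forall f, measurable_fun setT f -> (forall x, 0 <= f x) ->
  \int[m]_x f x = \int[q]_y \int[k y]_x f x.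
Proof.
move=> mk mE.
have mkf (f : T -> \bar R) : measurable_fun setT f -> (forall x, 0 <= f x) ->
    measurable_fun setT (fun y => \int[k y]_x f x).
  by move=> mf f0; exact: measurable_fun_integral_kernel.
apply: ge0_measurable_ind.
- move=> A mA; rewrite integral_indic// setIT mE//.
  by apply: eq_integral => y _; rewrite integral_indic// setIT.
- move=> f g c c0 f0 g0 mf mg fE gE.
  have lin (m0 : {measure set T -> \bar R}) : \int[m0]_x (c%:E * f x + g x) =
      c%:E * \int[m0]_x f x + \int[m0]_x g x.
    rewrite ge0_integralD ?ge0_integralZl_EFin//.
      by move=> x _; rewrite mule_ge0.
    exact: measurable_funeM.
  rewrite lin fE gE -ge0_integralZl_EFin//; last 2 first.
    by move=> y _; exact: integral_ge0.
    exact: mkf.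
  rewrite -ge0_integralD//; last 4 first.
    by move=> y _; rewrite mule_ge0// integral_ge0.
    by apply: measurable_funeM; exact: mkf.
    by move=> y _; exact: integral_ge0.
    exact: mkf.
  by apply: eq_integral => y _; rewrite lin.
- move=> v v0 mv ndv vE; rewrite monotone_convergence//.
  under eq_fun do rewrite vE.
  rewrite -monotone_convergence//; last 3 first.
    by move=> n; exact: mkf.
    by move=> n y _; exact: integral_ge0.
    by move=> y _ n m' nm; apply: ge0_le_integral => // x _; exact: ndv.
  apply: eq_integral => y _.
  by rewrite monotone_convergence// => x _; exact: ndv.
Qed.

End integral_formulas.

Section mbind.
Local Open Scope ereal_scope.
Context d d' (T : measurableType d) (Y : measurableType d') (R : realType).
Variables (q : {measure set Y -> \bar R}) (k : Y -> {measure set T -> \bar R}).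
Hypothesis mk : forall A, measurable A -> measurable_fun setT (fun y => k y A).

Definition mbind (_ : forall A, measurable A -> measurable_fun setT (fun y => k y A))
  (A : set T) : \bar R := \int[q]_y k y A.

Let mbind0 : mbind mk set0 = 0.
Proof. by rewrite /mbind integral0_eq// => y _; rewrite measure0. Qed.

Let mbind_ge0 A : 0 <= mbind mk A.
Proof. exact: integral_ge0. Qed.

Let mbind_sigma_additive : semi_sigma_additive (mbind mk).
Proof.
move=> F mF tF mUF; rewrite [X in _ --> X](_ : _ =
    \sum_(n <oo) mbind mk (F n)).
  by apply: is_cvg_ereal_nneg_natsum => n _; exact: mbind_ge0.
rewrite /mbind -integral_nneseries//; last by move=> n; exact: mk.
by apply: eq_integral => y _; rewrite measure_semi_bigcup.
Qed.

HB.instance Definition _ := isMeasure.Build _ _ _ (mbind mk)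
  mbind0 mbind_ge0 mbind_sigma_additive.

End mbind.

(** * Configurations and counts *)

Section config_basics.
Context {R : realType} {dM : measure_display} {M : measurableType dM}.
Local Notation E := (plane R * M)%type.
Local Notation C := (config R M).
Implicit Types (phi psi : C) (z : E) (A B W : set E) (L U : set (plane R)).

Lemma config_eq phi psi : pts phi = pts psi -> phi = psi.
Proof.
case: phi psi => [A fA] [B fB] /= AB; rewrite -AB in fB *.
by congr Config; exact: Prop_irrelevance.
Qed.

Definition bounded_window B :=
  measurable B /\ exists r, B `<=` eball origin r `*` setT.

Lemma eballE (x : plane R) (r : R) (y : plane R) : eball x r y <->
  0 <= r /\ ((y.1 : R) - x.1) ^+ 2 + ((y.2 : R) - x.2) ^+ 2 <= r ^+ 2.
Proof.
rewrite /eball/=; split => [h|[r0 h]]; last first.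
  by rewrite -[leRHS](ger0_norm r0) -sqrtr_sqr ler_wsqrtr.
have r0 : 0 <= r by apply: le_trans h; exact: sqrtr_ge0.
by split => //; rewrite -ler_sqrt ?sqr_ge0// sqrtr_sqr ger0_norm.
Qed.

Lemma measurable_eball (x : plane R) (r : R) : measurable (eball x r).
Proof.
have [r0|r0] := leP 0 r; last first.
  rewrite (_ : eball x r = set0)//; apply/seteqP; split=> y // /eballE[].
  by rewrite leNgt r0.
rewrite (_ : eball x r = (fun y : plane R =>
    ((y.1 : R) - x.1) ^+ 2 + ((y.2 : R) - x.2) ^+ 2 : measurableTypeR R)
      @^-1` [set` `]-oo, r ^+ 2]]); last first.
  apply/seteqP; split=> y /=; rewrite in_itv/=; first by case/eballE.
  by move=> h; apply/eballE.
rewrite -[X in measurable X]setTI; apply: (_ : measurable_fun setT _) => //.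
by apply: measurable_funD; apply: measurable_funX; apply: measurable_funB.
Qed.

Lemma bounded_windowS A B : measurable A -> A `<=` B -> bounded_window B ->
  bounded_window A.
Proof. by move=> mA AB [mB [r Br]]; split => //; exists r; exact: subset_trans Br. Qed.

Lemma bounded_windowI A B : measurable A -> bounded_window B ->
  bounded_window (A `&` B).
Proof.
move=> mA bB; apply: bounded_windowS (bB); last exact: subIsetr.
by apply: measurableI => //; case: bB.
Qed.

Lemma eball_le (x : plane R) (r s : R) : r <= s -> eball x r `<=` eball x s.
Proof. by move=> rs y /le_trans; exact. Qed.

Lemma bounded_windowU A B : bounded_window A -> bounded_window B ->
  bounded_window (A `|` B).
Proof.
move=> [mA [r Ar]] [mB [s Bs]]; split; first exact: measurableU.
exists (Num.max r s) => z [/Ar|/Bs] [/= h _]; split => //=;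
  by apply: eball_le h; rewrite le_max lexx ?orbT.
Qed.

Lemma bounded_window0 : bounded_window (set0 : set E).
Proof. by split => //; exists 0. Qed.

Lemma bounded_windowX L : bounded_borel L -> bounded_window (L `*` setT).
Proof.
move=> [mL [r Lr]]; split; first exact: measurableX.
by exists r => -[x m] [/= /Lr ? _].
Qed.

Lemma finite_pts phi W : bounded_window W -> finite_set (pts phi `&` W).
Proof.
move=> [_ [r Wr]]; apply: sub_finite_set (@pts_locally_finite _ _ _ phi r).
exact: setIS.
Qed.

(** Listing the points of a bounded window turns counts and sums over
    points into sums over a list. *)
Definition listing W phi : seq E := fset_set (pts phi `&` W).

Lemma listing_uniq W phi : uniq (listing W phi).
Proof. exact: fset_uniq. Qed.

Lemma mem_listing W phi z : bounded_window W ->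
  (z \in listing W phi) = (z \in pts phi) && (z \in W).
Proof.
move=> bW; rewrite /listing in_fset_set; last exact: finite_pts.
by rewrite in_setI.
Qed.

Lemma npts_listing phi W B : bounded_window W -> B `<=` W ->
  npts phi B = (\sum_(z <- listing W phi) (z \in B))%N.
Proof.
move=> bW BW; rewrite /npts -sum1_size.
have fB : finite_set (pts phi `&` B).
  by apply: sub_finite_set (finite_pts phi bW); exact: setIS.
rewrite (_ : (\sum_(z <- listing W phi) (z \in B))%N =
  \sum_(z <- listing W phi | z \in B) 1)%N; last by rewrite [RHS]big_mkcond/=; apply: eq_bigr => z _; case: (z \in B).
rewrite -[RHS]big_filter; apply: perm_big; apply: uniq_perm.
- exact: fset_uniq.
- by rewrite filter_uniq// listing_uniq.
- move=> z; rewrite mem_filter [in RHS]mem_listing//.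
  transitivity (z \in pts phi `&` B); first exact: in_fset_set.
  rewrite in_setI andbC; case: (boolP (z \in B)) => //= zB.
  by rewrite (mem_set (BW _ (set_mem zB))) andbT.
Qed.

Lemma listing_sumS (V : nmodType) phi W B (f : E -> V) : bounded_window W -> measurable B ->
  B `<=` W ->
  \sum_(z <- listing B phi) f z = \sum_(z <- listing W phi | z \in B) f z.
Proof.
move=> bW mB BW; have bB := bounded_windowS mB BW bW.
rewrite -[RHS]big_filter; apply: perm_big; apply: uniq_perm.
- exact: fset_uniq.
- by rewrite filter_uniq// listing_uniq.
- move=> z; rewrite mem_filter !mem_listing//.
  rewrite andbC; case: (boolP (z \in B)) => //= zB.
  by rewrite (mem_set (BW _ (set_mem zB))) andbT.
Qed.

Lemma eq_npts phi psi A B : pts phi `&` A = pts psi `&` B -> npts phi A = npts psi B.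
Proof. by rewrite /npts => ->. Qed.

Lemma eq_listing phi psi A B : pts phi `&` A = pts psi `&` B ->
  listing A phi = listing B psi.
Proof. by rewrite /listing => ->. Qed.

Lemma npts_restr U phi B : npts (restr U phi) B = npts phi (B `&` (U `*` setT)).
Proof. by apply: eq_npts; rewrite /= setIAC setIA. Qed.

Lemma npts_translate a phi B :
  npts (translate a phi) B = npts phi (mshift a @^-1` B).
Proof.
have inj : injective (@mshift R dM M a).
  move=> [[x1 x2] m] [[y1 y2] n]; rewrite /mshift /shift/= => -[/addIr-> /addIr-> ->].
  by [].
rewrite /npts (_ : pts (translate a phi) `&` B =
   mshift a @` (pts phi `&` mshift a @^-1` B)); last first.
  apply/seteqP; split => z /=.
    by move=> [[w phiw <-] Bw]; exists w.
  by move=> [w [phiw Bw] <-]; split => //; exists w.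
have [fB|nfB] := pselect (finite_set (pts phi `&` mshift a @^-1` B)).
  by rewrite fset_set_image// card_imfset.
rewrite /fset_set; case: pselect => [h|_]; last by case: pselect.
exfalso; apply: nfB; apply: (@sub_finite_set _ _ (mshift a @^-1`
  (mshift a @` (pts phi `&` mshift a @^-1` B)))); first by move=> z ?; exists z.
by apply: finite_preimage => // ? ? _ _; exact: inj.
Qed.

Lemma npts_csingle z B : npts (csingle z) B = (z \in B).
Proof.
rewrite /npts/=; case: (boolP (z \in B)) => zB.
  rewrite setIidl ?fset_set1 ?cardfs1// => w ->; exact: set_mem.
rewrite (_ : _ `&` _ = set0) ?fset_set0 ?cardfs0//.
by apply/seteqP; split => // w [-> /mem_set]; exact/negP.
Qed.

Lemma npts_union phi psi B : bounded_window B ->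
  pts phi `&` pts psi `&` B = set0 ->
  npts (cunion phi psi) B = (npts phi B + npts psi B)%N.
Proof.
move=> bB d; rewrite /npts/= setIUl fset_setU; [|exact: finite_pts..].
apply/eqP; rewrite -cardfsUI addnC -[eqbLHS]add0n eq_sym eqn_add2r.
rewrite -fset_setI; [|exact: finite_pts..].
by rewrite setIACA setIid d fset_set0 cardfs0.
Qed.

Lemma npts_remove phi z B : bounded_window B -> pts phi z ->
  npts phi B = (npts (cremove phi z) B + (z \in B))%N.
Proof.
move=> bB phiz; rewrite -npts_csingle -npts_union//; last first.
  by apply/seteqP; split => // w [[[/= _ wz] /= wz'] _]; exact: wz.
apply: eq_npts => /=; congr (_ `&` _); apply/seteqP; split => w /=.
  by move=> pw; have [->|wz] := pselect (w = z); [right|left].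
by move=> [[]//|->].
Qed.

Lemma npts0 phi B : (npts phi B = 0)%N -> bounded_window B ->
  pts phi `&` B = set0.
Proof.
move=> n0 bB; move/eqP: n0; rewrite /npts cardfs_eq0 => /eqP f0.
have := fset_setK (finite_pts phi bB); rewrite f0 => <-.
by apply/seteqP; split.
Qed.

Lemma npts_set0 phi B : pts phi `&` B = set0 -> npts phi B = 0%N.
Proof. by rewrite /npts => ->; rewrite fset_set0 cardfs0. Qed.

End config_basics.

Section config_measurable.
Context {R : realType} {dM : measure_display} {M : measurableType dM}.
Local Notation E := (plane R * M)%type.
Local Notation C := (config R M).

Lemma measurable_npts_eq (B : set E) k : bounded_window B ->
  measurable [set phi : C | npts phi B = k].
Proof.
by move=> [mB [r Br]]; apply: sub_sigma_algebra; exists B, k; split => //; exists r.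
Qed.

Lemma measurable_npts (B : set E) : bounded_window B ->
  measurable_fun setT (fun phi : C => npts phi B).
Proof.
move=> bB _ Y _; rewrite setTI.
rewrite (_ : _ @^-1` Y = \bigcup_(k in Y) [set phi : C | npts phi B = k]).
  by apply: bigcup_measurable => k _; exact: measurable_npts_eq.
by apply/seteqP; split => phi /=; [exists (npts phi B)|case=> k Yk /= ->].
Qed.

Lemma measurable_natR d (T : measurableType d) (f : T -> nat) :
  measurable_fun setT f -> measurable_fun setT (fun t => ((f t)%:R : measurableTypeR R)).
Proof. by move=> mf; apply: (@measurableT_comp _ _ _ _ _ _ (fun n : nat => n%:R : measurableTypeR R)). Qed.

(** The sigma-algebra of configurations is generated by counts, so
    measurability of a map into it is a matter of counting points. *)
Lemma measurable_config d (T : measurableType d) (f : T -> C) :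
  (forall B, bounded_window B -> measurable_fun setT (fun t => npts (f t) B)) ->
  measurable_fun setT f.
Proof.
move=> mf; apply: (@measurability _ _ _ _ _ f _ (erefl _)) => _ [_ [B [k [mB bB ->]]] <-].
have := mf B (conj mB bB) measurableT [set k] Logic.I.
by [].
Qed.

Lemma measurable_restr (U : set (plane R)) : measurable U ->
  measurable_fun setT (restr U : C -> C).
Proof.
move=> mU; apply: measurable_config => B bB; under eq_fun do rewrite npts_restr.
apply: measurable_npts; rewrite setIC; apply: bounded_windowI => //.
exact: measurableX.
Qed.

End config_measurable.

Section kernel_gen.
Local Open Scope ereal_scope.
Context d d' (U : measurableType d) (Z : measurableType d') (R : realType).

(** Dynkin's argument for families of finite measures: measurability in the
    parameter on a generating pi-system suffices. *)
Lemma measurable_kernel_gen (k : U -> {measure set Z -> \bar R}) (G : set (set Z)) :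
  @measurable _ Z = <<s G >> -> setI_closed G ->
  (forall u, k u setT < +oo) -> measurable_fun setT (fun u => k u setT) ->
  (forall X, G X -> measurable_fun setT (fun u => k u X)) ->
  forall X, measurable X -> measurable_fun setT (fun u => k u X).
Proof.
move=> GE GI koo mT mG X; rewrite GE; move: X.
apply: (@dynkin_induction _ Z G (fun X => measurable_fun setT (fun u => k u X))) => //.
- move=> S mS ih.
  rewrite (_ : (fun u => _) = (fun u => k u setT - k u S)).
    by apply: emeasurable_funB.
  apply/funext => u; rewrite -setTD measureD// ?setTI//.
  exact: koo.
- move=> F mF tF ih.
  rewrite (_ : (fun u => _) = (fun u => \sum_(n <oo) k u (F n))); last first.
    by apply/funext => u; rewrite measure_semi_bigcup//; exact: bigcupT_measurable.
  exact: ge0_emeasurable_sum.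
Qed.

Definition dirac_seq (s : seq Z) : {measure set Z -> \bar R} :=
  foldr (fun z m => measure_add (dirac z) m) mzero s.

Lemma dirac_seqE (s : seq Z) X :
  dirac_seq s X = \sum_(z <- s) (\1_X z)%:E.
Proof.
elim: s => [|z s ih] /=; first by rewrite big_nil.
rewrite big_cons -ih -[RHS]/(dirac z X + dirac_seq s X) -measure_addE.
by [].
Qed.

Lemma integral_dirac_seq (s : seq Z) (f : Z -> \bar R) :
  (forall z, 0 <= f z) -> measurable_fun setT f ->
  \int[dirac_seq s]_z f z = \sum_(z <- s) f z.
Proof.
move=> f0 mf; elim: s => [|z s ih] /=; first by rewrite big_nil integral_measure_zero.
rewrite big_cons ge0_integral_measure_add// ih integral_dirac//.
by rewrite diracT mul1e.
Qed.

End kernel_gen.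

Section counting.
Context {R : realType} {dM : measure_display} {M : measurableType dM}.
Local Notation E := (plane R * M)%type.
Local Notation C := (config R M).

Lemma sum_indic_listing (W B : set E) (phi : C) : bounded_window W -> B `<=` W ->
  (\sum_(z <- listing W phi) (\1_B z : R)%:E)%E = (npts phi B)%:R%:E.
Proof.
move=> bW BW; rewrite (npts_listing phi bW BW) natr_sum -sumEFin.
by apply: eq_bigr => z _; rewrite indicE.
Qed.

Lemma measurable_from_natE d (T : measurableType d) (f : T -> nat) :
  measurable_fun setT (fun t => ((f t)%:R%:E : \bar R)) ->
  measurable_fun setT f.
Proof.
move=> mf _ Y _; rewrite setTI.
rewrite (_ : _ @^-1` Y = \bigcup_(k in Y) ((fun t => ((f t)%:R%:E : \bar R)) @^-1` [set k%:R%:E])).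
  by apply: bigcup_measurable => k _; rewrite -[X in measurable X]setTI; apply: mf.
apply/seteqP; split => t /=; first by move=> ?; exists (f t).
by case=> k Yk /= -[] /eqP; rewrite eqr_nat => /eqP ->.
Qed.

(** Jointly measurable counts. The sections of a rectangle are trivial, and
    the counts of the sections of [X] form a kernel in [X]. *)
Lemma measurable_npts_xsection d (T : measurableType d) (W : set E) (X : set (T * E)) :
  bounded_window W -> measurable X ->
  measurable_fun setT (fun u : T * C => npts u.2 (W `&` xsection X u.1)).
Proof.
move=> bW mX; apply: measurable_from_natE.
pose k (u : T * C) := @dirac_seq _ (T * E)%type R [seq (u.1, z) | z <- listing W u.2].
have kE u Y : k u Y = (npts u.2 (W `&` xsection Y u.1))%:R%:E.
  rewrite /k dirac_seqE big_map -(sum_indic_listing u.2 bW); last exact: subIsetl.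
  rewrite big_seq [RHS]big_seq; apply: eq_bigr => z.
  rewrite mem_listing// => /andP[_ zW]; rewrite !indicE in_setI zW/=.
  by congr ((nat_of_bool _)%:R%:E); apply/idP/idP; rewrite inE => h; rewrite inE; apply/xsectionP.
rewrite (_ : (fun u => _) = (fun u => k u X)); last by apply/funext => u; rewrite kE.
have mW (A : set E) : measurable A -> measurable_fun setT (fun phi : C => ((npts phi (W `&` A))%:R%:E : \bar R)).
  move=> mA; apply/measurable_EFinP; apply: measurable_natR; apply: measurable_npts.
  by rewrite setIC; exact: bounded_windowI.
apply: (measurable_kernel_gen (measurable_prod_measurableType _ _)) => //.
- move=> _ _ [A mA [B mB <-]] [A' mA' [B' mB' <-]]; exists (A `&` A'); first exact: measurableI.
  by exists (B `&` B'); [exact: measurableI|rewrite setXI].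
- by move=> u; rewrite kE ltry.
- under eq_fun do rewrite kE.
  rewrite (_ : (fun u => _) = (fun phi : C => ((npts phi (W `&` setT))%:R%:E : \bar R)) \o snd).
    by apply: measurableT_comp => //; exact: mW.
  by apply/funext => u /=; rewrite xsectionE.
- move=> _ [A mA [B mB <-]]; under eq_fun do rewrite kE.
  rewrite (_ : (fun u => _) = (fun u : T * C => ((\1_A u.1)%:E * (npts u.2 (W `&` B))%:R%:E)%E)).
    apply: emeasurable_funM.
      by apply/measurable_EFinP; apply: measurableT_comp.
    exact: (measurableT_comp (mW B mB)).
  apply/funext => u; rewrite indicE; case: (boolP (u.1 \in A)) => uA.
    by rewrite in_xsectionX// mul1e.
  by rewrite notin_xsectionX// setI0 npts_set0 ?setI0// mul0e.
Qed.

Lemma measurable_cunion d (T : measurableType d) (f g : T -> C) :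
  measurable_fun setT f -> measurable_fun setT g ->
  (forall t, pts (f t) `&` pts (g t) = set0) ->
  measurable_fun setT (fun t => cunion (f t) (g t)).
Proof.
move=> mf mg fg; apply: measurable_config => B bB.
rewrite (_ : (fun t => _) = (fun t => npts (f t) B + npts (g t) B)%N); last first.
  by apply/funext => t; rewrite npts_union// fg set0I.
apply: measurable_from_natE; under eq_fun do rewrite natrD EFinD.
apply: emeasurable_funD; apply/measurable_EFinP; apply: measurable_natR.
  exact: (measurableT_comp (measurable_npts bB)).
exact: (measurableT_comp (measurable_npts bB)).
Qed.

Lemma measurable_csingle : measurable_fun setT (@csingle R dM M).
Proof.
apply: measurable_config => B bB; under eq_fun do rewrite npts_csingle.
apply: measurable_from_natE; apply/measurable_EFinP.
rewrite (_ : (fun t => _) = \1_B); first by apply: measurable_indic; case: bB.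
by apply/funext => t; rewrite indicE.
Qed.

(** Resampling a region amounts to splicing a new configuration into the
    old one. *)
Definition splice (L : set (plane R)) (psi phi : C) : C :=
  cunion (restr L psi) (restr (~` L) phi).

Lemma splice_disj L (psi phi : C) : pts (restr L psi) `&` pts (restr (~` L) phi) = set0.
Proof. by apply/seteqP; split => // z [[_ [zL _]] [_ [/(_ zL)]]]. Qed.

Lemma measurable_splice d (T : measurableType d) (f g : T -> C) (L : set (plane R)) :
  measurable L -> measurable_fun setT f -> measurable_fun setT g ->
  measurable_fun setT (fun t => splice L (f t) (g t)).
Proof.
move=> mL mf mg; apply: measurable_cunion.
- exact: (measurableT_comp (measurable_restr mL)).
- exact: (measurableT_comp (measurable_restr (measurableC mL))).
- by move=> t; exact: splice_disj.
Qed.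

Lemma eball_triangle (x y : plane R) (r s : R) : eball origin r x -> eball x s y ->
  eball origin (r + (s + s)) y.
Proof.
move=> /eballE[r0 xr] /eballE[s0 ys]; apply/eballE; split; first lra.
move: xr ys; rewrite /origin/= !subr0.
set a := (x.1 : R); set b := (x.2 : R); set c := (y.1 : R); set d := (y.2 : R) => xr ys.
have h : 2 * (a * (c - a) + b * (d - b)) <= 2 * (r * s).
  have : (a * (c - a) + b * (d - b)) ^+ 2 <= (r * s) ^+ 2.
    apply: (@le_trans _ _ ((a ^+ 2 + b ^+ 2) * ((c - a) ^+ 2 + (d - b) ^+ 2))).
      rewrite -subr_ge0 (_ : _ - _ = (a * (d - b) - b * (c - a)) ^+ 2); first exact: sqr_ge0.
      by ring.
    by rewrite exprMn ler_pM// addr_ge0// sqr_ge0.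
  move=> h2; rewrite ler_pM2l//; have rs0 : 0 <= r * s by exact: mulr_ge0.
  rewrite -[leRHS]ger0_norm// (le_trans (ler_norm _))// -!sqrtr_sqr ler_wsqrtr//.
have -> : c ^+ 2 + d ^+ 2 = (a ^+ 2 + b ^+ 2) + 2 * (a * (c - a) + b * (d - b)) +
    ((c - a) ^+ 2 + (d - b) ^+ 2) by ring.
have : 0 <= s ^+ 2 by exact: sqr_ge0.
have : 0 <= r * s by exact: mulr_ge0.
nra.
Qed.

Lemma measurable_near (r : R) :
  measurable [set u : E * E | eball u.1.1 r u.2.1].
Proof.
have [r0|r0] := leP 0 r; last first.
  rewrite (_ : [set _ | _] = set0)//; apply/seteqP; split=> y // /eballE[].
  by rewrite leNgt r0.
pose f (u : E * E) : measurableTypeR R :=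
   ((u.2.1.1 : R) - u.1.1.1) ^+ 2 + ((u.2.1.2 : R) - u.1.1.2) ^+ 2.
rewrite (_ : [set _ | _] = f @^-1` [set` `]-oo, r ^+ 2]]); last first.
  apply/seteqP; split=> y /=; rewrite in_itv/=; first by case/eballE.
  by move=> h; apply/eballE.
rewrite -[X in measurable X]setTI; apply: (_ : measurable_fun setT _) => //.
apply: measurable_funD; apply: measurable_funX; apply: measurable_funB.
- exact: (measurableT_comp measurable_fst (measurableT_comp measurable_fst measurable_snd)).
- exact: (measurableT_comp measurable_fst (measurableT_comp measurable_fst measurable_fst)).
- exact: (measurableT_comp measurable_snd (measurableT_comp measurable_fst measurable_snd)).
- exact: (measurableT_comp measurable_snd (measurableT_comp measurable_fst measurable_fst)).
Qed.

Lemma measurable_swap_set d1 d2 (T1 : measurableType d1) (T2 : measurableType d2)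
  (X : set (T1 * T2)) : measurable X -> measurable [set u : T2 * T1 | X (u.2, u.1)].
Proof.
move=> mX; rewrite -[Y in measurable Y]setTI.
exact: (measurable_fun_pair measurable_snd measurable_fst).
Qed.

Lemma measurable_near' (r : R) :
  measurable [set u : E * E | eball u.2.1 r u.1.1].
Proof. exact: (measurable_swap_set (measurable_near r)). Qed.

(** Membership in the halo is a count of points near the given place, hence
    measurable jointly in the place and the configuration. *)
Lemma halo_eq0 (r : R) psi (B : set E) (s : R) y : B `<=` eball origin s `*` setT ->
  B y ->
  halo r psi y.1 <->
  npts psi (eball origin (s + (r + r)) `*` setT `&`
            xsection [set u : E * E | eball u.2.1 r u.1.1] y) <> 0%N.
Proof.
move=> Bs By; have bb : bounded_window (eball (@origin R) (s + (r + r)) `*` setT `&`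
            xsection [set u : E * E | eball u.2.1 r u.1.1] y).
  rewrite setIC; apply: bounded_windowI.
    by apply: measurable_xsection; exact: measurable_near'.
  by apply: bounded_windowX; split; [exact: measurable_eball|exists (s + (r + r))].
have sym (a b : plane R) : eball a r b -> eball b r a.
  move=> /eballE[r0 h]; apply/eballE; split => //.
  rewrite (_ : _ + _ = (b.1 - a.1 : R) ^+ 2 + (b.2 - a.2 : R) ^+ 2)//; ring.
split.
  move=> [w pw /= wy] /npts0 => /(_ bb)/seteqP[/(_ w) + _]; apply; split => //.
  split; last by apply/xsectionP.
  by split => //=; apply: eball_triangle (sym _ _ wy); have [] := Bs _ By.
move=> n0; have [w [pw [_ /xsectionP wy]]] : (pts psi `&` (eball (@origin R) (s + (r + r)) `*` setT `&`
            xsection [set u : E * E | eball u.2.1 r u.1.1] y)) !=set0.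
  by apply/set0P/eqP => e; apply: n0; exact: npts_set0.
by exists w.
Qed.

Lemma measurable_halo_set (r : R) (B : set E) : bounded_window B ->
  measurable [set u : C * E | B u.2 /\ halo r u.1 u.2.1].
Proof.
move=> [mB [s Bs]].
pose W := eball (@origin R) (s + (r + r)) `*` [set: M].
pose N := [set u : E * E | eball u.2.1 r u.1.1].
have bW : bounded_window W.
  by apply: bounded_windowX; split; [exact: measurable_eball|exists (s + (r + r))].
have mN : measurable N by exact: measurable_near'.
rewrite (_ : [set _ | _] = (setT `*` B) `&` [set u : C * E |
    ((fun u : E * C => npts u.2 (W `&` xsection N u.1)) @^-1` [set~ 0%N]) (u.2, u.1)]).
  apply: measurableI; first exact: measurableX.
  apply: measurable_swap_set; rewrite -[X in measurable X]setTI.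
  exact: measurable_npts_xsection.
apply/seteqP; split => -[psi y] /=.
  by move=> [By h]; split => //; apply/(halo_eq0 _ _ Bs).
by move=> [[_ By] h]; split => //; apply/(halo_eq0 _ _ Bs).
Qed.

Lemma measurable_restr_halo d (T : measurableType d) (f g : T -> C) (r : R) :
  measurable_fun setT f -> measurable_fun setT g ->
  measurable_fun setT (fun t => restr (halo r (f t)) (g t)).
Proof.
move=> mf mg; apply: measurable_config => B bB.
have mX := measurable_halo_set r bB.
rewrite (_ : (fun t => _) = (fun u : C * C => npts u.2 (B `&`
    xsection [set u : C * E | B u.2 /\ halo r u.1 u.2.1] u.1)) \o (fun t => (f t, g t))).
  apply: measurableT_comp; first exact: measurable_npts_xsection.
  exact: measurable_fun_pair.
apply/funext => t /=; rewrite npts_restr; congr (npts _ _).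
apply/seteqP; split => z.
  by move=> [Bz [/= h _]]; split => //; apply/xsectionP.
by move=> [Bz /xsectionP[/= _ h]].
Qed.

Lemma measurable_restr_off_halo d (T : measurableType d) (f g : T -> C) (r : R) :
  measurable_fun setT f -> measurable_fun setT g ->
  measurable_fun setT (fun t => restr (~` halo r (f t)) (g t)).
Proof.
move=> mf mg; apply: measurable_config => B bB.
have mX := measurable_halo_set r bB.
rewrite (_ : (fun t => _) = (fun u : C * C => npts u.2 (B `&`
    xsection (~` [set u : C * E | B u.2 /\ halo r u.1 u.2.1]) u.1)) \o (fun t => (f t, g t))).
  apply: measurableT_comp; first by apply: measurable_npts_xsection => //; exact: measurableC.
  exact: measurable_fun_pair.
apply/funext => t /=; rewrite npts_restr; congr (npts _ _).
apply/seteqP; split => z.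
  by move=> [Bz [/= h _]]; split => //; apply/xsectionP => /= -[_].
by move=> [Bz /xsectionP/= h]; split => //; split => //= hz; apply: h.
Qed.

(** The points of [phi] that sit at a location of [psi] are dropped, which
    keeps the superposition measurable and changes it only on a null event. *)
Definition overlay (psi phi : C) : C :=
  cunion psi (restr (~` halo 0 psi) phi).

Lemma eballxx (x : plane R) r : 0 <= r -> eball x r x.
Proof. by move=> r0; apply/eballE; rewrite !subrr expr0n/= addr0 sqr_ge0. Qed.

Lemma measurable_overlay d (T : measurableType d) (f g : T -> C) :
  measurable_fun setT f -> measurable_fun setT g ->
  measurable_fun setT (fun t => overlay (f t) (g t)).
Proof.
move=> mf mg; apply: measurable_cunion => //.
- exact: measurable_restr_off_halo.
- move=> t; apply/seteqP; split => // z [fz [_ [/= + _]]]; apply.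
  by exists z => //; exact: eballxx.
Qed.

End counting.

(** * Measures on configurations *)

Section count_events.
Context {R : realType} {dM : measure_display} {M : measurableType dM}.
Local Notation E := (plane R * M)%type.
Local Notation C := (config R M).

Definition count_cell n (B : 'I_n -> set E) (k : 'I_n -> nat) : set C :=
  \bigcap_(i in setT) [set phi | npts phi (B i) = k i].

Definition count_event n (B : 'I_n -> set E) (K : set ('I_n -> nat)) : set C :=
  [set phi | K (fun i => npts phi (B i))].

Definition count_system : set (set C) :=
  [set X | exists n (B : 'I_n -> set E) K,
     (forall i, bounded_window (B i)) /\ X = count_event B K].

Lemma measurable_count_cell n (B : 'I_n -> set E) k :
  (forall i, bounded_window (B i)) -> measurable (count_cell B k).
Proof.
move=> bB; apply: fin_bigcap_measurable => // i _; exact: measurable_npts_eq.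
Qed.

(** A count event is a countable union of joint count cells, enumerated
    through a coding of the vectors of counts. *)
Definition count_piece n (B : 'I_n -> set E) (K : set ('I_n -> nat)) (m : nat) :
    set C :=
  if (pickle_inv m : option {ffun 'I_n -> nat}) is Some c then
    [set phi | K c /\ count_cell B c phi] else set0.

Lemma count_event_pieces n (B : 'I_n -> set E) K :
  count_event B K = \bigcup_m count_piece B K m.
Proof.
apply/seteqP; split => phi /=.
  move=> Kp; pose c := [ffun i => npts phi (B i)]; exists (choice.pickle c) => //.
  rewrite /count_piece pickleK_inv; split => /=.
    by rewrite (_ : (c : _ -> _) = (fun i => npts phi (B i)))//; apply/funext => i; rewrite ffunE.
  by move=> i _ /=; rewrite ffunE.
move=> [m _]; rewrite /count_piece; case: pickle_inv => // c [Kc cc].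
rewrite /count_event/= (_ : (fun i => _) = c)//; apply/funext => i; exact: cc.
Qed.

Lemma measurable_count_piece n (B : 'I_n -> set E) K m :
  (forall i, bounded_window (B i)) -> measurable (count_piece B K m).
Proof.
move=> bB; rewrite /count_piece; case: pickle_inv => // c.
have [Kc|nKc] := pselect (K c).
  rewrite (_ : [set _ | _] = count_cell B c); first exact: measurable_count_cell.
  by apply/seteqP; split => phi /=; [case|].
by rewrite (_ : [set _ | _] = set0)//; apply/seteqP; split => phi //= -[].
Qed.

Lemma trivIset_count_piece n (B : 'I_n -> set E) K : trivIset setT (count_piece B K).
Proof.
move=> i j _ _ [phi []]; rewrite /count_piece.
case ei : pickle_inv => [c|]//; case ej : pickle_inv => [c'|]// [_ cc] [_ cc'].
have : c = c' by apply/ffunP => a; rewrite -(cc a)// -(cc' a).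
move=> e; rewrite e in ei.
have := pickle_invK (T := {ffun 'I_n -> nat}) i.
have := pickle_invK (T := {ffun 'I_n -> nat}) j.
by rewrite ei ej /= => -> ->.
Qed.

Lemma measurable_count_event n (B : 'I_n -> set E) K :
  (forall i, bounded_window (B i)) -> measurable (count_event B K).
Proof.
move=> bB; rewrite count_event_pieces; apply: bigcupT_measurable => m.
exact: measurable_count_piece.
Qed.

Lemma count_system_gen : @measurable _ C = <<s count_system >>.
Proof.
apply/seteqP; split; apply: smallest_sub.
- exact: smallest_sigma_algebra.
- move=> _ [B [k [mB bB ->]]]; apply: sub_sigma_algebra.
  exists 1%N, (fun=> B), [set f | f ord0 = k]; split => //.
- exact: (@sigma_algebra_measurable _ C).
- by move=> _ [n [B [K [bB ->]]]]; exact: measurable_count_event.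
Qed.

Lemma count_systemI : setI_closed count_system.
Proof.
move=> _ _ [n [B [K [bB ->]]]] [n' [B' [K' [bB' ->]]]].
exists (n + n')%N, (fun i => match fintype.split i with inl a => B a | inr b => B' b end).
exists [set f : 'I_(n + n') -> nat | K (f \o lshift n') /\ K' (f \o @rshift n n')]; split.
  by move=> i; case: (fintype.split i).
apply/seteqP; split => phi; rewrite /count_event/=.
  move=> [Kp Kp']; split.
    by rewrite (_ : _ \o _ = fun i => npts phi (B i))//; apply/funext => i /=; rewrite (unsplitK (inl i)).
  by rewrite (_ : _ \o _ = fun i => npts phi (B' i))//; apply/funext => i /=; rewrite (unsplitK (inr i)).
move=> [Kp Kp']; split.
  by rewrite (_ : _ \o _ = fun i => npts phi (B i)) in Kp => //; apply/funext => i /=; rewrite (unsplitK (inl i)).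
by rewrite (_ : _ \o _ = fun i => npts phi (B' i)) in Kp' => //; apply/funext => i /=; rewrite (unsplitK (inr i)).
Qed.

Lemma eq_count_event (m1 m2 : {measure set C -> \bar R}) n (B : 'I_n -> set E) :
  (forall i, bounded_window (B i)) ->
  (forall k, m1 (count_cell B k) = m2 (count_cell B k)) ->
  forall K, m1 (count_event B K) = m2 (count_event B K).
Proof.
move=> bB m12 K; rewrite count_event_pieces.
have mp m : measurable (count_piece B K m) by exact: measurable_count_piece.
have mU : measurable (\bigcup_m count_piece B K m) by exact: bigcupT_measurable.
rewrite !measure_semi_bigcup//; [|exact: trivIset_count_piece..].
apply: eq_eseriesr => m _; rewrite /count_piece.
case: pickle_inv => [c|]; last by rewrite !measure0.
have [Kc|nKc] := pselect (K c).
  rewrite (_ : [set _ | _] = count_cell B c)//.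
  by apply/seteqP; split => phi /=; [case|].
rewrite (_ : [set _ | _] = set0) ?measure0//.
by apply/seteqP; split => phi //= -[].
Qed.

Definition atom n (B : 'I_n -> set E) (s : {set 'I_n}) : set E :=
  [set z | forall i, (z \in B i) = (i \in s)].

Lemma measurable_atom n (B : 'I_n -> set E) s :
  (forall i, measurable (B i)) -> measurable (atom B s).
Proof.
move=> mB; rewrite (_ : atom B s = \bigcap_(i in setT) (if i \in s then B i else ~` B i)).
  by apply: fin_bigcap_measurable => // i _; case: ifP => _ //; exact: measurableC.
apply/seteqP; split => z /=.
  by move=> h i _; rewrite -h; case: ifPn => [/set_mem//|]; rewrite notin_setE.
move=> h i; have := h i Logic.I; case: ifP => _; first exact: mem_set.
by move=> ?; apply/negbTE; rewrite notin_setE.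
Qed.

Lemma atom_of n (B : 'I_n -> set E) z : atom B [set i | z \in B i]%SET z.
Proof. by move=> i; rewrite inE. Qed.

Lemma atom_inj n (B : 'I_n -> set E) z s s' : atom B s z -> atom B s' z -> s = s'.
Proof. by move=> h h'; apply/setP => i; rewrite -h -h'. Qed.

Lemma atom_of_eq n (B : 'I_n -> set E) z s : atom B s z -> [set i | z \in B i]%SET = s.
Proof. by move=> h; apply: atom_inj h; exact: atom_of. Qed.

(** Finite measures on configurations are determined by their values on the
    joint counts of disjoint families, since any finite family can be cut
    into its atoms. With [A] added to the family, it is a union of atoms:
    this is what allows arguments that treat the inside and the outside of
    [A] differently. *)
Lemma config_measure_unique (m1 m2 : {measure set C -> \bar R}) (A : set E) :
  bounded_window A -> (m1 setT < +oo)%E ->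
  (forall n (B : 'I_n -> set E) (J : {set 'I_n}) k,
     (forall i, bounded_window (B i)) -> trivIset setT B ->
     A = \bigcup_(i in [set i | i \in J]) B i ->
     m1 (count_cell B k) = m2 (count_cell B k)) ->
  forall X, measurable X -> m1 X = m2 X.
Proof.
move=> bA m1oo m12; apply: (@measure_unique _ _ _ count_system (fun=> setT)).
- exact: count_system_gen.
- exact: count_systemI.
- by move=> _; exists 0%N, (fun=> set0), setT; split => // -[].
- by rewrite bigcup_const.
- move=> _ [n [B [K [bB ->]]]].
  pose Bx (i : 'I_n.+1) := if unlift ord0 i is Some j then B j else A.
  have Bx0 : Bx ord0 = A by rewrite /Bx unlift_none.
  have BxS j : Bx (lift ord0 j) = B j by rewrite /Bx liftK.
  have bBx i : bounded_window (Bx i) by rewrite /Bx; case: unlift.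
  pose W := \big[setU/set0]_(i < n.+1) Bx i.
  have bW : bounded_window W.
    rewrite /W; apply: (@big_ind _ (@bounded_window R dM M)) => //.
      exact: bounded_window0.
    exact: bounded_windowU.
  have BxW i : Bx i `<=` W by rewrite /W (bigD1 i)//=; exact: subsetUl.
  pose N := #|{set 'I_n.+1}|.
  pose sa (a : 'I_N) : {set 'I_n.+1} := enum_val a.
  have saK s : sa (enum_rank s) = s by exact: enum_rankK.
  have saI a b : sa a = sa b -> a = b by exact: enum_val_inj.
  pose At (a : 'I_N) := W `&` atom Bx (sa a).
  have bAt a : bounded_window (At a).
    rewrite /At setIC; apply: bounded_windowI => //; apply: measurable_atom => i.
    by have [] := bBx i.
  have tAt : trivIset setT At.
    move=> a b _ _ [z [[_ za] [_ zb]]]; apply: saI; exact: atom_inj za zb.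
  have BxE i : Bx i = \bigcup_(a in [set a | i \in sa a]) At a.
    apply/seteqP; split => z /=.
      move=> zi; exists (enum_rank [set i | z \in Bx i]%SET).
        by rewrite /= saK inE; exact: mem_set.
      by split; [exact: BxW zi|rewrite saK; exact: atom_of].
    by move=> [a /= ia [_ /(_ i)]]; rewrite ia => /set_mem.
  have AE : A = \bigcup_(a in [set a | a \in [set a | ord0 \in sa a]%SET]) At a.
    rewrite -Bx0 BxE; apply: eq_bigcupl; split => a /=; rewrite inE//.
  have nB phi j : npts phi (B j) = (\sum_(a : 'I_N | lift ord0 j \in sa a) npts phi (At a))%N.
    rewrite -BxS (npts_listing phi bW (BxW _)).
    under [RHS]eq_bigr => a _ do rewrite (npts_listing phi bW (@subIsetl _ _ _)).
    rewrite exchange_big/= big_seq [RHS]big_seq; apply: eq_bigr => z.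
    rewrite mem_listing// => /andP[_ zW].
    set a0 := enum_rank [set i | z \in Bx i]%SET.
    have za a : (z \in At a) = (a == a0).
      apply/idP/eqP; first by move=> /set_mem[_ /atom_of_eq h]; apply: saI; rewrite /a0 h saK.
      move=> ->; apply: mem_set; split; first exact: set_mem.
      by rewrite /a0 saK; exact: atom_of.
    under eq_bigr do rewrite za.
    rewrite -big_mkcondr/= (_ : (_ \in Bx _) = (lift ord0 j \in sa a0)); last first.
      by rewrite /a0 saK inE.
    case: (boolP (lift ord0 j \in sa a0)) => ja.
      rewrite (bigD1 a0)//= ?ja ?eqxx// big1// => a /andP[/andP[_ /eqP->]]; by rewrite eqxx.
    rewrite big_pred0// => a; apply/andP => -[+ /eqP e]; rewrite e; exact/negP.
  rewrite (_ : count_event B K = count_event At [set f | K (fun j =>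
      \sum_(a : 'I_N | lift ord0 j \in sa a) f a)%N]); last first.
    apply/seteqP; split => phi; rewrite /count_event/=;
      rewrite (_ : (fun i => npts phi (B i)) = (fun j =>
      \sum_(a : 'I_N | lift ord0 j \in sa a) npts phi (At a))%N)//; apply/funext => j//.
  apply: eq_count_event => // k.
  exact: m12 AE.
- by [].
Qed.

End count_events.

Section palm.
Context {R : realType} {dM : measure_display} {M : measurableType dM}.
Local Notation E := (plane R * M)%type.
Local Notation C := (config R M).
Local Open Scope ereal_scope.

(** The points of the window, each paired with the rest of the
    configuration: the integral of a function against this measure is the
    sum that appears in the Slivnyak--Mecke formula. *)
Definition palm (W : set E) (phi : C) : {measure set (E * C) -> \bar R} :=
  @dirac_seq _ (E * C)%type R [seq (z, cremove phi z) | z <- listing W phi].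

Lemma palmE W phi X :
  palm W phi X = \sum_(z <- listing W phi) (\1_X (z, cremove phi z))%:E.
Proof. by rewrite /palm dirac_seqE big_map. Qed.

Lemma integral_palm W phi (f : E * C -> \bar R) :
  (forall x, 0 <= f x) -> measurable_fun setT f ->
  \int[palm W phi]_x f x = \sum_(z <- listing W phi) f (z, cremove phi z).
Proof. by move=> f0 mf; rewrite integral_dirac_seq// big_map. Qed.

Lemma palm_setT W phi : bounded_window W -> palm W phi setT = (npts phi W)%:R%:E.
Proof.
move=> bW; rewrite palmE -(sum_indic_listing phi bW (@subset_refl _ W)).
rewrite big_seq [RHS]big_seq; apply: eq_bigr => z; rewrite mem_listing// => /andP[_ zW].
by rewrite !indicE zW in_setT.
Qed.

Let mnpts W : bounded_window W -> measurable_fun setT (fun phi : C => (npts phi W)%:R%:E : \bar R).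
Proof.
by move=> bW; apply/measurable_EFinP; apply: measurable_natR; exact: measurable_npts.
Qed.

Let measurable_palm_counts W A : bounded_window W -> measurable A ->
  forall F : set C, measurable F -> measurable_fun setT (fun phi : C => palm W phi (A `*` F)).
Proof.
move=> bW mA.
pose k (phi : C) := @dirac_seq _ C R [seq cremove phi z | z <- listing W phi & z \in A].
have kE phi F : k phi F = palm W phi (A `*` F).
  rewrite palmE /k dirac_seqE big_map big_filter big_mkcond/=; apply: eq_bigr => z _.
  rewrite !indicE in_setX/=; case: (z \in A) => //.
move=> F mF; rewrite (_ : (fun phi => _) = (fun phi => k phi F)); last by apply/funext => phi; rewrite kE.
apply: (measurable_kernel_gen count_system_gen count_systemI) => //.
- move=> phi; rewrite kE (@le_lt_trans _ _ (palm W phi setT))//.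
    by apply: le_measure; rewrite ?inE//; exact: measurableX.
  by rewrite palm_setT// ltry.
- rewrite (_ : (fun phi => _) = (fun phi : C => (npts phi (W `&` A))%:R%:E)).
    by apply: mnpts; rewrite setIC; exact: bounded_windowI.
  apply/funext => phi; rewrite kE palmE -(sum_indic_listing phi bW (@subIsetl _ W A)).
  rewrite big_seq [RHS]big_seq; apply: eq_bigr => z; rewrite mem_listing// => /andP[_ zW].
  by rewrite !indicE in_setX in_setI/= zW in_setT andbT.
move=> _ [n [B [K [bB ->]]]].
rewrite (_ : (fun phi => _) = (fun phi : C => \sum_(s : {set 'I_n})
    ((\1_(count_event B [set f | K (fun i => f i - (i \in s))%N]) phi : R)%:E *
     (npts phi (W `&` (A `&` atom B s)))%:R%:E))).
  apply: emeasurable_sum => s; apply: emeasurable_funM.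
    by apply/measurable_EFinP; apply: measurable_indic; exact: measurable_count_event.
  apply: mnpts; rewrite setIC; apply: bounded_windowI => //; apply: measurableI => //.
  by apply: measurable_atom => i; have [] := bB i.
apply/funext => phi; rewrite kE palmE.
under [RHS]eq_bigr => s _ do rewrite -(sum_indic_listing phi bW (@subIsetl _ _ _)).
under [RHS]eq_bigr => s _.
  rewrite ge0_sume_distrr; last by move=> z _; rewrite lee_fin.
  over.
rewrite exchange_big/= big_seq [RHS]big_seq; apply: eq_bigr => z.
rewrite mem_listing// => /andP[pz zW].
rewrite (bigD1 [set i | z \in B i]%SET)//= big1 ?adde0; last first.
  move=> s sz; rewrite [X in _ * X](_ : _ = 0) ?mule0//; congr EFin.
  rewrite indicE memNset// => -[_ [_ /atom_of_eq e]].
  by move/eqP: sz; apply; rewrite e.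
rewrite !indicE in_setX/= !in_setI zW (mem_set (atom_of B z))/= andbT.
case: (z \in A); last by rewrite mule0.
rewrite mule1/=; congr ((nat_of_bool _)%:R%:E).
rewrite /count_event/=; apply/idP/idP => /set_mem/= h; apply/mem_set => /=.
  rewrite (_ : (fun i => _) = (fun i => npts (cremove phi z) (B i)))//.
  by apply/funext => i; rewrite inE (npts_remove (bB i) (set_mem pz)) addnK.
rewrite (_ : (fun i => npts (cremove phi z) (B i)) = (fun i => npts phi (B i) - (i \in [set i | z \in B i]%SET))%N)//.
by apply/funext => i; rewrite inE (npts_remove (bB i) (set_mem pz)) addnK.
Qed.

Lemma measurable_palm W : bounded_window W ->
  forall X : set (E * C), measurable X -> measurable_fun setT (fun phi => palm W phi X).
Proof.
move=> bW X mX.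
apply: (measurable_kernel_gen (measurable_prod_measurableType _ _)) => //.
- move=> _ _ [A mA [B mB <-]] [A' mA' [B' mB' <-]]; exists (A `&` A'); first exact: measurableI.
  by exists (B `&` B'); [exact: measurableI|rewrite setXI].
- by move=> phi; rewrite palm_setT// ltry.
- by under eq_fun do rewrite palm_setT//; exact: mnpts.
- by move=> _ [A mA [B mB <-]]; exact: measurable_palm_counts.
Qed.

End palm.

(** * The intensity measure *)

Section intensity.
Context {R : realType} {dM : measure_display} {M : measurableType dM}.
Variable lm : probability M R.
Local Notation E := (plane R * M)%type.
Local Open Scope ereal_scope.

Lemma intensityX (A : set (plane R)) (B : set M) : measurable A -> measurable B ->
  intensity lm (A `*` B) = lebesgue2 A * lm B.
Proof. by move=> mA mB; rewrite /intensity/= product_measure1E. Qed.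

Lemma lebesgue2X (A B : set (measurableTypeR R)) : measurable A -> measurable B ->
  lebesgue2 (A `*` B) = lebesgue_measure A * lebesgue_measure B.
Proof. by move=> mA mB; rewrite /lebesgue2/= product_measure1E. Qed.

Lemma eball_box (x : plane R) (r : R) : eball x r `<=`
  [set` `[(x.1 : R) - r, (x.1 : R) + r]%R] `*` [set` `[(x.2 : R) - r, (x.2 : R) + r]%R].
Proof.
move=> y /eballE[r0 h]; rewrite /= !in_itv/= -!lerBlDl.
have [s1 s2] : (((y.1 : R) - x.1) ^+ 2 <= r ^+ 2 /\ ((y.2 : R) - x.2) ^+ 2 <= r ^+ 2)%R.
  by split; apply: le_trans h; rewrite ?lerDl ?lerDr sqr_ge0.
have abs (t : R) : (t ^+ 2 <= r ^+ 2)%R -> (- r <= t <= r)%R.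
  move=> h2; rewrite -ler_norml -[leRHS](ger0_norm r0) -!sqrtr_sqr ler_wsqrtr//.
have /andP[? ?] := abs _ s1; have /andP[? ?] := abs _ s2.
by split; apply/andP; split; lra.
Qed.

Lemma intensity_fin (B : set E) : bounded_window B -> intensity lm B < +oo.
Proof.
move=> [mB [r Br]].
pose box := [set` `[((@origin R).1 : R) - r, ((@origin R).1 : R) + r]%R] `*`
   [set` `[((@origin R).2 : R) - r, ((@origin R).2 : R) + r]%R] : set (plane R).
have mbox : measurable box by apply: measurableX; exact: measurable_itv.
apply: (@le_lt_trans _ _ (intensity lm (box `*` setT))).
  apply: le_measure; rewrite ?inE//; first exact: measurableX.
  by move=> z /Br[/= /eball_box].
rewrite intensityX// probability_setT mule1 lebesgue2X//; try exact: measurable_itv.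
have itv_fin (a b : R) : lebesgue_measure [set` `[a, b]%R] \is a fin_num.
  by rewrite lebesgue_measure_itv/=; case: ifP => _; rewrite ?fin_numB.
by rewrite -ge0_fin_numE ?fin_numM// mule_ge0.
Qed.

Lemma intensity_fin_num (B : set E) : bounded_window B -> intensity lm B \is a fin_num.
Proof. by move=> bB; rewrite ge0_fin_numE// intensity_fin. Qed.

Lemma lebesgue2_column (c : R) : lebesgue2 ([set c] `*` [set: measurableTypeR R]) = 0.
Proof.
by rewrite lebesgue2X// lebesgue_measure_set1 mul0e.
Qed.

Lemma lebesgue2_row (c : R) : lebesgue2 ([set: measurableTypeR R] `*` [set c]) = 0.
Proof.
by rewrite lebesgue2X// lebesgue_measure_set1 mule0.
Qed.

Lemma intensity_null (A : set (plane R)) (B : set E) : measurable A -> measurable B ->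
  lebesgue2 A = 0 -> B `<=` A `*` setT -> intensity lm B = 0.
Proof.
move=> mA mB A0 BA; apply: (@subset_measure0 _ _ _ _ _ (A `*` setT)) => //.
  exact: measurableX.
apply: (eq_trans (intensityX mA measurableT)).
by rewrite A0 mul0e.
Qed.

Lemma lebesgue_measure_shift (a : R) (A : set (measurableTypeR R)) : measurable A ->
  lebesgue_measure ((fun x : measurableTypeR R => (x : R) + a)%R @^-1` A) = lebesgue_measure A.
Proof.
move=> mA.
have mf : measurable_fun setT (fun x : measurableTypeR R => (x : R) + a : measurableTypeR R)%R.
  by apply: measurable_funD.
rewrite -[LHS]/(pushforward lebesgue_measure _ A).
apply/esym; apply: lebesgue_measure_unique => //= _ [[b c]] _ <- /=.
rewrite /pushforward (_ : _ @^-1` _ = [set` `]b - a, c - a]%R]); last first.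
  by apply/seteqP; split => x /=; rewrite !in_itv/= ltrBlDr lerBrDr.
rewrite !lebesgue_measure_itv/= !lte_fin ltrD2r; case: ifP => // _.
by rewrite -!EFinB opprB addrA subrK.
Qed.

(** An alias of the Lebesgue measure of the plane, to carry its structure
    of sigma-finite measure. *)
Definition leb2 (A : set (plane R)) : \bar R := lebesgue2 A.

HB.instance Definition _ := isMeasure.Build _ _ _ leb2
  (measure0 (@lebesgue2 R)) (measure_ge0 (@lebesgue2 R))
  (@measure_semi_sigma_additive _ _ _ (@lebesgue2 R)).

Lemma bigcup_eball : \bigcup_n eball (@origin R) n%:R = setT.
Proof.
apply/seteqP; split => // x _; exists (Num.truncn ((x.1 : R) ^+ 2 + (x.2 : R) ^+ 2)%R).+1 => //.
apply/eballE; split => //; rewrite /= !subr0.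
set t := (_ + _)%R; have t0 : (0 <= t)%R by rewrite addr_ge0// sqr_ge0.
apply: (@le_trans _ _ (Num.truncn t).+1%:R%R); first exact/ltW/truncnS_gt.
by rewrite -natrX ler_nat; apply: leq_pmulr.
Qed.

Let leb2_sigma_finite : sigma_finite setT leb2.
Proof.
exists (fun n => eball (@origin R) n%:R); first by rewrite bigcup_eball.
move=> n; split; first exact: measurable_eball.
have := @intensity_fin (eball (@origin R) n%:R `*` setT).
rewrite intensityX//; last exact: measurable_eball.
rewrite probability_setT mule1; apply; apply: bounded_windowX.
by split; [exact: measurable_eball|exists n%:R].
Qed.

HB.instance Definition _ := Measure_isSigmaFinite.Build _ _ _ leb2 leb2_sigma_finite.

Lemma measurable_shift (a : plane R) : measurable_fun setT (shift a).
Proof.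
apply: measurable_fun_pair.
  by apply: measurable_funD => //; exact: measurable_fst.
by apply: measurable_funD => //; exact: measurable_snd.
Qed.

Lemma measurable_mshift (a : plane R) : measurable_fun setT (@mshift R dM M a).
Proof.
apply: measurable_fun_pair => //.
exact: (measurableT_comp (measurable_shift a) measurable_fst).
Qed.

Lemma lebesgue2_shift (a : plane R) (A : set (plane R)) : measurable A ->
  lebesgue2 (shift a @^-1` A) = lebesgue2 A.
Proof.
move=> mA; have ms := measurable_shift a.
rewrite -[LHS]/(pushforward lebesgue2 _ A); apply/esym.
apply: (product_measure_unique (m1 := @lebesgue_measure R) (m2 := @lebesgue_measure R)) => // B B' mB mB'.
rewrite -[LHS]/(lebesgue2 (shift a @^-1` (B `*` B'))) (_ : _ @^-1` _ =
  ((fun x : measurableTypeR R => (x : R) + (a.1 : R))%R @^-1` B) `*`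
  ((fun x : measurableTypeR R => (x : R) + (a.2 : R))%R @^-1` B')).
  rewrite lebesgue2X ?lebesgue_measure_shift//.
    by rewrite -[X in measurable X]setTI; apply: measurable_funD.
  by rewrite -[X in measurable X]setTI; apply: measurable_funD.
by apply/seteqP; split.
Qed.

Lemma intensity_shift (a : plane R) (B : set E) : measurable B ->
  intensity lm (mshift a @^-1` B) = intensity lm B.
Proof.
move=> mB; have ms := measurable_mshift a.
rewrite -[LHS]/(pushforward (intensity lm) _ B); apply/esym.
apply: (product_measure_unique (m1 := leb2) (m2 := lm)) => // A A' mA mA'.
rewrite -[LHS]/(intensity lm (mshift a @^-1` (A `*` A'))) (_ : _ @^-1` _ = (shift a @^-1` A) `*` A'); last first.
  by apply/seteqP; split.
rewrite intensityX ?lebesgue2_shift//.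
by rewrite -[X in measurable X]setTI; exact: measurable_shift.
Qed.

End intensity.

(** * The Poisson process *)

Lemma null_bigcup d (T : measurableType d) (R : realType)
    (m : {measure set T -> \bar R}) (F : (set T)^nat) :
  (forall n, measurable (F n)) -> (forall n, m (F n) = 0%E) -> m (\bigcup_n F n) = 0%E.
Proof.
move=> mF F0; apply: measure_negligible; first exact: bigcupT_measurable.
apply: negligible_bigcup => n; apply/negligibleP; [exact: mF|exact: F0].
Qed.

Lemma probability_setC0 d (T : measurableType d) (R : realType)
    (m : probability T R) (A : set T) : measurable A -> m A = 1%E -> m (~` A) = 0%E.
Proof. by move=> mA A1; rewrite probability_setC// A1 subee. Qed.

Lemma probability_setC1 d (T : measurableType d) (R : realType)
    (m : probability T R) (A : set T) : measurable A -> m (~` A) = 0%E -> m A = 1%E.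
Proof.
move=> mA; rewrite probability_setC// => /eqP.
by rewrite sube_eq ?add0e ?fin_num_measure// => /eqP.
Qed.

Section poisson.
Context {R : realType} {dM : measure_display} {M : measurableType dM}.
Variable lm : probability M R.
Local Notation E := (plane R * M)%type.
Local Notation C := (config R M).
Local Open Scope ereal_scope.

Definition rate (L : set (plane R)) (B : set E) : R :=
  fine (intensity lm (B `&` (L `*` setT))).

Definition poisson_weight (r : R) (k : nat) : R := (r ^+ k / k`!%:R * expR (- r))%R.

Lemma poisson_weight0 : poisson_weight 0 0 = 1%R.
Proof. by rewrite /poisson_weight expr0 fact0 divr1 oppr0 expR0 mulr1. Qed.

Lemma rate_ge0 L B : (0 <= rate L B)%R.
Proof. by rewrite /rate fine_ge0. Qed.

Lemma poisson_cell L (Q : probability C R) n (B : 'I_n -> set E) k :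
  poisson_law lm L Q -> (forall i, bounded_window (B i)) -> trivIset setT B ->
  Q (count_cell B k) = (\prod_(i < n) poisson_weight (rate L (B i)) (k i))%:E.
Proof. by move=> QP bB tB; apply: QP => // i; have [] := bB i. Qed.

Lemma poisson_subcell L (Q : probability C R) n (B : 'I_n -> set E) k (J : {set 'I_n}) :
  poisson_law lm L Q -> (forall i, bounded_window (B i)) -> trivIset setT B ->
  Q [set phi | forall i, i \in J -> npts phi (B i) = k i] =
    (\prod_(i in J) poisson_weight (rate L (B i)) (k i))%:E.
Proof.
move=> QP bB tB.
pose B' i := if i \in J then B i else set0.
pose k' i := if i \in J then k i else 0%N.
rewrite (_ : [set _ | _] = count_cell B' k').
  have bB' i : bounded_window (B' i).
    by rewrite /B'; case: ifP => _; [exact: bB|exact: bounded_window0].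
  have tB' : trivIset setT B'.
    move=> i j _ _; rewrite /B'; case: ifP => _; case: ifP => _; rewrite ?setI0 ?set0I; try by case.
    exact: tB.
  rewrite (poisson_cell k' QP bB' tB').
  congr (_%:E); rewrite [RHS]big_mkcond; apply: eq_bigr => i _.
  rewrite /B' /k'; case: ifP => _; first by [].
  by rewrite /rate set0I measure0 poisson_weight0.
apply/seteqP; split => phi /=.
  move=> h i _ /=; rewrite /B' /k'; case: ifP => [/h//|_].
  by rewrite npts_set0// setI0.
by move=> h i iJ; have := h i Logic.I; rewrite /B' /k'/= iJ.
Qed.

Lemma poisson_one L (Q : probability C R) (B : set E) k :
  poisson_law lm L Q -> bounded_window B ->
  Q [set phi | npts phi B = k] = (poisson_weight (rate L B) k)%:E.
Proof.
move=> QP bB; have := @poisson_cell L Q 1 (fun=> B) (fun=> k) QP (fun=> bB).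
rewrite big_ord_recl big_ord0 mulr1 => <-.
  congr (Q _); apply/seteqP; split => phi; first by move=> h i _.
  by move=> /(_ ord0 Logic.I).
by move=> i j _ _ _; rewrite !ord1.
Qed.

Lemma poisson_outside L (Q : probability C R) (B : set E) :
  poisson_law lm L Q -> bounded_window B -> B `&` (L `*` setT) = set0 ->
  Q [set phi | npts phi B = 0%N] = 1.
Proof.
by move=> QP bB d; rewrite (poisson_one _ QP)// /rate d measure0/= poisson_weight0.
Qed.

Lemma configs_inE L : measurable L -> configs_in L =
  \bigcap_n [set phi : C | npts phi ((eball origin n%:R `&` ~` L) `*` setT) = 0%N].
Proof.
move=> mL; apply/seteqP; split => phi.
  move=> h n _ /=; apply: npts_set0; apply/seteqP; split => // z [/h[zL _] [[_ +] _]].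
  exact.
move=> h z pz; split => //; apply: contrapT => nL.
have [n _ zn] : (\bigcup_n eball (@origin R) n%:R) z.1 by rewrite bigcup_eball.
have := h n Logic.I => /= /npts0 e.
have : (pts phi `&` ((eball origin n%:R `&` ~` L) `*` setT)) z by [].
rewrite e//; apply: bounded_windowX; split.
  by apply: measurableI; [exact: measurable_eball|exact: measurableC].
by exists n%:R => ? [].
Qed.

Lemma bounded_window_ballD (L : set (plane R)) n : measurable L ->
  bounded_window ((eball origin n%:R `&` ~` L) `*` [set: M]).
Proof.
move=> mL; apply: bounded_windowX; split.
  by apply: measurableI; [exact: measurable_eball|exact: measurableC].
by exists n%:R => ? [].
Qed.

Lemma measurable_configs_in L : measurable L -> measurable (@configs_in R dM M L).
Proof.
move=> mL; rewrite configs_inE//; apply: bigcapT_measurable => n.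
by apply: measurable_npts_eq; exact: bounded_window_ballD.
Qed.

Lemma poisson_configs_in L (Q : probability C R) : measurable L ->
  poisson_law lm L Q -> Q (configs_in L) = 1.
Proof.
move=> mL QP; have mc := measurable_configs_in mL.
have : Q (~` configs_in L) = 0.
  rewrite configs_inE// setC_bigcap.
  apply: null_bigcup => n.
    by apply: measurableC; apply: measurable_npts_eq; exact: bounded_window_ballD.
  apply: probability_setC0; first by apply: measurable_npts_eq; exact: bounded_window_ballD.
  apply: (poisson_outside QP); first exact: bounded_window_ballD.
  by apply/seteqP; split => // z [[[_ +] _] [+ _]].
by move=> ?; exact: probability_setC1.
Qed.

(** The rates of the process restricted to [U] are those of the process of
    the smaller window. *)
Lemma poisson_restr W U (Q Q' : probability C R) : measurable U ->
  poisson_law lm W Q -> poisson_law lm (W `&` U) Q' ->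
  forall X, measurable X -> Q (restr U @^-1` X) = Q' X.
Proof.
move=> mU QP QP' X mX; have mr := @measurable_restr _ _ M _ mU.
rewrite -[LHS]/(pushforward Q (restr U) X).
apply: (config_measure_unique (@bounded_window0 R dM M)) => //.
- by rewrite -[X in (X < _)%E]/(Q setT) probability_setT ltry.
- move=> n B J k bB tB _; rewrite -[RHS]/(Q' (count_cell B k)) (poisson_cell k QP' bB tB).
  rewrite -[LHS]/(Q (restr U @^-1` count_cell B k)) (_ : _ @^-1` _ = count_cell (fun i => B i `&` (U `*` setT)) k); last first.
    by apply/seteqP; split => phi h i _ /=; have := h i Logic.I; rewrite /= npts_restr.
  have bB' i : bounded_window (B i `&` (U `*` setT)).
    by rewrite setIC; apply: bounded_windowI => //; exact: measurableX.
  have tB' : trivIset setT (fun i => B i `&` (U `*` [set: M])).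
    by move=> i j _ _ [z [[zi _] [zj _]]]; apply: tB => //; exists z.
  rewrite (poisson_cell k QP bB' tB').
  congr (_%:E); apply: eq_bigr => i _; rewrite /rate.
  by rewrite -setIA -setXI setIT [U `&` W]setIC.
Qed.

Lemma measurable_translate (a : plane R) : measurable_fun setT (@translate R dM M a).
Proof.
apply: measurable_config => B bB; under eq_fun do rewrite npts_translate.
apply: measurable_npts; split.
  by rewrite -[X in measurable X]setTI; apply: measurable_mshift => //; case: bB.
case: bB => _ [r Br]; exists (r + (`|a.1 : R| + `|a.2 : R|))%R => z /Br[/= h _].
by split => //; exact: eball_shift h.
Qed.

Lemma poisson_translate (a : plane R) (W W' : set (plane R)) (Q Q' : probability C R) :
  (forall x, W' (shift a x) <-> W x) -> measurable W' ->
  poisson_law lm W Q -> poisson_law lm W' Q' ->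
  forall X, measurable X -> Q (translate a @^-1` X) = Q' X.
Proof.
move=> WW' mW' QP QP' X mX; have mt := measurable_translate a.
rewrite -[LHS]/(pushforward Q (translate a) X).
apply: (config_measure_unique (@bounded_window0 R dM M)) => //.
- by rewrite -[X in (X < _)%E]/(Q setT) probability_setT ltry.
- move=> n B J k bB tB _; rewrite -[RHS]/(Q' (count_cell B k)) (poisson_cell k QP' bB tB).
  rewrite -[LHS]/(Q (translate a @^-1` count_cell B k)) (_ : _ @^-1` _ = count_cell (fun i => mshift a @^-1` B i) k); last first.
    by apply/seteqP; split => phi h i _ /=; have := h i Logic.I; rewrite /= npts_translate.
  have mB i : measurable (mshift a @^-1` B i).
    by rewrite -[Y in measurable Y]setTI; apply: measurable_mshift => //; case: (bB i).
  have bB' i : bounded_window (mshift a @^-1` B i).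
    split => //.
    case: (bB i) => _ [r Br]; exists (r + (`|a.1 : R| + `|a.2 : R|))%R => z /Br[/= h _].
    by split => //; exact: eball_shift h.
  have tB' : trivIset setT (fun i => mshift a @^-1` B i).
    by move=> i j _ _ [z [/= zi zj]]; apply: tB => //; exists (mshift a z).
  rewrite (poisson_cell k QP bB' tB').
  congr (_%:E); apply: eq_bigr => i _; rewrite /rate.
  rewrite -(intensity_shift lm a (B := B i `&` (W' `*` setT))); last first.
    by apply: measurableI; [case: (bB i)|exact: measurableX].
  congr (poisson_weight (fine (intensity lm _)) _).
  by apply/seteqP; split => z [Bz [/= h _]]; split => //; split => //=; exact/WW'.
Qed.

End poisson.

Section measure_extra.
Local Open Scope ereal_scope.
Context d (T : measurableType d) (R : realType).

Lemma measure_full_eq (m : {measure set T -> \bar R}) (N A B : set T) :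
  measurable N -> measurable A -> measurable B ->
  m (~` N) = 0 -> A `&` N = B `&` N -> m A = m B.
Proof.
move=> mN mA mB N0 AB.
have h X : measurable X -> m X = m (X `&` N).
  move=> mX; rewrite -{1}(setIT X) -(setUv N) setIUr measureU//.
  - have mXN : measurable (X `&` ~` N) by apply: measurableI => //; exact: measurableC.
    rewrite [X in _ + X](_ : _ = 0) ?adde0//.
    by apply: (subset_measure0 mXN (measurableC mN)).
  - exact: measurableI.
  - by apply: measurableI => //; exact: measurableC.
  - by rewrite setIACA setICr setI0.
by rewrite (h A)// (h B)// AB.
Qed.

Lemma ge0_integral_law d' (Y : measurableType d') (m : {measure set T -> \bar R})
    (q : {measure set Y -> \bar R}) (u : Y -> T) :
  measurable_fun setT u ->
  (forall A, measurable A -> m A = q (u @^-1` A)) ->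
  forall f, measurable_fun setT f -> (forall x, 0 <= f x) ->
  \int[m]_x f x = \int[q]_y f (u y).
Proof.
move=> mu mE f mf f0.
rewrite (@ge0_integral_density _ _ _ _ _ m q (cst 1%R) u)//.
  by apply: eq_integral => y _; rewrite mul1e.
move=> A mA; rewrite mE//; transitivity (\int[q]_y (\1_(u @^-1` A) y)%:E).
  by rewrite integral_indic ?setIT// -[X in measurable X]setTI; exact: mu.
by apply: eq_integral => y _; rewrite mul1e.
Qed.

End measure_extra.

Section poisson_independence.
Context {R : realType} {dM : measure_display} {M : measurableType dM}.
Variable lm : probability M R.
Local Notation E := (plane R * M)%type.
Local Notation C := (config R M).
Local Open Scope ereal_scope.

Lemma npts_splice_in (L : set (plane R)) (psi phi : C) (B : set E) : B `<=` L `*` setT ->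
  npts (splice L psi phi) B = npts psi B.
Proof.
move=> BL; apply: eq_npts; apply/seteqP; split => z.
  by move=> [[[pz _]|[_ [+ _]]] Bz] => [//|]; have [zL _] := BL _ Bz; move=> /(_ zL).
by move=> [pz Bz]; split => //; left; split => //; exact: BL.
Qed.

Lemma npts_splice_out (L : set (plane R)) (psi phi : C) (B : set E) : B `&` (L `*` setT) = set0 ->
  npts (splice L psi phi) B = npts phi B.
Proof.
move=> BL; apply: eq_npts; apply/seteqP; split => z.
  move=> [[[_ zL]|[pz _]] Bz]; last by [].
  by have : (B `&` (L `*` setT)) z by []; rewrite BL.
move=> [pz Bz]; split => //; right; split => //; split => //= zL.
by have : (B `&` (L `*` setT)) z by []; rewrite BL.
Qed.

(** Disjoint regions are independent: replacing what happens in [L] by an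
    independent copy preserves the Poisson law. On the joint counts of a
    family of which [L] is a union, both sides are the same product. *)
Lemma poisson_splice (W L : set (plane R)) (Q : probability C R) : bounded_borel L ->
  poisson_law lm W Q -> forall X, measurable X ->
  Q X = (Q \x Q) ((fun u : C * C => splice L u.1 u.2) @^-1` X).
Proof.
move=> bL QP X mX; have [mL _] := bL.
have ms : measurable_fun setT (fun u : C * C => splice L u.1 u.2).
  exact: measurable_splice.
rewrite -[RHS]/(pushforward (Q \x Q) _ X).
apply: (config_measure_unique (bounded_windowX bL)) => //.
  by rewrite -[X in (X < _)]/(Q setT) probability_setT ltry.
move=> n B J k bB tB AE; rewrite -[LHS]/(Q (count_cell B k)) (poisson_cell k QP bB tB).
rewrite -[RHS]/((Q \x Q) ((fun u : C * C => splice L u.1 u.2) @^-1` (count_cell B k))).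
rewrite (_ : _ @^-1` _ = [set phi : C | forall i, i \in J -> npts phi (B i) = k i] `*`
    [set phi : C | forall i, i \in (~: J)%SET -> npts phi (B i) = k i]); last first.
  have inJ i : i \in J -> B i `<=` L `*` setT by move=> iJ; rewrite AE; apply: bigcup_sup.
  have outJ i : i \notin J -> B i `&` (L `*` setT) = set0.
    move=> iJ; rewrite AE; apply/seteqP; split => // z [zi [j /= jJ zj]].
    by move: iJ; rewrite (tB i j Logic.I Logic.I (ex_intro _ z (conj zi zj))) jJ.
  apply/seteqP; split => -[psi phi] /= h.
    split => i.
      by move=> iJ; have := h i Logic.I; rewrite /= npts_splice_in//; exact: inJ.
    by rewrite inE => iJ; have := h i Logic.I; rewrite /= npts_splice_out//; exact: outJ.
  move=> i _ /=; have [iJ|iJ] := boolP (i \in J).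
    by rewrite npts_splice_in; [exact: h.1|exact: inJ].
  by rewrite npts_splice_out; [apply: h.2; rewrite inE|exact: outJ].
have mJ (J' : {set 'I_n}) : measurable [set phi : C | forall i, i \in J' -> npts phi (B i) = k i].
  exact: (@measurable_count_event _ _ _ n B [set f | forall i, i \in J' -> f i = k i] bB).
rewrite (product_measure1E Q Q (mJ J) (mJ (~: J)%SET)).
rewrite [X in _ = X * _](poisson_subcell k J QP bB tB).
rewrite [X in _ = _ * X](poisson_subcell k (~: J)%SET QP bB tB).
rewrite -EFinM; congr (_%:E); rewrite (bigID (mem J))/=; congr (_ * _)%R.
by apply: eq_bigl => i; rewrite inE.
Qed.

Lemma poisson_splice_integral (W L : set (plane R)) (Q : probability C R) F :
  bounded_borel L -> poisson_law lm W Q -> measurable_fun setT F -> (forall x, 0 <= F x) ->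
  \int[Q]_x F x = \int[Q]_psi \int[Q]_phi F (splice L psi phi).
Proof.
move=> bL QP mF F0; have [mL _] := bL.
have ms : measurable_fun setT (fun u : C * C => splice L u.1 u.2).
  exact: measurable_splice.
rewrite (ge0_integral_law ms (poisson_splice bL QP) mF F0).
rewrite (fubini_tonelli1 (fun u : C * C => F (splice L u.1 u.2)))//.
exact: measurableT_comp.
Qed.

Definition vacant (B : set (plane R)) : set C := [set phi | npts phi (B `*` setT) = 0%N].

Lemma measurable_vacant B : bounded_borel B -> measurable (vacant B).
Proof. by move=> bB; apply: measurable_npts_eq; exact: bounded_windowX. Qed.

Lemma bounded_borelD (A B : set (plane R)) : bounded_borel A -> measurable B ->
  bounded_borel (A `\` B).
Proof.
move=> [mA [r Ar]] mB; split; first exact: measurableD.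
by exists r => x [/Ar].
Qed.

Lemma bounded_borelI (A B : set (plane R)) : bounded_borel A -> measurable B ->
  bounded_borel (A `&` B).
Proof.
move=> [mA [r Ar]] mB; split; first exact: measurableI.
by exists r => x [/Ar].
Qed.

Lemma poisson_vacant_gt0 W B (Q : probability C R) : bounded_borel B ->
  poisson_law lm W Q -> 0 < Q (vacant B).
Proof.
move=> bB QP; rewrite /vacant (poisson_one 0 QP (bounded_windowX bB)) lte_fin.
by rewrite /poisson_weight expr0 fact0 divr1 mul1r expR_gt0.
Qed.

Lemma restr_id (L : set (plane R)) (phi : C) : configs_in L phi -> restr L phi = phi.
Proof.
move=> h; apply: config_eq; apply/seteqP; split => z; first by case.
by move=> pz; split => //; exact: h.
Qed.

Lemma vacant_notin (B : set (plane R)) (phi : C) z : bounded_borel B -> vacant B phi -> pts phi z -> ~ B z.1.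
Proof.
move=> bB /npts0 => /(_ (bounded_windowX bB)) e pz Bz.
by have : (pts phi `&` (B `*` setT)) z by []; rewrite e.
Qed.

Lemma notin_vacant (B : set (plane R)) (phi : C) : (forall z, pts phi z -> ~ B z.1) -> vacant B phi.
Proof.
by move=> h; apply: npts_set0; apply/seteqP; split => // z [/h + [+ _]].
Qed.

(** The Poisson process on [W] is that on [L] together with an independent
    one on the difference, so that its law conditioned on no point in the
    difference is the process on [L]. *)
Lemma poisson_vacant (W L : set (plane R)) (Q Q' : probability C R) :
  bounded_borel W -> measurable L -> L `<=` W ->
  poisson_law lm W Q -> poisson_law lm L Q' ->
  forall X, measurable X -> Q (X `&` vacant (W `\` L)) = Q (vacant (W `\` L)) * Q' X.
Proof.
move=> bW mL LW QP QP' X mX; have [mW _] := bW.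
have bL : bounded_borel L by rewrite -(setIidr LW); exact: bounded_borelI.
have bD : bounded_borel (W `\` L) by exact: bounded_borelD.
have mV := measurable_vacant bD.
have QP'' : poisson_law lm (W `&` L) Q' by rewrite setIidr.
rewrite -(poisson_restr mL QP QP'' mX) (poisson_splice bL QP); last exact: measurableI.
have mr : measurable (restr L @^-1` X : set C).
  by rewrite -[Y in measurable Y]setTI; exact: measurable_restr.
have ms : measurable_fun setT (fun u : C * C => splice L u.1 u.2).
  exact: measurable_splice.
have mc := @measurable_configs_in R dM M W mW.
rewrite muleC -(product_measure1E Q Q mr mV).
apply: (@measure_full_eq _ _ _ (Q \x Q)%E (setT `*` configs_in W)).
- exact: measurableX.
- by rewrite -[Y in measurable Y]setTI; apply: ms => //; exact: measurableI.
- exact: measurableX.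
- rewrite (_ : ~` _ = setT `*` ~` configs_in W); last first.
    by apply/seteqP; split => -[psi phi] /=; [move=> h; split => // ?; exact: h|case=> _ h []].
  apply: (eq_trans (product_measure1E Q Q measurableT (measurableC mc))).
  rewrite [X in _ * X](_ : _ = 0) ?mule0//.
  exact: probability_setC0 mc (poisson_configs_in mW QP).
have key psi phi : configs_in W phi -> vacant (W `\` L) phi -> splice L psi phi = restr L psi.
  move=> cp vp; apply: config_eq; apply/seteqP; split => z; last by left.
  move=> [//|[pz [/= nL _]]]; exfalso; apply: (vacant_notin bD vp pz); split => //.
  by have [] := cp _ pz.
apply/seteqP; split => -[psi phi] /=.
  move=> [[Xs Vs] [_ cp]].
  have vp : vacant (W `\` L) phi.
    apply: notin_vacant => z pz Wz; apply: (vacant_notin bD Vs _ Wz); right; split => //.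
    by case: Wz.
  by split => //; split => //; rewrite /preimage/= -(key psi phi).
move=> [[Xr vp] [_ cp]]; split => //.
rewrite /preimage/= (key psi phi)//; split => //.
by apply: notin_vacant => z [_ [zL _]] [_].
Qed.

Lemma poisson_vacant_integral (W L : set (plane R)) (Q Q' : probability C R) F :
  bounded_borel W -> measurable L -> L `<=` W ->
  poisson_law lm W Q -> poisson_law lm L Q' ->
  measurable_fun setT F -> (forall x, 0 <= F x) ->
  \int[Q]_x ((\1_(vacant (W `\` L)) x : R)%:E * F x) =
    Q (vacant (W `\` L)) * \int[Q']_x F x.
Proof.
move=> bW mL LW QP QP' mF F0.
have bD : bounded_borel (W `\` L) by exact: bounded_borelD.
have mV := measurable_vacant bD.
pose c := fine (Q (vacant (W `\` L))).
have cE : c%:E = Q (vacant (W `\` L)) by rewrite fineK// fin_num_measure.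
have c0 : (0 <= c)%R by rewrite fine_ge0.
rewrite -cE -ge0_integralZl_EFin//.
transitivity (\int[mrestr Q mV]_x F x); last first.
  apply: (@ge0_integral_density _ _ _ _ _ _ Q' (cst c) id) => // A mA.
  rewrite -[LHS]/(Q (A `&` vacant (W `\` L))) (poisson_vacant bW mL LW QP QP' mA) -cE.
  by rewrite ge0_integralZl_EFin// ?integral_indic ?setIT//; apply/measurable_EFinP.
apply/esym; apply: (@ge0_integral_density _ _ _ _ _ _ Q (\1_(vacant (W `\` L))) id) => // A mA.
rewrite -[LHS]/(Q (A `&` vacant (W `\` L))) setIC -[X in Q X]setIT -integral_indic//; last exact: measurableI.
by apply: eq_integral => x _; rewrite -EFinM indicI.
Qed.

End poisson_independence.

(** * The Slivnyak--Mecke formula *)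

Section mecke.
Context {R : realType} {dM : measure_display} {M : measurableType dM}.
Variable lm : probability M R.
Local Notation E := (plane R * M)%type.
Local Notation C := (config R M).
Local Open Scope ereal_scope.

Definition window_intensity (W : set E) (bW : bounded_window W) :=
  mfrestr (bW.1) (intensity_fin lm bW).

HB.instance Definition _ W (bW : bounded_window W) := 
  FiniteMeasure.copy (window_intensity bW) (mfrestr (bW.1) (intensity_fin lm bW)).

Lemma integral_window (W : set E) (bW : bounded_window W) f :
  measurable_fun setT f -> (forall z, 0 <= f z) ->
  \int[window_intensity bW]_z f z = \int[intensity lm]_(z in W) f z.
Proof.
move=> mf f0.
rewrite (@ge0_integral_density _ _ _ _ _ (window_intensity bW) (intensity lm) (\1_W) id)//.
- rewrite [RHS]integral_mkcond; apply: eq_integral => z _; rewrite patchE indicE.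
  by case: (z \in W); rewrite ?mul1e ?mul0e.
- by apply: measurable_indic; case: bW.
- move=> A mA; rewrite -[LHS]/(intensity lm (A `&` W)) setIC -[X in intensity lm X]setIT.
  rewrite -integral_indic//; last by apply: measurableI => //; case: bW.
  by apply: eq_integral => x _; rewrite -EFinM indicI.
Qed.

Definition bump_count n (k : 'I_n -> nat) (j : 'I_n) : 'I_n -> nat := fun i => (k i + (i == j))%N.

(** Removing a point of [B j] from a configuration with one more point in
    [B j] leads to the cell of the counts [k], in as many ways as there are
    points in [B j]. *)
Lemma palm_cell (W : set E) n (B : 'I_n -> set E) (J : {set 'I_n}) k (phi : C) :
  bounded_window W -> (forall i, bounded_window (B i)) -> trivIset setT B ->
  \bigcup_(i in [set i | i \in J]) B i `<=` W ->
  palm W phi ((\bigcup_(i in [set i | i \in J]) B i) `*` count_cell B k) =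
  \sum_(j in J) ((k j).+1%:R%:E * (\1_(count_cell B (bump_count k j)) phi : R)%:E).
Proof.
move=> bW bB tB JW; rewrite palmE.
transitivity (\sum_(z <- listing W phi) \sum_(j in J)
   ((\1_(B j) z : R)%:E * (\1_(count_cell B (bump_count k j)) phi : R)%:E)).
  rewrite big_seq [RHS]big_seq; apply: eq_bigr => z; rewrite mem_listing// => /andP[/set_mem pz zW].
  rewrite indicE in_setX/=.
  have [/set_mem[j /= jJ zj]|zJ] := boolP (z \in _); last first.
    rewrite big1// => j jJ; rewrite indicE memNset ?mul0e// => zj.
    by move/negP: zJ; apply; apply/mem_set; exists j.
  have zB i : (z \in B i) = (i == j).
    apply/idP/eqP => [/set_mem zi|->]; last exact: mem_set.
    by apply: tB => //; exists z.
  rewrite (bigD1 j)//= big1 ?adde0; last first.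
    by move=> i /andP[_ ij]; rewrite indicE zB (negbTE ij) mul0e.
  rewrite !indicE zB eqxx mul1e; congr ((nat_of_bool _)%:R%:E).
  apply/idP/idP => /set_mem h; apply/mem_set => i _ /=; have := h i Logic.I => /=.
    by rewrite /bump_count (npts_remove (bB i) pz) zB => ->.
  by rewrite /bump_count (npts_remove (bB i) pz) zB => /addIn.
rewrite exchange_big/=; apply: eq_bigr => j jJ.
rewrite -ge0_sume_distrl; last by move=> z _; rewrite lee_fin.
rewrite sum_indic_listing//; last by move=> z zj; apply: JW; exists j.
rewrite indicE; have [/set_mem h|_] := boolP (phi \in _); last by rewrite !mule0.
by have := h j Logic.I; rewrite /= /bump_count eqxx addn1 => ->.
Qed.

(** The ratio of two successive Poisson weights is the rate over the number
    of points: the combinatorial core of the Slivnyak--Mecke formula. *)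
Lemma poisson_bump L (Q : probability C R) n (B : 'I_n -> set E) k j :
  poisson_law lm L Q -> (forall i, bounded_window (B i)) -> trivIset setT B ->
  (k j).+1%:R%:E * Q (count_cell B (bump_count k j)) = (rate lm L (B j))%:E * Q (count_cell B k).
Proof.
move=> QP bB tB; rewrite [X in _ * X](poisson_cell _ QP bB tB) [X in _ = _ * X](poisson_cell _ QP bB tB).
rewrite -!EFinM; congr (_%:E).
rewrite (bigD1 j)//= [in RHS](bigD1 j)//= !mulrA; congr (_ * _)%R; last first.
  by apply: eq_bigr => i ij; rewrite /bump_count (negbTE ij) addn0.
rewrite /bump_count eqxx addn1 /poisson_weight factS exprS natrM invfM.
by rewrite !mulrA; congr (_ * _ * _)%R; field.
Qed.

(** For fixed [A], both sides are finite measures in [F]; they agree on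
    joint counts by the recurrence of the Poisson weights. *)
Lemma mecke_rectangle W (Q : probability C R) (bW : bounded_borel W) (A : set E) (F : set C) :
  poisson_law lm W Q -> measurable A -> measurable F ->
  \int[Q]_phi palm (W `*` setT) phi (A `*` F) =
  window_intensity (bounded_windowX bW) A * Q F.
Proof.
move=> QP mA mF; pose Wm : set E := W `*` setT.
have bWm : bounded_window Wm := bounded_windowX bW.
have bA : bounded_window (A `&` Wm) by exact: bounded_windowI.
have mp := measurable_palm bWm.
have -> : \int[Q]_phi palm Wm phi (A `*` F) = \int[Q]_phi palm Wm phi ((A `&` Wm) `*` F).
  apply: eq_integral => phi _; rewrite !palmE big_seq [RHS]big_seq; apply: eq_bigr => z.
  by rewrite mem_listing// => /andP[_ zW]; rewrite !indicE !in_setX/= in_setI zW andbT.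
rewrite -[window_intensity _ A]/(intensity lm (A `&` Wm)).
move: (A `&` Wm) (@subIsetr _ A Wm) bA => {A mA} A AW bA.
have mA : measurable A by case: bA.
have mAT : measurable (A `*` [set: C]) by exact: measurableX.
have fA := intensity_fin_num lm bA.
have c0 : (0 <= fine (intensity lm A))%R by exact: fine_ge0.
pose c := NngNum c0.
have msnd : measurable_fun setT (snd : E * C -> C) by exact: measurable_snd.
have rew (X : set C) : (snd : E * C -> C) @^-1` X `&` (A `*` setT) = A `*` X.
  by apply/seteqP; split => -[z phi] /=; [move=> [? []]|move=> []].
transitivity (pushforward (mrestr (mbind Q mp) mAT) (snd : E * C -> C) F).
  by rewrite /pushforward/= /mrestr rew.
transitivity (mscale c Q F); last by rewrite /mscale/= fineK.
apply/esym; apply: (config_measure_unique bA) => //.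
  rewrite -[X in X < _]/((fine (intensity lm A))%:E * Q setT).
  by rewrite probability_setT mule1 ltry.
move=> n B J k bB tB AE; apply/esym.
rewrite -[LHS]/(\int[Q]_phi palm Wm phi ((snd : E * C -> C) @^-1` (count_cell B k) `&` (A `*` setT))) rew.
rewrite -[RHS]/((fine (intensity lm A))%:E * Q (count_cell B k)) fineK// AE.
have JW : \bigcup_(i in [set i | i \in J]) B i `<=` Wm by rewrite -AE.
under eq_integral => phi _ do rewrite (palm_cell k phi bWm bB tB JW) -big_enum/=.
have mcell k' : measurable (count_cell B k') by exact: measurable_count_cell.
have mj j : measurable_fun setT (fun phi : C => (k j).+1%:R%:E * (\1_(count_cell B (bump_count k j)) phi : R)%:E).
  by apply: measurable_funeM; apply/measurable_EFinP; exact: measurable_indic.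
have j0 j (phi : C) : setT phi -> 0 <= (k j).+1%:R%:E * (\1_(count_cell B (bump_count k j)) phi : R)%:E.
  by move=> _; rewrite mule_ge0// lee_fin.
rewrite (@ge0_integral_sum _ _ _ Q setT measurableT _ _ mj j0).
under eq_bigr => j _.
  rewrite ge0_integralZl_EFin//; last by apply/measurable_EFinP; exact: measurable_indic.
  rewrite integral_indic// setIT.
  rewrite (poisson_bump k j QP bB tB).
  over.
rewrite -ge0_sume_distrl; last by move=> j _; rewrite lee_fin rate_ge0.
congr (_ * _); rewrite -AE.
have mB i : measurable (B i) by case: (bB i).
have -> : intensity lm A = \sum_(i \in [set i | i \in J]) intensity lm (B i).
  rewrite AE measure_fin_bigcup//; exact: sub_trivIset tB.
have JE : [set i | i \in J] = [set` enum J].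
  by apply/seteqP; split => i /=; rewrite mem_enum.
rewrite JE -fsbig_seq ?enum_uniq//= big_seq [RHS]big_seq; apply: eq_bigr => j.
rewrite mem_enum => jJ.
have jW : B j `<=` Wm by apply: subset_trans AW; rewrite AE; exact: bigcup_sup.
by rewrite /rate (setIidl jW) fineK// intensity_fin_num.
Qed.

(** The Slivnyak--Mecke formula as an equality of measures, which agree on
    rectangles by mecke_rectangle. *)
Lemma mecke_measure W (Q : probability C R) (bW : bounded_borel W) :
  poisson_law lm W Q -> forall X, measurable X ->
  (window_intensity (bounded_windowX bW) \x Q) X = \int[Q]_phi palm (W `*` setT) phi X.
Proof.
move=> QP X mX; have mp := measurable_palm (bounded_windowX bW : bounded_window (W `*` [set: M])).
rewrite -[RHS]/(mbind Q mp X).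
apply: product_measure_unique => // A B mA mB.
exact: mecke_rectangle.
Qed.

Lemma mecke W (Q : probability C R) (bW : bounded_borel W) (h : E * C -> \bar R) :
  poisson_law lm W Q -> measurable_fun setT h -> (forall x, 0 <= h x) ->
  \int[Q]_phi \sum_(z <- listing (W `*` setT) phi) h (z, cremove phi z) =
  \int[window_intensity (bounded_windowX bW)]_z \int[Q]_phi h (z, phi).
Proof.
move=> QP mh h0; have bWm := bounded_windowX bW : bounded_window (W `*` [set: M]).
rewrite -(fubini_tonelli1 (m1 := window_intensity (bounded_windowX bW)) (m2 := Q) h)//.
rewrite (ge0_integral_mixture (measurable_palm bWm) (mecke_measure bW QP))//.
by apply: eq_integral => phi _; rewrite integral_palm.
Qed.

(** Marked points are distinct as soon as their marks are; here the
    locations are required to be distinct. *)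
Definition simple_in (W : set (plane R)) (phi : C) :=
  forall z w, pts phi z -> pts phi w -> W z.1 -> W w.1 -> z.1 = w.1 -> z = w.

Lemma eball0 (x y : plane R) : eball x 0 y -> x = y.
Proof.
move=> /eballE[_]; rewrite expr0n/= => h.
have a0 : (((y.1 : R) - x.1) ^+ 2 = 0)%R.
  by apply/eqP; rewrite eq_le sqr_ge0 andbT (le_trans _ h)// lerDl sqr_ge0.
have b0 : (((y.2 : R) - x.2) ^+ 2 = 0)%R.
  by apply/eqP; rewrite eq_le sqr_ge0 andbT (le_trans _ h)// lerDr sqr_ge0.
move/eqP: a0; move/eqP: b0; rewrite !sqrf_eq0 !subr_eq0 => /eqP e2 /eqP e1.
by case: x y e1 e2 {h} => [x1 x2] [y1 y2] /= -> ->.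
Qed.

(** By the Slivnyak--Mecke formula, the mean number of points that share
    their location with another one is the integral over the places of the
    rate of a single place, which is zero. *)
Lemma poisson_simple W (Q : probability C R) : bounded_borel W ->
  poisson_law lm W Q -> {ae Q, forall phi, simple_in W phi}.
Proof.
move=> bW QP; have bWm := bounded_windowX bW : bounded_window (W `*` [set: M]).
pose N := [set u : E * E | eball u.1.1 0 u.2.1].
have mN : measurable N by exact: measurable_near.
pose X := [set u : E * C | npts u.2 ((W `*` setT) `&` xsection N u.1) <> 0%N].
have mX : measurable X.
  rewrite (_ : X = (fun u : E * C => npts u.2 ((W `*` setT) `&` xsection N u.1)) @^-1` [set~ 0%N])//.
  by rewrite -[Y in measurable Y]setTI; exact: measurable_npts_xsection.
have bz z : bounded_window ((W `*` setT) `&` xsection N z).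
  by rewrite setIC; apply: bounded_windowI => //; exact: measurable_xsection.
have null : \int[Q]_phi palm (W `*` setT) phi X = 0.
  rewrite -(mecke_measure bW QP mX) /product_measure1.
  rewrite integral0_eq// => z _ /=.
  have : Q [set phi : C | npts phi ((W `*` setT) `&` xsection N z) = 0%N] = 1.
    rewrite (poisson_one 0 QP (bz z)) (_ : rate lm W _ = 0%R) ?poisson_weight0//.
    rewrite /rate (_ : intensity lm _ = 0)//.
    apply: (@intensity_null _ _ _ _ ([set z.1.1] `*` setT)).
    - by apply: measurableX.
    - by apply: measurableI; [case: (bz z)|case: bWm].
    - exact: lebesgue2_column.
    - by move=> w [[_ /xsectionP/= /eball0 e] _]; split => //=; split => //; rewrite e.
  move=> h; have := probability_setC0 (measurable_npts_eq 0 (bz z)) h.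
  rewrite (_ : xsection X z = ~` [set phi : C | npts phi ((W `*` setT) `&` xsection N z) = 0%N])//.
  by apply/seteqP; split => phi; [move=> /xsectionP|move=> ?; apply/xsectionP].
have mpX : measurable_fun setT (fun phi : C => palm (W `*` setT) phi X) by exact: measurable_palm.
have /(_ null) : \int[Q]_phi palm (W `*` setT) phi X = 0 -> ae_eq Q setT (fun phi => palm (W `*` setT) phi X) (cst 0).
  by move=> e; apply/ae_eq_integral_abs => //; rewrite -[RHS]e; apply: eq_integral => phi _; rewrite gee0_abs.
apply: filterS => phi /(_ Logic.I) p0 z w pz pw Wz Ww zw.
apply: contrapT => nzw; move: p0; rewrite palmE.
have zl : z \in listing (W `*` setT) phi.
  by rewrite mem_listing// !mem_set.
rewrite (bigD1_seq z)//= ?listing_uniq// indicE mem_set ?mulr1n; last first.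
  move=> /= /npts0 => /(_ (bz z)) e.
  have : (pts (cremove phi z) `&` (W `*` setT `&` xsection N z)) w.
    split; first by split => //= wz; apply: nzw; rewrite wz.
    split; first by split.
    by apply/xsectionP; rewrite /N/= zw; exact: eballxx.
  by rewrite e.
move=> /eqP; rewrite gt_eqF//.
by rewrite (@lt_le_trans _ _ 1)// leeDl// sume_ge0.
Qed.

(** The number of points has a Poisson law, whose exponential moments are
    exponential series. *)
Lemma poisson_exp_moment W (Q : probability C R) (bW : bounded_borel W) (c : R) :
  poisson_law lm W Q -> (0 <= c)%R ->
  \int[Q]_phi (c ^+ npts phi (W `*` setT))%:E < +oo.
Proof.
move=> QP c0; have bWm := bounded_windowX bW : bounded_window (W `*` [set: M]).
pose r := rate lm W (W `*` setT).
have r0 : (0 <= r)%R by exact: rate_ge0.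
pose A k := [set phi : C | npts phi (W `*` setT) = k].
have mA k : measurable (A k) by exact: measurable_npts_eq.
have -> : \int[Q]_phi (c ^+ npts phi (W `*` setT))%:E =
    \int[Q]_phi \sum_(k <oo) ((c ^+ k)%:E * (\1_(A k) phi : R)%:E).
  apply: eq_integral => phi _; rewrite (@nneseriesD1 _ _ (npts phi (W `*` setT)))//; last first.
    by move=> k _; rewrite mule_ge0// lee_fin// exprn_ge0.
  rewrite indicE mem_set// mule1 eseries0 ?adde0// => k _ kn.
  by rewrite indicE memNset ?mule0// => e; move/eqP: kn; apply; rewrite e.
rewrite integral_nneseries//; last 2 first.
- by move=> k; apply: measurable_funeM; apply/measurable_EFinP; exact: measurable_indic.
- by move=> k phi _; rewrite mule_ge0// lee_fin// exprn_ge0.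
have -> : \sum_(k <oo) \int[Q]_phi ((c ^+ k)%:E * (\1_(A k) phi : R)%:E) =
    \sum_(k <oo) (exp_coeff (c * r) k * expR (- r))%:E.
  apply: eq_eseriesr => k _; rewrite ge0_integralZl_EFin//; last 2 first.
  - by apply/measurable_EFinP; exact: measurable_indic.
  - exact: exprn_ge0.
  rewrite integral_indic// setIT [X in _ * X](poisson_one k QP bWm) -EFinM /poisson_weight /exp_coeff/=.
  by rewrite exprMn !mulrA.
have cv : cvgn (series (fun k => exp_coeff (c * r) k * expR (- r))%R).
  rewrite (_ : (fun k => _) = expR (- r) *: exp_coeff (c * r)).
    by apply: is_cvg_seriesZ; exact: is_cvg_series_exp_coeff.
  by apply/funext => k; rewrite /GRing.scale/= mulrC.
have := EFin_lim cv; rewrite /series/= => e.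
rewrite (_ : \sum_(k <oo) _ = (limn (fun n => \sum_(0 <= k < n) (exp_coeff (c * r) k * expR (- r)))%R)%:E) ?ltry//.
rewrite -e; congr (limn _); apply/funext => n /=; by rewrite sumEFin.
Qed.

End mecke.

(** * A law of large numbers on the square lattice *)

Section index_square.

Definition square (n : nat) : seq (int * int) :=
  [seq (Posz u - n%:Z, Posz w - n%:Z) | u <- iota 0 (n.*2.+1), w <- iota 0 (n.*2.+1)].

Lemma size_square n : size (square n) = (n.*2.+1 * n.*2.+1)%N.
Proof. by rewrite size_allpairs !size_iota. Qed.

Lemma square_uniq n : uniq (square n).
Proof.
apply: allpairs_uniq; rewrite ?iota_uniq// => -[u w] [u' w'] _ _ /= [].
by move=> /addIr [->] /addIr [->].
Qed.

Lemma mem_iota_shift (n : nat) (a : int) : (`|a| <= n%:Z) =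
  (a \in [seq Posz u - n%:Z | u <- iota 0 (n.*2.+1)]).
Proof.
apply/idP/mapP => [|[u]].
  rewrite ler_norml => /andP[h1 h2]; exists (absz (a + n%:Z)).
    by rewrite mem_iota/= add0n ltnS; lia.
  by rewrite gez0_abs ?addrK//; lia.
by rewrite mem_iota/= add0n ltnS ler_norml => h ->; apply/andP; split; lia.
Qed.

Lemma mem_square n (i : int * int) : (i \in square n) = (Num.max `|i.1| `|i.2| <= n%:Z).
Proof.
rewrite ge_max !mem_iota_shift; case: i => i j; apply/allpairsP/andP => [[[u w] [hu hw [-> ->]]]|].
  by split; apply/mapP; [exists u|exists w].
move=> [/mapP[u hu ei] /mapP[w hw ej]]; exists (u, w); split => //.
by congr pair; [exact: ei|exact: ej].
Qed.

Definition close (r : nat) (i j : int * int) : bool :=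
  Num.max `|(j - i).1| `|(j - i).2| <= r%:Z.

Lemma square_near (n r : nat) (i : int * int) :
  (count (close r i) (square n) <= size (square r))%N.
Proof.
rewrite -size_filter -(size_map (fun j => j - i)); apply: uniq_leq_size.
  by rewrite map_inj_uniq ?filter_uniq ?square_uniq// => x y /addIr.
by move=> _ /mapP[j + ->]; rewrite mem_filter => /andP[+ _]; rewrite mem_square.
Qed.

End index_square.

Section square_lln.
Context d (T : measurableType d) (R : realType) (m : probability T R).
Variable tau : int * int -> T -> T.
Hypothesis mtau : forall i, measurable_fun setT (tau i).
Hypothesis tauP : forall i A, measurable A -> m (tau i @^-1` A) = m A.
Hypothesis tauD : forall i j x, tau i (tau j x) = tau (i + j) x.
Variables (a c : T -> R).
Hypothesis ma : measurable_fun setT (a : T -> measurableTypeR R).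
Hypothesis mc : measurable_fun setT (c : T -> measurableTypeR R).
Hypothesis a0 : forall x, 0 <= a x.
Hypothesis c0 : forall x, 0 <= c x.
Local Open Scope ereal_scope.
Hypothesis a2 : \int[m]_x (a x ^+ 2)%:E < +oo.
Hypothesis c2 : \int[m]_x (c x ^+ 2)%:E < +oo.
Variable r : nat.
Hypothesis orth : forall j : int * int, (r%:Z < Num.max `|j.1| `|j.2|)%R ->
  \int[m]_x (a x * a (tau j x))%:E = \int[m]_x (c x * a (tau j x))%:E /\
  \int[m]_x (a x * c (tau j x))%:E = \int[m]_x (c x * c (tau j x))%:E.

Let X x := (a x - c x)%R.

Let mX : measurable_fun setT (X : T -> measurableTypeR R).
Proof. exact: measurable_funB. Qed.

Let tau_integral (f : T -> \bar R) i : measurable_fun setT f -> (forall x, 0 <= f x) ->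
  \int[m]_x f (tau i x) = \int[m]_x f x.
Proof.
move=> mf f0; rewrite -(@ge0_integral_pushforward _ _ _ _ _ (tau i) (mtau i) m setT)//.
by apply: eq_measure_integral => A mA _; exact: tauP.
Qed.

Let sq_integrable (f : T -> R) (g : T -> R) : measurable_fun setT (f : T -> measurableTypeR R) ->
  measurable_fun setT (g : T -> measurableTypeR R) ->
  \int[m]_x (f x ^+ 2)%:E < +oo -> \int[m]_x (g x ^+ 2)%:E < +oo ->
  m.-integrable setT (fun x => (f x * g x)%:E).
Proof.
move=> mf mg f2 g2; apply/integrableP; split.
  by apply/measurable_EFinP; exact: measurable_funM.
apply: (@le_lt_trans _ _ (\int[m]_x ((f x ^+ 2)%:E + (g x ^+ 2)%:E))).
  apply: ge0_le_integral => //.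
  - by apply: measurableT_comp => //; apply/measurable_EFinP; exact: measurable_funM.
  - by apply/measurable_EFinP; apply: measurable_funD; exact: measurable_funX.
  move=> x _; rewrite lee_fin; have := sqr_ge0 (`|f x| - `|g x|)%R.
  rewrite normrM -[(f x ^+ 2)%R]real_normK ?num_real// -[(g x ^+ 2)%R]real_normK ?num_real//.
  have := normr_ge0 (f x); have := normr_ge0 (g x); nra.
rewrite ge0_integralD//; first exact: lte_add_pinfty.
- by move=> x _; rewrite lee_fin sqr_ge0.
- by apply/measurable_EFinP; exact: measurable_funX.
- by move=> x _; rewrite lee_fin sqr_ge0.
- by apply/measurable_EFinP; exact: measurable_funX.
Qed.

Let mtauc (f : T -> R) i : measurable_fun setT (f : T -> measurableTypeR R) ->
  measurable_fun setT (f \o tau i : T -> measurableTypeR R).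
Proof. by move=> mf; exact: measurableT_comp. Qed.

Let tau2 (f : T -> R) i : measurable_fun setT (f : T -> measurableTypeR R) ->
  \int[m]_x ((f \o tau i) x ^+ 2)%:E = \int[m]_x (f x ^+ 2)%:E.
Proof.
move=> mf; rewrite (tau_integral (f := fun x => (f x ^+ 2)%:E))//.
- by apply/measurable_EFinP; exact: measurable_funX.
- by move=> x; rewrite lee_fin sqr_ge0.
Qed.

Let X2 : \int[m]_x (X x ^+ 2)%:E < +oo.
Proof.
apply: (@le_lt_trans _ _ (\int[m]_x ((a x ^+ 2)%:E + (c x ^+ 2)%:E))).
  apply: ge0_le_integral => //.
  - by move=> x _; rewrite lee_fin sqr_ge0.
  - by apply/measurable_EFinP; exact: measurable_funX.
  - by apply/measurable_EFinP; apply: measurable_funD; exact: measurable_funX.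
  move=> x _; rewrite lee_fin /X sqrrB; have := a0 x; have := c0 x; nra.
rewrite ge0_integralD//; first exact: lte_add_pinfty.
- by move=> x _; rewrite lee_fin sqr_ge0.
- by apply/measurable_EFinP; exact: measurable_funX.
- by move=> x _; rewrite lee_fin sqr_ge0.
- by apply/measurable_EFinP; exact: measurable_funX.
Qed.

Let iX (i j : int * int) : m.-integrable setT (fun x => (X (tau i x) * X (tau j x))%:E).
Proof.
by apply: (sq_integrable (mtauc i mX) (mtauc j mX)); rewrite tau2//; exact: X2.
Qed.

Let B := fine (\int[m]_x (X x ^+ 2)%:E).

Let BE : B%:E = \int[m]_x (X x ^+ 2)%:E.
Proof.
rewrite fineK// ge0_fin_numE; first exact: X2.
by apply: integral_ge0 => x _; rewrite lee_fin sqr_ge0.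
Qed.

Let B0 : (0 <= B)%R.
Proof. by apply: fine_ge0; apply: integral_ge0 => x _; rewrite lee_fin sqr_ge0. Qed.

Let far0 (j : int * int) : (r%:Z < Num.max `|j.1| `|j.2|)%R ->
  \int[m]_x (X x * X (tau j x))%:E = 0.
Proof.
move=> /orth[e1 e2].
have I (f g : T -> R) : measurable_fun setT (f : T -> measurableTypeR R) ->
    measurable_fun setT (g : T -> measurableTypeR R) ->
    \int[m]_x (f x ^+ 2)%:E < +oo -> \int[m]_x (g x ^+ 2)%:E < +oo ->
    m.-integrable setT (fun x => (f x * g (tau j x))%:E).
  by move=> mf mg f2 g2; apply: (sq_integrable mf (mtauc j mg)); rewrite ?tau2.
have e : (fun x => (X x * X (tau j x))%:E) =
    (fun x => ((a x * a (tau j x))%:E - (c x * a (tau j x))%:E) -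
              ((a x * c (tau j x))%:E - (c x * c (tau j x))%:E)).
  by apply/funext => x; rewrite -!EFinB /X; congr (_%:E); ring.
rewrite e integralB//; last 2 first.
- by apply: integrableB => //; exact: I.
- by apply: integrableB => //; exact: I.
rewrite !integralB//; try exact: I.
rewrite e1 e2 !subee ?sube0//; apply: integrable_fin_num => //; exact: I.
Qed.

(** Covariances vanish at distant sites and are at most the common second
    moment elsewhere. *)
Let cov_le (i j : int * int) : \int[m]_x (X (tau i x) * X (tau j x))%:E <=
  (if close r i j then B else 0)%:E.
Proof.
case: ifPn => [_|]; last first.
  rewrite /close -ltNge => /far0 h; rewrite -[leRHS]h.
  have mfun : measurable_fun setT (fun x => (X x * X (tau (j - i)%R x))%:E).
    by apply/measurable_EFinP; apply: measurable_funM => //; exact: (mtauc _ mX).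
  rewrite (_ : (fun x => (X (tau i x) * X (tau j x))%:E) =
    (fun x => (X x * X (tau (j - i)%R x))%:E) \o tau i); last first.
    by apply/funext => x /=; rewrite tauD subrK.
  have ii : m.-integrable (tau i @^-1` setT) ((fun x => (X x * X (tau (j - i)%R x))%:E) \o tau i).
    rewrite preimage_setT (_ : _ \o _ = fun x => (X (tau i x) * X (tau j x))%:E).
      exact: iX.
    by apply/funext => x /=; rewrite tauD subrK.
  have := integral_pushforward (mtau i) mfun ii measurableT.
  rewrite preimage_setT => <-.
  by rewrite (@eq_measure_integral _ _ _ _ m)// => A mA _; exact: tauP.
have -> : B%:E = \int[m]_x ((2^-1)%:E * ((X (tau i x) ^+ 2)%:E + (X (tau j x) ^+ 2)%:E)).
  have m2 k : measurable_fun setT (fun x => (X (tau k x) ^+ 2)%:E).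
    by apply/measurable_EFinP; apply: measurable_funX; exact: (mtauc k mX).
  have p2 k x : 0 <= (X (tau k x) ^+ 2)%:E by rewrite lee_fin sqr_ge0.
  rewrite ge0_integralZl_EFin//; last 2 first.
  - by move=> x _; rewrite adde_ge0.
  - exact: emeasurable_funD.
  rewrite ge0_integralD// (tau2 i mX) (tau2 j mX) -BE -EFinD -EFinM; congr (_%:E).
  by field.
apply: le_integral => //.
- apply: integrableZl => //; apply: integrableD => //.
    by under eq_fun do rewrite expr2; exact: iX.
  by under eq_fun do rewrite expr2; exact: iX.
- move=> x _; rewrite -EFinD -EFinM lee_fin; have := sqr_ge0 (X (tau i x) - X (tau j x))%R.
  by rewrite sqrrB; nra.
Qed.

Let S n x := (\sum_(i <- square n) X (tau i x))%R.

(** Each site of the square has boundedly many neighbours with a nonzero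
    covariance. *)
Let S2 n : \int[m]_x (S n x ^+ 2)%:E <= ((size (square n))%:R * ((size (square r))%:R * B))%:E.
Proof.
have -> : (fun x => (S n x ^+ 2)%:E) = (fun x => \sum_(i <- square n) \sum_(j <- square n)
    (X (tau i x) * X (tau j x))%:E).
  apply/funext => x; rewrite /S expr2 mulr_suml -sumEFin; apply: eq_bigr => i _.
  by rewrite mulr_sumr -sumEFin.
rewrite integral_sum//; last by move=> i; apply: integrable_sum => // j _; exact: iX.
have -> : ((size (square n))%:R * ((size (square r))%:R * B))%:E =
    \sum_(i <- square n) ((size (square r))%:R * B)%:E.
  by rewrite sumEFin big_const_seq count_predT iter_addr_0 mulr_natl.
apply: lee_sum => i _; rewrite integral_sum//.
apply: (@le_trans _ _ (\sum_(j <- square n)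
    (if close r i j then B else 0)%:E)).
  by apply: lee_sum => j _; exact: cov_le.
rewrite sumEFin -big_mkcond/= big_const_seq iter_addr_0 lee_fin -[(B *+ _)%R]mulr_natl ler_wpM2r//.
by rewrite ler_nat; exact: square_near.
Qed.

Lemma sum_inv_square N : (\sum_(0 <= k < N) (k.+1%:R ^+ 2)^-1 <= 2 :> R)%R.
Proof.
case: N => [|N]; first by rewrite big_nil.
suff h : (\sum_(0 <= k < N.+1) (k.+1%:R ^+ 2)^-1 <= 2 - N.+1%:R^-1 :> R)%R.
  by apply: le_trans h _; rewrite gerBl invr_ge0.
elim: N => [|N ih].
  by rewrite big_nat1 expr1n invr1; lra.
rewrite big_nat_recr//=; apply: (le_trans (lerD ih (lexx _))).
set x : R := N.+1%:R%R; have x0 : (0 < x)%R by rewrite ltr0n.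
have -> : (N.+2%:R = x + 1 :> R)%R by rewrite -natr1.
have x10 : (0 < x + 1)%R by rewrite addr_gt0.
have e : (((x + 1) ^+ 2)^-1 = x^-1 - (x + 1)^-1 - (x * (x + 1) ^+ 2)^-1)%R.
  by field; rewrite !gt_eqF.
have : (0 <= (x * (x + 1) ^+ 2)^-1)%R by rewrite invr_ge0 mulr_ge0 ?ltW// exprn_gt0.
move=> q0; rewrite -subr_ge0.
by rewrite (_ : _ - _ = (x * (x + 1) ^+ 2)^-1)%R// e; ring.
Qed.

(** A law of large numbers over growing squares for a stationary field
    whose increments at distant sites are uncorrelated. A square of side
    [n] has of the order of [n ^+ 2] sites, so the mean square of the
    average is of the order of [n ^- 2]: it is summable, and the averages
    tend to zero along the whole sequence, without passing to a
    subsequence. *)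
Lemma square_lln : {ae m, forall x,
  ((\sum_(i <- square n) (a (tau i x) - c (tau i x))) / (size (square n))%:R)%R @[n --> \oo] --> (0 : R)%R}.
Proof.
pose N n : R := (size (square n))%:R%R.
have N0 n : (0 < N n)%R by rewrite ltr0n size_square.
pose y n x : \bar R := ((S n x / N n) ^+ 2)%:E.
have mS n : measurable_fun setT (S n : T -> measurableTypeR R).
  by apply: measurable_sum => i; exact: (mtauc i mX).
have my n : measurable_fun setT (y n).
  apply/measurable_EFinP; apply: measurable_funX.
  exact: (measurable_funM (mS n) (measurable_cst _)).
have y0 n x : 0 <= y n x by rewrite lee_fin sqr_ge0.
have Ny n : \int[m]_x y n x <= (((size (square r))%:R * B) * (n.+1%:R ^+ 2)^-1)%:E.
  have -> : y n = (fun x => ((N n ^+ 2)^-1)%:E * (S n x ^+ 2)%:E).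
    by apply/funext => x; rewrite /y expr_div_n mulrC EFinM.
  rewrite ge0_integralZl_EFin//; last 3 first.
  - by move=> x _; rewrite lee_fin sqr_ge0.
  - apply/measurable_EFinP; exact: (measurable_funX 2 (mS n)).
  - by rewrite invr_ge0 sqr_ge0.
  apply: (le_trans (lee_wpmul2l _ (S2 n))); first by rewrite lee_fin invr_ge0 sqr_ge0.
  rewrite -EFinM lee_fin -/(N n).
  have -> : ((N n ^+ 2)^-1 * (N n * ((size (square r))%:R * B)) = (size (square r))%:R * B * (N n)^-1)%R.
    by field; rewrite gt_eqF.
  rewrite ler_wpM2l ?mulr_ge0// lef_pV2 ?posrE ?exprn_gt0//.
  rewrite /N size_square -natrX ler_nat expnS expn1 leq_mul// ltnS -addnn leq_addr//.
have fin : \int[m]_x (\sum_(n <oo) y n x) < +oo.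
  rewrite integral_nneseries//.
  apply: (@le_lt_trans _ _ ((size (square r))%:R * B * 2)%:E); last exact: ltry.
  apply: lime_le; first by apply: is_cvg_nneseries => n _ _; exact: integral_ge0.
  apply: nearW => n; apply: (@le_trans _ _ (\sum_(0 <= k < n) ((size (square r))%:R * B * (k.+1%:R ^+ 2)^-1)%:E)).
    by apply: lee_sum => k _; exact: Ny.
  rewrite sumEFin -mulr_sumr lee_fin ler_wpM2l ?mulr_ge0//.
  exact: sum_inv_square.
have my' : measurable_fun setT (fun x => \sum_(n <oo) y n x) by exact: ge0_emeasurable_sum.
have y0' x : 0 <= \sum_(n <oo) y n x by apply: nneseries_ge0.
have ify : m.-integrable setT (fun x => \sum_(n <oo) y n x).
  by apply/integrableP; split => //; under eq_integral do rewrite gee0_abs//.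
have := integrable_ae measurableT ify; apply: filterS => x /(_ Logic.I) fx.
pose u n : R := ((S n x / N n) ^+ 2)%R.
have u0 n : (0 <= u n)%R by exact: sqr_ge0.
have cu : cvgn (series u).
  apply: nondecreasing_is_cvgn; first by apply: nondecreasing_series => n _ _.
  exists (fine (\sum_(n <oo) y n x)) => _ [n _ <-].
  rewrite -lee_fin fineK// /series/= -sumEFin.
  by apply: nneseries_lim_ge => k _; rewrite lee_fin.
have := cvg_series_cvg_0 cu => uc.
apply/cvgr0Pnorm_lt => e e0.
have e20 : (0 < e ^+ 2)%R by rewrite exprn_gt0.
near=> n.
have : (`|u n| < e ^+ 2)%R by near: n; exact: (cvgr0_norm_lt _ uc _ e20).
rewrite ger0_norm// /u -[((S n x / N n) ^+ 2)%R]real_normK ?num_real//.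
by rewrite ltr_pXn2r // nnegrE ltW.
Unshelve. all: by end_near.
Qed.

End square_lln.

(** * Analytic lemmas *)

Section null_set.
Context d (T : measurableType d) (R : realType) (m : {measure set T -> \bar R}).
Local Open Scope ereal_scope.
Import HBNNSimple.

(** Simple functions below [f] are cut off on [N]. At the places of the
    points of a configuration the local energy may depend on the mark in a
    way that is not measurable, so a comparison of almost everywhere equal
    measurable functions would not do. *)
Lemma ge0_integral_off_null (N : set T) (f g : T -> \bar R) :
  measurable N -> m N = 0 -> (forall x, 0 <= f x) -> (forall x, 0 <= g x) ->
  (forall x, ~ N x -> f x = g x) -> \int[m]_x f x = \int[m]_x g x.
Proof.
move=> mN N0.
have key (f1 f2 : T -> \bar R) : (forall x, 0 <= f1 x) -> (forall x, 0 <= f2 x) ->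
    (forall x, ~ N x -> f1 x = f2 x) -> \int[m]_x f1 x <= \int[m]_x f2 x.
  move=> f10 f20 e; rewrite !ge0_integralTE//; apply: ge_ereal_sup => /= _ [h /= hf <-].
  pose h' := proj_nnsfun h (measurableC mN).
  apply: (@le_trans _ _ (sintegral m h')).
    have sE (k : {nnsfun T >-> R}) : sintegral m k = \int[m]_x (k x)%:E.
      by rewrite integral_nnsfun// patch_setT.
    rewrite !sE le_eqVlt; apply/orP; left; apply/eqP.
    apply: ae_eq_integral => //; try exact/measurable_EFinP.
    exists N; split => // x /= h1; apply: contrapT => nN; apply: h1 => _.
    by rewrite -[RHS]/(h x * \1_(~` N) x)%:E indicE mem_set// mulr1.
  apply: ereal_sup_ubound; exists h' => //= x; rewrite -[leLHS]/(h x * \1_(~` N) x)%:E indicE.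
  have [/set_mem nN|_] := boolP (x \in ~` N); last by rewrite mulr0 f20.
  by rewrite mulr1 -e.
move=> f0 g0 e; apply/eqP; rewrite eq_le !key// => x nN; exact/esym/e.
Qed.
End null_set.

(** For [x <= 2] the square of [1 - x / 2] gives a gap of [x ^+ 2 / 4]; for
    [x > 2] the gap is at least [x / 2], and [x / (1 + s)] is at most [B]. *)
Lemma expR_quad_lower (R : realType) (x s B : R) : 1 <= B -> 0 <= s -> `|x| <= B * s ->
  1 - x + (4 * B)^-1 * (x / (1 + s)) ^+ 2 <= expR (- x).
Proof.
move=> B1 s0 xB; have B0 : 0 < B by exact: lt_le_trans B1.
have s1 : 0 < 1 + s by rewrite ltr_pwDl.
have q0 : 0 <= (x / (1 + s)) ^+ 2 by exact: sqr_ge0.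
have [x2|x2] := lerP x 2.
  apply: (@le_trans _ _ ((1 - x / 2) ^+ 2)).
    have qx : (x / (1 + s)) ^+ 2 <= x ^+ 2.
      rewrite expr_div_n ler_piMr ?sqr_ge0// invf_le1 ?exprn_gt0//.
      by rewrite exprn_ege1// lerDl.
    have c0 : 0 <= (4 * B)^-1 by rewrite invr_ge0 mulr_ge0// ltW.
    have c4 : (4 * B)^-1 <= 4^-1 by rewrite lef_pV2 ?posrE ?mulr_gt0// ler_peMr.
    have : (4 * B)^-1 * (x / (1 + s)) ^+ 2 <= 4^-1 * x ^+ 2 by apply: ler_pM.
    by move=> h; nra.
  have -> : - x = - (x / 2) + - (x / 2) by field.
  rewrite expRD -expr2 lerXn2r ?nnegrE ?expR_ge0//; first by lra.
  exact: expR_ge1Dx.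
have x0 : 0 <= x by lra.
apply: (@le_trans _ _ 0); last exact: expR_ge0.
suff : (x / (1 + s)) ^+ 2 <= B * x.
  have c0 : 0 <= (4 * B)^-1 by rewrite invr_ge0 mulr_ge0// ltW.
  move=> /(ler_wpM2l c0); rewrite (_ : (4 * B)^-1 * (B * x) = x / 4); first by lra.
  by field; rewrite gt_eqF.
rewrite expr_div_n ler_pdivrMr ?exprn_gt0// expr2 mulrAC ler_wpM2r//.
rewrite ger0_norm// in xB; apply: (le_trans xB); rewrite ler_wpM2l ?(ltW B0)//.
nra.
Qed.

(** Away from its only zero, [g] has a positive minimum on the compact set. *)
Lemma compact_cvg_to_zero (R : realType) (p : nat) (A : set 'rV[R]_p) (a : 'rV[R]_p)
    (g : 'rV[R]_p -> R) (t : nat -> 'rV[R]_p) (e : nat -> R) :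
  compact A -> continuous g -> (forall x, x <> a -> 0 < g x) ->
  (forall n, A (t n)) -> (forall n, g (t n) <= e n) ->
  e n @[n --> \oo] --> (0 : R) -> t n @[n --> \oo] --> a.
Proof.
move=> cA cg g0 At ge e0; apply/cvgrPdist_lt => r r0.
pose S := A `&` ~` ball a r.
have [S0|/set0P SN] := eqVneq S set0.
  apply: nearW => n; have : ~ S (t n) by rewrite S0.
  by move=> /not_andP[|/contrapT]; [move/(_ (At n))|rewrite -ball_normE].
have cS : compact S.
  apply: compact_closedI => //; apply: open_closedC; exact: ball_open.
have cgS : {within S, continuous g} by exact: continuous_subspaceT.
have [c /set_mem[_ ca] cmin] := EVT_min_rV SN cS cgS.
have gc : 0 < g c by apply: g0 => ca'; apply: ca; rewrite ca'; exact: ballxx.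
have : \forall n \near \oo, `|0 - e n| < g c by move/cvgrPdist_lt : e0; apply.
apply: filterS => n; rewrite sub0r normrN => en.
have : ~ S (t n).
  move=> St; have := cmin _ (mem_set St); apply/negP; rewrite -ltNge.
  by apply: le_lt_trans (ge n) _; apply: le_lt_trans en; exact: ler_norm.
by move=> /not_andP[|/contrapT]; [move/(_ (At n))|rewrite -ball_normE].
Qed.

Lemma cvg_sumr (R : realType) (T : Type) (F : set_system T) {FF : Filter F} (I : Type)
    (s : seq I) (f : I -> T -> R) (a : I -> R) :
  (forall i, f i t @[t --> F] --> a i) ->
  \sum_(i <- s) f i t @[t --> F] --> \sum_(i <- s) a i.
Proof.
move=> fa; elim: s => [|i s ih].
  by rewrite big_nil; under eq_fun do rewrite big_nil; exact: cvg_cst.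
by rewrite big_cons; under eq_fun do rewrite big_cons; apply: cvgD.
Qed.

(** * The Gibbs measure *)

Section mple_consistency.
Context (R : realType) (dM : measure_display) (M : measurableType dM).
Context (lm : probability M R) (p : nat) (v : config R M -> 'rV[R]_p).
Context (Theta : set 'rV[R]_p) (thetastar : 'rV[R]_p) (D : R).
Context (Q : set (plane R) -> probability (config R M) R).
Context (P : probability (config R M) R).
Hypothesis v_measurable : forall i,
  measurable_fun finite_config (fun phi => v phi ord0 i : measurableTypeR R).
Hypothesis v_invariant : translation_invariant v Theta.
Hypothesis thetastar_interior : interior Theta thetastar.
Hypothesis D_ge0 : 0 <= D.
Hypothesis Q_poisson : forall L, bounded_borel L -> poisson_law lm L (Q L).
Hypothesis P_gibbs : gibbs v Q D thetastar P.
Hypothesis P_stationary : stationary P.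
Local Notation Adm := (admissible v Q D thetastar).
Context (K : R).
Hypothesis K_ge0 : 0 <= K.
Hypothesis stability : forall theta m phi, Theta theta -> Adm phi ->
  finite_config phi -> - K <= local_energy v theta (at_origin m) phi.
Hypothesis locality : forall theta m phi, Theta theta -> Adm phi ->
  finite_config phi -> local_energy v theta (at_origin m) phi =
    local_energy v theta (at_origin m) (restr (eball origin D) phi).
Hypothesis Ident : identifiability lm v Adm D P.
Hypothesis p_gt0 : (0 < p)%N.
Local Notation E := (plane R * M)%type.
Local Notation C := (config R M).
Implicit Types (phi psi : C) (L U W : set (plane R)) (z : E).

Lemma finite_configE : finite_config = \bigcup_n @configs_in R dM M (eball origin n%:R).
Proof.
apply/seteqP; split => phi.
  move=> fphi; rewrite /finite_config/= in fphi.
  have [n nP] : exists n, forall z, z \in (fset_set (pts phi) : seq E) -> eball origin n%:R z.1.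
    elim: (fset_set (pts phi) : seq E) => [|z s [n ih]]; first by exists 0%N.
    have [m _ zm] : (\bigcup_n eball (@origin R) n%:R) z.1 by rewrite bigcup_eball.
    exists (maxn n m) => w; rewrite inE => /orP[/eqP->|/ih h]; [apply: eball_le zm|apply: eball_le h];
      by rewrite ler_nat ?leq_maxl ?leq_maxr.
  exists n => // z pz; split => //; apply: nP.
  by rewrite in_fset_set// mem_set.
move=> [n _ h]; rewrite /finite_config/=.
apply: sub_finite_set (@pts_locally_finite _ _ _ phi n%:R).
by move=> z pz; split => //; exact: h.
Qed.

Lemma measurable_finite_config : measurable (@finite_config R dM M).
Proof.
rewrite finite_configE; apply: bigcupT_measurable => n.
by apply: measurable_configs_in; exact: measurable_eball.
Qed.

Lemma finite_in_bounded L phi : bounded_borel L -> configs_in L phi -> finite_config phi.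
Proof.
move=> [_ [r Lr]] h; apply: sub_finite_set (@pts_locally_finite _ _ _ phi r) => z pz.
by split => //; have [zL _] := h _ pz; split => //; exact: Lr.
Qed.

Lemma finite_restr L phi : bounded_borel L -> finite_config (restr L phi).
Proof. by move=> bL; apply: (finite_in_bounded bL) => z []. Qed.

Lemma finite_restr' L phi : finite_config phi -> finite_config (restr L phi).
Proof. by move=> fp; apply: sub_finite_set fp => z []. Qed.

Lemma finite_cunion phi psi : finite_config phi -> finite_config psi ->
  finite_config (cunion phi psi).
Proof. by rewrite /finite_config/= finite_setU; split. Qed.

Lemma measurable_v d (T : measurableType d) (f : T -> C) i :
  measurable_fun setT f -> (forall t, finite_config (f t)) ->
  measurable_fun setT (fun t => v (f t) ord0 i : measurableTypeR R).
Proof.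
move=> mf ff; apply: (measurable_comp measurable_finite_config _ (v_measurable i)) => //.
by move=> _ [t _ <-].
Qed.

Lemma measurable_energy d (T : measurableType d) (f : T -> C) theta :
  measurable_fun setT f -> (forall t, finite_config (f t)) ->
  measurable_fun setT (fun t => energy v theta (f t) : measurableTypeR R).
Proof.
move=> mf ff; rewrite /energy; apply: measurable_sum => i.
by apply: measurable_funM => //; exact: measurable_v.
Qed.

Let V := energy v thetastar.

(** The part of [phi] outside [L] that interacts with [psi] inside [L]. *)
Definition env L phi psi : C := restr (halo D (restr L psi)) (restr (~` L) phi).

(** The Boltzmann factor, for a boundary condition that is seen through its
    halo only. It is measurable in both configurations, and equals
    [boltzmann] when [phi] is infinite or empty. *)
Definition weight L phi psi : R :=
  expR (- (V (cunion (restr L psi) (env L phi psi)) - V (env L phi psi))).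

Lemma bounded_halo psi : finite_config psi -> exists r, halo D psi `<=` eball origin r.
Proof.
rewrite finite_configE => -[n _ h]; exists (n%:R + (D + D)) => x [z pz zx].
by apply: eball_triangle zx; have [] := h _ pz.
Qed.

Lemma finite_env L phi psi : bounded_borel L -> finite_config (env L phi psi).
Proof.
move=> bL; have [r hr] := bounded_halo (finite_restr psi bL).
apply: sub_finite_set (@pts_locally_finite _ _ _ phi r) => z [[pz _] [hz _]].
by split => //; split => //; exact: hr.
Qed.

Lemma measurable_env d (T : measurableType d) (f g : T -> C) L : measurable L ->
  measurable_fun setT f -> measurable_fun setT g ->
  measurable_fun setT (fun t => env L (f t) (g t)).
Proof.
move=> mL mf mg; apply: measurable_restr_halo.
  exact: (measurableT_comp (measurable_restr mL)).
exact: (measurableT_comp (measurable_restr (measurableC mL))).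
Qed.

Lemma env_disj L phi psi : pts (restr L psi) `&` pts (env L phi psi) = set0.
Proof. by apply/seteqP; split => // z [[_ [zL _]] [[_ [/(_ zL)]]]]. Qed.

Lemma measurable_weight d (T : measurableType d) (f g : T -> C) L : bounded_borel L ->
  measurable_fun setT f -> measurable_fun setT g ->
  measurable_fun setT (fun t => weight L (f t) (g t) : measurableTypeR R).
Proof.
move=> bL mf mg; have [mL _] := bL; apply: measurableT_comp => //.
apply: measurableT_comp => //; apply: measurable_funB.
  apply: measurable_energy.
    apply: measurable_cunion; last by move=> t; exact: env_disj.
      exact: (measurableT_comp (measurable_restr mL)).
    exact: measurable_env.
  by move=> t; apply: finite_cunion; [exact: finite_restr|exact: finite_env].
apply: measurable_energy; first exact: measurable_env.
by move=> t; exact: finite_env.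
Qed.

Lemma weight_gt0 L phi psi : 0 < weight L phi psi.
Proof. exact: expR_gt0. Qed.

(** For a finite nonempty outside, what is visible is all of it and not
    only the halo; such configurations are excluded almost surely. *)
Definition infinite_or_empty : set C :=
  [set phi | ~ finite_config phi \/ pts phi = set0].

Lemma finite_splice_out L phi : bounded_borel L -> finite_config (restr (~` L) phi) ->
  finite_config phi.
Proof.
move=> bL fo; have := finite_cunion (finite_restr phi bL) fo.
apply: sub_finite_set => z pz /=.
by have [zL|zL] := pselect (L z.1); [left|right].
Qed.

Lemma boltzmannE L phi psi : bounded_borel L -> infinite_or_empty phi ->
  configs_in L psi -> boltzmann v D thetastar L phi psi = weight L phi psi.
Proof.
move=> bL ip cp; rewrite /boltzmann /weight /energy_given /local_energy -/V.
have -> : visible D psi (restr (~` L) phi) = env L phi psi.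
  rewrite /env (restr_id cp) /visible; case: asboolP => // fo.
  case: ip => [nf|e]; first by exfalso; apply: nf; exact: finite_splice_out fo.
  by apply: config_eq; rewrite /= e !set0I.
by rewrite restr_id.
Qed.

Local Open Scope ereal_scope.

Definition Zpart L phi : \bar R := \int[Q L]_psi (weight L phi psi)%:E.

Lemma Q_outside L : bounded_borel L -> Q L (~` configs_in L) = 0.
Proof.
move=> bL; have [mL _] := bL; apply: probability_setC0; first exact: measurable_configs_in.
exact: poisson_configs_in (Q_poisson bL).
Qed.

Lemma integral_configs_in L (f g : C -> \bar R) : bounded_borel L ->
  measurable_fun setT g -> (forall x, 0 <= g x) ->
  (forall psi, configs_in L psi -> f psi = g psi) ->
  \int[Q L]_(psi in configs_in L) f psi = \int[Q L]_psi g psi.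
Proof.
move=> bL mg g0 fg; have [mL _] := bL.
have mc := @measurable_configs_in R dM M L mL.
transitivity (\int[Q L]_(psi in configs_in L) g psi).
  by apply: eq_integral => psi /set_mem; exact: fg.
rewrite [RHS](@ge0_negligible_integral _ _ _ (Q L) setT (~` configs_in L))//.
- by rewrite setTD setCK.
- exact: measurableC.
- exact: Q_outside.
Qed.

Lemma partition_functionE L phi : bounded_borel L -> infinite_or_empty phi ->
  partition_function v Q D thetastar L phi = Zpart L phi.
Proof.
move=> bL ip; apply: integral_configs_in => //.
- by apply/measurable_EFinP; exact: measurable_weight.
- by move=> psi; rewrite lee_fin ltW// weight_gt0.
- by move=> psi cp; rewrite boltzmannE.
Qed.

Lemma measurable_Zpart L : bounded_borel L -> measurable_fun setT (Zpart L).
Proof.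
move=> bL; apply: (measurable_fun_fubini_tonelli_F (fun u : C * C => (weight L u.1 u.2)%:E)).
- by apply/measurable_EFinP; exact: measurable_weight.
- by move=> u; rewrite lee_fin ltW// weight_gt0.
Qed.

Lemma outside_measurable L (G : set C) : measurable L -> outside_events L G -> measurable G.
Proof.
move=> mL [B mB <-]; rewrite setTI -[X in measurable X]setTI.
exact: (measurable_restr (measurableC mL)).
Qed.

Lemma gibbs_kernel L F : bounded_borel L -> measurable F ->
  exists g : C -> \bar R, [/\ measurable_fun setT g, \int[P]_phi g phi = P F &
    {ae P, forall phi, g phi = specification v Q D thetastar L phi F}].
Proof.
move=> bL mF; have [mL _] := bL; have [g [[mg ig] gE]] := P_gibbs bL mF.
exists g; split => //.
  move=> _ B mB; rewrite setTI; exact: outside_measurable (mg B mB).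
rewrite ig ?setIT//; exists setT => //; by rewrite preimage_setT setTI.
Qed.

(** The conditional law has total mass one, whereas the specification
    vanishes where it is not regular. *)
Lemma gibbs_regular L : bounded_borel L ->
  {ae P, forall phi, regular v Q D thetastar L phi}.
Proof.
move=> bL; have [g [mg ig gE]] := gibbs_kernel bL (@measurableT _ C).
have gE1 : {ae P, forall phi, g phi = 1 /\ regular v Q D thetastar L phi \/
    g phi = 0 /\ ~ regular v Q D thetastar L phi}.
  apply: filterS gE => phi ->; rewrite /specification indicE.
  have [/set_mem r|/negP r] := boolP (phi \in regular v Q D thetastar L).
    left; split => //; rewrite mule1.
    move: r => /andP[Z0 Zoo].
    rewrite (_ : (\int[Q L]_(psi in configs_in L) _) = partition_function v Q D thetastar L phi); last first.
      by apply: eq_integral => psi _; rewrite indicT mulr1.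
    have fZ : partition_function v Q D thetastar L phi \is a fin_num by rewrite ge0_fin_numE// ltW.
    rewrite -{2}(fineK fZ) -EFinM mulVf//.
    by rewrite gt_eqF// fine_gt0// Z0.
  by right; rewrite mule0; split => // h; apply: r; exact: mem_set.
pose G1 : set C := g @^-1` [set 1].
have mg1 : measurable G1 by rewrite -[X in measurable X]setTI; exact: mg.
have : P G1 = 1.
  transitivity (\int[P]_phi (\1_G1 phi : R)%:E).
    by rewrite integral_indic ?setIT.
  rewrite -[RHS](probability_setT P) -ig.
  apply: ae_eq_integral => //; first by apply/measurable_EFinP; exact: measurable_indic.
  apply: filterS gE1 => phi + _; rewrite indicE => -[[g1 _]|[g0 _]].
    by rewrite mem_set// g1.
  rewrite memNset ?g0// /G1/= g0 => /eqP; by rewrite eqe eq_sym oner_eq0.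
move=> /(probability_setC0 mg1) n1.
have : {ae P, forall phi, g phi = 1}.
  by exists (~` G1); split => //; exact: measurableC.
apply: filterS2 gE1 => phi [[_ //]|[-> _]] /eqP.
by rewrite eqe eq_sym oner_eq0.
Qed.

Local Close Scope ereal_scope.

(** * Recurrence under translations *)

Lemma translate_comp (a b : plane R) phi :
  translate a (translate b phi) = translate (shift a b) phi.
Proof.
apply: config_eq; apply/seteqP; split => z /=.
  by move=> [_ [w pw <-] <-]; exists w; rewrite // /mshift /shift/= !addrA.
move=> [w pw <-]; exists (mshift b w); first by exists w.
by rewrite /mshift /shift/= !addrA.
Qed.

Lemma translate0 phi : translate origin phi = phi.
Proof.
apply: config_eq; apply/seteqP; split => z /=.
  by move=> [[[w1 w2] m] pw <-]; rewrite /mshift /shift/= !addr0.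
by move=> pz; exists z => //; case: z pz => -[w1 w2] m _; rewrite /mshift /shift/= !addr0.
Qed.

Definition slide (s : R) (j : nat) : C -> C := translate ((s * j%:R, 0) : plane R).

Lemma slide0 s phi : slide s 0 phi = phi.
Proof. by rewrite /slide mulr0; exact: translate0. Qed.

Lemma slideD s i j phi : slide s i (slide s j phi) = slide s (i + j) phi.
Proof.
rewrite /slide translate_comp /shift/= addr0 natrD mulrDr.
by rewrite [in RHS]addrC.
Qed.

Lemma measurable_slide s j : measurable_fun setT (slide s j).
Proof. exact: measurable_translate. Qed.

Lemma P_slide s j (B : set C) : measurable B -> P (slide s j @^-1` B) = P B.
Proof. exact: P_stationary. Qed.

Lemma null_disjoint_copies (m : probability C R) (F : (set C)^nat) :
  (forall n, measurable (F n)) -> trivIset setT F ->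
  (forall n, m (F n) = m (F 0%N)) -> m (F 0%N) = 0%E.
Proof.
move=> mF tF mE; apply/eqP; rewrite eq_le measure_ge0 andbT leNgt; apply/negP => F0.
have fF : m (F 0%N) \is a fin_num by exact: fin_num_measure.
pose r := fine (m (F 0%N)); have r0 : 0 < r.
  by rewrite fine_gt0// F0 ltey_eq fF.
have rE : m (F 0%N) = r%:E by rewrite fineK.
pose n := (Num.truncn (1 / r)).+1.
have : (\sum_(0 <= i < n) m (F i) <= 1)%E.
  apply: (@le_trans _ _ (m (\bigcup_i F i))); last exact: probability_le1 (bigcupT_measurable _ mF).
  rewrite measure_semi_bigcup//; last exact: bigcupT_measurable.
  exact: nneseries_lim_ge.
under eq_bigr do rewrite mE rE.
rewrite sumEFin sumr_const_nat subn0 lee_fin; apply/negP; rewrite -ltNge.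
by rewrite -mulr_natl -ltr_pdivrMr// truncnS_gt.
Qed.

(** Poincare recurrence. The events that the last visit to [B] takes place
    at a given time are disjoint and, by stationarity, equally likely. *)
Lemma last_visit_null s (B : set C) : measurable B ->
  P [set phi | B phi /\ forall i, ~ B (slide s i.+1 phi)] = 0%E.
Proof.
move=> mB; set E0 := [set phi | _].
have mE0 : measurable E0.
  rewrite (_ : E0 = B `&` \bigcap_i (slide s i.+1 @^-1` (~` B))); last first.
    by apply/seteqP; split => phi [Bp h]; split => // i; [move=> _; exact: h|exact: h].
  apply: measurableI => //; apply: bigcapT_measurable => i.
  rewrite -[X in measurable X]setTI; apply: measurable_slide => //; exact: measurableC.
have := @null_disjoint_copies P (fun j => slide s j @^-1` E0).
rewrite (_ : slide s 0 @^-1` E0 = E0); last first.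
  by rewrite (_ : slide s 0 = id)//; apply/funext => phi; rewrite slide0.
apply.
- by move=> j; rewrite -[X in measurable X]setTI; exact: measurable_slide.
- have key i j phi : (i < j)%N -> E0 (slide s i phi) -> E0 (slide s j phi) -> False.
    move=> ij [_ /(_ (j - i.+1)%N)]; rewrite slideD -subSn// subSS subnK 1?ltnW// => nB [Bj _].
    exact: nB.
  move=> i j _ _ [phi [/= Ei Ej]]; case: (ltngtP i j) => // ij; exfalso.
    exact: key ij Ei Ej.
  exact: key ij Ej Ei.
- by move=> j; rewrite P_slide.
Qed.

Lemma slide_escape n m j phi : configs_in (eball (@origin R) m%:R) phi -> (n + m < j)%N ->
  npts (slide 1 j phi) (eball origin n%:R `*` setT) = 0%N.
Proof.
move=> cp nmj; apply: npts_set0; apply/seteqP; split => // z [/= [w pw <-] [/= zn _]].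
have [wm _] := cp _ pw.
have [/= + _] := eball_box zn; rewrite in_itv/= !add0r => /andP[_ h1].
have [/= + _] := eball_box wm; rewrite in_itv/= !sub0r => /andP[h2 _].
move: h1; apply/negP; rewrite -ltNge mul1r.
apply: (@lt_le_trans _ _ (j%:R - m%:R)); first by rewrite ltrBrDr -natrD ltr_nat.
by rewrite addrC lerD2r.
Qed.

(** A finite configuration slides out of every bounded window, so it has a
    last visit to the event that the window is occupied. *)
Lemma finite_nonempty_null : P [set phi | finite_config phi /\ pts phi !=set0] = 0%E.
Proof.
pose W n : set E := eball (@origin R) n%:R `*` setT.
have bW n : bounded_window (W n).
  by apply: bounded_windowX; split; [exact: measurable_eball|exists n%:R].
pose B n : set C := finite_config `&` ~` [set phi | npts phi (W n) = 0%N].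
have mB n : measurable (B n).
  apply: measurableI; first exact: measurable_finite_config.
  by apply: measurableC; exact: measurable_npts_eq.
have -> : [set phi | finite_config phi /\ pts phi !=set0] = \bigcup_n B n.
  apply/seteqP; split => phi.
    move=> [fp [z pz]]; have [n _ zn] : (\bigcup_n eball (@origin R) n%:R) z.1 by rewrite bigcup_eball.
    exists n => //; split => // /npts0 => /(_ (bW n)) e.
    by have : (pts phi `&` W n) z by []; rewrite e.
  move=> [n _ [fp nn]]; split => //; apply/set0P/eqP => e; apply: nn.
  by apply: npts_set0; rewrite e set0I.
apply: null_bigcup => // n.
pose E0 : set C := [set phi | B n phi /\ forall i, ~ B n (slide 1 i.+1 phi)].
have mE0 : measurable E0.
  rewrite (_ : E0 = B n `&` \bigcap_i (slide 1 i.+1 @^-1` (~` B n))); last first.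
    by apply/seteqP; split => phi [Bp h]; split => // i; [move=> _; exact: h|exact: h].
  apply: measurableI => //; apply: bigcapT_measurable => i.
  rewrite -[X in measurable X]setTI; apply: measurable_slide => //; exact: measurableC.
have mU j : measurable (slide 1 j @^-1` E0).
  by rewrite -[X in measurable X]setTI; exact: measurable_slide.
apply: (@subset_measure0 _ _ _ P _ (\bigcup_j slide 1 j @^-1` E0)) => //.
- exact: bigcupT_measurable.
- move=> phi Bp; have [m _ cm] : (\bigcup_m @configs_in R dM M (eball origin m%:R)) phi.
    by rewrite -finite_configE; case: Bp.
  pose b j := `[< B n (slide 1 j phi) >].
  have exb : exists j, b j by exists 0%N; apply/asboolP; rewrite slide0.
  have ub j : b j -> (j <= n + m)%N.
    move=> /asboolP[_ nz]; rewrite leqNgt; apply/negP => nmj; apply: nz.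
    exact: (slide_escape cm).
  have [j bj jmax] := ex_maxnP exb ub.
  exists j => //; split; first exact/asboolP.
  move=> i; rewrite slideD => Bi; have := jmax (i.+1 + j)%N; rewrite /b.
  by move=> /(_ (asboolT Bi)); rewrite addSn ltnNge leq_addl.
- apply: null_bigcup => // j; rewrite -[LHS]/(P (slide 1 j @^-1` E0)) P_slide//.
  exact: last_visit_null.
Qed.

Lemma P_ioe : {ae P, forall phi, infinite_or_empty phi}.
Proof.
exists [set phi | finite_config phi /\ pts phi !=set0]; split.
- rewrite (_ : [set _ | _] = finite_config `&` ~` [set phi | pts phi = set0]).
    apply: measurableI; first exact: measurable_finite_config.
    apply: measurableC; rewrite (_ : [set _ | _] = configs_in set0).
      exact: measurable_configs_in.
    by apply/seteqP; split => phi /=; [move=> e z; rewrite e|move=> h; apply/seteqP; split => // z /h[]].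
  by apply/seteqP; split => phi [fp np]; split => //; [exact/eqP/set0P|exact/set0P/eqP].
- exact: finite_nonempty_null.
- move=> phi /= h; split; apply: contrapT => h'; apply: h; [by left|right].
  by apply: contrapT => /eqP/set0P.
Qed.

Local Open Scope ereal_scope.

(** * The DLR equations *)

(** The inverse partition function is written as an exponential so that the
    density is positive everywhere, including where the partition function
    vanishes or is infinite. *)
Definition dlr_density L phi psi : R :=
  (expR (- ln (fine (Zpart L phi))) * weight L phi psi)%R.

Lemma Zpart_ge0 L phi : 0 <= Zpart L phi.
Proof. by apply: integral_ge0 => psi _; rewrite lee_fin ltW// weight_gt0. Qed.

Lemma dlr_density_gt0 L phi psi : (0 < dlr_density L phi psi)%R.
Proof. by rewrite mulr_gt0 ?expR_gt0 ?weight_gt0. Qed.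

Lemma dlr_density_ge0 L phi psi : (0 <= dlr_density L phi psi)%R.
Proof. exact/ltW/dlr_density_gt0. Qed.

Lemma dlr_densityE L phi psi : 0 < Zpart L phi < +oo ->
  dlr_density L phi psi = ((fine (Zpart L phi))^-1 * weight L phi psi)%R.
Proof.
by move=> Z0; rewrite /dlr_density expRN lnK// posrE fine_gt0.
Qed.

Lemma measurable_dlr_density d (T : measurableType d) (f g : T -> C) L : bounded_borel L ->
  measurable_fun setT f -> measurable_fun setT g ->
  measurable_fun setT (fun t => dlr_density L (f t) (g t) : measurableTypeR R).
Proof.
move=> bL mf mg; apply: measurable_funM; last exact: measurable_weight.
apply: measurableT_comp => //; apply: measurableT_comp => //.
apply: (measurableT_comp (@measurable_ln R)); apply: measurableT_comp => //.
exact: (measurableT_comp (measurable_Zpart bL)).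
Qed.


Lemma P_Zpart L : bounded_borel L -> {ae P, forall phi, 0 < Zpart L phi < +oo}.
Proof.
move=> bL; apply: filterS2 P_ioe (gibbs_regular bL) => phi ip.
by rewrite /regular/= partition_functionE.
Qed.

Lemma dlr_measure L F : bounded_borel L -> measurable F ->
  P F = \int[P]_phi \int[Q L]_psi
    ((dlr_density L phi psi)%:E * (\1_F (splice L psi phi))%:E).
Proof.
move=> bL mF; have [mL _] := bL; have [g [mg <- gE]] := gibbs_kernel bL mF.
have md : measurable_fun setT (fun u : C * C =>
    (dlr_density L u.1 u.2)%:E * (\1_F (splice L u.2 u.1) : R)%:E).
  apply: emeasurable_funM; apply/measurable_EFinP; first exact: measurable_dlr_density.
  by apply: measurableT_comp; [exact: measurable_indic|exact: measurable_splice].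
have d0 (u : C * C) : 0 <= (dlr_density L u.1 u.2)%:E * (\1_F (splice L u.2 u.1) : R)%:E.
  by rewrite mule_ge0// lee_fin dlr_density_ge0.
apply: ae_eq_integral => //.
  exact: (measurable_fun_fubini_tonelli_F (fun u : C * C =>
    (dlr_density L u.1 u.2)%:E * (\1_F (splice L u.2 u.1) : R)%:E)).
apply: filterS3 P_ioe (gibbs_regular bL) gE => phi ip r -> _.
rewrite /specification indicE mem_set// mule1 partition_functionE//.
have mi : measurable_fun setT (fun psi : C => (weight L phi psi * \1_F (splice L psi phi))%:E).
  apply/measurable_EFinP; apply: measurable_funM; first exact: measurable_weight.
  by apply: measurableT_comp; [exact: measurable_indic|exact: measurable_splice].
rewrite (integral_configs_in (g := fun psi => (weight L phi psi * \1_F (splice L psi phi))%:E))//; last 2 first.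
- by move=> psi; rewrite lee_fin mulr_ge0// ltW// weight_gt0.
- by move=> psi cp; rewrite boltzmannE// /splice (restr_id cp).
rewrite -ge0_integralZl_EFin//; last 2 first.
- by move=> psi _; rewrite lee_fin mulr_ge0// ltW// weight_gt0.
- by rewrite invr_ge0 fine_ge0// Zpart_ge0.
have Zp : 0 < Zpart L phi < +oo by move: r; rewrite /regular/= partition_functionE.
by apply: eq_integral => psi _; rewrite -!EFinM mulrA (dlr_densityE _ Zp).
Qed.

(** The DLR equation as an invariance: resampling what happens in [L]
    according to the density [dlr_density] preserves [P]. *)
Lemma dlr L H : bounded_borel L -> measurable_fun setT H -> (forall x, 0 <= H x) ->
  \int[P]_phi H phi = \int[P]_phi \int[Q L]_psi
    ((dlr_density L phi psi)%:E * H (splice L psi phi)).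
Proof.
move=> bL mH H0; have [mL _] := bL.
have ms : measurable_fun setT (fun u : C * C => splice L u.2 u.1) by exact: measurable_splice.
have md : measurable_fun setT (fun u : C * C => dlr_density L u.1 u.2).
  exact: measurable_dlr_density.
have d0 (u : C * C) : (0 <= dlr_density L u.1 u.2)%R by exact: dlr_density_ge0.
rewrite (@ge0_integral_density _ _ _ _ _ P (P \x Q L)
  (fun u : C * C => dlr_density L u.1 u.2) (fun u : C * C => splice L u.2 u.1))//.
  rewrite (fubini_tonelli1 (fun u : C * C => (dlr_density L u.1 u.2)%:E * H (splice L u.2 u.1)))//.
    by apply: emeasurable_funM; [exact/measurable_EFinP|exact: measurableT_comp].
  by move=> u; rewrite mule_ge0// lee_fin.
move=> F mF; rewrite -[LHS]/(P F) (dlr_measure bL mF).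
rewrite (fubini_tonelli1 (fun u : C * C => (dlr_density L u.1 u.2)%:E * (\1_F (splice L u.2 u.1) : R)%:E))//.
  apply: emeasurable_funM; apply/measurable_EFinP => //.
  by apply: measurableT_comp; [exact: measurable_indic|exact: ms].
by move=> u; rewrite mule_ge0// lee_fin.
Qed.

Lemma ge0_integral_ae0 d (T : measurableType d) (m : {measure set T -> \bar R}) (f : T -> \bar R) :
  measurable_fun setT f -> (forall x, 0 <= f x) -> \int[m]_x f x = 0 ->
  {ae m, forall x, f x = 0}.
Proof.
move=> mf f0 i0; have : ae_eq m setT f (cst 0).
  apply/ae_eq_integral_abs => //; rewrite -i0.
  by apply: eq_integral => x _; rewrite gee0_abs.
by apply: filterS => x /(_ Logic.I).
Qed.

Lemma ae_exists d (T : measurableType d) (m : probability T R) (A : T -> Prop) :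
  {ae m, forall x, A x} -> exists x, A x.
Proof.
move=> h; apply: contrapT => nA; have : m setT = 0.
  apply: measure_negligible => //; apply: negligibleS h => x _ /= Ax.
  by apply: nA; exists x.
by move=> /eqP; rewrite probability_setT eqe oner_eq0.
Qed.

Lemma dlr_null L (F : set C) : bounded_borel L -> measurable F -> P F = 0 ->
  {ae P, forall phi, {ae Q L, forall psi, ~ F (splice L psi phi)}}.
Proof.
move=> bL mF; rewrite (dlr_measure bL mF) => F0; have [mL _] := bL.
have md : measurable_fun setT (fun u : C * C =>
    (dlr_density L u.1 u.2)%:E * (\1_F (splice L u.2 u.1) : R)%:E).
  apply: emeasurable_funM; apply/measurable_EFinP; first exact: measurable_dlr_density.
  by apply: measurableT_comp; [exact: measurable_indic|exact: measurable_splice].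
have d0 (u : C * C) : 0 <= (dlr_density L u.1 u.2)%:E * (\1_F (splice L u.2 u.1) : R)%:E.
  by rewrite mule_ge0// lee_fin dlr_density_ge0.
have mF1 := measurable_fun_fubini_tonelli_F (m2 := Q L) _ md d0.
have := ge0_integral_ae0 mF1 (fun phi => integral_ge0 _ (fun psi _ => d0 (phi, psi))) F0.
apply: filterS => phi F1.
have md1 : measurable_fun setT (fun psi : C =>
    (dlr_density L phi psi)%:E * (\1_F (splice L psi phi) : R)%:E).
  apply: emeasurable_funM; apply/measurable_EFinP; first exact: measurable_dlr_density.
  by apply: measurableT_comp; [exact: measurable_indic|exact: measurable_splice].
have := ge0_integral_ae0 md1 (fun psi => d0 (phi, psi)) F1.
apply: filterS => psi /eqP + Fs; rewrite indicE mem_set// mule1 eqe.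
by rewrite gt_eqF// dlr_density_gt0.
Qed.

Lemma dlr_ae L (A : C -> Prop) : bounded_borel L -> {ae P, forall phi, A phi} ->
  {ae P, forall phi, {ae Q L, forall psi, A (splice L psi phi)}}.
Proof.
move=> bL [N [mN N0 AN]]; apply: filterS (dlr_null bL mN N0) => phi.
apply: filterS => psi nN; apply: contrapT => nA; apply: nN; exact: AN.
Qed.

Lemma ae_configs_in L : bounded_borel L -> {ae Q L, forall psi, configs_in L psi}.
Proof.
move=> bL; have [mL _] := bL; exists (~` configs_in L); split => //.
- by apply: measurableC; exact: measurable_configs_in.
- exact: Q_outside.
Qed.

Lemma restr_splice L psi phi : restr L (splice L psi phi) = restr L psi.
Proof.
apply: config_eq; apply/seteqP; split => z; first by move=> [[//|[_ [+ _]]] [zL _]] => /(_ zL).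
by move=> [pz [zL _]]; split => //; left.
Qed.

Lemma restrC_splice L psi phi : restr (~` L) (splice L psi phi) = restr (~` L) phi.
Proof.
apply: config_eq; apply/seteqP; split => z; first by move=> [[[_ [zL _]]|//] [/(_ zL)]].
by move=> [pz [zL _]]; split => //; right.
Qed.

(** The law of the configuration in a bounded window is absolutely
    continuous with respect to the Poisson law of the window. *)
Lemma P_ae_restr L (A : C -> Prop) : bounded_borel L -> {ae Q L, forall psi, A psi} ->
  {ae P, forall phi, A (restr L phi)}.
Proof.
move=> bL [N [mN N0 AN]]; have [mL _] := bL.
have mF : measurable (restr L @^-1` N : set C).
  by rewrite -[X in measurable X]setTI; exact: measurable_restr.
exists (restr L @^-1` N); split => //; last by move=> phi h; exact: AN.
rewrite (dlr_measure bL mF) integral0_eq// => phi _.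
rewrite -(@integral0 _ _ R (Q L) setT); apply: ge0_ae_eq_integral => //.
- apply: emeasurable_funM; apply/measurable_EFinP; first exact: measurable_dlr_density.
  by apply: measurableT_comp; [exact: measurable_indic|exact: measurable_splice].
- by move=> psi _; rewrite mule_ge0// lee_fin dlr_density_ge0.
have : {ae Q L, forall psi, ~ N psi} by exists N; split => // psi /= /contrapT.
apply: filterS2 (ae_configs_in bL) => psi cp nN _.
by rewrite indicE memNset ?mule0// /preimage/= restr_splice restr_id.
Qed.

(** Conversely, the density is positive, so that a bounded region is empty
    with positive probability. *)
Lemma P_vacant_gt0 A : bounded_borel A -> 0 < P (vacant A).
Proof.
move=> bA; rewrite lt0e measure_ge0 andbT; apply/negP => /eqP P0.
have := dlr_null bA (measurable_vacant bA) P0.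
move=> /ae_exists[phi h].
have := poisson_vacant_gt0 bA (Q_poisson bA).
rewrite (_ : Q A (vacant A) = 0) ?ltxx//.
apply: measure_negligible; first exact: measurable_vacant.
apply: negligibleS h => psi vp /= nv; apply: nv.
apply: notin_vacant => z [[pz _]|[_ [nA _]]]; last exact: nA.
exact: (vacant_notin bA vp).
Qed.

Definition window_ball (n : nat) : set (plane R) := eball origin n%:R.

Lemma bounded_ball n : bounded_borel (window_ball n).
Proof. by split; [exact: measurable_eball|exists n%:R]. Qed.

Lemma in_ball (x : plane R) : exists n, window_ball n x.
Proof.
have [n _ xn] : (\bigcup_n eball (@origin R) n%:R) x by rewrite bigcup_eball.
by exists n.
Qed.

Lemma ball_le m n : (m <= n)%N -> window_ball m `<=` window_ball n.
Proof. by move=> mn; apply: eball_le; rewrite ler_nat. Qed.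

Lemma bounded_sub_ball L : bounded_borel L -> exists n, L `<=` window_ball n.
Proof.
move=> [_ [r Lr]]; exists (Num.truncn `|r|).+1; apply: subset_trans Lr _.
by apply: eball_le; rewrite (le_trans (ler_norm _))// ltW// truncnS_gt.
Qed.

Lemma halo_in_ball L : bounded_borel L -> exists n, L `<=` window_ball n /\
  forall psi, configs_in L psi -> halo D psi `<=` window_ball n.
Proof.
move=> bL; have [m Lm] := bounded_sub_ball bL.
pose n := (m + (Num.truncn (D + D)).+1)%N; exists n; split.
  by apply: subset_trans Lm (ball_le _); rewrite leq_addr.
move=> psi cp x [z pz zx]; have [zL _] := cp _ pz.
have : eball origin (m%:R + (D + D)) x by apply: eball_triangle (Lm _ zL) zx.
by apply: eball_le; rewrite natrD lerD2l ltW// truncnS_gt.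
Qed.

(** If the configuration could be empty, then resampling a square would
    produce a finite nonempty configuration with positive probability. *)
Lemma P_infinite : {ae P, forall phi, ~ finite_config phi}.
Proof.
suff ne : {ae P, forall phi, pts phi <> set0}.
  by apply: filterS2 P_ioe ne => phi [].
pose L : set (plane R) := [set` `[0%R, 1%R]] `*` [set` `[0%R, 1%R]].
have mL : measurable L by apply: measurableX; exact: measurable_itv.
have bL : bounded_borel L.
  split => //; exists 2%R => -[x y]; rewrite /L/= !in_itv/= => -[/andP[x0 x1] /andP[y0 y1]].
  by apply/eballE; split => //=; rewrite !subr0; nra.
have mF : measurable [set phi : C | finite_config phi /\ pts phi !=set0].
  rewrite (_ : [set _ | _] = finite_config `&` ~` configs_in set0).
    apply: measurableI; first exact: measurable_finite_config.
    by apply: measurableC; exact: measurable_configs_in.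
  apply/seteqP; split => phi [fp h]; split => //.
    by case: h => z pz /(_ z pz)[].
  by apply: contrapT => nz; apply: h => z pz; exfalso; apply: nz; exists z.
apply: filterS (dlr_null bL mF finite_nonempty_null) => phi h p0.
have : Q L (vacant L) = 1.
  apply: probability_setC1; first exact: measurable_vacant.
  apply: measure_negligible; first by apply: measurableC; exact: measurable_vacant.
  apply: negligibleS h => psi nv /= h; apply: h; split.
    apply: finite_cunion; first exact: finite_restr.
    by apply: sub_finite_set (@finite_set0 E) => z [+ _]; rewrite p0.
  apply: contrapT => nz; apply: nv; apply: notin_vacant => z pz Lz; apply: nz; exists z.
  by left.
rewrite /vacant (poisson_one 0 (Q_poisson bL) (bounded_windowX bL)).
rewrite /rate setIid intensityX// probability_setT mule1 lebesgue2X; [|exact: measurable_itv..].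
rewrite !lebesgue_measure_itv/= lte_fin ltr01 sube0 mule1/= /poisson_weight expr0 fact0 divr1 mul1r.
move=> /eqP; rewrite eqe => /eqP e1; have : (expR (- 1) < 1 :> R)%R by rewrite expR_lt1 oppr_lt0.
by rewrite e1 ltxx.
Qed.

Definition simple phi := simple_in setT phi.

Lemma P_simple : {ae P, forall phi, simple phi}.
Proof.
have : {ae P, forall phi, forall n, simple_in (window_ball n) (restr (window_ball n) phi)}.
  apply/ae_foralln => n; apply: P_ae_restr; first exact: bounded_ball.
  exact: poisson_simple (bounded_ball n) (Q_poisson (bounded_ball n)).
apply: filterS => phi h z w pz pw _ _ zw.
have [n zn] := in_ball z.1.
apply: (h n) => //; first by rewrite /= -zw.
by rewrite -zw.
Qed.

(** * Almost sure locality *)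

Lemma restrI (A B : set (plane R)) phi : restr A (restr B phi) = restr (A `&` B) phi.
Proof.
apply: config_eq; apply/seteqP; split => z; first by move=> [[pz [Bz _]] [Az _]].
by move=> [pz [[Az Bz] _]].
Qed.

Lemma restr_set0 phi : restr set0 phi = cempty.
Proof. by apply: config_eq; apply/seteqP; split => // z [_ []]. Qed.

Lemma halo_cempty : halo D (cempty : C) = set0.
Proof. by apply/seteqP; split => // x [z []]. Qed.

Lemma cunion0c phi : cunion cempty phi = phi.
Proof. by apply: config_eq; rewrite /= set0U. Qed.

Lemma mule_gt0_inj (a x y : \bar R) : 0 < a -> a \is a fin_num -> a * x = a * y -> x = y.
Proof.
case: a => [a| |]//; rewrite lte_fin => a0 _.
move=> /(congr1 (fun t => (a^-1)%:E * t)).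
by rewrite !muleA -EFinM mulVf ?gt_eqF// !mul1e.
Qed.

(** Erasing the points in a part of the window preserves almost sure
    properties, because that part is empty with positive probability. *)
Lemma poisson_ae_erase W L (A : C -> Prop) : bounded_borel W -> measurable L ->
  {ae Q W, forall psi, A psi} -> {ae Q W, forall psi, A (restr (~` L) psi)}.
Proof.
move=> bW mL [N [mN N0 AN]].
have bD : bounded_borel (W `\` L) by exact: bounded_borelD.
have bDD : bounded_borel (W `\` (W `\` L)) by apply: bounded_borelD => //; case: bD.
have mv : measurable (vacant (W `\` (W `\` L)) : set C) by exact: measurable_vacant.
have QN : Q (W `\` L) N = 0.
  have := poisson_vacant bW bD.1 (@subDsetl _ W L) (Q_poisson bW) (Q_poisson bD) mN.
  rewrite (_ : Q W (N `&` _) = 0); last first.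
    apply/eqP; rewrite eq_le measure_ge0 andbT -N0.
    by apply: le_measure; rewrite ?inE//; exact: measurableI.
  move=> /esym/eqP; rewrite mule_eq0 => /orP[|/eqP//].
  by rewrite gt_eqF// (poisson_vacant_gt0 bDD (Q_poisson bW)).
have mr : measurable_fun setT (@restr R dM M (~` L)) by apply: measurable_restr; exact: measurableC.
have mrN : measurable (restr (~` L) @^-1` N : set C).
  by rewrite -[X in measurable X]setTI; exact: mr.
exists (restr (~` L) @^-1` N); split => //; last by move=> psi h; exact: AN.
rewrite -[LHS]/(Q W (restr (~` L) @^-1` N)).
have QD : poisson_law lm (W `&` ~` L) (Q (W `\` L)) by exact: Q_poisson.
by rewrite (poisson_restr (measurableC mL) (Q_poisson bW) QD mN).
Qed.

Lemma poisson_ae_splice W L (A : C -> Prop) : bounded_borel L -> bounded_borel W ->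
  {ae Q W, forall psi, A psi} ->
  {ae Q W, forall phi, {ae Q W, forall psi, A (splice L psi phi)}}.
Proof.
move=> bL bW [N [mN N0 AN]]; have [mL _] := bL.
have ms : measurable_fun setT (fun u : C * C => splice L u.2 u.1) by exact: measurable_splice.
have mI : measurable_fun setT (fun psi : C => (\1_N psi : R)%:E).
  by apply/measurable_EFinP; exact: measurable_indic.
have I0 (psi : C) : 0 <= (\1_N psi : R)%:E by rewrite lee_fin.
have mI2 : measurable_fun setT (fun u : C * C => (\1_N (splice L u.2 u.1) : R)%:E).
  exact: (measurableT_comp mI ms).
have mI1 psi : measurable_fun setT (fun phi : C => (\1_N (splice L phi psi) : R)%:E).
  by apply: (measurableT_comp mI); exact: measurable_splice.
have : \int[Q W]_phi \int[Q W]_psi (\1_N (splice L psi phi) : R)%:E = 0.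
  rewrite -[RHS]N0 -[X in Q W X]setIT -integral_indic//.
  rewrite [RHS](poisson_splice_integral bL (Q_poisson bW))//.
  rewrite [LHS](fubini_tonelli (fun u : C * C => (\1_N (splice L u.2 u.1) : R)%:E))//.
move=> /ge0_integral_ae0 h.
have {}h := h (measurable_fun_fubini_tonelli_F _ mI2 (fun u => I0 _))
  (fun phi => integral_ge0 _ (fun psi _ => I0 (splice L psi phi))).
apply: filterS h => phi /(ge0_integral_ae0 (mI1 phi) (fun psi => I0 _)).
apply: filterS => psi h; apply: contrapT => nA.
have /AN Ns : (~` [set x | A x]) (splice L psi phi) by [].
by move: h; rewrite indicE mem_set// => /eqP; rewrite eqe oner_eq0.
Qed.

Lemma restrK (A B : set (plane R)) phi : A `<=` B -> restr A (restr B phi) = restr A phi.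
Proof. by move=> AB; rewrite restrI setIidl. Qed.

Lemma splice_splice L psi psi' phi : splice L psi (splice L psi' phi) = splice L psi phi.
Proof. by rewrite /splice -[X in cunion _ X = _]/(restr (~` L) (splice L psi' phi)) restrC_splice. Qed.

Lemma env_cut L phi psi (U : set (plane R)) :
  (forall z, pts phi z -> ~ L z.1 -> halo D (restr L psi) z.1 -> U z.1) ->
  env L phi psi = env L (restr U phi) psi.
Proof.
move=> h; apply: config_eq; apply/seteqP; split => z.
  by move=> [[pz [nL _]] [hz _]]; split => //; split => //; split => //; split => //; exact: h.
by move=> [[[pz _] [nL _]] [hz _]]; split.
Qed.

Lemma eq_weight L phi phi' psi psi' : restr L psi = restr L psi' ->
  env L phi psi = env L phi' psi' -> weight L phi psi = weight L phi' psi'.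
Proof. by move=> e1 e2; rewrite /weight e1 e2. Qed.

Lemma env_out L phi phi' psi : restr (~` L) phi = restr (~` L) phi' ->
  env L phi psi = env L phi' psi.
Proof. by rewrite /env => ->. Qed.

Lemma eq_Zpart L phi phi' : (forall psi, env L phi psi = env L phi' psi) ->
  Zpart L phi = Zpart L phi'.
Proof.
by move=> e; apply: eq_integral => psi _; congr (_%:E); exact: eq_weight.
Qed.

Lemma eq_dlr_density L phi phi' psi : (forall psi, env L phi psi = env L phi' psi) ->
  dlr_density L phi psi = dlr_density L phi' psi.
Proof. by move=> e; rewrite /dlr_density (eq_Zpart e) (eq_weight _ (e psi)). Qed.

Lemma dlr_density_out L phi phi' psi psi' : restr (~` L) phi = restr (~` L) phi' ->
  restr L psi = restr L psi' -> dlr_density L phi psi = dlr_density L phi' psi'.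
Proof.
move=> e e'; rewrite (eq_dlr_density (phi' := phi')); last by move=> ?; exact: env_out.
by rewrite /dlr_density; congr (_ * _)%R; apply: eq_weight => //; rewrite /env e'.
Qed.

Section ae_locality.
Variables (W L : set (plane R)).
Hypotheses (bW : bounded_borel W) (mL : measurable L) (LW : L `<=` W).

Let bL : bounded_borel L.
Proof. by rewrite -(setIidr LW); exact: bounded_borelI. Qed.

Let mW : measurable W. Proof. by case: bW. Qed.

Let w0 psi : R := expR (- (V (restr W psi) - V cempty)).

Let mw0 : measurable_fun setT (fun psi => w0 psi : measurableTypeR R).
Proof.
have mVW : measurable_fun setT (fun psi => V (restr W psi) : measurableTypeR R).
  apply: measurable_energy; first exact: measurable_restr.
  by move=> t; exact: finite_restr.
rewrite /w0; apply: (measurableT_comp (@measurable_expR R)).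
apply: measurable_funN; exact: (measurable_funB mVW (measurable_cst _)).
Qed.

Lemma measurable_vacantE A : bounded_borel A ->
  measurable_fun setT (fun phi : C => (\1_(vacant A) phi : R)%:E).
Proof.
by move=> bA; apply/measurable_EFinP; apply: measurable_indic; exact: measurable_vacant.
Qed.

(** The boundary condition is seen in the surroundings [A] of [W] only;
    when these are empty, what remains is the finite volume Gibbs law. *)
Lemma isolated_law : exists (c : R) (A : set (plane R)),
  [/\ (0 < c)%R, bounded_borel A, A `&` W = set0 &
   (forall phi psi, vacant A phi -> env W phi psi = cempty) /\
   (forall phi psi, vacant A phi -> env L phi psi = env L (restr W phi) psi) /\
  forall H : C -> \bar R, measurable_fun setT H -> (forall x, 0 <= H x) ->
   \int[P]_phi ((\1_(vacant A) phi : R)%:E * H (restr W phi)) =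
   P (vacant A) * \int[Q W]_psi ((c * w0 psi)%:E * H (restr W psi))].
Proof.
have [n [Wn hn]] := halo_in_ball bW.
pose A := window_ball n `\` W.
have bA : bounded_borel A by apply: bounded_borelD => //; exact: bounded_ball.
have AW : A `&` W = set0 by apply/seteqP; split => // x [[]].
have hW psi (U : set (plane R)) : U `<=` W -> halo D (restr U psi) `<=` window_ball n.
  move=> UW; apply: hn => z [_ [Uz _]]; by split => //; exact: UW.
have eW phi psi : vacant A phi -> env W phi psi = cempty.
  move=> vA; apply: config_eq; apply/seteqP; split => // z [[pz [nW _]] [hz _]].
  by apply: (vacant_notin bA vA pz); split => //; exact: (hW psi W).
have eL phi psi : vacant A phi -> env L phi psi = env L (restr W phi) psi.
  move=> vA; apply: env_cut => z pz nL hz; apply: contrapT => nW.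
  by apply: (vacant_notin bA vA pz); split => //; exact: (hW psi L).
pose c : R := expR (- ln (fine (\int[Q W]_psi (w0 psi)%:E))).
exists c, A; split => //; first exact: expR_gt0.
split => //; split => //.
move=> H mH H0.
have mr := @measurable_restr R dM M W mW.
have mHr : measurable_fun setT (H \o restr W) by exact: measurableT_comp.
have mV : measurable (vacant A : set C) by exact: measurable_vacant.
rewrite (dlr (H := fun phi => (\1_(vacant A) phi : R)%:E * H (restr W phi)) bW); last 2 first.
- exact: (emeasurable_funM (measurable_vacantE bA) mHr).
- by move=> phi; rewrite mule_ge0// lee_fin.
transitivity (\int[P]_phi ((\1_(vacant A) phi : R)%:E *
    \int[Q W]_psi ((c * w0 psi)%:E * H (restr W psi)))); last first.
  rewrite ge0_integralZr//; last 2 first.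
  - exact: measurable_vacantE.
  - by apply: integral_ge0 => psi _; rewrite mule_ge0// lee_fin mulr_ge0// ?expR_ge0// ltW// expR_gt0.
  by rewrite integral_indic// setIT.
apply: eq_integral => phi _.
rewrite indicE; have [/set_mem vA|nvA] := boolP (phi \in vacant A); last first.
  rewrite mul0e; rewrite integral0_eq// => psi _.
  rewrite indicE memNset ?mul0e ?mule0// => vs; move/negP: nvA; apply; apply: mem_set.
  apply: notin_vacant => z pz Az; apply: (vacant_notin bA vs _ Az); right; split => //.
  by case: Az.
rewrite mul1e; apply: eq_integral => psi _.
rewrite indicE mem_set ?mul1e; last first.
  apply: notin_vacant => z [[_ [Wz _]] [_ nW]|[pz _]]; first exact: nW.
  exact: (vacant_notin bA vA).
rewrite restr_splice.
have wE psi' : weight W phi psi' = w0 psi'.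
  have e0 : cunion (restr W psi') cempty = restr W psi' by apply: config_eq; rewrite /= setU0.
  by rewrite /weight /w0 eW// e0.
have ZE : Zpart W phi = \int[Q W]_psi (w0 psi)%:E.
  by apply: eq_integral => psi' _; rewrite wE.
by rewrite /dlr_density wE ZE.
Qed.

Definition resampled (g : C -> \bar R) psi : \bar R := \int[Q W]_chi g (splice L chi psi).

Lemma measurable_resampled g : measurable_fun setT g -> (forall x, 0 <= g x) ->
  measurable_fun setT (resampled g).
Proof.
move=> mg g0; apply: (measurable_fun_fubini_tonelli_F (fun u : C * C => g (splice L u.2 u.1))).
  by apply: (measurableT_comp mg); exact: measurable_splice.
by move=> u; exact: g0.
Qed.

Lemma resampled_ge0 g psi : (forall x, 0 <= g x) -> 0 <= resampled g psi.
Proof. by move=> g0; apply: integral_ge0. Qed.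

Lemma resampled_splice g chi psi : resampled g (splice L chi psi) = resampled g psi.
Proof. by apply: eq_integral => chi' _; rewrite splice_splice. Qed.

Lemma resampled_integral g h : measurable_fun setT g -> (forall x, 0 <= g x) ->
  measurable_fun setT h -> (forall x, 0 <= h x) ->
  \int[Q W]_psi (g psi * resampled h psi) = \int[Q W]_psi (resampled g psi * resampled h psi).
Proof.
move=> mg g0 mh h0.
have mrh := measurable_resampled mh h0.
have rh0 psi : 0 <= resampled h psi by exact: resampled_ge0.
have ms : measurable_fun setT (fun u : C * C => splice L u.1 u.2) by exact: measurable_splice.
rewrite [LHS](poisson_splice_integral bL (Q_poisson bW)); last 2 first.
- exact: emeasurable_funM.
- by move=> psi; rewrite mule_ge0.
under eq_integral => psi _ do under eq_integral => chi _ do rewrite resampled_splice.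
rewrite [LHS](fubini_tonelli (fun u : C * C => g (splice L u.1 u.2) * resampled h u.2)); last 2 first.
- apply: emeasurable_funM; first exact: (measurableT_comp mg).
  exact: (measurableT_comp mrh measurable_snd).
- by move=> u; rewrite mule_ge0.
apply: eq_integral => psi _ /=; move: (rh0 psi); move: (resampled h psi) => k k0.
have mgs : measurable_fun setT (fun chi => g (splice L chi psi)).
  by apply: (measurableT_comp mg); exact: measurable_splice.
have key (G : C -> \bar R) : measurable_fun setT G -> (forall x, 0 <= G x) ->
    \int[Q W]_x (G x * k) = (\int[Q W]_x G x) * k.
  by move=> mG G0; rewrite ge0_integralZr.
exact: (key (fun chi => g (splice L chi psi))).
Qed.

(** The points in [L] and an independent copy of them are exchangeable. *)
Lemma resampled_symmetric g h : measurable_fun setT g -> (forall x, 0 <= g x) ->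
  measurable_fun setT h -> (forall x, 0 <= h x) ->
  \int[Q W]_psi (g psi * resampled h psi) = \int[Q W]_psi (resampled g psi * h psi).
Proof.
move=> mg g0 mh h0; rewrite resampled_integral//.
under eq_integral do rewrite muleC.
by rewrite -resampled_integral//; apply: eq_integral => psi _; rewrite muleC.
Qed.

(** Locality holds almost surely as a consequence of the consistency of the
    specification: resampling [L] inside [W] must leave the finite volume
    law on [W] invariant. Its density is thus the product of its marginal
    over what happens in [L] and of the conditional density. The latter
    only involves the halo, and the marginal is eliminated by comparing
    [psi] with what remains after erasing its points in [L]. *)
Lemma ae_local : {ae Q W, forall psi,
  expR (- (V (restr W psi) - V (restr (W `\` L) psi))) = weight L psi psi}.
Proof.
have [c [A [c0 bA AW [eW [eL key]]]]] := isolated_law.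
have mV : measurable (vacant A : set C) by exact: measurable_vacant.
have PA0 := P_vacant_gt0 bA.
have fPA : P (vacant A) \is a fin_num 
  by rewrite ge0_fin_numE//; apply: le_lt_trans (probability_le1 _ mV) _; exact: ltry.
have mr := @measurable_restr R dM M W mW.
pose d psi := dlr_density L psi psi.
have md : measurable_fun setT (fun psi => d psi : measurableTypeR R) by exact: measurable_dlr_density.
have d_gt0 psi : (0 < d psi)%R by exact: dlr_density_gt0.
have dE psi chi : d (splice L chi psi) = dlr_density L psi chi.
  by apply: dlr_density_out; [rewrite restrC_splice|rewrite restr_splice].
have cw0 psi : (0 <= c * w0 psi)%R by rewrite mulr_ge0 ?ltW// expR_gt0.
have mcw : measurable_fun setT (fun psi => (c * w0 psi)%:E).
  by apply/measurable_EFinP; apply: measurable_funM.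
(* the density of the law on W, integrated over what happens in L *)
pose Z1 := resampled (fun psi => (c * w0 psi)%:E).
have msp : measurable_fun setT (fun u : C * C => splice L u.2 u.1) by exact: measurable_splice.
have mZ1 : measurable_fun setT Z1 by apply: measurable_resampled => // u; rewrite lee_fin.
have Z10 psi : 0 <= Z1 psi by apply: resampled_ge0 => u; rewrite lee_fin.
have Z1E psi chi : Z1 (splice L chi psi) = Z1 psi.
  exact: resampled_splice.
have resample H : measurable_fun setT H -> (forall x, 0 <= H x) ->
    \int[Q W]_psi ((c * w0 psi)%:E * H psi) = \int[Q W]_psi (Z1 psi * (d psi)%:E * H psi).
  move=> mH H0.
  have mHr : measurable_fun setT (H \o restr W) by exact: measurableT_comp.
  (* the process on W has no point outside W *)
  have aeW (G : C -> \bar R) : measurable_fun setT G -> (forall x, 0 <= G x) ->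
      \int[Q W]_psi ((c * w0 psi)%:E * G (restr W psi)) = \int[Q W]_psi ((c * w0 psi)%:E * G psi).
    move=> mG G0; apply: ge0_ae_eq_integral => //.
    - by apply: emeasurable_funM => //; exact: measurableT_comp.
    - exact: emeasurable_funM.
    - by move=> psi _; rewrite mule_ge0// lee_fin.
    - by move=> psi _; rewrite mule_ge0// lee_fin.
    by apply: filterS (ae_configs_in bW) => psi cp _; rewrite restr_id.
  pose J psi := \int[Q L]_chi ((dlr_density L psi chi)%:E * H (splice L chi psi)).
  have mK2 : measurable_fun setT (fun u : C * C => (dlr_density L u.1 u.2)%:E * H (splice L u.2 u.1)).
    apply: emeasurable_funM; last exact: measurableT_comp.
    by apply/measurable_EFinP; exact: measurable_dlr_density.
  have K20 (u : C * C) : 0 <= (dlr_density L u.1 u.2)%:E * H (splice L u.2 u.1).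
    by rewrite mule_ge0// lee_fin dlr_density_ge0.
  have mK : measurable_fun setT J.
    by apply: (measurable_fun_fubini_tonelli_F (fun u : C * C => (dlr_density L u.1 u.2)%:E * H (splice L u.2 u.1))).
  have K0 psi : 0 <= J psi by apply: integral_ge0 => chi _; exact: (K20 (psi, chi)).
  have step1 : \int[Q W]_psi ((c * w0 psi)%:E * H psi) = \int[Q W]_psi ((c * w0 psi)%:E * J psi).
    rewrite -aeW// -[RHS]aeW//.
    apply: (mule_gt0_inj PA0 fPA); rewrite -!key//.
    rewrite (dlr (H := fun phi => (\1_(vacant A) phi : R)%:E * H (restr W phi)) bL); last 2 first.
    - exact: (emeasurable_funM (measurable_vacantE bA) mHr).
    - by move=> phi; rewrite mule_ge0// lee_fin.
    apply: eq_integral => phi _.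
    rewrite indicE; have [/set_mem vA|nvA] := boolP (phi \in vacant A); last first.
      rewrite mul0e; rewrite integral0_eq// => psi _.
      rewrite indicE memNset ?mul0e ?mule0// => vs; move/negP: nvA; apply; apply: mem_set.
      apply: notin_vacant => z pz Az; apply: (vacant_notin bA vs _ Az); right; split => //.
      by split => //= Lz; have : (A `&` W) z.1 by [split => //; exact: LW]; rewrite AW.
    rewrite mul1e; apply: eq_integral => psi _.
    rewrite indicE mem_set ?mul1e; last first.
      apply: notin_vacant => z [[_ [Lz _]] Az|[pz _]]; last exact: (vacant_notin bA vA).
      by have : (A `&` W) z.1 by [split => //; exact: LW]; rewrite AW.
    congr (_%:E * H _); first by apply: eq_dlr_density => psi''; exact: eL.
    apply: config_eq; apply/seteqP; split => z.
      by move=> [[h|[pz nL]] Wz]; [left|right; split].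
    move=> [[pz [zL t]]|[[pz Wz] nL]]; last by split => //; right.
    by split; [left|split => //; exact: LW].
  rewrite step1.
  have JE psi : J psi = \int[Q W]_chi ((d (splice L chi psi))%:E * H (splice L chi psi)).
    have QWL : poisson_law lm (W `&` L) (Q L) by rewrite (setIidr LW); exact: Q_poisson.
    have lawE := poisson_restr mL (Q_poisson bW) QWL.
    rewrite /J (ge0_integral_law (measurable_restr mL) (fun X mX => esym (lawE X mX))).
    - apply: eq_integral => chi _; congr (_%:E * H _).
        rewrite dE; apply: dlr_density_out => //; exact: restrK.
      by rewrite /splice restrK.
    - apply: emeasurable_funM.
        by apply/measurable_EFinP; exact: measurable_dlr_density.
      by apply: (measurableT_comp mH); exact: measurable_splice.
    - by move=> chi; exact: (K20 (psi, chi)).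
  pose h psi := (d psi)%:E * H psi.
  have mh : measurable_fun setT h by apply: emeasurable_funM => //; exact/measurable_EFinP.
  have h0 psi : 0 <= h psi by rewrite mule_ge0// lee_fin ltW.
  under eq_integral => psi _ do rewrite JE.
  rewrite -[LHS]/(\int[Q W]_psi ((c * w0 psi)%:E * resampled h psi)).
  rewrite resampled_symmetric//.
  by apply: eq_integral => psi _; rewrite muleA.
have aeq : {ae Q W, forall psi, (c * w0 psi)%:E = Z1 psi * (d psi)%:E}.
  have : ae_eq (Q W) setT (fun psi => (c * w0 psi)%:E) (fun psi => Z1 psi * (d psi)%:E).
    apply: integral_ae_eq => //.
    - apply/integrableP; split => //.
      under eq_integral => psi _ do rewrite gee0_abs ?lee_fin//.
      have e : P (vacant A) = P (vacant A) * \int[Q W]_psi (c * w0 psi)%:E.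
        transitivity (\int[P]_phi ((\1_(vacant A) phi : R)%:E * cst 1 (restr W phi))).
          under eq_integral do rewrite /= mule1.
          by rewrite integral_indic// setIT.
        rewrite key//; congr (_ * _); by apply: eq_integral => psi _; rewrite /= mule1.
      rewrite ltNge leye_eq; apply/negP => /eqP oo; move: e.
      by rewrite oo gt0_muley// => e; move: fPA; rewrite e.
    - by apply: emeasurable_funM => //; exact/measurable_EFinP.
    - move=> F _ mF; have mI : measurable_fun setT (fun psi : C => (\1_F psi : R)%:E).
        by apply/measurable_EFinP; exact: measurable_indic.
      rewrite (integral_mkcond F) [RHS](integral_mkcond F).
      have pE (f : C -> \bar R) : f \_ F = fun psi => f psi * (\1_F psi : R)%:E.
        apply/funext => psi; rewrite patchE indicE.
        by case: ifP => _; rewrite ?mule1 ?mule0.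
      by rewrite !pE; apply: resample => // psi; rewrite lee_fin.
  by apply: filterS => psi /(_ Logic.I).
apply: filterS2 aeq (poisson_ae_erase bW mL aeq) => xi e e0.
set xi0 := restr (~` L) xi in e0.
have LL : restr (~` L) xi0 = restr (~` L) xi by rewrite /xi0 restrI setIid.
have Zxi : Z1 xi0 = Z1 xi.
  by apply: eq_integral => chi _; rewrite /splice LL.
have rL0 : restr L xi0 = cempty by rewrite /xi0 restrI setICr restr_set0.
have w1 : weight L xi0 xi0 = 1%R.
  have ee : env L xi0 xi0 = cempty by rewrite /env rL0 halo_cempty restr_set0.
  by rewrite /weight rL0 ee cunion0c subrr oppr0 expR0.
have ZZ : Zpart L xi0 = Zpart L xi by apply: eq_Zpart => psi; exact: env_out.
have rW : restr W xi0 = restr (W `\` L) xi by rewrite /xi0 restrI setDE.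
clear resample mcw Z10 mZ1 msp key dE md.
move: e0; rewrite Zxi /d /dlr_density ZZ w1 mulr1.
move: e; rewrite /d /dlr_density; set k := expR (- ln (fine (Zpart L xi))).
have k0 : (0 < k)%R by exact: expR_gt0.
case: (Z1 xi) => [x| |]; last 2 first.
- by rewrite gt0_mulye ?lte_fin ?mulr_gt0// weight_gt0.
- by rewrite gt0_mulNye ?lte_fin ?mulr_gt0// weight_gt0.
move=> [e] [e0].
have : (w0 xi = w0 xi0 * weight L xi xi)%R.
  by apply: (mulfI (lt0r_neq0 c0)); rewrite mulrA e e0 mulrA.
rewrite /w0 rW => ew.
apply: (mulfI (lt0r_neq0 (expR_gt0 (- (V (restr (W `\` L) xi) - V cempty))))).
rewrite -ew -expRD; congr expR; ring.
Qed.

End ae_locality.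

Local Close Scope ereal_scope.
Implicit Types (eta chi : C) (x y : plane R).

(** The index [i] of the half-open square of centre [d i] and side [d] that
    contains [x]. *)
Definition grid (d : R) (x : plane R) : int * int :=
  (Num.floor ((x.1 : R) / d + 2^-1), Num.floor ((x.2 : R) / d + 2^-1)).

Definition box (d : R) (i : int * int) : set (plane R) := [set x | grid d x = i].

Lemma floor_box (d a : R) (i : int) : 0 < d ->
  (Num.floor (a / d + 2^-1) = i) <-> (d * (i%:~R - 2^-1) <= a < d * (i%:~R + 2^-1)).
Proof.
move=> d0; have := @floor_eq R (a / d + 2^-1) i.
have -> : (i%:~R <= a / d + 2^-1) = (d * (i%:~R - 2^-1) <= a).
  by rewrite -lerBlDr ler_pdivlMr// mulrC.
have -> : (a / d + 2^-1 < (i + 1)%:~R) = (a < d * (i%:~R + 2^-1)).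
  rewrite -ltrBrDr ltr_pdivrMr// mulrC intrD; congr (a < d * _); lra.
by move=> <-; split => [/eqP|/eqP].
Qed.

Lemma boxE (d : R) (i : int * int) : 0 < d -> box d i =
  [set` `[d * (i.1%:~R - 2^-1), d * (i.1%:~R + 2^-1)[] `*`
  [set` `[d * (i.2%:~R - 2^-1), d * (i.2%:~R + 2^-1)[].
Proof.
move=> d0; case: i => i j; apply/seteqP; split => x; rewrite /box/= !in_itv/=.
  by move=> [/(floor_box _ _ d0) h /(floor_box _ _ d0)].
by move=> [/(floor_box _ _ d0) h /(floor_box _ _ d0) h']; rewrite /grid h h'.
Qed.

Lemma measurable_box d i : 0 < d -> measurable (box d i).
Proof. by move=> d0; rewrite boxE//; apply: measurableX; exact: measurable_itv. Qed.

Lemma box_diam d (x y : plane R) : 0 < d -> grid d x = grid d y ->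
  `|(x.1 : R) - y.1| < d /\ `|(x.2 : R) - y.2| < d.
Proof.
move=> d0 [e1 e2].
have [h1 h2] := ((floor_box x.1 _ d0).1 e1, (floor_box x.2 _ d0).1 e2).
have h3 := (floor_box y.1 _ d0).1 (erefl _); have h4 := (floor_box y.2 _ d0).1 (erefl _).
move: h1 h2 h3 h4; rewrite !mulrBr !mulrDr => /andP[? ?] /andP[? ?] /andP[? ?] /andP[? ?].
by split; rewrite ltr_norml; apply/andP; split; lra.
Qed.

Definition mesh (n : nat) : R := n.+1%:R^-1.

Lemma mesh_gt0 n : 0 < mesh n. Proof. by rewrite invr_gt0. Qed.

Lemma grid_separates (x y : plane R) : x <> y ->
  exists N, forall n, (N <= n)%N -> grid (mesh n) x <> grid (mesh n) y.
Proof.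
move=> xy; pose e := `|(x.1 : R) - y.1| + `|(x.2 : R) - y.2|.
have e0 : 0 < e.
  rewrite lt0r addr_ge0// andbT paddr_eq0// !normr_eq0 !subr_eq0.
  apply/negP => /andP[/eqP h1 /eqP h2]; apply: xy.
  by rewrite [x]surjective_pairing [y]surjective_pairing h1 h2.
exists (Num.truncn (2 / e)) => n Nn /(box_diam (mesh_gt0 n)) [h1 h2].
have : 2 / e < n.+1%:R by apply: lt_le_trans (truncnS_gt _) _; rewrite ler_nat.
rewrite ltr_pdivrMr// => h.
have : e < 2 * mesh n by rewrite /e; lra.
rewrite /mesh ltr_pdivlMr// mulrC => h'.
by have := lt_trans h h'; rewrite ltxx.
Qed.

Lemma grid_separates_seq (s t : seq E) :
  exists N, forall n, (N <= n)%N -> forall z w, z \in s -> w \in t -> z.1 <> w.1 ->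
    grid (mesh n) z.1 <> grid (mesh n) w.1.
Proof.
have one z : exists N, forall n, (N <= n)%N -> forall w, w \in t -> z.1 <> w.1 ->
    grid (mesh n) z.1 <> grid (mesh n) w.1.
  elim: t => [|w t [N IH]]; first by exists 0%N.
  have [zw|zw] := pselect (z.1 = w.1).
    by exists N => n Nn w'; rewrite inE => /orP[/eqP->//|]; exact: IH.
  have [N' h'] := grid_separates zw; exists (maxn N N') => n.
  rewrite geq_max => /andP[Nn Nn'] w'; rewrite inE => /orP[/eqP->|]; last exact: IH.
  by move=> _; exact: h'.
elim: s => [|z s [N IH]]; first by exists 0%N.
have [N' h'] := one z; exists (maxn N N') => n.
rewrite geq_max => /andP[Nn Nn'] z' w'; rewrite inE => /orP[/eqP->|]; last exact: IH.
exact: h'.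
Qed.

(** A countable family of regions that is rich enough to isolate any finite
    part of a configuration. *)
Definition patch (k : nat) (c : nat * seq (int * int)) : set (plane R) :=
  window_ball k `&` [set x | grid (mesh c.1) x \in c.2].

Lemma bounded_patch k c : bounded_borel (patch k c).
Proof.
apply: bounded_borelI; first exact: bounded_ball.
case: c => n s /=.
rewrite (_ : [set x | _] = \bigcup_(i in [set` s]) box (mesh n) i).
  apply: fin_bigcup_measurable; first exact: finite_seq.
  by move=> i _; apply: measurable_box; exact: mesh_gt0.
apply/seteqP; split => x /=; first by move=> h; exists (grid (mesh n) x).
by move=> [i /= ins]; rewrite /box/= => ->.
Qed.

(** A mesh that separates the points of [eta] from the other points of
    [phi] in the window and from those of [chi]. *)
Lemma isolate k phi chi eta : simple phi -> pts eta `<=` pts phi ->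
  configs_in (window_ball k) eta -> configs_in (window_ball k) chi ->
  (forall z w, pts chi z -> pts eta w -> z.1 <> w.1) ->
  exists c, restr (patch k c) phi = eta /\ vacant (patch k c) chi.
Proof.
move=> sphi ephi ek ck ce.
have fe : finite_config eta := finite_in_bounded (bounded_ball k) ek.
have fc : finite_config chi := finite_in_bounded (bounded_ball k) ck.
have fp := finite_restr phi (bounded_ball k).
have fu := finite_cunion fp fc.
have [n nP] := grid_separates_seq (fset_set (pts eta)) (fset_set (pts (cunion (restr (window_ball k) phi) chi))).
have {}nP z w : pts eta z -> pts (cunion (restr (window_ball k) phi) chi) w -> z.1 <> w.1 ->
    grid (mesh n) z.1 <> grid (mesh n) w.1.
  move=> ez uw; apply: nP => //; first by rewrite in_fset_set// mem_set.
  by rewrite in_fset_set// mem_set.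
pose s := [seq grid (mesh n) z.1 | z <- (fset_set (pts eta) : seq E)].
have sP (i : int * int) : i \in s -> exists2 z, pts eta z & grid (mesh n) z.1 = i.
  by move=> /mapP[z]; rewrite in_fset_set// => /set_mem ez ->; exists z.
exists (n, s); split.
  apply: config_eq; apply/seteqP; split => w.
    move=> [pw [[/= kw /sP[z ez zw]] _]]; apply: contrapT => nw.
    have zw1 : z.1 <> w.1.
      by move=> e; apply: nw; rewrite -(sphi z w (ephi _ ez) pw Logic.I Logic.I e).
    by apply: (nP z w) => //; left.
  move=> ew; split; first exact: ephi.
  split => //; split; first by have [] := ek _ ew.
  by apply/mapP; exists w => //; rewrite in_fset_set// mem_set.
apply: notin_vacant => w cw [/= kw /sP[z ez zw]].
by apply: (nP z w) => //; [right|move=> e; apply: (ce w z) => //].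
Qed.

Lemma halo0E eta x : halo 0 eta x <-> exists2 w, pts eta w & w.1 = x.
Proof.
split; first by move=> [w ew /eball0 <-]; exists w.
by move=> [w ew <-]; exists w => //; exact: eballxx.
Qed.

Lemma halo0_null eta : finite_config eta ->
  measurable (halo 0 eta) /\ lebesgue2 (halo 0 eta) = 0%E.
Proof.
move=> fe; have mh : measurable (halo 0 eta).
  by apply: fin_bigcup_measurable => // z _; exact: measurable_eball.
split => //; apply/eqP; rewrite eq_le measure_ge0 andbT.
apply: (@le_trans _ _ (\sum_(z \in pts eta) lebesgue2 (eball z.1 0))%E).
  by apply: content_sub_fsum => // z _; exact: measurable_eball.
rewrite fsbig1// => z _; apply: (@subset_measure0 _ _ _ _ _ ([set z.1.1] `*` setT)).
- exact: measurable_eball.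
- exact: measurableX.
- by move=> x /eball0 <-.
- exact: lebesgue2_column.
Qed.

Lemma vacant_halo0 eta chi : finite_config eta -> finite_config chi ->
  vacant (halo 0 eta) chi <-> (forall z w, pts chi z -> pts eta w -> z.1 <> w.1).
Proof.
move=> fe fc; split.
  move=> v0 z w cz ew e; have [mh _] := halo0_null fe.
  have bh : bounded_borel (halo 0 eta).
    split => //; move: fe; rewrite finite_configE => -[n _ h]; exists n%:R.
    by move=> x /halo0E[w' /h[] + _ <-].
  by apply: (vacant_notin bh v0 cz); apply/halo0E; exists w.
by move=> h; apply: notin_vacant => z cz /halo0E[w ew] e; exact: h cz ew (esym e).
Qed.

Lemma bounded_halo0 eta : finite_config eta -> bounded_borel (halo 0 eta).
Proof.
move=> fe; split; first by have [] := halo0_null fe.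
move: fe; rewrite finite_configE => -[n _ h]; exists n%:R.
by move=> x /halo0E[w' /h[] + _ <-].
Qed.

Lemma Q_avoids W eta : bounded_borel W -> finite_config eta ->
  {ae Q W, forall chi, vacant (halo 0 eta) chi}.
Proof.
move=> bW fe; have [mh h0] := halo0_null fe; have bh := bounded_halo0 fe.
have bhw : bounded_window (halo 0 eta `*` [set: M]) by exact: bounded_windowX.
exists (~` vacant (halo 0 eta)); split => //.
  by apply: measurableC; exact: measurable_vacant.
apply: probability_setC0; first exact: measurable_vacant.
rewrite /vacant (poisson_one 0 (Q_poisson bW) bhw) /rate.
have -> : intensity lm (halo 0 eta `*` [set: M] `&` W `*` [set: M]) = 0%E.
  apply: (intensity_null _ mh _ h0); last exact: subIsetl.
  apply: measurableI; first by case: bhw.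
  by apply: measurableX => //; case: bW.
by rewrite poisson_weight0.
Qed.

Local Open Scope ereal_scope.

(** The points added in a window interact with a finite part of the typical
    configuration only through the points in their halo. The countably many
    patches carry the almost sure locality to all finite parts at once. *)
Lemma finite_locality : {ae P, forall phi, forall k eta, pts eta `<=` pts phi ->
  configs_in (window_ball k) eta ->
  {ae Q (window_ball k), forall chi,
     (V (cunion chi eta) - V eta =
      V (cunion chi (restr (halo D chi) eta)) - V (restr (halo D chi) eta))%R}}.
Proof.
have H : {ae P, forall phi, forall k, forall c : nat * seq (int * int),
    {ae Q (window_ball k), forall chi,
      let L := window_ball k `\` patch k c in
      let xi := splice L chi (restr (window_ball k) phi) in
      expR (- (V (restr (window_ball k) xi) - V (restr (window_ball k `\` L) xi))) =
      weight L xi xi}}.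
  apply/ae_foralln => k.
  suff H : {ae P, forall phi, forall j : nat, forall c : nat * seq (int * int),
      choice.unpickle j = Some c ->
    {ae Q (window_ball k), forall chi,
      let L := window_ball k `\` patch k c in
      let xi := splice L chi (restr (window_ball k) phi) in
      expR (- (V (restr (window_ball k) xi) - V (restr (window_ball k `\` L) xi))) =
      weight L xi xi}}.
    by apply: filterS H => phi h c; apply: (h (choice.pickle c)); rewrite choice.pickleK.
  apply/ae_foralln => j.
  case: (choice.unpickle j : option (nat * seq (int * int))) => [c|]; last exact: aeW.
  set L := window_ball k `\` patch k c.
  have bW := bounded_ball k.
  have LW : L `<=` window_ball k by exact: subDsetl.
  have mL : measurable L by apply: measurableD; [case: bW|case: (bounded_patch k c)].
  have bL : bounded_borel L by rewrite -(setIidr LW); exact: bounded_borelI.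
  have h := P_ae_restr bW (poisson_ae_splice bL bW (ae_local bW mL LW)).
  by apply: filterS h => phi h c' [<-].
apply: filterS2 P_simple H => phi sphi h k eta ephi ek.
have fe : finite_config eta := finite_in_bounded (bounded_ball k) ek.
have h' : {ae Q (window_ball k), forall chi, forall c : nat * seq (int * int),
      let L := window_ball k `\` patch k c in
      let xi := splice L chi (restr (window_ball k) phi) in
      expR (- (V (restr (window_ball k) xi) - V (restr (window_ball k `\` L) xi))) =
      weight L xi xi}.
  suff H2 : {ae Q (window_ball k), forall chi, forall j : nat, forall c : nat * seq (int * int),
      choice.unpickle j = Some c ->
      let L := window_ball k `\` patch k c in
      let xi := splice L chi (restr (window_ball k) phi) in
      expR (- (V (restr (window_ball k) xi) - V (restr (window_ball k `\` L) xi))) =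
      weight L xi xi}.
    by apply: filterS H2 => chi h2 c; apply: (h2 (choice.pickle c)); rewrite choice.pickleK.
  apply/ae_foralln => j.
  case: (choice.unpickle j : option (nat * seq (int * int))) => [c|]; last exact: aeW.
  by apply: filterS (h k c) => chi hc c' [<-].
apply: filterS3 h' (ae_configs_in (bounded_ball k)) (Q_avoids (bounded_ball k) fe).
move=> chi {}h ck va.
have fc := finite_in_bounded (bounded_ball k) ck.
have ce := (vacant_halo0 fe fc).1 va.
have [c [re vc]] := isolate sphi ephi ek ck ce.
have bp := bounded_patch k c.
have := h c; set L := window_ball k `\` patch k c.
have pW : patch k c `<=` window_ball k by exact: subIsetl.
have chiL : restr L chi = chi.
  apply: restr_id => z cz; split => //; split; first by have [] := ck _ cz.
  exact: (vacant_notin bp vc cz).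
have phiL : restr (~` L) (restr (window_ball k) phi) = eta.
  rewrite restrI -re; congr restr; rewrite /L setDE setCI setCK setIUl setIC setICr set0U.
  by rewrite setIidl.
have xiE : splice L chi (restr (window_ball k) phi) = cunion chi eta.
  by rewrite /splice chiL phiL.
rewrite /= xiE.
have e1 : restr (window_ball k) (cunion chi eta) = cunion chi eta.
  by apply: restr_id => z [/ck|/ek].
have eta_out : restr (~` L) (cunion chi eta) = eta.
  by rewrite -xiE restrC_splice phiL.
have chi_in : restr L (cunion chi eta) = chi by rewrite -xiE restr_splice chiL.
have e2 : restr (window_ball k `\` L) (cunion chi eta) = eta.
  rewrite -{2}eta_out -{2}e1 restrI; congr restr; by rewrite setDE setIC.
rewrite e1 e2 /weight /env chi_in eta_out => /expR_inj/oppr_inj.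
by [].
Qed.

Implicit Types (j : nat).

(** * Admissibility of the finite parts *)

Lemma integral_gt0_prob (m : probability C R) (f : C -> \bar R) :
  measurable_fun setT f -> (forall phi, 0 < f phi) -> 0 < \int[m]_phi f phi.
Proof.
move=> mf f0; have f00 phi : 0 <= f phi by exact: ltW.
rewrite lt0e integral_ge0// andbT; apply/negP => /eqP i0.
have [x fx0] := ae_exists (ge0_integral_ae0 mf f00 i0).
by have := f0 x; rewrite fx0 ltxx.
Qed.

Lemma thetastar_Theta : Theta thetastar.
Proof. exact: interior_subset. Qed.

Lemma translate_restr a L phi :
  restr L (translate a phi) = translate a (restr (shift a @^-1` L) phi).
Proof.
apply: config_eq; apply/seteqP; split => z.
  by move=> [[w pw <-] [/= Lw _]]; exists w.
by move=> [w [pw [/= Lw _]] <-]; split => //; exists w.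
Qed.

Lemma translate_cunion a phi psi :
  translate a (cunion phi psi) = cunion (translate a phi) (translate a psi).
Proof. by apply: config_eq; rewrite /= image_setU. Qed.

Lemma shiftK (a : plane R) : cancel (shift a) (shift ((- (a.1 : R), - (a.2 : R))%R : plane R)).
Proof. by move=> [x y]; rewrite /shift/= !addrK. Qed.

Lemma eball_shiftE (a x y : plane R) (r : R) :
  eball (shift a x) r (shift a y) = eball x r y.
Proof.
have e (b c d' : R) : (b + c - (d' + c) = b - d')%R by ring.
by rewrite /eball /shift/= !e.
Qed.

Lemma halo_translate a (r : R) psi x :
  halo r (translate a psi) (shift a x) <-> halo r psi x.
Proof.
split=> [[_ [z pz <-] /=]|[z pz zx]]; first by rewrite eball_shiftE => h; exists z.
by exists (mshift a z); [exists z|rewrite /= eball_shiftE].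
Qed.

Lemma translate_overlay a psi phi :
  translate a (overlay psi phi) = overlay (translate a psi) (translate a phi).
Proof.
rewrite /overlay translate_cunion; congr cunion; rewrite translate_restr; congr translate.
congr (restr _ _); apply/seteqP; split => x /= h hx; apply: h; by move: hx; rewrite halo_translate.
Qed.

Lemma finite_translate a phi : finite_config phi -> finite_config (translate a phi).
Proof. by move=> fp; exact: finite_image. Qed.

Lemma V_translate a phi : finite_config phi -> V (translate a phi) = V phi.
Proof. by move=> fp; apply: v_invariant => //; exact: thetastar_Theta. Qed.

Lemma finite_overlay psi phi : finite_config psi -> finite_config phi ->
  finite_config (overlay psi phi).
Proof. by move=> fp fq; apply: finite_cunion => //; exact: finite_restr'. Qed.

Lemma overlay_disjoint eta chi :
  (forall z w, pts chi z -> pts eta w -> z.1 <> w.1) -> overlay eta chi = cunion eta chi.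
Proof.
move=> h; rewrite /overlay restr_id// => z cz; split => //.
by move=> /halo0E[w ew] e; exact: h cz ew (esym e).
Qed.

(** The partition function with boundary condition [eta], up to the factor
    [expR (V eta)]; unlike it, this quantity makes no difference between
    the points of [eta] that lie inside and outside [L]. *)
Definition total_weight L eta : \bar R :=
  \int[Q L]_chi (expR (- V (overlay eta (restr L chi))))%:E.

Lemma measurable_total_weight_integrand d (T : measurableType d) (f g : T -> C) L :
  bounded_borel L -> measurable_fun setT f -> (forall t, finite_config (f t)) ->
  measurable_fun setT g ->
  measurable_fun setT (fun t => (expR (- V (overlay (f t) (restr L (g t)))))%:E).
Proof.
move=> bL mf ff mg; have [mL _] := bL; apply/measurable_EFinP.
have mV : measurable_fun setT (fun t => V (overlay (f t) (restr L (g t))) : measurableTypeR R).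
  apply: measurable_energy.
    by apply: measurable_overlay => //; exact: (measurableT_comp (measurable_restr mL)).
  by move=> t; apply: finite_overlay => //; exact: finite_restr.
apply: (measurableT_comp (@measurable_expR R)); exact: measurable_funN.
Qed.

Lemma total_weight_sub W L eta : bounded_borel W -> measurable L -> L `<=` W ->
  finite_config eta -> total_weight W eta < +oo -> total_weight L eta < +oo.
Proof.
move=> bW mL LW fe; apply: contraTT; rewrite -!leNgt !leye_eq => /eqP tL.
have bL : bounded_borel L by rewrite -(setIidr LW); apply: bounded_borelI.
have bD : bounded_borel (W `\` L) by exact: bounded_borelD.
have mF : measurable_fun setT (fun chi => (expR (- V (overlay eta (restr L chi))))%:E).
  exact: measurable_total_weight_integrand.
have mG : measurable_fun setT (fun chi => (expR (- V (overlay eta (restr W chi))))%:E).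
  exact: measurable_total_weight_integrand.
have F0 chi : 0 <= (expR (- V (overlay eta (restr L chi))))%:E by rewrite lee_fin expR_ge0.
have := poisson_vacant_integral bW mL LW (Q_poisson bW) (Q_poisson bL) mF F0.
rewrite [X in _ * X](_ : _ = +oo); last exact: tL.
rewrite gt0_muley; last exact: (poisson_vacant_gt0 bD (Q_poisson bW)).
move=> e; rewrite -leye_eq -e; apply: ge0_le_integral => //.
- apply: emeasurable_funM => //; apply/measurable_EFinP; apply: measurable_indic.
  exact: measurable_vacant.
move=> chi _; rewrite indicE; have [/set_mem vc|_] := boolP (chi \in _); last first.
  by rewrite mul0e lee_fin expR_ge0.
rewrite mul1e (_ : restr L chi = restr W chi)//.
apply: config_eq; apply/seteqP; split => z [cz [zL _]]; split => //; split => //.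
  exact: LW.
by apply: contrapT => nL; apply: (vacant_notin bD vc cz).
Qed.

Lemma bounded_preshift a L : bounded_borel L -> bounded_borel (shift a @^-1` L).
Proof.
move=> [mL [r Lr]]; split.
  by rewrite -[X in measurable X]setTI; exact: measurable_shift.
by exists (r + (`|a.1 : R| + `|a.2 : R|))%R => x /Lr; exact: eball_shift.
Qed.

Lemma total_weight_translate a L eta : bounded_borel L -> finite_config eta ->
  total_weight L (translate a eta) = total_weight (shift a @^-1` L) eta.
Proof.
move=> bL fe; have bL' := bounded_preshift a bL; have [mL _] := bL.
rewrite /total_weight.
rewrite (ge0_integral_law (measurable_translate a)
  (fun X mX => esym (poisson_translate (fun x => iff_refl _) mL (Q_poisson bL') (Q_poisson bL) mX))).
- apply: eq_integral => chi _ /=; rewrite translate_restr -translate_overlay V_translate//.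
  by apply: finite_overlay => //; exact: finite_restr.
- apply: measurable_total_weight_integrand => // _; exact: finite_translate.
- by move=> chi; rewrite lee_fin expR_ge0.
Qed.

(** Finite parts with finite partition functions, in the sense that
    survives translations and the removal of points. *)
Definition tame phi := forall eta, finite_config eta -> pts eta `<=` pts phi ->
  forall L, bounded_borel L -> total_weight L eta < +oo.

Lemma tame_sub phi psi : pts psi `<=` pts phi -> tame phi -> tame psi.
Proof. by move=> pp tp eta fe ep; apply: tp => //; exact: subset_trans pp. Qed.

Lemma translateKV a phi : translate a (translate ((- (a.1 : R), - (a.2 : R))%R : plane R) phi) = phi.
Proof.
rewrite translate_comp -[RHS]translate0; congr translate.
by rewrite /shift/= !addNr.
Qed.

Lemma tame_translate a phi : tame phi -> tame (translate a phi).
Proof.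
move=> tp eta fe ep L bL; rewrite -(translateKV a eta) total_weight_translate//; last first.
  exact: finite_translate.
apply: tp; last exact: bounded_preshift.
  exact: finite_translate.
by move=> _ [w /ep + <-] => -[z pz <-]; move: pz; case: z => -[z1 z2] m; rewrite /mshift /shift/= !addrK.
Qed.

Lemma tame_admissible phi : tame phi -> finite_config phi -> Adm phi.
Proof.
move=> tp fp L bL; have [mL _] := bL; rewrite /regular/=.
set eta := restr (~` L) phi.
have fe : finite_config eta by exact: finite_restr'.
have tL : total_weight L eta < +oo by apply: tp => //; exact: subIsetl.
have mi : measurable_fun setT (fun chi => (expR (- V (overlay eta (restr L chi))))%:E).
  exact: measurable_total_weight_integrand.
have i0 chi : 0 < (expR (- V (overlay eta (restr L chi))))%:E by rewrite lte_fin expR_gt0.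
have -> : partition_function v Q D thetastar L phi = (expR (V eta))%:E * total_weight L eta.
  rewrite -ge0_integralZl_EFin// ?expR_ge0//.
  apply: integral_configs_in => //.
  - by apply: emeasurable_funM.
  move=> chi cc; rewrite -EFinM -expRD /boltzmann -/eta restr_id//.
  have -> : overlay eta chi = cunion chi eta.
    rewrite overlay_disjoint; last first.
      by move=> z w cz [_ [nL _]] e; apply: nL; rewrite -e; have [] := cc _ cz.
    by apply: config_eq; rewrite /= setUC.
  rewrite /energy_given /local_energy /visible asboolT//.
  by rewrite opprB.
apply/andP; split; first by rewrite mule_gt0 ?lte_fin ?expR_gt0// integral_gt0_prob.
have : total_weight L eta \is a fin_num by rewrite ge0_fin_numE// integral_ge0// => chi _; exact: ltW.
by move=> /fineK <-; rewrite -EFinM ltry.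
Qed.

Lemma poisson_law_off_points W eta : bounded_borel W -> finite_config eta ->
  poisson_law lm W (Q (W `\` halo 0 eta)).
Proof.
move=> bW fe; have [mh h0] := halo0_null fe; have [mW _] := bW.
have bD : bounded_borel (W `\` halo 0 eta) by exact: bounded_borelD.
move=> n B k mB bB tB /=; rewrite (Q_poisson bD k mB bB tB)/=.
congr (_%:E); apply: eq_bigr => i _.
have -> // : intensity lm (B i `&` (W `\` halo 0 eta) `*` [set: M]) =
             intensity lm (B i `&` W `*` [set: M]).
have -> : B i `&` W `*` [set: M] = (B i `&` (W `\` halo 0 eta) `*` [set: M]) `|`
     (B i `&` (W `&` halo 0 eta) `*` [set: M]).
  apply/seteqP; split => z; last by move=> [[? [[]]]|[? [[]]]].
  move=> [Bz [/= Wz _]]; have [hz|hz] := pselect (halo 0 eta z.1); [by right|by left].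
rewrite measureU0//.
- apply: measurableI => //; apply: measurableX => //; exact: measurableD.
- apply: measurableI => //; apply: measurableX => //; exact: measurableI.
apply: (intensity_null _ mh _ h0); last by move=> z [_ [[]]].
apply: measurableI => //; apply: measurableX => //; exact: measurableI.
Qed.

(** Along an admissible configuration of the support of [P], finite parts
    are admissible: take a large window, with the places of [eta] removed.
    The partition function is finite there, and it dominates the
    contribution of the configurations that leave empty the surroundings of
    a smaller window. By almost sure locality, those see nothing but [eta]. *)
Lemma Adm_tame : {ae P, forall phi, Adm phi -> tame phi}.
Proof.
apply: filterS3 P_infinite P_simple finite_locality => phi ip sphi loc adm eta fe ep L bL.
have [k0 ek0] : exists k, configs_in (window_ball k) eta.
  by move: (fe); rewrite finite_configE => -[k _ h]; exists k.
have [k1 Lk1] := bounded_sub_ball bL.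
pose k := maxn k0 k1.
have ek : configs_in (window_ball k) eta.
  by move=> z /ek0[zk _]; split => //; apply: ball_le zk; rewrite leq_maxl.
have Lk : L `<=` window_ball k by apply: subset_trans Lk1 (ball_le _); rewrite leq_maxr.
apply: (total_weight_sub (bounded_ball k) _ Lk fe); first by case: bL.
have bk := bounded_ball k; have [mk _] := bk.
have [n [kn hn]] := halo_in_ball bk; have bn := bounded_ball n.
have [mh h0] := halo0_null fe; pose Lam := window_ball n `\` halo 0 eta.
have bLam : bounded_borel Lam by exact: bounded_borelD.
have bD : bounded_borel (window_ball n `\` window_ball k) by exact: bounded_borelD.
have ZLam : Zpart Lam phi < +oo.
  by have /andP[_] := adm _ bLam; rewrite partition_functionE//; left.
have mw : measurable_fun setT (fun chi => (weight Lam phi chi)%:E).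
  by apply/measurable_EFinP; exact: measurable_weight.
have w0 chi : 0 <= (weight Lam phi chi)%:E by rewrite lee_fin ltW// weight_gt0.
have law := poisson_law_off_points bn fe.
have := poisson_vacant_integral bn mk kn law (Q_poisson bk) mw w0.
rewrite -/Lam => vE.
have Iw : \int[Q (window_ball k)]_chi (weight Lam phi chi)%:E < +oo.
  rewrite ltNge leye_eq; apply/negP => /eqP oo; move: vE.
  rewrite [X in _ * X](_ : _ = +oo); last exact: oo.
  rewrite gt0_muley; last exact: (poisson_vacant_gt0 bD law).
  apply/eqP; rewrite lt_eqF//; apply: le_lt_trans ZLam; apply: ge0_le_integral => //.
  - by move=> chi _; rewrite mule_ge0// lee_fin.
  - apply: emeasurable_funM => //; apply/measurable_EFinP; apply: measurable_indic.
    exact: measurable_vacant.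
  by move=> chi _; rewrite indicE; case: (_ \in _); rewrite ?mul1e ?mul0e.
have mi : measurable_fun setT (fun chi => (expR (- V (overlay eta (restr (window_ball k) chi))))%:E).
  exact: measurable_total_weight_integrand.
have i0 chi : 0 <= (expR (- V (overlay eta (restr (window_ball k) chi))))%:E.
  by rewrite lee_fin expR_ge0.
have : \int[Q (window_ball k)]_chi (weight Lam phi chi)%:E = (expR (V eta))%:E * total_weight (window_ball k) eta.
  rewrite -ge0_integralZl_EFin// ?expR_ge0//.
  apply: ge0_ae_eq_integral => //.
  - exact: emeasurable_funM.
  apply: filterS3 (loc k eta ep ek) (ae_configs_in bk) (Q_avoids bk fe) => chi lc ck va _.
  have fc := finite_in_bounded bk ck.
  have ce := (vacant_halo0 fe fc).1 va.
  rewrite -EFinM -expRD (restr_id ck) (overlay_disjoint ce).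
  have -> : cunion eta chi = cunion chi eta by apply: config_eq; rewrite /= setUC.
  have cL : restr Lam chi = chi.
    apply: restr_id => z cz; split => //; split; first by have [/kn] := ck _ cz.
    by move=> /halo0E[w ew] e; exact: ce cz ew (esym e).
  have eE : env Lam phi chi = restr (halo D chi) eta.
    rewrite /env cL; apply: config_eq; apply/seteqP; split => z.
      move=> [[pz [nL _]] [hz _]]; split => //; apply: contrapT => nz; apply: nL; split.
        exact: (hn _ ck).
      move=> /halo0E[w ew] e; apply: nz.
      by rewrite -(sphi w z (ep _ ew) pz Logic.I Logic.I e).
    move=> [ez [hz _]]; split => //; split; first exact: ep.
    by split => // -[_]; apply; apply/halo0E; exists z.
  by rewrite /weight cL eE -lc; congr (expR _)%:E; ring.
move=> e; move: Iw; rewrite e; apply: contraTT; rewrite -!leNgt !leye_eq => /eqP ->.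
by rewrite gt0_muley// lte_fin expR_gt0.
Qed.

(** Identifiability provides a set of positive probability of admissible
    configurations. *)
Lemma Adm_exists (A : C -> Prop) : {ae P, forall phi, A phi} -> exists2 phi, Adm phi & A phi.
Proof.
move=> hA; case: Ident => l [B [Bm [pl hB _ pos _]]].
have l0 : (0 < l)%N by exact: leq_trans pl.
pose i := Ordinal l0; have [mB BA mBm] := hB i.
apply: contrapT => none; have PB : P (B i) = 0.
  apply: measure_negligible => //; apply: negligibleS hA => phi Bp /= Ap.
  by apply: none; exists phi => //; exact: BA.
by have := pos i; rewrite product_measure1E// [X in _ * X]PB mule0 ltxx.
Qed.

Lemma measurable_restr_total_weight L U : bounded_borel L -> bounded_borel U ->
  measurable_fun setT (fun phi => total_weight L (restr U phi)).
Proof.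
move=> bL bU; apply: (measurable_fun_fubini_tonelli_F (fun u : C * C =>
   (expR (- V (overlay (restr U u.1) (restr L u.2))))%:E)).
- apply: measurable_total_weight_integrand => //.
    by apply: measurableT_comp => //; apply: measurable_restr; case: bU.
  by move=> u; exact: finite_restr.
- by move=> u; rewrite lee_fin expR_ge0.
Qed.

(** Suppose that the part seen in [U] could fail to be tame. By recurrence,
    almost surely such a failure would then be seen again in translated
    windows. But an admissible configuration shows no failure, and
    resampling the window [U] only leaves the translated windows unchanged:
    failures in [U] have probability zero under the Poisson law of [U],
    hence under [P]. *)
Lemma patch_tame U : bounded_borel U ->
  {ae P, forall phi, forall n, total_weight (window_ball n) (restr U phi) < +oo}.
Proof.
move=> bU; have [mU _] := bU; have [k Uk] := bounded_sub_ball bU.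
pose B : set C := [set phi | exists n, total_weight (window_ball n) (restr U phi) = +oo].
have mB : measurable B.
  rewrite (_ : B = \bigcup_n ((fun phi => total_weight (window_ball n) (restr U phi)) @^-1` [set +oo])).
    apply: bigcupT_measurable => n; rewrite -[X in measurable X]setTI.
    by apply: measurable_restr_total_weight => //; exact: bounded_ball.
  by apply/seteqP; split => phi; [move=> [n h]; exists n|move=> [n _ h]; exists n].
have BU phi psi : restr U phi = restr U psi -> B phi -> B psi by rewrite /B/= => ->.
suff : {ae P, forall phi, ~ B phi}.
  apply: filterS => phi nB n; rewrite ltNge leye_eq; apply/negP => /eqP oo.
  by apply: nB; exists n.
pose s : R := (2 * k.+1%:R)%R.
pose N : set C := [set phi | forall i, ~ B (slide s i.+1 phi)].
have mN : measurable N.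
  rewrite (_ : N = \bigcap_i (slide s i.+1 @^-1` (~` B))); last first.
    by apply/seteqP; split => phi h i //; [move=> _; exact: h|exact: h].
  apply: bigcapT_measurable => i; rewrite -[X in measurable X]setTI.
  by apply: measurable_slide => //; exact: measurableC.
have far i x : U (shift ((s * i.+1%:R)%R : R, 0%R : R) x) -> ~ U x.
  move=> /Uk/eball_box[/= + _] /Uk/eball_box[/= + _].
  rewrite !in_itv/= /s => /andP[_ h1] /andP[h2 _].
  have i1 : (1 <= i.+1%:R :> R)%R by rewrite ler1n.
  have k0 : (0 <= k%:R :> R)%R by [].
  move: h1 h2; rewrite !add0r => h1 h2.
  have : (2 * k.+1%:R <= 2 * k.+1%:R * i.+1%:R :> R)%R by rewrite ler_peMr.
  by rewrite -[k.+1]addn1 natrD; lra.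
have NU phi psi : restr (~` U) phi = restr (~` U) psi -> N phi -> N psi.
  move=> e Np i; apply: contra_not (Np i); apply: BU.
  rewrite /slide !translate_restr; congr translate.
  have sU : shift ((s * i.+1%:R)%R : R, 0%R : R) @^-1` U `<=` ~` U by move=> x; exact: far.
  by rewrite -(restrK _ sU) -[in RHS](restrK _ sU) e.
have null : P (B `&` N) = 0 by exact: last_visit_null.
have [phi adm [h tp]] := Adm_exists (filterI (dlr_null bU (measurableI _ _ mB mN) null) Adm_tame).
have Np : N phi.
  move=> i [n oo]; have := tame_translate (a := ((s * i.+1%:R)%R : R, 0%R : R)) (tp adm).
  move=> /(_ (restr U (slide s i.+1 phi)) (finite_restr _ bU) (@subIsetl _ _ _) _ (bounded_ball n)).
  by rewrite oo.
have : {ae Q U, forall psi, ~ B psi}.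
  apply: filterS h => psi nBN Bs; apply: nBN; split.
    by apply: BU Bs; rewrite restr_splice.
  by apply: NU Np; rewrite restrC_splice.
move=> /(P_ae_restr bU); apply: filterS => psi nB Bp; apply: nB.
by apply: BU Bp; rewrite restrI setIid.
Qed.

(** Almost surely, every finite part is isolated by one of the countably
    many patches, and is therefore admissible. *)
Lemma P_tame : {ae P, forall phi, tame phi}.
Proof.
have : {ae P, forall phi, forall k, forall j, forall c : nat * seq (int * int),
    choice.unpickle j = Some c ->
    forall n, total_weight (window_ball n) (restr (patch k c) phi) < +oo}.
  apply/ae_foralln => k; apply/ae_foralln => j.
  case: (choice.unpickle j : option (nat * seq (int * int))) => [c|]; last exact: aeW.
  by apply: filterS (patch_tame (bounded_patch k c)) => phi h c' [<-].
apply: filterS2 P_simple => phi sphi h eta fe ep L bL.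
have [k ek] : exists k, configs_in (window_ball k) eta.
  by move: (fe); rewrite finite_configE => -[k _ h']; exists k.
have [n Ln] := bounded_sub_ball bL.
have e0 : configs_in (window_ball k) (cempty : C) by [].
have [//|c [re _]] := isolate (chi := cempty) sphi ep ek e0.
apply: (total_weight_sub (bounded_ball n) _ Ln fe); first by case: bL.
by rewrite -re; apply: (h k (choice.pickle c)); rewrite choice.pickleK.
Qed.

Local Close Scope ereal_scope.
Implicit Types (theta delta : 'rV[R]_p) (i : 'I_p).

(** * Increments of the energy *)

Lemma Theta_directions : exists2 e : R, 0 < e &
  forall i (s : R), `|s| <= e -> Theta (thetastar + s *: delta_mx ord0 i).
Proof.
have /nbhs_ballP[e /= e0 eT] := thetastar_interior.
exists (e / 2); first by rewrite divr_gt0.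
move=> i s se; apply: eT; rewrite -ball_normE/= opprD addrA subrr sub0r normrN.
apply: (@le_lt_trans _ _ `|s|); last by apply: le_lt_trans se _; rewrite ltr_pdivrMr// ltr_pMr// ltr1n.
rewrite [leLHS]mx_normrE; apply/bigmax_leP; split => // -[j k] _ /=.
by rewrite !mxE; case: (_ && _); rewrite ?mulr1 ?mulr0// normr0.
Qed.

Let eps : R := sval (cid2 Theta_directions).

Let eps_gt0 : 0 < eps. Proof. exact: (s2valP (cid2 Theta_directions)). Qed.

Let eps_Theta i s : `|s| <= eps -> Theta (thetastar + s *: delta_mx ord0 i).
Proof. exact: (s2valP' (cid2 Theta_directions)). Qed.

Definition dot delta (a : 'rV[R]_p) : R := \sum_(i < p) delta ord0 i * a ord0 i.

Lemma dot_direction i s a :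
  dot (thetastar + s *: delta_mx ord0 i) a = dot thetastar a + s * a ord0 i.
Proof.
rewrite /dot; under eq_bigr do rewrite !mxE mulrDl.
rewrite big_split/=; congr (_ + _); rewrite (bigD1 i)//= eqxx/= mulr1 big1 ?addr0// => j ji.
by rewrite (negbTE ji) mulr0 mul0r.
Qed.

(** The parameter set has an interior point, so that linear forms that
    agree on it are equal. *)
Lemma Theta_separates a b : (forall theta, Theta theta -> dot theta a = dot theta b) -> a = b.
Proof.
move=> h; apply/rowP => i; apply: (mulfI (lt0r_neq0 eps_gt0)).
apply: (@addrI _ (dot thetastar a)); rewrite -dot_direction.
rewrite [in RHS](h _ thetastar_Theta) -dot_direction; apply: h.
by apply: eps_Theta; rewrite ger0_norm// ltW.
Qed.

Lemma energyE theta phi : energy v theta phi = dot theta (v phi). Proof. by []. Qed.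

Lemma dotB delta a b : dot delta (a - b) = dot delta a - dot delta b.
Proof. by rewrite /dot -sumrB; apply: eq_bigr => i _; rewrite !mxE mulrBr. Qed.

Lemma local_energyE theta psi phi :
  local_energy v theta psi phi = dot theta (local_stat v psi phi).
Proof. by rewrite /local_energy !energyE -dotB. Qed.

Lemma v_translate a phi : finite_config phi -> v (translate a phi) = v phi.
Proof.
move=> fp; apply: Theta_separates => theta tT.
by rewrite -!energyE; apply: v_invariant.
Qed.

Lemma local_stat_translate a psi phi : finite_config psi -> finite_config phi ->
  local_stat v (translate a psi) (translate a phi) = local_stat v psi phi.
Proof.
move=> fq fp; rewrite /local_stat -translate_cunion !v_translate//.
exact: finite_cunion.
Qed.

Lemma translate_csingle a z : translate a (csingle z) = csingle (mshift a z).
Proof. by apply: config_eq; rewrite /= image_set1. Qed.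

Lemma halo_csingle (r : R) z : halo r (csingle z) = eball z.1 r.
Proof. by rewrite /halo /= bigcup_set1. Qed.

Definition to_origin z : plane R := (- (z.1.1 : R), - (z.1.2 : R)).

Lemma mshift_to_origin z : mshift (to_origin z) z = (origin, z.2).
Proof. by case: z => -[x y] m; rewrite /mshift /shift /to_origin/= !subrr. Qed.

Lemma shift_to_origin z : shift (to_origin z) z.1 = origin.
Proof. by rewrite /shift /to_origin/= !subrr. Qed.

Lemma finite_csingle z : finite_config (csingle z).
Proof. exact: finite_set1. Qed.

(** Stability and locality are moved from the origin to any place by
    translation invariance. *)
Lemma tame_stable theta z eta : Theta theta -> finite_config eta -> tame eta ->
  - K <= dot theta (local_stat v (csingle z) eta).
Proof.
move=> tT fe te; rewrite -(local_stat_translate (to_origin z) (finite_csingle z) fe).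
rewrite translate_csingle mshift_to_origin -local_energyE; apply: stability => //.
  by apply: tame_admissible; [exact: tame_translate|exact: finite_translate].
exact: finite_translate.
Qed.

Lemma tame_local z eta : finite_config eta -> tame eta ->
  local_stat v (csingle z) eta = local_stat v (csingle z) (restr (eball z.1 D) eta).
Proof.
move=> fe te; apply: Theta_separates => theta tT.
rewrite -(local_stat_translate (to_origin z) (finite_csingle z) fe).
rewrite -[in RHS](local_stat_translate (to_origin z) (finite_csingle z)); last exact: finite_restr'.
rewrite translate_csingle mshift_to_origin -!local_energyE.
have -> : translate (to_origin z) (restr (eball z.1 D) eta) =
          restr (eball origin D) (translate (to_origin z) eta).
  rewrite translate_restr; congr (translate _ (restr _ _)).
  apply/seteqP; split => x /=; by rewrite -(shift_to_origin z) eball_shiftE.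
apply: locality => //.
  by apply: tame_admissible; [exact: tame_translate|exact: finite_translate].
exact: finite_translate.
Qed.

Lemma V_csingle z eta : V (cunion (csingle z) eta) = V eta + dot thetastar (local_stat v (csingle z) eta).
Proof. by rewrite -local_energyE /local_energy /V addrC subrK. Qed.

Definition cseq (s : seq E) : C := foldr (fun z c => cunion (csingle z) c) cempty s.

Lemma pts_cseq s : pts (cseq s) = [set` s].
Proof.
elim: s => [|z s ih] /=; first by apply/seteqP; split.
by rewrite ih; apply/seteqP; split => w /=; rewrite inE; [move=> [->|->]; rewrite ?eqxx ?orbT|move=> /orP[/eqP|]; [left|right]].
Qed.

Lemma finite_cseq s : finite_config (cseq s).
Proof. by rewrite /finite_config/= pts_cseq; exact: finite_seq. Qed.

Lemma cseqE phi : finite_config phi -> phi = cseq (fset_set (pts phi)).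
Proof.
move=> fp; apply: config_eq; rewrite pts_cseq; apply/seteqP; split => z /=.
  by move=> pz; rewrite in_fset_set// mem_set.
by rewrite in_fset_set// => /set_mem.
Qed.

Lemma cunionA phi psi chi : cunion phi (cunion psi chi) = cunion (cunion phi psi) chi.
Proof. by apply: config_eq; rewrite /= setUA. Qed.

Lemma restr_cunion L phi psi : restr L (cunion phi psi) = cunion (restr L phi) (restr L psi).
Proof. by apply: config_eq; rewrite /= setIUl. Qed.

(** A group of points interacts with the rest through its halo: its points
    are added one at a time. *)
Lemma tame_locality alpha beta : finite_config alpha -> finite_config beta ->
  tame (cunion alpha beta) ->
  V (cunion alpha beta) - V beta =
  V (cunion alpha (restr (halo D alpha) beta)) - V (restr (halo D alpha) beta).
Proof.
move=> /cseqE ->; move: (fset_set _ : seq E) => s {alpha}.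
elim: s beta => [|z s ih] beta fb; first by rewrite /= !cunion0c !subrr.
rewrite [cseq (z :: s)]/= => tb; set h := halo D _.
have hE : h = eball z.1 D `|` halo D (cseq s).
  rewrite /h /halo/= bigcup_setU bigcup_set1.
  by [].
have tb' : tame (cunion (cseq s) beta) by apply: tame_sub tb => w; case => ?; [left; right|right].
have tb2 : tame (cunion (cseq s) (restr h beta)).
  by apply: tame_sub tb' => w []; [left|move=> []; right].
have fh : finite_config (restr h beta) by exact: finite_restr'.
rewrite -!cunionA !V_csingle.
have -> : local_stat v (csingle z) (cunion (cseq s) beta) =
          local_stat v (csingle z) (cunion (cseq s) (restr h beta)).
  rewrite (tame_local _ _ tb'); last by apply: finite_cunion => //; exact: finite_cseq.
  rewrite (tame_local _ _ tb2); last by apply: finite_cunion => //; exact: finite_cseq.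
  congr (local_stat _ _ _); rewrite !restr_cunion restrI; congr (cunion _ (restr _ _)).
  by rewrite hE setIidl//; left.
have e : restr (halo D (cseq s)) (restr h beta) = restr (halo D (cseq s)) beta.
  by rewrite restrI hE setIidl//; right.
have := ih beta fb tb'; have := ih (restr h beta) fh tb2; rewrite e.
set x := V (cunion _ (restr (halo _ _) _)); set y := V (restr (halo _ _) _) => h1 h2.
set t := dot _ _; lra.
Qed.

(** Points at the location of [z] are left out, which makes the increment
    jointly measurable in [z] and [phi], even where [z] is a point of
    [phi]. *)
Definition near_pts z phi : C :=
  restr (~` halo 0 (csingle z)) (restr (halo D (csingle z)) phi).

Definition stat z phi : 'rV[R]_p := local_stat v (csingle z) (near_pts z phi).

Lemma near_ptsE z phi : near_pts z phi = restr (eball z.1 D `\` [set z.1]) phi.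
Proof.
rewrite /near_pts restrI !halo_csingle; congr restr; apply/seteqP; split => x [].
  by move=> h zx; split => // e; apply: h; rewrite e; exact: eballxx.
by move=> zx h; split => // /eball0 e; apply: h.
Qed.

Lemma near_ptsI z phi W : eball z.1 D `<=` W -> near_pts z (restr W phi) = near_pts z phi.
Proof. by move=> zW; rewrite !near_ptsE restrK// => x [/zW]. Qed.

Lemma near_pts_sub z phi : pts (near_pts z phi) `<=` pts phi.
Proof. by move=> w [[]]. Qed.

Lemma finite_near_pts z phi : finite_config (near_pts z phi).
Proof.
have [r hr] := bounded_halo (finite_csingle z).
apply: sub_finite_set (@pts_locally_finite _ _ _ phi r) => w [[pw [hw _]] _].
by split => //; split => //; exact: hr.
Qed.

Lemma stat_restr z phi W : eball z.1 D `<=` W -> stat z (restr W phi) = stat z phi.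
Proof. by move=> zW; rewrite /stat near_ptsI. Qed.

Lemma near_pts_translate a z phi :
  near_pts (mshift a z) (translate a phi) = translate a (near_pts z phi).
Proof.
rewrite !near_ptsE translate_restr; congr (translate _ (restr _ _)).
apply/seteqP; split => x; rewrite /preimage/= eball_shiftE => -[h hn]; split => //= e.
  by apply: hn; rewrite e.
by apply: hn; rewrite -(shiftK a x) e shiftK.
Qed.

Lemma stat_translate a z phi : stat (mshift a z) (translate a phi) = stat z phi.
Proof.
rewrite /stat near_pts_translate -translate_csingle local_stat_translate//.
  exact: finite_csingle.
exact: finite_near_pts.
Qed.

Lemma stat_stable theta z phi : Theta theta -> tame phi -> - K <= dot theta (stat z phi).
Proof.
move=> tT tp; apply: tame_stable => //; first exact: finite_near_pts.
by apply: tame_sub tp; exact: near_pts_sub.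
Qed.

Lemma stat_givenE z phi : ~ finite_config phi -> (forall w, pts phi w -> w.1 <> z.1) ->
  stat_given v D (csingle z) phi = stat z phi.
Proof.
move=> nf nz; rewrite /stat_given /visible asboolF// /stat near_ptsE halo_csingle.
congr (local_stat _ _ _); apply: config_eq; apply/seteqP; split => w.
  by move=> [pw [h _]]; split => //; split => //; split => //; exact: nz.
by move=> [pw [[h _] _]].
Qed.

Lemma energy_givenE theta z phi : ~ finite_config phi ->
  (forall w, pts phi w -> w.1 <> z.1) ->
  energy_given v D theta (csingle z) phi = dot theta (stat z phi).
Proof. by move=> nf nz; rewrite /energy_given local_energyE -(stat_givenE nf nz). Qed.

Lemma measurable_stat d (T : measurableType d) (f : T -> E) (g : T -> C) i :
  measurable_fun setT f -> measurable_fun setT g ->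
  measurable_fun setT (fun t => stat (f t) (g t) ord0 i : measurableTypeR R).
Proof.
move=> mf mg.
have ms : measurable_fun setT (fun t => csingle (f t)) by exact: (measurableT_comp measurable_csingle).
have mn : measurable_fun setT (fun t => near_pts (f t) (g t)).
  by apply: measurable_restr_off_halo => //; exact: measurable_restr_halo.
rewrite (_ : (fun t => _) = (fun t => v (cunion (csingle (f t)) (near_pts (f t) (g t))) ord0 i -
    v (near_pts (f t) (g t)) ord0 i)); last by apply/funext => t; rewrite /stat /local_stat !mxE.
apply: measurable_funB; last by apply: measurable_v => // t; exact: finite_near_pts.
apply: measurable_v; last first.
  by move=> t; apply: finite_cunion; [exact: finite_csingle|exact: finite_near_pts].
apply: measurable_cunion => // t; apply/seteqP; split => // w [/= -> [_ [+ _]]].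
by rewrite halo_csingle /= => h; apply: h; exact: eballxx.
Qed.

Lemma measurable_dot d (T : measurableType d) (f : T -> E) (g : T -> C) delta :
  measurable_fun setT f -> measurable_fun setT g ->
  measurable_fun setT (fun t => dot delta (stat (f t) (g t)) : measurableTypeR R).
Proof.
move=> mf mg; rewrite /dot; apply: measurable_sum => i.
by apply: measurable_funM => //; exact: measurable_stat.
Qed.

Lemma finite_localityE chi beta gamma : finite_config chi -> finite_config beta ->
  tame (cunion chi beta) -> restr (halo D chi) beta = gamma ->
  V (cunion chi beta) - V beta = V (cunion chi gamma) - V gamma.
Proof. by move=> fc fb tb <-; exact: tame_locality. Qed.

(** The point [z] interacts with all the others, inside and outside the
    window, through its own halo. *)
Lemma weight_remove L phi psi z : bounded_borel L -> tame (splice L psi phi) ->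
  simple (splice L psi phi) -> pts psi z -> L z.1 ->
  weight L phi psi = weight L phi (cremove psi z) *
    expR (- dot thetastar (stat z (cremove (splice L psi phi) z))).
Proof.
move=> bL tp sp pz Lz.
set chi := restr L psi; set beta := env L phi psi.
have fb : finite_config beta by exact: finite_env.
set chi' := restr L (cremove psi z).
have fchi' : finite_config chi' by exact: finite_restr.
have chiE : chi = cunion (csingle z) chi'.
  apply: config_eq; apply/seteqP; split => w.
    move=> [pw Lw]; have [->|wz] := eqVneq w z; first by left.
    by right; split => //; split => //= /eqP; rewrite (negbTE wz).
  by move=> [/= ->|[[pw _] Lw]].
have bsub : pts beta `<=` pts (restr (~` L) phi) by move=> w [].
have tb : tame (cunion chi beta).
  by apply: tame_sub tp => w [?|/bsub ?]; [left|right].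
have tb' : tame (cunion chi' beta).
  by apply: tame_sub tb => w []; [rewrite chiE; left; right|right].
have hsub : halo D chi' `<=` halo D chi.
  by move=> x [w cw wx]; exists w => //; rewrite chiE; right.
have eb : restr (halo D chi') beta = env L phi (cremove psi z).
  by rewrite /beta /env restrI setIidl.
have e1 : weight L phi (cremove psi z) = expR (- (V (cunion chi' beta) - V beta)).
  by rewrite (finite_localityE fchi' fb tb' eb).
rewrite e1 /weight -/chi -/beta chiE -cunionA V_csingle -expRD.
have -> : local_stat v (csingle z) (cunion chi' beta) = stat z (cremove (splice L psi phi) z).
  rewrite (tame_local _ _ tb'); last exact: finite_cunion.
  rewrite /stat near_ptsE; congr (local_stat _ _ _); apply: config_eq; apply/seteqP; split => w.
    move=> [+ [zw _]] => -[[[pw wz] [Lw _]]|[[pw [nL _]] [hw _]]].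
      split; last first.
        split => //; split => // e; apply: wz.
        by apply: (sp w z) => //; left.
      by split => //; left.
    split; first by split; [right|move=> /= e; apply: nL; rewrite e].
    by split => //; split => // e; apply: nL; rewrite /= e.
  move=> [[pw wz] [[zw nw] _]]; split => //.
  move: pw => [[pw Lw]|[pw nL]]; first by left; split => //; split.
  right; split => //; split => //; exists z => //.
by congr expR; ring.
Qed.

Local Open Scope ereal_scope.

(** * The equation of Georgii, Nguyen and Zessin *)

Lemma measurable_palm_sum (W : set E) (h : E * C -> \bar R) : bounded_window W ->
  measurable_fun setT h -> (forall u, 0 <= h u) ->
  measurable_fun setT (fun phi => \sum_(z <- listing W phi) h (z, cremove phi z)).
Proof.
move=> bW mh h0; rewrite (_ : (fun phi => _) = (fun phi => \int[palm W phi]_x h x)); last first.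
  by apply/funext => phi; rewrite integral_palm.
by apply: measurable_fun_integral_kernel => //; exact: measurable_palm.
Qed.

(** How far the energy increment is above the lower bound [- K] of the
    stability condition. *)
Definition slack (u : E * C) : R := Num.max 0%R (dot thetastar (stat u.1 u.2) + K)%R.

(** The conditional intensity of the process: [expR] of minus the energy
    increment on tame configurations, and bounded everywhere. *)
Definition cintensity (u : E * C) : R := expR (K - slack u)%R.

Lemma slack_ge0 u : (0 <= slack u)%R. Proof. by rewrite le_max lexx. Qed.

Lemma slackE z phi : tame phi -> slack (z, phi) = (dot thetastar (stat z phi) + K)%R.
Proof.
move=> tp; rewrite /slack/= max_r// -lerBlDr sub0r.
by apply: stat_stable => //; exact: thetastar_Theta.
Qed.

Lemma cintensityE z phi : tame phi -> cintensity (z, phi) = expR (- dot thetastar (stat z phi)).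
Proof. by move=> tp; rewrite /cintensity slackE//; congr expR; ring. Qed.

Lemma cintensity_ge0 u : (0 <= cintensity u)%R. Proof. exact: expR_ge0. Qed.

Lemma cintensity_le u : (cintensity u <= expR K)%R.
Proof. by rewrite ler_expR gerBl slack_ge0. Qed.

Lemma measurable_slack : measurable_fun setT (slack : E * C -> measurableTypeR R).
Proof.
apply: measurable_maxr => //; apply: measurable_funD => //.
exact: measurable_dot.
Qed.

Lemma measurable_cintensity : measurable_fun setT (cintensity : E * C -> measurableTypeR R).
Proof.
apply: (measurableT_comp (@measurable_expR R)); apply: measurable_funB => //.
exact: measurable_slack.
Qed.

Lemma slack_exp_le u : (slack u * cintensity u <= expR K)%R.
Proof.
rewrite /cintensity expRD; set t := slack u.
have t0 : (0 <= t)%R by exact: slack_ge0.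
rewrite mulrCA -[leRHS]mulr1 ler_wpM2l ?expR_ge0// expRN.
rewrite ler_pdivrMr ?expR_gt0// mul1r; apply: le_trans (expR_ge1Dx t).
by rewrite lerDr.
Qed.

Lemma slack2_exp_le u : (slack u ^+ 2 * cintensity u <= 2 * expR K)%R.
Proof.
rewrite /cintensity expRD; set t := slack u.
have t0 : (0 <= t)%R by exact: slack_ge0.
rewrite mulrCA [leRHS]mulrC ler_wpM2l ?expR_ge0// expRN.
rewrite ler_pdivrMr ?expR_gt0// mulrC -ler_pdivrMr//.
have := @expR_ge1Dxn _ t 1 t0.
rewrite /= => h; apply: le_trans h; rewrite lerDr//.
Qed.

Section gnz.
Variables (L : set (plane R)) (bL : bounded_borel L).

Let bLM : bounded_window (L `*` [set: M]). Proof. exact: bounded_windowX. Qed.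

Let mL : measurable L. Proof. by case: bL. Qed.

Definition mark_window : {measure set E -> \bar R} := window_intensity lm bLM.

Lemma listing_splice psi phi :
  listing (L `*` [set: M]) (splice L psi phi) = listing (L `*` [set: M]) psi.
Proof.
apply: eq_listing; apply/seteqP; split => z; last by move=> [pz [Lz _]]; split => //; left.
by move=> [[[pz _]|[_ [+ _]]] [/= Lz _]] => // /(_ Lz).
Qed.

Lemma cremove_splice psi phi z : L z.1 ->
  cremove (splice L psi phi) z = splice L (cremove psi z) phi.
Proof.
move=> Lz; apply: config_eq; apply/seteqP; split => w.
  by move=> [[[pw Lw]|[pw nL]] wz]; [left|right].
move=> [[[pw wz] Lw]|[pw [nL t]]]; first by split => //; left.
by split; [right|move=> /= e; apply: nL; rewrite e].
Qed.

Lemma tame_remove phi z : tame phi -> tame (cremove phi z).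
Proof. by apply: tame_sub; exact: subIsetl. Qed.

Lemma dlr_density_remove phi psi z : tame (splice L psi phi) ->
  simple (splice L psi phi) -> pts psi z -> L z.1 ->
  dlr_density L phi psi =
  (dlr_density L phi (cremove psi z) * cintensity (z, splice L (cremove psi z) phi))%R.
Proof.
move=> tp sp pz Lz; rewrite /dlr_density (weight_remove bL tp sp pz Lz) -mulrA.
by rewrite cremove_splice// cintensityE// -cremove_splice//; exact: tame_remove.
Qed.

(** The equation of Georgii, Nguyen and Zessin, for test functions weighted
    by what happens outside the window: resample the window by the DLR
    equation, apply the Slivnyak--Mecke formula to the Poisson process, and
    absorb the interaction of the marked point with the others into the
    conditional intensity. *)
Lemma gnz (h : E * C -> \bar R) (G : C -> \bar R) :
  measurable_fun setT h -> (forall u, 0 <= h u) ->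
  measurable_fun setT G -> (forall phi, 0 <= G phi) ->
  (forall phi phi', restr (~` L) phi = restr (~` L) phi' -> G phi = G phi') ->
  \int[P]_phi (G phi * \sum_(z <- listing (L `*` setT) phi) h (z, cremove phi z)) =
  \int[P]_phi (G phi * \int[mark_window]_z ((cintensity (z, phi))%:E * h (z, phi))).
Proof.
move=> mh h0 mG G0 GL.
have GE psi phi : G (splice L psi phi) = G phi by apply: GL; rewrite restrC_splice.
have mS := measurable_palm_sum bLM mh h0.
have S0 phi : 0 <= \sum_(z <- listing (L `*` setT) phi) h (z, cremove phi z).
  by rewrite sume_ge0.
have mch : measurable_fun setT (fun u : E * C => (cintensity u)%:E * h u).
  by apply: emeasurable_funM => //; apply/measurable_EFinP; exact: measurable_cintensity.
have ch0 (u : E * C) : 0 <= (cintensity u)%:E * h u by rewrite mule_ge0// lee_fin cintensity_ge0.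
have mI : measurable_fun setT (fun phi => \int[mark_window]_z ((cintensity (z, phi))%:E * h (z, phi))).
  exact: (measurable_fun_fubini_tonelli_G (m1 := window_intensity lm bLM) (fun u : E * C => (cintensity u)%:E * h u)).
have I0 phi : 0 <= \int[mark_window]_z ((cintensity (z, phi))%:E * h (z, phi)).
  by apply: integral_ge0 => z _; exact: (ch0 (z, phi)).
rewrite [LHS](dlr bL); last 2 first.
- exact: emeasurable_funM.
- by move=> phi; rewrite mule_ge0.
rewrite [RHS](dlr bL); last 2 first.
- exact: emeasurable_funM.
- by move=> phi; rewrite mule_ge0.
apply: ae_eq_integral => //.
- apply: (measurable_fun_fubini_tonelli_F (fun u : C * C => (dlr_density L u.1 u.2)%:E *
    (G (splice L u.2 u.1) * \sum_(z <- listing (L `*` setT) (splice L u.2 u.1)) h (z, cremove (splice L u.2 u.1) z)))).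
    apply: emeasurable_funM; first by apply/measurable_EFinP; exact: measurable_dlr_density.
    apply: (measurableT_comp (f := fun phi => G phi * \sum_(z <- listing (L `*` setT) phi) h (z, cremove phi z))).
      exact: emeasurable_funM.
    exact: measurable_splice.
  by move=> u; rewrite mule_ge0 ?lee_fin ?dlr_density_ge0// mule_ge0.
- apply: (measurable_fun_fubini_tonelli_F (fun u : C * C => (dlr_density L u.1 u.2)%:E *
    (G (splice L u.2 u.1) * \int[mark_window]_z ((cintensity (z, splice L u.2 u.1))%:E * h (z, splice L u.2 u.1))))).
    apply: emeasurable_funM; first by apply/measurable_EFinP; exact: measurable_dlr_density.
    apply: (measurableT_comp (f := fun phi => G phi * \int[mark_window]_z ((cintensity (z, phi))%:E * h (z, phi)))).
      exact: emeasurable_funM.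
    exact: measurable_splice.
  by move=> u; rewrite mule_ge0 ?lee_fin ?dlr_density_ge0// mule_ge0.
apply: filterS2 (dlr_ae bL P_tame) (dlr_ae bL P_simple) => phi tp sp _.
pose H (u : E * C) : \bar R := (dlr_density L phi u.2)%:E *
  (G phi * ((cintensity (u.1, splice L u.2 phi))%:E * h (u.1, splice L u.2 phi))).
have ms2 : measurable_fun setT (fun u : E * C => (u.1, splice L u.2 phi)).
  by apply: measurable_fun_pair => //; exact: measurable_splice.
have mH : measurable_fun setT H.
  apply: emeasurable_funM; first by apply/measurable_EFinP; exact: measurable_dlr_density.
  by apply: emeasurable_funM; [exact: measurable_cst|exact: (measurableT_comp mch ms2)].
have H0 u : 0 <= H u.
  by rewrite mule_ge0 ?lee_fin ?dlr_density_ge0// mule_ge0// (ch0 (u.1, _)).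
transitivity (\int[Q L]_psi \sum_(z <- listing (L `*` setT) psi) H (z, cremove psi z)).
  apply: ae_eq_integral => //.
  - apply: emeasurable_funM; first by apply/measurable_EFinP; exact: measurable_dlr_density.
    apply: (measurableT_comp (f := fun phi => G phi * \sum_(z <- listing (L `*` setT) phi) h (z, cremove phi z))).
      exact: emeasurable_funM.
    exact: measurable_splice.
  - exact: measurable_palm_sum.
  apply: filterS2 tp sp => psi tp sp _.
  rewrite GE listing_splice ge0_sume_distrr// ge0_sume_distrr; last by move=> z _; rewrite mule_ge0.
  rewrite big_seq [RHS]big_seq; apply: eq_bigr => z.
  rewrite mem_listing// => /andP[/set_mem pz /set_mem[/= Lz _]].
  rewrite (dlr_density_remove tp sp pz Lz) /H/= cremove_splice// EFinM -!muleA.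
  by congr (_ * _); rewrite muleCA.
rewrite (mecke bL (Q_poisson bL))// -/mark_window.
rewrite -[LHS]/(\int[window_intensity lm bLM]_z \int[Q L]_psi H (z, psi)).
rewrite (fubini_tonelli (m1 := window_intensity lm bLM) (m2 := Q L) H)//.
apply: eq_integral => psi _; rewrite GE.
have mc1 : measurable_fun setT (fun z : E => (cintensity (z, splice L psi phi))%:E * h (z, splice L psi phi)).
  by apply: (measurableT_comp mch).
have mc2 : measurable_fun setT (fun z : E => G phi * ((cintensity (z, splice L psi phi))%:E * h (z, splice L psi phi))).
  by apply: emeasurable_funM => //; exact: measurable_cst.
have mul (f : E -> \bar R) (k : \bar R) : measurable_fun setT f -> (forall z, 0 <= f z) -> 0 <= k ->
    \int[mark_window]_z (k * f z) = k * \int[mark_window]_z f z.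
  by move=> mf f0 k0; rewrite ge0_integralZl.
rewrite -(mul _ _ mc1 (fun z => ch0 (z, _)) (G0 phi)) -mul//.
- by move=> z; rewrite mule_ge0// (ch0 (z, _)).
- by rewrite lee_fin dlr_density_ge0.
Qed.

Local Notation count psi := (npts psi (L `*` [set: M])).

Lemma weight_vacant phi psi : vacant L psi -> weight L phi psi = 1%R.
Proof.
move=> vL; have rL0 : restr L psi = cempty.
  apply: config_eq; apply/seteqP; split => // z [pz [Lz _]].
  exact: (vacant_notin bL vL pz).
by rewrite /weight /env rL0 halo_cempty restr_set0 cunion0c subrr oppr0 expR0.
Qed.

Lemma simple_remove phi z : simple phi -> simple (cremove phi z).
Proof. by move=> sp x y [px _] [py _]; exact: sp. Qed.

Lemma count_remove psi z : pts psi z -> L z.1 -> count psi = (count (cremove psi z)).+1.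
Proof.
by move=> pz Lz; rewrite (npts_remove bLM pz) mem_set ?addn1.
Qed.

(** Stability, applied as the points are added one at a time. *)
Lemma weight_le phi psi : tame (splice L psi phi) -> simple (splice L psi phi) ->
  (weight L phi psi <= expR (K * (count psi)%:R))%R.
Proof.
have [n] := ubnP (count psi); elim: n psi => // n ih psi pn tp sp.
have [v0|] := eqVneq (count psi) 0%N.
  by rewrite weight_vacant// v0 mulr0 expR0.
move=> n0; have [z [pz Lz]] : exists z, pts psi z /\ L z.1.
  apply: contrapT => none; move/eqP: n0; apply; apply: npts_set0.
  by apply/seteqP; split => // z [pz [Lz _]]; apply: none; exists z.
have eS := count_remove pz Lz.
rewrite (weight_remove bL tp sp pz Lz) eS -natr1 mulrDr mulr1 expRD.
apply: ler_pM; rewrite ?expR_ge0//.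
- apply: ih; first by rewrite -ltnS -eS.
  + by rewrite -cremove_splice//; exact: tame_remove.
  + by rewrite -cremove_splice//; exact: simple_remove.
- rewrite ler_expR lerNl; apply: stat_stable; last exact: tame_remove.
  exact: thetastar_Theta.
Qed.

(** The weight decays exponentially in the energy increment of each point,
    so it controls the squared increment. *)
Lemma weight_slack2 phi psi z : tame (splice L psi phi) -> simple (splice L psi phi) ->
  pts psi z -> L z.1 ->
  (weight L phi psi * slack (z, cremove (splice L psi phi) z) ^+ 2 <=
   2 * expR (K * (count psi)%:R))%R.
Proof.
move=> tp sp pz Lz; have eS := count_remove pz Lz.
rewrite (weight_remove bL tp sp pz Lz) -cintensityE; last exact: tame_remove.
have e1 : ((count psi)%:R = (count (cremove psi z))%:R + 1 :> R)%R by rewrite eS natr1.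
rewrite -mulrA [X in (_ * X)%R]mulrC e1.
have -> : (2 * expR (K * ((count (cremove psi z))%:R + 1)) =
   expR (K * (count (cremove psi z))%:R) * (2 * expR K))%R.
  by rewrite mulrDr mulr1 expRD; ring.
apply: ler_pM.
- exact/ltW/weight_gt0.
- exact: mulr_ge0 (sqr_ge0 _) (cintensity_ge0 _).
- apply: weight_le.
  + by rewrite -cremove_splice//; exact: tame_remove.
  + by rewrite -cremove_splice//; exact: simple_remove.
- exact: slack2_exp_le.
Qed.

Lemma sqr_sum_le (I : Type) (s : seq I) (f : I -> R) :
  ((\sum_(x <- s) f x) ^+ 2 <= (size s)%:R * \sum_(x <- s) f x ^+ 2)%R.
Proof.
elim: s => [|x s ih]; first by rewrite !big_nil expr0n/= mul0r.
rewrite !big_cons/= -natr1; move: ih.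
have T0 : (0 <= \sum_(y <- s) f y ^+ 2)%R by apply: sumr_ge0 => y _; exact: sqr_ge0.
move: T0; set S := (\sum_(y <- s) f y)%R; set T := (\sum_(y <- s) _)%R; set a := f x => T0 ST.
have [n0|n0] := eqVneq (size s) 0%N.
  have S0 : S = 0%R.
    by apply/eqP; rewrite -sqrf_eq0 eq_le sqr_ge0 andbT; move: ST; rewrite n0 mul0r.
  by rewrite S0 n0 add0r mul1r addr0 lerDl.
have np : (0 < (size s)%:R :> R)%R by rewrite ltr0n lt0n.
move: np ST; set n := (size s)%:R%R => np ST.
have h : (2 * a * S <= n * a ^+ 2 + T)%R.
  rewrite -(ler_pM2l np); have := sqr_ge0 (n * a - S)%R.
  rewrite sqrrB !exprMn => h; move: h ST; nra.
rewrite sqrrD mulrDl mulrDr mul1r; move: h ST; rewrite -mulr_natl; nra.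
Qed.

Lemma sqr_le_exp4 (n : nat) : ((n%:R : R) * n%:R <= 4 ^+ n)%R.
Proof.
have n2 : (n%:R <= 2 ^+ n :> R)%R by rewrite -natrX ler_nat ltnW// ltn_expl.
have -> : (4 = 2 * 2 :> R)%R by rewrite -natrM.
by rewrite exprMn; apply: ler_pM.
Qed.

Lemma mark_window_fin : mark_window setT \is a fin_num.
Proof. exact: (fin_num_measure (window_intensity lm bLM)). Qed.

(** By the equation of Georgii, Nguyen and Zessin this has the same
    conditional expectation, given the outside of the window, as the sum of
    [h] over the points of the window. *)
Definition compensator (h : E * C -> R) phi : R :=
  fine (\int[mark_window]_z (cintensity (z, phi) * h (z, phi))%:E).

Section compensator.
Variables (h : E * C -> R) (B0 : R).
Hypothesis mh : measurable_fun setT (h : E * C -> measurableTypeR R).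
Hypothesis h_ge0 : forall u, (0 <= h u)%R.
Hypothesis ch_le : forall u, (cintensity u * h u <= B0)%R.

Let ch u := (cintensity u * h u)%R.

Let ch0 u : (0 <= ch u)%R. Proof. by rewrite mulr_ge0 ?cintensity_ge0. Qed.

Let mch : measurable_fun setT (ch : E * C -> measurableTypeR R).
Proof. by apply: measurable_funM => //; exact: measurable_cintensity. Qed.

Let B : R := (B0 * fine (mark_window setT))%R.

Let comp_le phi : \int[mark_window]_z (ch (z, phi))%:E <= B%:E.
Proof.
rewrite /B EFinM (fineK mark_window_fin) -integral_cst//; apply: ge0_le_integral => //.
- by move=> z _; rewrite lee_fin.
- apply/measurable_EFinP; apply: (measurableT_comp mch).
  exact: measurable_fun_pair.
- by move=> z _; rewrite lee_fin ch_le.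
Qed.

Lemma compensatorE phi : (compensator h phi)%:E = \int[mark_window]_z (ch (z, phi))%:E.
Proof.
rewrite fineK// ge0_fin_numE; first by apply: le_lt_trans (comp_le phi) _; rewrite ltry.
by apply: integral_ge0 => z _; rewrite lee_fin; exact: ch0.
Qed.

Lemma compensator_ge0 phi : (0 <= compensator h phi)%R.
Proof. by apply: fine_ge0; apply: integral_ge0 => z _; rewrite lee_fin; exact: ch0. Qed.

Lemma compensator_le phi : (compensator h phi <= B0 * fine (mark_window setT))%R.
Proof. by rewrite -lee_fin compensatorE comp_le. Qed.

Lemma measurable_compensator : measurable_fun setT (compensator h : C -> measurableTypeR R).
Proof.
apply/measurable_EFinP; rewrite (_ : EFin \o _ = fun phi => \int[mark_window]_z (ch (z, phi))%:E); last first.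
  by apply/funext => phi; rewrite /= compensatorE.
apply: (measurable_fun_fubini_tonelli_G (m1 := window_intensity lm bLM) (fun u : E * C => (ch u)%:E)).
  exact/measurable_EFinP.
by move=> u; rewrite lee_fin.
Qed.

Lemma compensator_moment : \int[P]_phi (compensator h phi ^+ 2)%:E < +oo.
Proof.
apply: (@le_lt_trans _ _ (\int[P]_phi (B ^+ 2)%:E)); last first.
  by rewrite integral_cst// [X in _ * X](@probability_setT _ _ _ P) mule1 ltry.
apply: ge0_le_integral => //.
- by move=> phi _; rewrite lee_fin sqr_ge0.
- by apply/measurable_EFinP; apply: measurable_funX; exact: measurable_compensator.
- move=> phi _; rewrite lee_fin lerXn2r ?nnegrE ?compensator_ge0 ?compensator_le//.
  exact: le_trans (compensator_ge0 phi) (compensator_le phi).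
Qed.

End compensator.

Section innovation.
Variable h : E * C -> R.
Hypothesis mh : measurable_fun setT (h : E * C -> measurableTypeR R).
Hypothesis h_ge0 : forall u, (0 <= h u)%R.
Hypothesis h_le : forall u, (h u <= slack u / eps)%R.

Definition visits phi : R := \sum_(z <- listing (L `*` setT) phi) h (z, cremove phi z).

Lemma visits_ge0 phi : (0 <= visits phi)%R. Proof. exact: sumr_ge0. Qed.

Lemma measurable_visits : measurable_fun setT (visits : C -> measurableTypeR R).
Proof.
apply/measurable_EFinP; rewrite (_ : EFin \o _ = fun phi =>
    \sum_(z <- listing (L `*` setT) phi) (h (z, cremove phi z))%:E); last first.
  by apply/funext => phi; rewrite /= /visits sumEFin.
apply: (measurable_palm_sum bLM (h := fun u => (h u)%:E)); first exact/measurable_EFinP.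
by move=> u; rewrite lee_fin.
Qed.

Lemma weight_visits2 phi psi : tame (splice L psi phi) -> simple (splice L psi phi) ->
  (weight L phi psi * visits (splice L psi phi) ^+ 2 <=
   2 / eps ^+ 2 * (4 * expR K) ^+ count psi)%R.
Proof.
move=> tp sp.
apply: (@le_trans _ _ (weight L phi psi * ((count psi)%:R *
   \sum_(z <- listing (L `*` setT) psi) h (z, cremove (splice L psi phi) z) ^+ 2))%R).
  rewrite ler_wpM2l//; first exact/ltW/weight_gt0.
  by rewrite /visits listing_splice; exact: sqr_sum_le.
rewrite mulrCA mulr_sumr.
apply: (@le_trans _ _ ((count psi)%:R *
   \sum_(z <- listing (L `*` setT) psi) (2 / eps ^+ 2 * expR (K * (count psi)%:R)))%R).
  rewrite ler_wpM2l// big_seq [leRHS]big_seq; apply: ler_sum => z.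
  rewrite mem_listing// => /andP[/set_mem pz /set_mem[/= Lz _]].
  apply: (@le_trans _ _ (weight L phi psi * (slack (z, cremove (splice L psi phi) z) ^+ 2 / eps ^+ 2))%R).
    rewrite ler_wpM2l//; first exact/ltW/weight_gt0.
    by rewrite -expr_div_n lerXn2r ?nnegrE// (le_trans (h_ge0 _) (h_le _)).
  rewrite mulrA [leRHS]mulrAC ler_wpM2r// ?invr_ge0 ?sqr_ge0//.
  exact: weight_slack2.
set x := (2 / eps ^+ 2 * _)%R.
have -> : (\sum_(z <- listing (L `*` [set: M]) psi) x = (count psi)%:R * x)%R.
  by rewrite big_const_seq count_predT iter_addr_0 mulr_natl.
rewrite (_ : (_ * (_ * x) = 2 / eps ^+ 2 * ((count psi)%:R * (count psi)%:R * expR (K * (count psi)%:R)))%R); last first.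
  by rewrite /x; ring.
rewrite ler_wpM2l ?divr_ge0 ?sqr_ge0//.
rewrite exprMn -expRM_natr ler_wpM2r ?expR_ge0//.
exact: sqr_le_exp4.
Qed.

(** The partition function is at least the Poisson probability of an empty
    window. *)
Lemma dlr_density_visits2 : exists2 B : R, (0 <= B)%R & {ae P, forall phi, {ae Q L, forall psi,
  (dlr_density L phi psi * visits (splice L psi phi) ^+ 2 <= B * (4 * expR K) ^+ count psi)%R}}.
Proof.
have q0 := poisson_vacant_gt0 bL (Q_poisson bL).
have mV : measurable (vacant L : set C) by exact: measurable_vacant.
have fq : Q L (vacant L) \is a fin_num by exact: fin_num_measure.
pose q := fine (Q L (vacant L)).
have qp : (0 < q)%R by rewrite fine_gt0// q0 ltey_eq fq.
exists (q^-1 * (2 / eps ^+ 2))%R; first by rewrite mulr_ge0 ?invr_ge0 ?(ltW qp)// divr_ge0 ?sqr_ge0.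
apply: filterS3 (P_Zpart bL) (dlr_ae bL P_tame) (dlr_ae bL P_simple) => phi Z0 tp sp.
apply: filterS2 tp sp => psi tp sp; rewrite (dlr_densityE _ Z0) -!mulrA.
apply: ler_pM; rewrite ?invr_ge0 ?fine_ge0 ?Zpart_ge0 ?mulr_ge0 ?visits_ge0//.
- exact/ltW/weight_gt0.
- rewrite lef_pV2 ?posrE//; last by rewrite fine_gt0.
  rewrite fine_le// ?ge0_fin_numE ?Zpart_ge0//; first by case/andP: Z0.
  rewrite -[X in Q L X]setIT -integral_indic//; apply: ge0_le_integral => //.
  + by apply/measurable_EFinP; exact: measurable_indic.
  + by apply/measurable_EFinP; exact: measurable_weight.
  move=> chi _; rewrite lee_fin indicE; have [/set_mem vc|_] := boolP (_ \in _).
    by rewrite weight_vacant.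
  exact/ltW/weight_gt0.
- by rewrite mulrA; exact: weight_visits2.
Qed.

Lemma visits_moment : \int[P]_phi (visits phi ^+ 2)%:E < +oo.
Proof.
have [B B0 hB] := dlr_density_visits2.
have mv2 : measurable_fun setT (fun phi => (visits phi ^+ 2)%:E).
  by apply/measurable_EFinP; apply: measurable_funX; exact: measurable_visits.
rewrite (dlr bL mv2); last by move=> phi; rewrite lee_fin sqr_ge0.
have em := poisson_exp_moment bL (c := (4 * expR K)%R) (Q_poisson bL).
have {}em : \int[Q L]_phi ((4 * expR K) ^+ npts phi (L `*` setT))%:E < +oo.
  by apply: em; rewrite mulr_ge0 ?expR_ge0.
have mc : measurable_fun setT (fun psi : C => ((4 * expR K) ^+ count psi)%:E).
  apply/measurable_EFinP.
  have mf : measurable_fun setT (fun n : nat => ((4 * expR K) ^+ n)%R : measurableTypeR R) by [].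
  by apply: (measurableT_comp mf); exact: measurable_npts.
have c0 (psi : C) : 0 <= ((4 * expR K) ^+ count psi)%:E.
  by rewrite lee_fin exprn_ge0// mulr_ge0 ?expR_ge0.
apply: (@le_lt_trans _ _ (\int[P]_phi (B%:E * \int[Q L]_psi ((4 * expR K) ^+ count psi)%:E))); last first.
  have : \int[Q L]_psi ((4 * expR K) ^+ count psi)%:E \is a fin_num.
    by rewrite ge0_fin_numE// integral_ge0.
  move=> /fineK <-; rewrite -EFinM integral_cst//.
  by rewrite [X in _ * X](@probability_setT _ _ _ P) mule1 ltry.
have md : measurable_fun setT (fun u : C * C => (dlr_density L u.1 u.2)%:E * (visits (splice L u.2 u.1) ^+ 2)%:E).
  apply: emeasurable_funM; first by apply/measurable_EFinP; exact: measurable_dlr_density.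
  by apply: (measurableT_comp mv2); exact: measurable_splice.
have d0 (u : C * C) : 0 <= (dlr_density L u.1 u.2)%:E * (visits (splice L u.2 u.1) ^+ 2)%:E.
  by rewrite mule_ge0// lee_fin ?dlr_density_ge0// sqr_ge0.
apply: ae_ge0_le_integral => //.
- by move=> phi _; apply: integral_ge0 => psi _; exact: (d0 (phi, psi)).
- exact: (measurable_fun_fubini_tonelli_F _ md d0).
- by move=> phi _; rewrite mule_ge0 ?lee_fin// integral_ge0.
apply: filterS hB => phi hB _; rewrite -ge0_integralZl_EFin//.
apply: ae_ge0_le_integral => //.
- by move=> psi _; exact: (d0 (phi, psi)).
- apply: emeasurable_funM; first by apply/measurable_EFinP; exact: measurable_dlr_density.
  by apply: (measurableT_comp mv2); exact: measurable_splice.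
- by move=> psi _; rewrite mule_ge0 ?lee_fin.
- exact: emeasurable_funM.
by apply: filterS hB => psi hB _; rewrite -!EFinM lee_fin.
Qed.

Let ch_le u : (cintensity u * h u <= expR K / eps)%R.
Proof.
apply: (@le_trans _ _ (cintensity u * (slack u / eps))%R).
  by rewrite ler_wpM2l ?cintensity_ge0.
by rewrite mulrA ler_wpM2r ?invr_ge0 ?(ltW eps_gt0)// mulrC slack_exp_le.
Qed.

Lemma innovation_compensator_ge0 phi : (0 <= compensator h phi)%R.
Proof. exact: compensator_ge0. Qed.

Lemma measurable_innovation_compensator :
  measurable_fun setT (compensator h : C -> measurableTypeR R).
Proof. exact: (measurable_compensator mh h_ge0 ch_le). Qed.

Lemma innovation_compensator_moment : \int[P]_phi (compensator h phi ^+ 2)%:E < +oo.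
Proof. exact: (compensator_moment mh h_ge0 ch_le). Qed.

Lemma innovation_orthogonal (G : C -> R) : measurable_fun setT (G : C -> measurableTypeR R) ->
  (forall phi, 0 <= G phi)%R ->
  (forall phi phi', restr (~` L) phi = restr (~` L) phi' -> G phi = G phi') ->
  \int[P]_phi (visits phi * G phi)%:E = \int[P]_phi (compensator h phi * G phi)%:E.
Proof.
move=> mG G0 GL.
transitivity (\int[P]_phi ((G phi)%:E * \sum_(z <- listing (L `*` setT) phi) (h (z, cremove phi z))%:E)).
  by apply: eq_integral => phi _; rewrite sumEFin -EFinM mulrC.
rewrite (@gnz (fun u => (h u)%:E) (fun phi => (G phi)%:E))//.
- by apply: eq_integral => phi _; rewrite EFinM (compensatorE mh h_ge0 ch_le) muleC.
- exact/measurable_EFinP.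
- exact/measurable_EFinP.
- by move=> phi phi' /GL ->.
Qed.

End innovation.

End gnz.

Local Close Scope ereal_scope.

(** * Averages over the cells *)

Context (Dtilde : R).
Hypothesis Dtilde_gt0 : 0 < Dtilde.

(** Minus the centre of the cell [j]: the translation brings that cell to
    the origin. *)
Definition to_cell (j : int * int) : plane R := (- (Dtilde * j.1%:~R), - (Dtilde * j.2%:~R)).

Definition tau (j : int * int) : C -> C := translate (to_cell j).

Lemma measurable_tau (j : int * int) : measurable_fun setT (tau j).
Proof. exact: measurable_translate. Qed.

Lemma P_tau (j : int * int) (A : set C) : measurable A -> P (tau j @^-1` A) = P A.
Proof. by move=> mA; exact: P_stationary. Qed.

Lemma tauD (i j : int * int) phi : tau i (tau j phi) = tau (i + j) phi.
Proof.
rewrite /tau translate_comp; congr translate; rewrite /shift /to_cell/= !intrD !mulrDr !opprD.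
by congr pair; rewrite addrC.
Qed.

Definition cell0 : set (plane R) := box Dtilde (0, 0).

Lemma cell0_bounded : bounded_borel cell0.
Proof.
split; first exact: measurable_box.
exists (Dtilde + Dtilde) => x; rewrite /cell0 boxE// => -[/=].
rewrite !in_itv/= sub0r add0r => /andP[h1 h2] /andP[h3 h4].
apply/eballE; split; rewrite /= ?subr0 ?addr_ge0 ?ltW//.
have sq (u : R) : Dtilde * - 2^-1 <= u -> u < Dtilde / 2 -> u ^+ 2 <= Dtilde ^+ 2.
  by move=> u1 u2; have := Dtilde_gt0; nra.
have := sq _ h1 h2; have := sq _ h3 h4; move: Dtilde_gt0.
nra.
Qed.

Definition local_to k (F : C -> R) := forall phi, F (restr (window_ball k) phi) = F phi.

Lemma far_outside k k0 : exists r : nat, forall j : int * int, r%:Z < Num.max `|j.1| `|j.2| ->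
  forall (F : C -> R), local_to k F -> forall phi phi',
  restr (~` window_ball k0) phi = restr (~` window_ball k0) phi' ->
  F (tau j phi) = F (tau j phi').
Proof.
exists (Num.truncn ((k + k0)%:R / Dtilde)).+1 => j jr F loc phi phi' e.
rewrite -loc -[in RHS]loc; congr F; rewrite /tau !translate_restr; congr translate.
have sU : shift (to_cell j) @^-1` window_ball k `<=` ~` window_ball k0.
  move=> x; rewrite /preimage/= => /eball_box[/= + +] /eball_box[/= + +].
  rewrite !in_itv/= !add0r => /andP[a1 a2] /andP[b1 b2] /andP[c1 c2] /andP[d1 d2].
  have big (u : int) : (Num.truncn ((k + k0)%:R / Dtilde)).+1%:Z < `|u| ->
      (k + k0)%:R < `|Dtilde * u%:~R|.
    move=> hu; rewrite normrM gtr0_norm// mulrC -ltr_pdivrMr//.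
    apply: (lt_trans (truncnS_gt _)).
    by move: hu; rewrite -(ltr_int R) intr_norm.
  move: jr; rewrite lt_max => /orP[] /big; rewrite natrD lter_normr => /orP[]; lra.
by rewrite -(restrK _ sU) -[in RHS](restrK _ sU) e.
Qed.

Local Open Scope ereal_scope.

(** The law of large numbers for a function [a] of the configuration seen
    from the cells, centred by a function [c] that stands for the
    conditional expectation of [a] given the outside of a window. As both
    are local, the values at distant cells are such outside events, and the
    differences are uncorrelated. *)
Lemma cell_lln (a c : C -> R) k k0 :
  measurable_fun setT (a : C -> measurableTypeR R) ->
  measurable_fun setT (c : C -> measurableTypeR R) ->
  (forall phi, 0 <= a phi)%R -> (forall phi, 0 <= c phi)%R ->
  \int[P]_phi (a phi ^+ 2)%:E < +oo -> \int[P]_phi (c phi ^+ 2)%:E < +oo ->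
  local_to k a -> local_to k c ->
  (forall G : C -> R, measurable_fun setT (G : C -> measurableTypeR R) ->
    (forall phi, 0 <= G phi)%R ->
    (forall phi phi', restr (~` window_ball k0) phi = restr (~` window_ball k0) phi' ->
       G phi = G phi') ->
    \int[P]_phi (a phi * G phi)%:E = \int[P]_phi (c phi * G phi)%:E) ->
  {ae P, forall phi,
    ((\sum_(i <- square n) (a (tau i phi) - c (tau i phi))) / (size (square n))%:R)%R
      @[n --> \oo] --> (0 : R)%R}.
Proof.
move=> ma mc a0 c0 a2 c2 la lc orth; have [r hr] := far_outside k k0.
apply: (square_lln measurable_tau P_tau tauD ma mc a0 c0 a2 c2 (r := r)) => j jr.
split; apply: orth.
- exact: (measurableT_comp ma (measurable_tau j)).
- by move=> phi; exact: a0.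
- by move=> phi phi' e; exact: (hr j jr a la).
- exact: (measurableT_comp mc (measurable_tau j)).
- by move=> phi; exact: c0.
- by move=> phi phi' e; exact: (hr j jr c lc).
Qed.

Lemma cell_window_exists : exists k, forall x, cell0 x -> eball x D `<=` window_ball k.
Proof.
have [_ [rr hr]] := cell0_bounded.
exists (Num.truncn (rr + (D + D))%R).+1 => x /hr xr y xy.
have := eball_triangle xr xy; apply: eball_le; exact/ltW/truncnS_gt.
Qed.

(** Points of the cell interact within this window only. *)
Definition cell_reach : nat := sval (cid cell_window_exists).

Lemma cell_reachP x : cell0 x -> eball x D `<=` window_ball cell_reach.
Proof. exact: (svalP (cid cell_window_exists)). Qed.

Lemma cell0_reach : cell0 `<=` window_ball cell_reach.
Proof. by move=> x x0; apply: (cell_reachP x0); exact: eballxx. Qed.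

Definition local_fun (h : E * C -> R) :=
  forall z phi (W : set (plane R)), eball z.1 D `<=` W -> h (z, restr W phi) = h (z, phi).

Lemma slack_local : local_fun slack.
Proof. by move=> z phi W zW; rewrite /slack/= stat_restr. Qed.

Lemma cintensity_local : local_fun cintensity.
Proof. by move=> z phi W zW; rewrite /cintensity slack_local. Qed.

Lemma mark_window_ae L (bL : bounded_borel L) :
  {ae mark_window bL, forall z, L z.1}.
Proof.
have [mL _] := bL; exists (~` (L `*` setT)); split.
- by apply: measurableC; exact: measurableX.
- rewrite -[LHS]/(intensity lm (~` (L `*` setT) `&` (L `*` setT))).
  by rewrite setICl measure0.
- by move=> z /= h [].
Qed.

Local Notation mu := (mark_window cell0_bounded).
Local Notation Acell := (compensator cell0_bounded).

Lemma measurable_section (h : E * C -> R) phi :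
  measurable_fun setT (h : E * C -> measurableTypeR R) ->
  measurable_fun setT (fun z => h (z, phi) : measurableTypeR R).
Proof. by move=> mh; apply: (measurableT_comp mh); exact: measurable_fun_pair. Qed.

Lemma compensator_local (h : E * C -> R) : measurable_fun setT (h : E * C -> measurableTypeR R) ->
  local_fun h -> local_to cell_reach (Acell h).
Proof.
move=> mh lh phi; rewrite /compensator; congr fine.
have mch phi' : measurable_fun setT (fun z => (cintensity (z, phi') * h (z, phi'))%:E).
  apply/measurable_EFinP; apply: measurable_funM; last exact: measurable_section.
  by apply: measurable_section; exact: measurable_cintensity.
apply: ae_eq_integral => //.
apply: filterS (mark_window_ae cell0_bounded) => z z0 _.
by rewrite cintensity_local ?lh//; exact: cell_reachP.
Qed.

Lemma visits_local (h : E * C -> R) : local_fun h -> local_to cell_reach (visits cell0 h).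
Proof.
move=> lh phi; have bc : bounded_window (cell0 `*` [set: M]).
  by apply: bounded_windowX; exact: cell0_bounded.
rewrite /visits (_ : listing _ (restr _ phi) = listing (cell0 `*` setT) phi).
  rewrite big_seq [RHS]big_seq; apply: eq_bigr => z.
  rewrite mem_listing// => /andP[_ /set_mem[/= z0 _]].
  rewrite (_ : cremove _ z = restr (window_ball cell_reach) (cremove phi z)); last first.
    apply: config_eq; apply/seteqP; split => w; first by move=> [[pw Ww] wz].
    by move=> [[pw wz] Ww].
  by rewrite lh//; exact: cell_reachP.
apply: eq_listing; apply/seteqP; split => z; first by move=> [[pz _] z0].
by move=> [pz [z0 _]]; split => //; split => //; split => //; exact: cell0_reach.
Qed.

(** The positive and negative parts of the increments, for [s] equal to [1]
    and [-1]. The cut-off by the slack does not affect tame configurations;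
    it gives, everywhere, the bound from which the second moments are
    finite. *)
Definition part (s : R) i (u : E * C) : R :=
  Num.min (Num.max 0%R (s * stat u.1 u.2 ord0 i)%R) (slack u / eps)%R.

Lemma part_ge0 s i u : (0 <= part s i u)%R.
Proof. by rewrite le_min le_max lexx/= divr_ge0 ?slack_ge0// (ltW eps_gt0). Qed.

Lemma part_le s i u : (part s i u <= slack u / eps)%R.
Proof. by rewrite ge_min lexx orbT. Qed.

Lemma measurable_part s i : measurable_fun setT (part s i : E * C -> measurableTypeR R).
Proof.
apply: measurable_minr.
  by apply: measurable_maxr => //; apply: measurable_funM => //; exact: measurable_stat.
by apply: measurable_funM => //; exact: measurable_slack.
Qed.

Lemma part_local s i : local_fun (part s i).
Proof. by move=> z phi W zW; rewrite /part slack_local//= stat_restr. Qed.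

(** The interior of the parameter set contains both [thetastar + eps e] and
    [thetastar - eps e] for each direction [e], and stability for these two
    parameters bounds the increment on both sides. *)
Lemma tame_stat_le z phi i : tame phi -> (`|stat z phi ord0 i| <= slack (z, phi) / eps)%R.
Proof.
move=> tp; rewrite ler_pdivlMr ?eps_gt0// slackE//.
have h1 := stat_stable z (eps_Theta i (s := eps) _) tp.
have h2 := stat_stable z (eps_Theta i (s := (- eps)%R) _) tp.
move: h1 h2; rewrite normrN ger0_norm ?(ltW eps_gt0)// => /(_ (lexx _)) + /(_ (lexx _)).
rewrite !dot_direction => h1 h2; have e0 := eps_gt0.
by case: (ler0P (stat z phi ord0 i)) => _; lra.
Qed.

Lemma tame_part z phi i : tame phi ->
  (part 1 i (z, phi) - part (-1) i (z, phi) = stat z phi ord0 i)%R.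
Proof.
move=> /(@tame_stat_le z phi i); rewrite ler_norml /part/= mul1r mulN1r => /andP[h1 h2].
have s0 : (0 <= slack (z, phi) / eps)%R by rewrite divr_ge0 ?slack_ge0// (ltW eps_gt0).
rewrite !min_l.
- have [x0|x0] := lerP 0%R (stat z phi ord0 i).
    by rewrite max_l ?subr0// oppr_le0.
  by rewrite max_r ?oppr_ge0 ?(ltW x0)// sub0r opprK.
- by rewrite ge_max s0 lerNl h1.
- by rewrite ge_max s0.
Qed.

Lemma innovation_lln s i : {ae P, forall phi,
  ((\sum_(b <- square n) (visits cell0 (part s i) (tau b phi) -
      Acell (part s i) (tau b phi))) / (size (square n))%:R)%R
      @[n --> \oo] --> (0 : R)%R}.
Proof.
have mp := measurable_part s i; have p0 := part_ge0 s i; have pl := part_le s i.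
apply: (cell_lln (k := cell_reach) (k0 := cell_reach)).
- exact: (measurable_visits cell0_bounded mp).
- exact: measurable_innovation_compensator.
- by move=> phi; apply: sumr_ge0 => z _; exact: p0.
- exact: innovation_compensator_ge0.
- exact: (visits_moment cell0_bounded mp p0 pl).
- exact: innovation_compensator_moment.
- exact: visits_local (part_local s i).
- exact: compensator_local (part_local s i).
- move=> G mG G0 GL; apply: innovation_orthogonal => // phi phi' e; apply: GL.
  have sub : ~` window_ball cell_reach `<=` ~` cell0 by apply: subsetC; exact: cell0_reach.
  by rewrite -(restrK _ sub) -[in RHS](restrK _ sub) e.
Qed.

Lemma bounded_integrable d (T : measurableType d) (m : {measure set T -> \bar R}) (f : T -> R) (B : R) :
  m setT < +oo -> measurable_fun setT (f : T -> measurableTypeR R) ->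
  (forall t, `|f t| <= B)%R -> m.-integrable setT (EFin \o f).
Proof.
move=> moo mf fB; apply/integrableP; split; first exact/measurable_EFinP.
apply: (@le_lt_trans _ _ (\int[m]_x B%:E)).
  apply: ge0_le_integral => //.
  - by do 2 apply: measurableT_comp => //.
  - by move=> x _; rewrite /= lee_fin.
rewrite integral_cst//.
have [->|T0] := eqVneq (m setT) 0; first by rewrite mule0.
by rewrite -(fineK (_ : m setT \is a fin_num)) ?ge0_fin_numE// -EFinM ltry.
Qed.

Definition outer_window_spec := halo_in_ball (bounded_ball cell_reach).

(** Beyond the reach of the cell, a second window: the halo of the inner
    one fits into it. *)
Definition outer : nat := sval (cid outer_window_spec).

Lemma reach_outer : window_ball cell_reach `<=` window_ball outer.
Proof. by have [] := svalP (cid outer_window_spec). Qed.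

Lemma halo_outer psi : configs_in (window_ball cell_reach) psi ->
  halo D psi `<=` window_ball outer.
Proof. by have [_] := svalP (cid outer_window_spec); exact. Qed.

Local Notation C0 := (window_ball outer).
Let bC0 : bounded_borel C0. Proof. exact: bounded_ball. Qed.
Let mC0 : measurable C0. Proof. by case: bC0. Qed.

Definition outer2 : nat := sval (cid (halo_in_ball bC0)).

Lemma outer_outer2 : window_ball outer `<=` window_ball outer2.
Proof. by have [] := svalP (cid (halo_in_ball bC0)). Qed.

Lemma halo_outer2 psi : configs_in C0 psi -> halo D psi `<=` window_ball outer2.
Proof. by have [_] := svalP (cid (halo_in_ball bC0)); exact. Qed.

Lemma local_to_le k k' F : window_ball k `<=` window_ball k' -> local_to k F -> local_to k' F.
Proof. by move=> kk lF phi; rewrite -lF restrK// lF. Qed.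

(** The conditional expectation given the outside of the outer window, as a
    function of the configuration. *)
Definition resample (F : C -> R) phi : R :=
  (\int[Q C0]_psi (dlr_density C0 phi psi * F (splice C0 psi phi)))%R.

Lemma dlr_density_integral L : bounded_borel L ->
  {ae P, forall phi, \int[Q L]_psi (dlr_density L phi psi)%:E = 1}.
Proof.
move=> bL; apply: filterS (P_Zpart bL) => phi Z0.
under eq_integral do rewrite (dlr_densityE _ Z0) EFinM.
have Zf : Zpart L phi \is a fin_num.
  by rewrite ge0_fin_numE ?Zpart_ge0//; case/andP: Z0.
rewrite ge0_integralZl_EFin//; last 3 first.
- by move=> psi _; rewrite lee_fin ltW// weight_gt0.
- by apply/measurable_EFinP; exact: measurable_weight.
- by rewrite invr_ge0 fine_ge0// Zpart_ge0.
rewrite -/(Zpart L phi) -{2}(fineK Zf) -EFinM mulVf// gt_eqF// fine_gt0//.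
Qed.

Lemma resample_local (F : C -> R) : local_to cell_reach F -> local_to outer2 (resample F).
Proof.
move=> lF phi; rewrite /resample; apply: eq_Rintegral => psi _; congr (_ * _)%R.
  apply: eq_dlr_density => psi'; apply/esym; apply: env_cut => z pz nz hz.
  by apply: (halo_outer2 (psi := restr C0 psi')) hz => w [].
rewrite -lF -[RHS]lF; congr F.
have sub : window_ball cell_reach `<=` window_ball outer2.
  by apply: subset_trans reach_outer outer_outer2.
rewrite /splice !restr_cunion; congr cunion.
by rewrite restrI [RHS]restrI restrI setIAC (setIidl sub).
Qed.

Section resampling.
Variables (F : C -> R) (B : R).
Hypothesis mF : measurable_fun setT (F : C -> measurableTypeR R).
Hypothesis F_le : forall phi, (`|F phi| <= B)%R.

Let B0 : (0 <= B)%R. Proof. exact: le_trans (F_le cempty). Qed.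

Let mFs : measurable_fun setT (fun u : C * C =>
  dlr_density C0 u.1 u.2 * F (splice C0 u.2 u.1) : measurableTypeR R)%R.
Proof.
apply: measurable_funM; first exact: measurable_dlr_density.
by apply: (measurableT_comp mF); exact: measurable_splice.
Qed.

Lemma resample_integrable : {ae P, forall phi, (Q C0).-integrable setT
  (fun psi => (dlr_density C0 phi psi * F (splice C0 psi phi))%:E)}.
Proof.
apply: filterS (dlr_density_integral bC0) => phi e; apply/integrableP; split.
  apply/measurable_EFinP; apply: measurable_funM; first exact: measurable_dlr_density.
  by apply: (measurableT_comp mF); exact: measurable_splice.
apply: (@le_lt_trans _ _ (\int[Q C0]_psi (B%:E * (dlr_density C0 phi psi)%:E))).
  apply: ge0_le_integral => //.
  - apply: measurableT_comp => //; apply/measurable_EFinP.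
    apply: measurable_funM; first exact: measurable_dlr_density.
    by apply: (measurableT_comp mF); exact: measurable_splice.
  - by apply: emeasurable_funM => //; apply/measurable_EFinP; exact: measurable_dlr_density.
  - move=> psi _; rewrite -EFinM lee_fin normrM mulrC (ger0_norm (dlr_density_ge0 _ _ _)).
    by rewrite ler_wpM2r ?dlr_density_ge0.
rewrite ge0_integralZl_EFin//.
- by rewrite e mule1 ltry.
- by move=> psi _; rewrite lee_fin dlr_density_ge0.
- by apply/measurable_EFinP; exact: measurable_dlr_density.
Qed.

Hypothesis F_ge0 : forall phi, (0 <= F phi)%R.

Lemma resample_ge0 phi : (0 <= resample F phi)%R.
Proof. by apply: Rintegral_ge0 => psi _; rewrite mulr_ge0 ?dlr_density_ge0. Qed.

Lemma resampleE : {ae P, forall phi, (resample F phi)%:E =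
  \int[Q C0]_psi ((dlr_density C0 phi psi)%:E * (F (splice C0 psi phi))%:E)}.
Proof.
apply: filterS resample_integrable => phi ii.
rewrite /resample /Rintegral fineK//.
exact: integrable_fin_num ii.
Qed.

Lemma measurable_resample : measurable_fun setT (resample F : C -> measurableTypeR R).
Proof.
apply: (measurableT_comp (fine_measurable measurableT)).
apply: (measurable_fun_fubini_tonelli_F (fun u : C * C =>
  (dlr_density C0 u.1 u.2 * F (splice C0 u.2 u.1))%:E)); first exact/measurable_EFinP.
by move=> u; rewrite lee_fin mulr_ge0 ?dlr_density_ge0.
Qed.

Lemma resample_le : {ae P, forall phi, (resample F phi <= B)%R}.
Proof.
apply: filterS2 resampleE (dlr_density_integral bC0) => phi e d1.
rewrite -lee_fin e -[leRHS]mule1 -d1 -ge0_integralZl_EFin//; last 2 first.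
- by move=> psi _; rewrite lee_fin dlr_density_ge0.
- by apply/measurable_EFinP; exact: measurable_dlr_density.
apply: ge0_le_integral => //.
- by move=> psi _; rewrite mule_ge0 ?lee_fin ?dlr_density_ge0.
- apply: emeasurable_funM; apply/measurable_EFinP; first exact: measurable_dlr_density.
  by apply: (measurableT_comp mF); exact: measurable_splice.
- by apply: emeasurable_funM => //; apply/measurable_EFinP; exact: measurable_dlr_density.
move=> psi _; rewrite -!EFinM lee_fin mulrC ler_wpM2r ?dlr_density_ge0//.
exact: le_trans (ler_norm _) (F_le _).
Qed.

Lemma resample_moment : \int[P]_phi (resample F phi ^+ 2)%:E < +oo.
Proof.
apply: (@le_lt_trans _ _ (\int[P]_phi (B ^+ 2)%:E)); last first.
  by rewrite integral_cst// [X in _ * X](@probability_setT _ _ _ P) mule1 ltry.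
apply: ae_ge0_le_integral => //.
- by move=> phi _; rewrite lee_fin sqr_ge0.
- by apply/measurable_EFinP; apply: measurable_funX; exact: measurable_resample.
- by move=> phi _; rewrite lee_fin sqr_ge0.
apply: filterS resample_le => phi h _.
by rewrite lee_fin lerXn2r ?nnegrE ?resample_ge0.
Qed.

Lemma resample_orthogonal (G : C -> R) : measurable_fun setT (G : C -> measurableTypeR R) ->
  (forall phi, 0 <= G phi)%R ->
  (forall phi phi', restr (~` C0) phi = restr (~` C0) phi' -> G phi = G phi') ->
  \int[P]_phi (F phi * G phi)%:E = \int[P]_phi (resample F phi * G phi)%:E.
Proof.
move=> mG G0 GL.
have mFG : measurable_fun setT (fun phi => (F phi * G phi)%:E).
  by apply/measurable_EFinP; exact: measurable_funM.
rewrite (dlr bC0 mFG); last by move=> phi; rewrite lee_fin mulr_ge0.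
apply: ae_eq_integral => //.
- apply: (measurable_fun_fubini_tonelli_F (fun u : C * C =>
    (dlr_density C0 u.1 u.2)%:E * (F (splice C0 u.2 u.1) * G (splice C0 u.2 u.1))%:E)).
    apply: emeasurable_funM; first by apply/measurable_EFinP; exact: measurable_dlr_density.
    by apply: (measurableT_comp mFG); exact: measurable_splice.
  by move=> u; rewrite mule_ge0 ?lee_fin ?dlr_density_ge0 ?mulr_ge0.
- by apply/measurable_EFinP; apply: measurable_funM => //; exact: measurable_resample.
apply: filterS resampleE => phi e _; rewrite mulrC EFinM e -ge0_integralZl_EFin//; last 2 first.
- by move=> psi _; rewrite mule_ge0 ?lee_fin ?dlr_density_ge0.
- apply: emeasurable_funM; apply/measurable_EFinP; first exact: measurable_dlr_density.
  by apply: (measurableT_comp mF); exact: measurable_splice.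
apply: eq_integral => psi _; rewrite (GL (splice C0 psi phi) phi); last by rewrite restrC_splice.
by rewrite -!EFinM; congr (_%:E); ring.
Qed.

End resampling.

Lemma resample_lln (F : C -> R) (B : R) : measurable_fun setT (F : C -> measurableTypeR R) ->
  (forall phi, 0 <= F phi)%R -> (forall phi, F phi <= B)%R -> local_to cell_reach F ->
  {ae P, forall phi,
   ((\sum_(b <- square n) (F (tau b phi) - resample F (tau b phi))) / (size (square n))%:R)%R
      @[n --> \oo] --> (0 : R)%R}.
Proof.
move=> mF F0 FB lF.
have FB' phi : (`|F phi| <= B)%R by rewrite ger0_norm.
apply: (cell_lln (k := outer2) (k0 := outer)) => //.
- exact: measurable_resample.
- by move=> phi; apply: Rintegral_ge0 => psi _; rewrite mulr_ge0 ?dlr_density_ge0.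
- apply: (@le_lt_trans _ _ (\int[P]_phi (B ^+ 2)%:E)); last first.
    by rewrite integral_cst// [X in _ * X](@probability_setT _ _ _ P) mule1 ltry.
  apply: ge0_le_integral => //.
  + by move=> phi _; rewrite lee_fin sqr_ge0.
  + by apply/measurable_EFinP; exact: measurable_funX.
  + by move=> phi _; rewrite lee_fin lerXn2r ?nnegrE// (le_trans (F0 phi)).
- exact: (resample_moment mF FB' F0).
- apply: local_to_le lF; exact: subset_trans reach_outer outer_outer2.
- exact: (resample_local lF).
- by move=> G mG G0 GL; exact: (resample_orthogonal mF FB' F0).
Qed.

Local Notation W0 := (window_ball cell_reach).
Local Notation sites := ('I_p * 'I_p)%type.
Implicit Types (kl : 'I_p * 'I_p).

(** * Quadratic forms of the increments *)

Lemma Rintegral_lincomb d (T : measurableType d) (m : {measure set T -> \bar R}) (I : Type)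
    (s : seq I) (c : I -> R) (g : I -> T -> R) :
  (forall k, m.-integrable setT (EFin \o g k)) ->
  m.-integrable setT (fun t => (\sum_(k <- s) c k * g k t)%R%:E) /\
  (\int[m]_t (\sum_(k <- s) c k * g k t) = \sum_(k <- s) c k * \int[m]_t g k t)%R.
Proof.
move=> ig; elim: s => [|i s [ih1 ih2]].
  split; first by under eq_fun do rewrite big_nil; exact: integrable0.
  by under eq_Rintegral do rewrite big_nil; rewrite big_nil Rintegral_cst// mul0r.
have ii : m.-integrable setT (EFin \o (fun t => c i * g i t)%R).
  exact: (integrableZl measurableT (c i) (ig i)).
split.
  under eq_fun do rewrite big_cons EFinD; exact: integrableD.
under eq_Rintegral do rewrite big_cons.
by rewrite RintegralD// RintegralZl// big_cons ih2.
Qed.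

(** Bounded substitutes for the increments, proportional to them: the
    quadratic terms have bounded integrals over the cell, and vanish in the
    same directions. *)
Definition damped (i : 'I_p) (u : E * C) : R :=
  (stat u.1 u.2 ord0 i / (1 + \sum_(j < p) `|stat u.1 u.2 ord0 j|))%R.

Let norm1_ge0 (u : E * C) : (0 <= \sum_(j < p) `|stat u.1 u.2 ord0 j|)%R.
Proof. exact: sumr_ge0. Qed.

Lemma damped_le i u : (`|damped i u| <= 1)%R.
Proof.
have h := norm1_ge0 u; have h1 : (0 < 1 + \sum_(j < p) `|stat u.1 u.2 ord0 j|)%R.
  by rewrite ltr_pwDl.
rewrite /damped normrM normfV (gtr0_norm h1) ler_pdivrMr// mul1r.
rewrite (bigD1 i)//= addrCA lerDl addr_ge0// sumr_ge0//.
Qed.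

Lemma measurable_damped i : measurable_fun setT (damped i : E * C -> measurableTypeR R).
Proof.
have mden : measurable_fun setT (fun u : E * C =>
    (1 + \sum_(j < p) `|stat u.1 u.2 ord0 j|)%R : measurableTypeR R).
  apply: measurable_funD => //; apply: measurable_sum => j.
  by apply: measurableT_comp => //; exact: measurable_stat.
have -> : damped i = fun u : E * C => (stat u.1 u.2 ord0 i *
    expR (- ln (1 + \sum_(j < p) `|stat u.1 u.2 ord0 j|)))%R.
  apply/funext => u; rewrite expRN lnK// posrE ltr_pwDl//; exact: norm1_ge0.
apply: measurable_funM; first exact: measurable_stat.
apply: (measurableT_comp (@measurable_expR R)); apply: measurable_funN.
by apply: (measurableT_comp (@measurable_ln R)).
Qed.

Lemma damped_local i : local_fun (damped i).
Proof. by move=> z phi W zW; rewrite /damped/= stat_restr. Qed.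

Definition damped2 kl u : R := (damped kl.1 u * damped kl.2 u)%R.

Lemma damped2_le kl u : (`|damped2 kl u| <= 1)%R.
Proof.
rewrite /damped2 normrM -[leRHS]mulr1; apply: ler_pM => //; exact: damped_le.
Qed.

Lemma measurable_damped2 kl : measurable_fun setT (damped2 kl : E * C -> measurableTypeR R).
Proof. by apply: measurable_funM; exact: measurable_damped. Qed.

Lemma damped2_local kl : local_fun (damped2 kl).
Proof. by move=> z phi W zW; rewrite /damped2 !damped_local. Qed.

Definition quad delta (u : E * C) : R := ((\sum_(i < p) delta ord0 i * damped i u) ^+ 2)%R.

Lemma quadE delta u :
  quad delta u = (\sum_kl (delta ord0 kl.1 * delta ord0 kl.2) * damped2 kl u)%R.
Proof.
rewrite /quad expr2 big_distrlr/= pair_big/=; apply: eq_bigr => kl _.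
by rewrite /damped2; ring.
Qed.

Lemma mark_window_finite L (bL : bounded_borel L) : mark_window bL setT < +oo.
Proof. by have := mark_window_fin bL; rewrite ge0_fin_numE. Qed.

Lemma measurable_section_cint (h : E * C -> R) phi :
  measurable_fun setT (h : E * C -> measurableTypeR R) ->
  measurable_fun setT (fun z => cintensity (z, phi) * h (z, phi) : measurableTypeR R)%R.
Proof.
move=> mh; apply: measurable_funM; last exact: measurable_section.
by apply: measurable_section; exact: measurable_cintensity.
Qed.

Lemma cell_integrable (h : E * C -> R) (B : R) phi :
  measurable_fun setT (h : E * C -> measurableTypeR R) ->
  (forall u, `|cintensity u * h u| <= B)%R ->
  mu.-integrable setT (fun z => (cintensity (z, phi) * h (z, phi))%:E).
Proof.
move=> mh hB; apply: (bounded_integrable (B := B)).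
- exact: mark_window_finite.
- exact: measurable_section_cint.
- by move=> z.
Qed.

Lemma cint_bounded (h : E * C -> R) (B : R) : (forall u, `|h u| <= B)%R ->
  forall u, (`|cintensity u * h u| <= expR K * B)%R.
Proof.
move=> hB u; rewrite normrM ger0_norm ?cintensity_ge0//.
by apply: ler_pM; rewrite ?cintensity_ge0 ?cintensity_le.
Qed.

Definition cell_form kl phi : R := Acell (damped2 kl) phi.

Lemma cell_formE delta phi :
  Acell (quad delta) phi =
  (\sum_kl (delta ord0 kl.1 * delta ord0 kl.2) * cell_form kl phi)%R.
Proof.
have ii kl := cell_integrable phi (measurable_damped2 kl) (cint_bounded (damped2_le kl)).
have [_ <-] := Rintegral_lincomb (index_enum _) (fun kl => delta ord0 kl.1 * delta ord0 kl.2)%R ii.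
rewrite /compensator /Rintegral; congr fine; apply: eq_integral => z _.
congr (_%:E); rewrite quadE mulr_sumr; apply: eq_bigr => kl _ /=.
by rewrite mulrCA.
Qed.

(** Averages are taken of nonnegative functions; the products of two damped
    increments are shifted by one. *)
Let one1 kl (u : E * C) : R := (1 + damped2 kl u)%R.
Let one0 (u : E * C) : R := 1%R.

Let one1_ge0 kl u : (0 <= one1 kl u)%R.
Proof. by have := damped2_le kl u; rewrite ler_norml /one1 => /andP[]; lra. Qed.

Let one1_le kl u : (`|one1 kl u| <= 2)%R.
Proof.
rewrite ger0_norm ?one1_ge0//.
by have := damped2_le kl u; rewrite ler_norml /one1 => /andP[]; lra.
Qed.

Let one0_le u : (`|one0 u| <= 1)%R. Proof. by rewrite normr1. Qed.

Let mone1 kl : measurable_fun setT (one1 kl : E * C -> measurableTypeR R).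
Proof. by apply: measurable_funD => //; exact: measurable_damped2. Qed.

Let mone0 : measurable_fun setT (one0 : E * C -> measurableTypeR R).
Proof. exact: measurable_cst. Qed.

Lemma cell_form_sub kl phi : cell_form kl phi = (Acell (one1 kl) phi - Acell one0 phi)%R.
Proof.
have i1 := cell_integrable phi (mone1 kl) (cint_bounded (one1_le kl)).
have i0 := cell_integrable phi mone0 (cint_bounded one0_le).
rewrite /compensator -(RintegralB measurableT i1 i0) /cell_form /compensator /Rintegral.
by congr fine; apply: eq_integral => z _; congr (_%:E); rewrite /one1 /one0; ring.
Qed.

Let le_of_norm (h : E * C -> R) (B : R) : (forall u, `|h u| <= B)%R ->
  forall u, (cintensity u * h u <= expR K * B)%R.
Proof. by move=> hB u; apply: le_trans (ler_norm _) _; exact: cint_bounded. Qed.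

Let BA : R := (expR K * 2 * fine (mark_window cell0_bounded setT))%R.

Let mA1 kl : measurable_fun setT (Acell (one1 kl) : C -> measurableTypeR R).
Proof. exact: (measurable_compensator cell0_bounded (mone1 kl) (one1_ge0 kl) (le_of_norm (one1_le kl))). Qed.

Let mA0 : measurable_fun setT (Acell one0 : C -> measurableTypeR R).
Proof.
apply: (measurable_compensator cell0_bounded mone0 _ (le_of_norm one0_le)).
by move=> u; rewrite /one0.
Qed.

Let A1_ge0 kl phi : (0 <= Acell (one1 kl) phi)%R.
Proof. by apply: fine_ge0; apply: integral_ge0 => z _; rewrite lee_fin mulr_ge0 ?cintensity_ge0 ?one1_ge0. Qed.

Let A0_ge0 phi : (0 <= Acell one0 phi)%R.
Proof. by apply: fine_ge0; apply: integral_ge0 => z _; rewrite lee_fin mulr_ge0 ?cintensity_ge0. Qed.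

Let A1_le kl phi : (Acell (one1 kl) phi <= BA)%R.
Proof. exact: (compensator_le cell0_bounded (mone1 kl) (one1_ge0 kl) (le_of_norm (one1_le kl))). Qed.

Let A0_le phi : (Acell one0 phi <= BA)%R.
Proof.
apply: (le_trans (compensator_le cell0_bounded mone0 _ (le_of_norm one0_le) phi)).
  by move=> u; rewrite /one0.
rewrite /BA ler_wpM2r ?fine_ge0// ler_wpM2l ?expR_ge0// ler1n.
by [].
Qed.

Lemma measurable_cell_form kl : measurable_fun setT (cell_form kl : C -> measurableTypeR R).
Proof.
rewrite (_ : cell_form kl = fun phi => Acell (one1 kl) phi - Acell one0 phi)%R; last first.
  by apply/funext => phi; exact: cell_form_sub.
exact: (measurable_funB (mA1 kl) mA0).
Qed.

Lemma cell_form_le kl phi : (`|cell_form kl phi| <= BA)%R.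
Proof.
rewrite cell_form_sub ler_norml; have := A1_ge0 kl phi; have := A1_le kl phi.
have := A0_ge0 phi; have := A0_le phi => *; apply/andP; split; lra.
Qed.

Lemma cell_form_local kl : local_to cell_reach (cell_form kl).
Proof. exact: compensator_local (measurable_damped2 kl) (damped2_local kl). Qed.

Lemma ae_tau (A : C -> Prop) : {ae P, forall phi, A phi} ->
  {ae P, forall phi, forall b, A (tau b phi)}.
Proof.
move=> [N [mN N0 AN]].
suff H : {ae P, forall phi, forall n : nat, forall b : int * int,
    choice.unpickle n = Some b -> A (tau b phi)}.
  by apply: filterS H => phi h b; apply: (h (choice.pickle b)); rewrite choice.pickleK.
apply/ae_foralln => n.
case: (choice.unpickle n : option (int * int)) => [b|]; last exact: aeW.
exists (tau b @^-1` N); split.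
- by rewrite -[X in measurable X]setTI; exact: measurable_tau.
- by rewrite -[LHS]/(P (tau b @^-1` N)) P_tau.
- move=> phi /= h; apply: AN => /= Ab; apply: h => b' [<-]; exact: Ab.
Qed.

Lemma resample_cell_form kl : {ae P, forall phi, resample (cell_form kl) phi =
  (resample (Acell (one1 kl)) phi - resample (Acell one0) phi)%R}.
Proof.
have A1n phi : (`|Acell (one1 kl) phi| <= BA)%R by rewrite ger0_norm ?A1_ge0 ?A1_le.
have A0n phi : (`|Acell one0 phi| <= BA)%R by rewrite ger0_norm ?A0_ge0 ?A0_le.
apply: filterS2 (resample_integrable (mA1 kl) A1n) (resample_integrable mA0 A0n) => phi i1 i0.
rewrite /resample -RintegralB//; apply: eq_Rintegral => psi _.
by rewrite cell_form_sub mulrBr.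
Qed.

Lemma cvg_sub0 (a b : nat -> R) : a n @[n --> \oo] --> (0 : R)%R ->
  b n @[n --> \oo] --> (0 : R)%R -> (a n - b n)%R @[n --> \oo] --> (0 : R)%R.
Proof. by move=> ha hb; rewrite -(subr0 (0 : R)%R); exact: (cvgB ha hb). Qed.

Lemma cell_form_lln : {ae P, forall phi, forall kl,
  ((\sum_(b <- square n) (cell_form kl (tau b phi) - resample (cell_form kl) (tau b phi))) /
     (size (square n))%:R)%R @[n --> \oo] --> (0 : R)%R}.
Proof.
have l1 kl : local_to cell_reach (Acell (one1 kl)).
  apply: compensator_local => // z phi W zW; by rewrite /one1 damped2_local.
have l0 : local_to cell_reach (Acell one0) by exact: compensator_local.
suff H : {ae P, forall phi, forall n : nat, forall kl, choice.unpickle n = Some kl ->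
  ((\sum_(b <- square n) (cell_form kl (tau b phi) - resample (cell_form kl) (tau b phi))) /
     (size (square n))%:R)%R @[n --> \oo] --> (0 : R)%R}.
  by apply: filterS H => phi h kl; apply: (h (choice.pickle kl)); rewrite choice.pickleK.
apply/ae_foralln => n.
case: (choice.unpickle n : option ('I_p * 'I_p)) => [kl|]; last exact: aeW.
apply: filterS3 (ae_tau (resample_cell_form kl))
  (resample_lln (mA1 kl) (A1_ge0 kl) (A1_le kl) (l1 kl))
  (resample_lln mA0 A0_ge0 A0_le l0) => phi e c1 c0 kl' [<-].
have -> : (fun n => (\sum_(b <- square n) (cell_form kl (tau b phi) -
     resample (cell_form kl) (tau b phi))) / (size (square n))%:R)%R =
   (fun n => (\sum_(b <- square n) (Acell (one1 kl) (tau b phi) - resample (Acell (one1 kl)) (tau b phi))) / (size (square n))%:R -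
     (\sum_(b <- square n) (Acell one0 (tau b phi) - resample (Acell one0) (tau b phi))) / (size (square n))%:R)%R.
  apply/funext => k; rewrite -mulrBl -sumrB; congr (_ / _)%R; apply: eq_bigr => b _.
  by rewrite e cell_form_sub; ring.
exact: (cvg_sub0 c1 c0).
Qed.

Let ring_vacant : set C := vacant (C0 `\` W0).

Let bring : bounded_borel (C0 `\` W0).
Proof. by apply: (bounded_borelD bC0); case: (bounded_ball cell_reach). Qed.

Lemma ring_env phi psi : ring_vacant psi -> env C0 phi psi = cempty.
Proof.
move=> vr; apply: config_eq; apply/seteqP; split => // z [[pz [nC _]] [hz _]].
apply: nC; apply: (halo_outer (psi := restr C0 psi)) hz => w [pw [Cw _]].
split => //; apply: contrapT => nW; exact: (vacant_notin bring vr pw).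
Qed.

Lemma ring_weight phi psi : ring_vacant psi -> weight C0 phi psi = weight C0 cempty psi.
Proof. by move=> vr; apply: eq_weight => //; rewrite !ring_env. Qed.

(** A lower bound of the weight of the resampled configuration that does
    not depend on the outside: with an empty annulus, the inner points
    interact with nothing else. The truncation at [1] makes it bounded. *)
Definition floor_weight psi : R :=
  (\1_ring_vacant psi * Num.min (weight C0 cempty psi) 1)%R.

Lemma floor_weight_ge0 psi : (0 <= floor_weight psi)%R.
Proof. by rewrite mulr_ge0// le_min ler01 andbT ltW// weight_gt0. Qed.

Lemma floor_weight_le1 psi : (floor_weight psi <= 1)%R.
Proof.
rewrite /floor_weight -[leRHS]mulr1 ler_pM ?ge_min ?lexx ?orbT//.
by rewrite le_min ler01 andbT ltW// weight_gt0.
Qed.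

Lemma floor_weight_le phi psi : (floor_weight psi <= weight C0 phi psi)%R.
Proof.
rewrite /floor_weight indicE; have [/set_mem vr|_] := boolP (_ \in _).
  by rewrite mul1r (ring_weight phi vr) ge_min lexx.
by rewrite mul0r ltW// weight_gt0.
Qed.

Lemma measurable_floor_weight : measurable_fun setT (floor_weight : C -> measurableTypeR R).
Proof.
apply: measurable_funM; first by apply: measurable_indic; exact: (measurable_vacant bring).
by apply: measurable_minr => //; apply: (measurable_weight bC0).
Qed.

(** Stability bounds the weight exponentially in the number of points. *)
Lemma Zpart_bounded : exists2 Z : R, (0 < Z)%R &
  {ae P, forall phi, Zpart C0 phi <= Z%:E}.
Proof.
pose f (psi : C) : \bar R := (expR K ^+ npts psi (C0 `*` setT))%:E.
have foo : \int[Q C0]_psi f psi < +oo.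
  by apply: (poisson_exp_moment bC0 (Q_poisson bC0)); exact: expR_ge0.
have f1 psi : 1 <= f psi.
  by rewrite lee_fin exprn_ege1// -expR0 ler_expR.
have mf : measurable_fun setT f.
  apply/measurable_EFinP.
  have mg : measurable_fun setT (fun n : nat => (expR K ^+ n)%R : measurableTypeR R) by [].
  by apply: (measurableT_comp mg); apply: measurable_npts; exact: (bounded_windowX bC0).
have f0 psi : 0 <= f psi by apply: le_trans (f1 psi).
have fi : \int[Q C0]_psi f psi \is a fin_num by rewrite ge0_fin_numE// integral_ge0.
exists (fine (\int[Q C0]_psi f psi)).
  rewrite fine_gt0// foo andbT; apply: (@lt_le_trans _ _ (\int[Q C0]_psi (cst 1 psi))).
    by rewrite integral_cst// [X in _ * X](@probability_setT _ _ _ (Q C0)) mule1.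
  exact: ge0_le_integral.
apply: filterS2 (dlr_ae bC0 P_tame) (dlr_ae bC0 P_simple) => phi tp sp.
rewrite fineK//; apply: ae_ge0_le_integral => //.
- by move=> psi _; rewrite lee_fin ltW// weight_gt0.
- by apply/measurable_EFinP; apply: (measurable_weight bC0).
apply: filterS2 tp sp => psi tp sp _; rewrite lee_fin -expRM_natr.
exact: (weight_le bC0).
Qed.

Definition floor_form kl : R := (\int[Q C0]_psi (floor_weight psi * cell_form kl psi))%R.

Let floor_bounded kl psi : (`|floor_weight psi * cell_form kl psi| <= BA)%R.
Proof.
rewrite normrM ger0_norm ?floor_weight_ge0//.
have := cell_form_le kl psi => h; apply: le_trans h.
by rewrite ler_piMl ?floor_weight_le1.
Qed.

Let floor_integrable kl : (Q C0).-integrable setT (EFin \o (fun psi => floor_weight psi * cell_form kl psi)%R).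
Proof.
apply: (bounded_integrable (B := BA)) => //.
- by rewrite [X in X < _](@probability_setT _ _ _ (Q C0)) ltry.
- by apply: measurable_funM; [exact: measurable_floor_weight|exact: measurable_cell_form].
Qed.

(** The integral of the quadratic form against the lower bound of the
    density; it is a deterministic quadratic form in [delta]. *)
Definition floor_quad delta : R :=
  (\sum_kl (delta ord0 kl.1 * delta ord0 kl.2) * floor_form kl)%R.

Lemma floor_quadE delta :
  floor_quad delta = (\int[Q C0]_psi (floor_weight psi * Acell (quad delta) psi))%R.
Proof.
rewrite /floor_quad /floor_form.
have [_ <-] := Rintegral_lincomb (index_enum _) (fun kl => delta ord0 kl.1 * delta ord0 kl.2)%R floor_integrable.
apply: eq_Rintegral => psi _; rewrite cell_formE mulr_sumr.
by apply: eq_bigr => kl _; rewrite mulrCA.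
Qed.

Lemma quad_ge0 delta u : (0 <= quad delta u)%R. Proof. exact: sqr_ge0. Qed.

Lemma cell_quad_ge0 delta phi : (0 <= Acell (quad delta) phi)%R.
Proof.
by apply: fine_ge0; apply: integral_ge0 => z _; rewrite lee_fin mulr_ge0 ?cintensity_ge0 ?quad_ge0.
Qed.

Lemma resample_lower : exists2 Z : R, (0 < Z)%R & {ae P, forall phi, forall delta,
  (floor_quad delta <= Z * \sum_kl (delta ord0 kl.1 * delta ord0 kl.2) *
     resample (cell_form kl) phi)%R}.
Proof.
have [Z Z0 hZ] := Zpart_bounded; exists Z => //.
have H : {ae P, forall phi, forall n : nat, forall kl, choice.unpickle n = Some kl ->
    (Q C0).-integrable setT (fun psi => (dlr_density C0 phi psi * cell_form kl (splice C0 psi phi))%:E)}.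
  apply/ae_foralln => n.
  case: (choice.unpickle n : option ('I_p * 'I_p)) => [kl|]; last exact: aeW.
  apply: filterS (resample_integrable (measurable_cell_form kl) (cell_form_le kl)) => phi h kl' [<-].
  exact: h.
apply: filterS3 hZ (P_Zpart bC0) H => phi hZ ZP H delta.
have {}H kl : (Q C0).-integrable setT (EFin \o (fun psi => dlr_density C0 phi psi * cell_form kl (splice C0 psi phi))%R).
  by apply: (H (choice.pickle kl)); rewrite choice.pickleK.
have [i1 <-] := Rintegral_lincomb (index_enum _) (fun kl => delta ord0 kl.1 * delta ord0 kl.2)%R H.
rewrite -RintegralZl// floor_quadE; apply: le_Rintegral => //.
- have [i2 _] := Rintegral_lincomb (index_enum _) (fun kl => delta ord0 kl.1 * delta ord0 kl.2)%R floor_integrable.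
  rewrite (_ : EFin \o _ = (fun psi => (\sum_kl delta ord0 kl.1 * delta ord0 kl.2 *
      (floor_weight psi * cell_form kl psi))%R%:E))//.
  apply/funext => psi /=; congr (_%:E); rewrite cell_formE mulr_sumr.
  by apply: eq_bigr => kl _; rewrite mulrCA.
- exact: (integrableZl measurableT Z i1).
move=> psi _.
have -> : (\sum_kl delta ord0 kl.1 * delta ord0 kl.2 *
    (dlr_density C0 phi psi * cell_form kl (splice C0 psi phi)) =
    dlr_density C0 phi psi * Acell (quad delta) psi)%R.
  rewrite cell_formE mulr_sumr; apply: eq_bigr => kl _; rewrite mulrCA; congr (_ * (_ * _))%R.
  rewrite -(cell_form_local kl) -[RHS](cell_form_local kl); congr cell_form.
  rewrite -(restrK _ reach_outer) restr_splice restrK//; exact: reach_outer.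
rewrite mulrA ler_wpM2r ?cell_quad_ge0//.
apply: (le_trans (floor_weight_le phi psi)).
rewrite (dlr_densityE _ ZP) mulrA -[leLHS]mul1r ler_wpM2r//; first exact/ltW/weight_gt0.
have Zf : (0 < fine (Zpart C0 phi))%R by rewrite fine_gt0.
rewrite ler_pdivlMr// mul1r -lee_fin fineK//.
by rewrite ge0_fin_numE ?Zpart_ge0//; case/andP: ZP.
Qed.

(** * Positivity under identifiability *)

Lemma quad0 delta u : quad delta u = 0%R -> dot delta (stat u.1 u.2) = 0%R.
Proof.
have h1 : (0 < 1 + \sum_(j < p) `|stat u.1 u.2 ord0 j|)%R.
  by rewrite ltr_pwDl// sumr_ge0.
move=> /eqP; rewrite /quad sqrf_eq0 => /eqP e.
apply: (mulIf (invr_neq0 (lt0r_neq0 h1))); rewrite mul0r -[RHS]e /dot mulr_suml.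
by apply: eq_bigr => i _; rewrite /damped mulrA.
Qed.

Lemma measurable_quad delta : measurable_fun setT (quad delta : E * C -> measurableTypeR R).
Proof.
apply: measurable_funX; apply: measurable_sum => i; apply: measurable_funM => //.
exact: measurable_damped.
Qed.

Lemma quad_le delta u : (quad delta u <= (\sum_(i < p) `|delta ord0 i|) ^+ 2)%R.
Proof.
rewrite /quad -[leLHS]real_normK ?num_real// lerXn2r ?nnegrE ?sumr_ge0//.
apply: (le_trans (ler_norm_sum _ _ _)); apply: ler_sum => i _.
by rewrite normrM ler_piMr ?damped_le.
Qed.

Lemma cell_quadE delta phi :
  (Acell (quad delta) phi)%:E = \int[mu]_z (cintensity (z, phi) * quad delta (z, phi))%:E.
Proof.
apply: (compensatorE cell0_bounded (measurable_quad delta) (quad_ge0 delta)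
  (B0 := (expR K * (\sum_(i < p) `|delta ord0 i|) ^+ 2)%R)) => u.
by apply: ler_pM; rewrite ?cintensity_ge0 ?quad_ge0 ?cintensity_le ?quad_le.
Qed.

Lemma cell0_area_gt0 : 0 < lebesgue2 cell0.
Proof.
rewrite /cell0 boxE// lebesgue2X; [|exact: measurable_itv..].
have a0 : (Dtilde * (0 - 2^-1) < Dtilde * (0 + 2^-1))%R.
  by rewrite ltr_pM2l//; lra.
rewrite !lebesgue_measure_itv/= !lte_fin a0 -!EFinB mule_gt0// lte_fin subr_gt0//.
Qed.

Lemma null_integral_ge0 d (T : measurableType d) (m : {measure set T -> \bar R}) (f : T -> \bar R) :
  {ae m, forall t, f t = 0} -> measurable_fun setT f -> (forall t, 0 <= f t) ->
  \int[m]_t f t = 0.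
Proof.
move=> h mf f0; rewrite -(@integral0 _ _ R m setT); apply: ge0_ae_eq_integral => //.
by apply: filterS h => t ->.
Qed.

Lemma floor_quad_ge0 delta : (0 <= floor_quad delta)%R.
Proof.
by rewrite floor_quadE; apply: Rintegral_ge0 => psi _; rewrite mulr_ge0 ?floor_weight_ge0 ?cell_quad_ge0.
Qed.

(** The integral of the square against the positive weight vanishes, so the
    square vanishes for almost every place, mark and configuration in the
    cell; by absolute continuity and stationarity the place may be moved to
    the origin. *)
Lemma degenerate_direction delta : floor_quad delta = 0%R ->
  (lm \x P) [set u | dot delta (stat (origin, u.1) u.2) <> 0%R] = 0.
Proof.
move=> f0.
have mA : measurable_fun setT (fun psi => Acell (quad delta) psi : measurableTypeR R).
  have -> : (fun psi => Acell (quad delta) psi) = fun psi =>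
      (\sum_kl (delta ord0 kl.1 * delta ord0 kl.2) * cell_form kl psi)%R.
    by apply/funext => psi; exact: cell_formE.
  by apply: measurable_sum => kl; apply: measurable_funM => //; exact: measurable_cell_form.
have mwA : measurable_fun setT (fun psi => (floor_weight psi * Acell (quad delta) psi)%:E).
  by apply/measurable_EFinP; apply: measurable_funM => //; exact: measurable_floor_weight.
have wA0 psi : 0 <= (floor_weight psi * Acell (quad delta) psi)%:E.
  by rewrite lee_fin mulr_ge0 ?floor_weight_ge0 ?cell_quad_ge0.
have ii : (Q C0).-integrable setT (fun psi => (floor_weight psi * Acell (quad delta) psi)%:E).
  apply: (bounded_integrable (B := (expR K * (\sum_(i < p) `|delta ord0 i|) ^+ 2 * fine (mu setT))%R)
    (f := fun psi => (floor_weight psi * Acell (quad delta) psi)%R)).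
  - by rewrite [X in X < _](@probability_setT _ _ _ (Q C0)) ltry.
  - by apply: measurable_funM => //; exact: measurable_floor_weight.
  - move=> psi; rewrite ger0_norm; last exact: mulr_ge0 (floor_weight_ge0 _) (cell_quad_ge0 _ _).
    apply: (@le_trans _ _ (Acell (quad delta) psi)).
      by rewrite ler_piMl ?cell_quad_ge0 ?floor_weight_le1.
    apply: (compensator_le cell0_bounded (measurable_quad delta) (quad_ge0 delta)) => u.
    by apply: ler_pM; rewrite ?cintensity_ge0 ?quad_ge0 ?cintensity_le ?quad_le.
have I0 : \int[Q C0]_psi (floor_weight psi * Acell (quad delta) psi)%:E = 0.
  rewrite -(fineK (integrable_fin_num measurableT ii)); congr (_%:E).
  by rewrite -[RHS]f0 floor_quadE.
have aeC := ge0_integral_ae0 mwA wA0 I0.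
have aeW0 : {ae Q W0, forall psi, Acell (quad delta) psi = 0%R}.
  pose X : set C := [set psi | Acell (quad delta) psi <> 0%R].
  have mX : measurable X.
    rewrite (_ : X = (fun psi => Acell (quad delta) psi) @^-1` [set~ 0%R]); last by apply/seteqP; split.
    by rewrite -[Y in measurable Y]setTI; apply: mA => //; exact: measurableC.
  exists X; split => //.
  have bW0 := bounded_ball cell_reach.
  have := poisson_vacant bC0 bW0.1 reach_outer (Q_poisson bC0) (Q_poisson bW0) mX.
  rewrite (_ : Q C0 (X `&` _) = 0); last first.
    apply: measure_negligible; first by apply: measurableI => //; exact: (measurable_vacant bring).
    apply: negligibleS aeC => psi [Xp vp] /= h; apply: Xp; move: h => /eqP.
    rewrite eqe mulf_eq0 => /orP[|/eqP//]; rewrite gt_eqF//.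
    by rewrite /floor_weight indicE mem_set// mul1r lt_min ltr01 weight_gt0.
  move=> /esym/eqP; rewrite mule_eq0 => /orP[|/eqP//].
  by rewrite gt_eqF// (poisson_vacant_gt0 bring (Q_poisson bC0)).
have aeP : {ae P, forall phi, Acell (quad delta) phi = 0%R}.
  apply: filterS (P_ae_restr (bounded_ball cell_reach) aeW0) => phi.
  by rewrite !cell_formE; under eq_bigr do rewrite cell_form_local.
pose X : set (E * C) := [set u | dot delta (stat u.1 u.2) <> 0%R].
have mX : measurable X.
  rewrite (_ : X = (fun u : E * C => dot delta (stat u.1 u.2)) @^-1` [set~ 0%R]); last by apply/seteqP; split.
  by rewrite -[Y in measurable Y]setTI; apply: measurable_dot => //; exact: measurableC.
pose f (u : E * C) : \bar R := (\1_X u : R)%:E.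
have mf : measurable_fun setT f by apply/measurable_EFinP; exact: measurable_indic.
have f_ge0 u : 0 <= f u by rewrite lee_fin.
pose g (z : E) : \bar R := \int[P]_phi f (z, phi).
have mg : measurable_fun setT g by exact: measurable_fun_fubini_tonelli_F.
have g0 z : 0 <= g z by exact: integral_ge0.
have aeg : {ae mu, forall z, g z = 0}.
  apply: ge0_integral_ae0 => //.
  rewrite -[LHS]/(\int[window_intensity lm (bounded_windowX cell0_bounded)]_z \int[P]_phi f (z, phi)).
  rewrite (fubini_tonelli (m1 := window_intensity lm (bounded_windowX cell0_bounded)) (m2 := P) f)//.
  apply: null_integral_ge0.
  - apply: filterS aeP => phi A0; apply: null_integral_ge0 => //.
      have := cell_quadE delta phi; rewrite A0 => /esym.
      move=> /ge0_integral_ae0 h.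
      have {}h := h _ (fun z => _).
      apply: filterS (h _ _) => [z /eqP||].
      + rewrite eqe mulf_eq0 gt_eqF ?expR_gt0//= => /eqP/quad0 e.
        by rewrite /f indicE memNset// => /(_ e).
      + apply/measurable_EFinP; apply: measurable_section_cint; exact: measurable_quad.
      + by move=> z; rewrite lee_fin mulr_ge0 ?cintensity_ge0 ?quad_ge0.
    by apply: (measurableT_comp mf).
  - exact: (measurable_fun_fubini_tonelli_G (m1 := window_intensity lm (bounded_windowX cell0_bounded)) f).
  - by move=> phi; exact: integral_ge0.
pose pr (m : M) : \bar R := g (origin, m).
have gE z : g z = pr z.2.
  rewrite /pr /g; have mf1 w : measurable_fun setT (fun phi => f (w, phi)) by exact: (measurableT_comp mf).
  rewrite [RHS](ge0_integral_law (measurable_translate (to_origin z))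
    (fun A mA => esym (P_stationary (to_origin z) mA)) (mf1 _))//.
  apply: eq_integral => phi _; rewrite -mshift_to_origin /f !indicE.
  have -> // : ((z, phi) \in X) = ((mshift (to_origin z) z, translate (to_origin z) phi) \in X).
  by apply/idP/idP => /set_mem h; apply/mem_set; move: h; rewrite /X/= stat_translate.
have mo : measurable_fun setT (fun m : M => (origin, m) : E) by exact: measurable_fun_pair.
have mpr : measurable_fun setT pr by exact: (measurableT_comp mg mo).
pose B : set M := [set m | pr m <> 0].
have mB : measurable B.
  rewrite (_ : B = pr @^-1` [set~ 0]); last by apply/seteqP; split.
  by rewrite -[Y in measurable Y]setTI; apply: mpr => //; exact: measurableC.
have B0 : lm B = 0.
  have : mu (setT `*` B) = 0.
    apply: measure_negligible; first exact: measurableX.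
    by apply: negligibleS aeg => z [_ Bz] /=; rewrite gE.
  rewrite -[LHS]/(intensity lm ((setT `*` B) `&` (cell0 `*` setT))).
  rewrite -setXI setTI setIT intensityX//; last by case: cell0_bounded.
  move=> /eqP; rewrite mule_eq0 => /orP[|/eqP//].
  by rewrite gt_eqF// cell0_area_gt0.
pose N : set (M * C) := [set u | dot delta (stat (origin, u.1) u.2) <> 0%R].
have mN : measurable N.
  rewrite (_ : N = (fun u : M * C => ((origin, u.1), u.2)) @^-1` X); last by apply/seteqP; split.
  rewrite -[Y in measurable Y]setTI; apply: measurable_fun_pair => //.
  exact: (measurableT_comp mo).
rewrite -/N -[N]setIT -integral_indic//.
rewrite (fubini_tonelli1 (m1 := lm) (m2 := P) (fun u : M * C => (\1_N u : R)%:E))//; last first.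
  by apply/measurable_EFinP; exact: measurable_indic.
apply: null_integral_ge0.
- by exists B; split => // m /=.
- exact: mpr.
- by move=> m; apply: integral_ge0 => phi _; rewrite lee_fin.
Qed.

(** A degenerate direction would be in the kernel of one of the matrices of
    the identifiability condition: each of the sets in that condition has
    positive measure, so it contains a mark and a configuration for which
    the increment in that direction vanishes. *)
Lemma floor_quad_gt0 delta : delta <> 0%R -> (0 < floor_quad delta)%R.
Proof.
move=> d0; rewrite lt0r floor_quad_ge0 andbT; apply/eqP => /degenerate_direction nullN.
apply: d0; move: nullN; set N := [set u | _] => nullN.
have mN : measurable N.
  have mo : measurable_fun setT (fun m : M => (origin, m) : E) by exact: measurable_fun_pair.
  rewrite (_ : N = (fun u : M * C => dot delta (stat (origin, u.1) u.2)) @^-1` [set~ 0%R]); last by apply/seteqP; split.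
  rewrite -[Y in measurable Y]setTI; apply: measurable_dot => //.
    exact: (measurableT_comp mo).
  exact: measurableC.
have [m0 _] : exists m : M, True.
  apply: contrapT => none; have e : [set: M] = set0 by apply/seteqP; split => // y _; apply: none; exists y.
  have := @probability_setT _ _ _ lm; rewrite e measure0 => /eqP.
  by rewrite eqe eq_sym oner_eq0.
have good : {ae P, forall phi, ~ finite_config phi /\ forall w, pts phi w -> w.1 <> origin}.
  pose eta : C := csingle (origin, m0).
  have fe : finite_config eta by exact: finite_csingle.
  have b1 := bounded_ball 1.
  apply: filterS2 P_infinite (P_ae_restr b1 (Q_avoids b1 fe)) => phi ip va; split => // w pw w0.
  have bh := bounded_halo0 fe.
  apply: (vacant_notin (z := w) bh va); last by apply/halo0E; exists (origin, m0).
  by split => //; split => //=; rewrite w0; apply: eballxx.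
case: good => [N2 [mN2 PN2 gN2]].
case: Ident => l [A [Am [pl hA _ pos inj]]].
have pick (i : 'I_l) : exists u : M * C, (Am i `*` A i) u /\ ~ N u /\ ~ N2 u.2.
  apply: contrapT => none; have [mAi _ mAmi] := hA i.
  have : (lm \x P) (Am i `*` A i) = 0.
    apply: (@subset_measure0 _ _ _ _ _ (N `|` setT `*` N2)) => //.
    - exact: measurableX.
    - by apply: measurableU => //; exact: measurableX.
    - move=> u Au; apply: contrapT => h; apply: none; exists u; split => //; split => hu; apply: h.
        by left.
      by right.
    - apply/eqP; rewrite eq_le measure_ge0 andbT.
      apply: (le_trans (measureU2 _ _ _)) => //; first exact: measurableX.
      rewrite [Y in Y + _]nullN add0e [leLHS](product_measure1E lm P measurableT mN2).
      by rewrite [Y in _ * Y]PN2 mule0.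
  by move=> e; have := pos i; rewrite e ltxx.
have [u hu] := choice pick.
have injM := inj (fun i : 'I_l => (u i).1) (fun i : 'I_l => (u i).2) (fun i : 'I_l => (hu i).1).
have : delta^T = 0%R.
  apply: injM; rewrite mulmx0; apply/matrixP => i j; rewrite !mxE.
  have [_ [nN nN2]] := hu i.
  have [inf0 no0] : ~ finite_config (u i).2 /\ forall w, pts (u i).2 w -> w.1 <> origin.
    by apply: contrapT => h; apply: nN2; exact: gN2.
  have : dot delta (stat (origin, (u i).1) (u i).2) = 0%R by apply: contrapT => h; exact: nN.
  rewrite /dot => e; rewrite -[RHS]e; apply: eq_bigr => k _.
  rewrite [(\matrix_(_, _) _) i k]mxE [trmx delta k j]mxE mulrC (ord1 j).
  by rewrite /at_origin (stat_givenE (z := (origin, (u i).1)) inf0 no0).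
by move=> /(congr1 trmx); rewrite trmxK trmx0.
Qed.

Local Close Scope ereal_scope.

(** * The pseudolikelihood, cell by cell *)

(** The observation window without its upper and right edges, which the
    cells tile exactly. *)
Definition field (n : nat) : set (plane R) := [set x | grid Dtilde x \in square n].

Lemma fieldE n : field n = \big[setU/set0]_(b <- square n) box Dtilde b.
Proof.
rewrite -bigcup_seq; apply/seteqP; split => x /=; first by move=> h; exists (grid Dtilde x).
by move=> [b /= bn e]; rewrite /field/= (e : grid Dtilde x = b).
Qed.

Lemma measurable_field n : measurable (field n).
Proof. by rewrite fieldE; apply: bigsetU_measurable => b _; exact: measurable_box. Qed.

Definition edge (k : int) : set (plane R) :=
  [set Dtilde * (k%:~R + 2^-1)] `*` setT `|` setT `*` [set Dtilde * (k%:~R + 2^-1)].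

Definition edges : set (plane R) := \bigcup_k edge k.

Lemma measurable_edges : measurable edges.
Proof.
apply: countable_bigcupT_measurable; first exact: countableP.
by move=> k; apply: measurableU; apply: measurableX.
Qed.

Lemma edges_null : lebesgue2 edges = 0%E.
Proof.
apply: measure_negligible; first exact: measurable_edges.
rewrite (_ : edges = \bigcup_n oapp edge set0 (choice.unpickle n : option int)); last first.
  apply/seteqP; split => x [k _ ek]; first by exists (choice.pickle k) => //; rewrite choice.pickleK.
  by move: ek; case: choice.unpickle => //= k' ek'; exists k'.
apply: negligible_bigcup => n; case: choice.unpickle => [k|] /=; last exact: negligible_set0.
apply: negligibleU.
  by exists ([set Dtilde * ((k%:~R : R) + 2^-1)] `*` setT); split => //; [exact: measurableX|exact: lebesgue2_column].
by exists (setT `*` [set Dtilde * ((k%:~R : R) + 2^-1)]); split => //; [exact: measurableX|exact: lebesgue2_row].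
Qed.

Lemma window_field n x : ~ edges x -> window Dtilde n x <-> field n x.
Proof.
move=> nx; split; last first.
  rewrite /field/= mem_square => xn; exists (grid Dtilde x) => //.
  have : box Dtilde (grid Dtilde x) x by [].
  by rewrite boxE// => -[]; rewrite /= !in_itv/= => /andP[h1 /ltW h2] /andP[h3 /ltW h4]; split; apply/andP.
move=> [i /= iN [/andP[h1 h2] /andP[h3 h4]]].
have strict (k : int) (c : R) : (c = Dtilde * (k%:~R + 2^-1) -> edges x) ->
    c <= Dtilde * (k%:~R + 2^-1) -> c < Dtilde * (k%:~R + 2^-1).
  move=> hk; rewrite le_eqVlt => /orP[/eqP e|//]; by case: nx; exact: hk.
have : box Dtilde i x.
  rewrite boxE//; split; rewrite /= in_itv/= ?h1 ?h3/=.
    by apply: strict h2 => e; exists i.1 => //; left.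
  by apply: strict h4 => e; exists i.2 => //; right.
by rewrite /field/box/= => ->; rewrite mem_square.
Qed.

Lemma bounded_field n : bounded_borel (field n).
Proof.
split; first exact: measurable_field.
pose r : R := Dtilde * (n%:R + 1).
exists (r + r) => x; rewrite /field/= => xn.
have : box Dtilde (grid Dtilde x) x by [].
rewrite boxE//; move: xn; move: (grid Dtilde x) => b.
rewrite mem_square ge_max -!(ler_int R) !intr_norm => /andP[b1 b2] [/=].
rewrite !in_itv/= => /andP[h1 h2] /andP[h3 h4].
have d0 := Dtilde_gt0.
move: b1 b2; rewrite !ler_norml -!pmulrn => /andP[b1 b1'] /andP[b2 b2'].
have a1 : `|(x.1 : R)| <= r by rewrite /r ler_norml; apply/andP; split; nra.
have a2 : `|(x.2 : R)| <= r by rewrite /r ler_norml; apply/andP; split; nra.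
have r0 : 0 <= r by exact: le_trans a1.
apply/eballE; split; rewrite /= ?subr0 ?addr_ge0//.
rewrite -[((x.1 : R) ^+ 2)]real_normK ?num_real// -[((x.2 : R) ^+ 2)]real_normK ?num_real//.
have q1 : `|(x.1 : R)| ^+ 2 <= r ^+ 2 by rewrite lerXn2r ?nnegrE.
have q2 : `|(x.2 : R)| ^+ 2 <= r ^+ 2 by rewrite lerXn2r ?nnegrE.
have := sqr_ge0 r; nra.
Qed.

Lemma P_off_null A : measurable A -> lebesgue2 A = 0%E ->
  {ae P, forall phi, forall z, pts phi z -> ~ A z.1}.
Proof.
move=> mA A0.
suff H : {ae P, forall phi, forall n, forall z, pts phi z -> window_ball n z.1 -> ~ A z.1}.
  by apply: filterS H => phi h z pz; have [n zn] := in_ball z.1; exact: (h n).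
apply/ae_foralln => n.
have bA : bounded_borel (window_ball n `&` A) by apply: bounded_borelI => //; exact: bounded_ball.
have h : {ae Q (window_ball n), forall psi, vacant (window_ball n `&` A) psi}.
  have mV := measurable_vacant bA; exists (~` vacant (window_ball n `&` A)); split => //.
    by apply: measurableC; exact: mV.
  apply: probability_setC0; first exact: mV.
  have bW : bounded_window ((window_ball n `&` A) `*` [set: M]) := bounded_windowX bA.
  rewrite /vacant (poisson_one 0 (Q_poisson (bounded_ball n)) bW) /rate.
  have -> : intensity lm ((window_ball n `&` A) `*` [set: M] `&` window_ball n `*` [set: M]) = 0%E.
    apply: (intensity_null _ mA _ A0); last by move=> z [[[_ Az] _] _]; split.
    by apply: measurableI; apply: measurableX => //; [case: bA|case: (bounded_ball n)].
  by rewrite poisson_weight0.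
apply: filterS (P_ae_restr (bounded_ball n) h) => phi va z pz zn Az.
by apply: (vacant_notin (z := z) bA va) => //; split.
Qed.

Lemma field_sum n (f : E * C -> R) phi :
  \sum_(z <- listing (field n `*` setT) phi) f (z, cremove phi z) =
  \sum_(b <- square n) \sum_(z <- listing (box Dtilde b `*` setT) phi) f (z, cremove phi z).
Proof.
have bF := bounded_windowX (bounded_field n).
have e (b : int * int) : b \in square n ->
    \sum_(z <- listing (box Dtilde b `*` setT) phi) f (z, cremove phi z) =
    \sum_(z <- listing (field n `*` setT) phi | z \in box Dtilde b `*` [set: M]) f (z, cremove phi z).
  move=> bn; apply: listing_sumS => //.
    by apply: measurableX => //; exact: measurable_box.
  by move=> z [/= zb _]; split => //; rewrite /field/= (zb : grid Dtilde z.1 = b).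
rewrite [RHS]big_seq; under [RHS]eq_bigr => b bn do rewrite (e b bn) big_mkcond/=.
rewrite -big_seq exchange_big/= [LHS]big_seq [RHS]big_seq; apply: eq_bigr => z.
rewrite mem_listing// => /andP[_ /set_mem[/= zn _]].
rewrite (bigD1_seq (grid Dtilde z.1) zn (square_uniq n))/=.
rewrite mem_set// big1 ?addr0// => b bz; rewrite memNset// => -[/= zb _].
by move: bz; rewrite -(zb : grid Dtilde z.1 = b) eqxx.
Qed.

Lemma box_to_cell (b : int * int) x : box Dtilde b x <-> cell0 (shift (to_cell b) x).
Proof.
rewrite /cell0 !boxE// /shift /to_cell; split; move=> [/=]; rewrite !in_itv/= !add0r ?sub0r => /andP[? ?] /andP[? ?]; split; apply/andP; split; lra.
Qed.

Lemma mshift_inj (a : plane R) : injective (@mshift R dM M a).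
Proof. by move=> [[x1 x2] m] [[y1 y2] n]; rewrite /mshift /shift/= => -[/addIr-> /addIr-> ->]. Qed.

Lemma cell_sum (b : int * int) (f : E * C -> R) phi :
  (forall z chi, f (mshift (to_cell b) z, translate (to_cell b) chi) = f (z, chi)) ->
  \sum_(z <- listing (box Dtilde b `*` setT) phi) f (z, cremove phi z) =
  \sum_(z <- listing (cell0 `*` setT) (tau b phi)) f (z, cremove (tau b phi) z).
Proof.
move=> ef.
have bb : bounded_window (box Dtilde b `*` [set: M]).
  apply: bounded_windowX; split; first exact: measurable_box.
  have [_ [r hr]] := bounded_field (absz b.1 + absz b.2); exists r => x xb; apply: hr.
  rewrite /field/= (xb : grid Dtilde x = b) mem_square ge_max PoszD !abszE.
  by rewrite lerDl lerDr !normr_ge0.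
have b0 := bounded_windowX cell0_bounded.
pose g z := mshift (to_cell b) z.
rewrite [RHS](perm_big (map g (listing (box Dtilde b `*` setT) phi))); last first.
  apply: uniq_perm; rewrite ?listing_uniq// ?map_inj_uniq ?listing_uniq//; try exact: mshift_inj.
  move=> w; rewrite mem_listing//; apply/idP/mapP.
    move=> /andP[/set_mem[z pz <-] /set_mem[/= zc _]]; exists z => //.
    rewrite mem_listing//; apply/andP; split; first exact: mem_set.
    by apply: mem_set; split => //; apply/box_to_cell.
  move=> [z]; rewrite mem_listing// => /andP[/set_mem pz /set_mem[/= zb _]] ->.
  apply/andP; split; apply: mem_set; first by exists z.
  by split => //; exact: ((box_to_cell b z.1).1 zb).
rewrite big_map; apply: eq_bigr => z _; rewrite -(ef z); congr (f (_, _)).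
apply: config_eq; apply/seteqP; split => w /=.
  by move=> [u [pu uz] <-]; split; [exists u|move=> /mshift_inj].
by move=> [[u pu <-] nz]; exists u => //; split => // uz; apply: nz; rewrite uz.
Qed.

Definition cell_energy theta phi : R := \int[mu]_z expR (- dot theta (stat z phi)).

Lemma cell_energy_integrable theta phi : Theta theta -> tame phi ->
  mu.-integrable setT (EFin \o (fun z => expR (- dot theta (stat z phi)))).
Proof.
move=> tT tp; apply: (bounded_integrable (B := expR K)).
- exact: mark_window_finite.
- apply: (measurableT_comp (@measurable_expR R)); apply: measurable_funN.
  by apply: measurable_dot.
- by move=> z; rewrite ger0_norm ?expR_ge0// ler_expR lerNl; exact: stat_stable.
Qed.

Definition cell_stat i phi : R := visits cell0 (part 1 i) phi - visits cell0 (part (-1) i) phi.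

Definition drift i phi : R := Acell (part 1 i) phi - Acell (part (-1) i) phi.

Lemma cint_part_le s i u : `|cintensity u * part s i u| <= expR K / eps.
Proof.
rewrite ger0_norm; last exact: mulr_ge0 (cintensity_ge0 _) (part_ge0 _ _ _).
apply: (@le_trans _ _ (cintensity u * (slack u / eps))).
  by rewrite ler_wpM2l ?cintensity_ge0 ?part_le.
by rewrite mulrA ler_wpM2r ?invr_ge0 ?(ltW eps_gt0)// mulrC slack_exp_le.
Qed.

(** The convexity gap of the exponential, multiplied by the conditional
    intensity and integrated over a cell. *)
Lemma cell_energy_lower (B : R) theta phi : 1 <= B -> Theta theta -> tame phi ->
  (forall i, `|(theta - thetastar) ord0 i| <= B) ->
  cell_energy thetastar phi - \sum_i (theta - thetastar) ord0 i * drift i phi +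
    (4 * B)^-1 * Acell (quad (theta - thetastar)) phi <= cell_energy theta phi.
Proof.
move=> B1 tT tp; set delta := theta - thetastar => dB.
have is0 := cell_energy_integrable thetastar_Theta tp.
have ip s i := cell_integrable phi (measurable_part s i) (cint_part_le s i).
have id i : mu.-integrable setT (EFin \o (fun z => cintensity (z, phi) * part 1 i (z, phi) -
    cintensity (z, phi) * part (-1) i (z, phi))).
  exact: (integrableB measurableT (ip 1 i) (ip (-1) i)).
have iq := cell_integrable phi (measurable_quad delta) (cint_bounded (B := (\sum_(i < p) `|delta ord0 i|) ^+ 2) _).
have {}iq : mu.-integrable setT (EFin \o (fun z => cintensity (z, phi) * quad delta (z, phi))).
  by apply: iq => u; rewrite ger0_norm ?quad_ge0//; exact: quad_le.
have [il el] := Rintegral_lincomb (index_enum _) (fun i => delta ord0 i) id.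
have driftE i : drift i phi = \int[mu]_z (cintensity (z, phi) * part 1 i (z, phi) -
    cintensity (z, phi) * part (-1) i (z, phi)).
  by rewrite RintegralB//; [exact: ip|exact: ip].
have -> : \sum_i delta ord0 i * drift i phi = \int[mu]_z (\sum_i delta ord0 i *
    (cintensity (z, phi) * part 1 i (z, phi) - cintensity (z, phi) * part (-1) i (z, phi))).
  by rewrite el; apply: eq_bigr => i _; rewrite driftE.
have i1 := integrableB measurableT is0 il.
have i2 := integrableZl measurableT (4 * B)^-1 iq.
rewrite -[Acell _ _]/(\int[mu]_z (cintensity (z, phi) * quad delta (z, phi))).
rewrite -RintegralZl// -RintegralB// -RintegralD//; apply: le_Rintegral => //.
- exact: (integrableD measurableT i1 i2).
- exact: cell_energy_integrable.
move=> z _; rewrite -cintensityE//.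
set s := stat z phi; pose S := \sum_(j < p) `|s ord0 j|.
have S0 : 0 <= S by exact: sumr_ge0.
have xB : `|dot delta s| <= B * S.
  rewrite /dot mulr_sumr; apply: (le_trans (ler_norm_sum _ _ _)); apply: ler_sum => i _.
  by rewrite normrM ler_wpM2r.
have -> : expR (- dot theta s) = cintensity (z, phi) * expR (- dot delta s).
  rewrite cintensityE// -expRD; congr expR; rewrite /dot -!sumrN -big_split/=.
  by apply: eq_bigr => i _; rewrite !mxE/= -/s; ring.
have -> : \sum_i delta ord0 i * (cintensity (z, phi) * part 1 i (z, phi) -
    cintensity (z, phi) * part (-1) i (z, phi)) = cintensity (z, phi) * dot delta s.
  rewrite /dot mulr_sumr; apply: eq_bigr => i _.
  by rewrite -mulrBr tame_part// mulrCA.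
have -> : quad delta (z, phi) = (dot delta s / (1 + S)) ^+ 2.
  rewrite /quad /dot mulr_suml; congr (_ ^+ 2); apply: eq_bigr => i _.
  by rewrite /damped mulrA.
have := ler_wpM2l (cintensity_ge0 (z, phi)) (expR_quad_lower B1 S0 xB).
apply: le_trans; rewrite le_eqVlt; apply/orP; left; apply/eqP; ring.
Qed.

Local Open Scope ereal_scope.

Lemma places_null phi : exists A, [/\ measurable A, lebesgue2 A = 0 &
  forall z, pts phi z -> A z.1].
Proof.
have fin n : finite_config (restr (window_ball n) phi).
  by apply: (sub_finite_set _ (finite_pts phi (bounded_windowX (bounded_ball n)))).
exists (\bigcup_n halo 0 (restr (window_ball n) phi)); split.
- by apply: bigcupT_measurable => n; case: (halo0_null (fin n)).
- by apply: null_bigcup => n; case: (halo0_null (fin n)).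
- by move=> z pz; have [n zn] := in_ball z.1; exists n => //; apply/halo0E; exists z.
Qed.

Lemma cell_energy_box (b : int * int) theta phi : Theta theta -> tame phi ->
  \int[intensity lm]_(z in box Dtilde b `*` setT) (expR (- dot theta (stat z phi)))%:E =
  (cell_energy theta (tau b phi))%:E.
Proof.
move=> tT tp; have tt : tame (tau b phi) by exact: tame_translate.
rewrite /cell_energy /Rintegral fineK; last exact: (integrable_fin_num measurableT (cell_energy_integrable tT tt)).
have me phi' : measurable_fun setT (fun z => (expR (- dot theta (stat z phi')))%:E).
  apply/measurable_EFinP; apply: (measurableT_comp (@measurable_expR R)); apply: measurable_funN.
  by apply: measurable_dot.
rewrite (integral_window lm (bounded_windowX cell0_bounded) (me _)); last by move=> z; rewrite lee_fin expR_ge0.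
have mc : measurable (cell0 `*` [set: M]) by apply: measurableX => //; exact: measurable_box.
rewrite integral_mkcond [RHS]integral_mkcond.
rewrite [RHS](ge0_integral_law (measurable_mshift (to_cell b))
    (fun A mA => esym (intensity_shift lm (to_cell b) mA))); first last.
- by move=> z; rewrite patchE; case: ifP => // _; rewrite lee_fin expR_ge0.
- by apply/(measurable_restrictT _ mc); exact: (measurable_funS measurableT).
apply: eq_integral => z _; rewrite !patchE stat_translate.
congr (if _ then _ else _); apply/idP/idP => /set_mem[/= h _]; apply/mem_set; split => //.
  exact: ((box_to_cell b z.1).1 h).
exact: ((box_to_cell b z.1).2 h).
Qed.

(** Up to the edges and to the places of the points, the pseudolikelihood
    is a sum over the cells of a function of the configuration seen from
    the cell. *)
Lemma lpl_cells n theta phi : Theta theta -> tame phi -> simple phi ->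
  ~ finite_config phi -> (forall z, pts phi z -> ~ edges z.1) ->
  log_pseudolikelihood lm v D (window Dtilde n) phi theta =
  (- \sum_(b <- square n) cell_energy theta (tau b phi) -
    \sum_i theta ord0 i * \sum_(b <- square n) cell_stat i (tau b phi))%:E.
Proof.
move=> tT tp sp ip np; rewrite /log_pseudolikelihood.
have -> : \int[intensity lm]_(z in window Dtilde n `*` setT)
    (expR (- energy_given v D theta (csingle z) phi))%:E =
    (\sum_(b <- square n) cell_energy theta (tau b phi))%:E.
  have [A [mA A0 Aphi]] := places_null phi.
  have mN : measurable ((edges `|` A) `*` [set: M]).
    by apply: measurableX => //; apply: measurableU => //; exact: measurable_edges.
  have N0 : intensity lm ((edges `|` A) `*` [set: M]) = 0.
    rewrite intensityX//; last by apply: measurableU => //; exact: measurable_edges.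
    by rewrite measureU0 ?edges_null ?mul0e//; exact: measurable_edges.
  rewrite integral_mkcond (ge0_integral_off_null (g := (fun z => (expR (- dot theta (stat z phi)))%:E)
      \_ (field n `*` setT)) mN N0); first last.
  - move=> z nz; rewrite !patchE.
    have ez : ~ edges z.1 by move=> h; apply: nz; split => //; left.
    have Az : ~ A z.1 by move=> h; apply: nz; split => //; right.
    have -> : (z \in window Dtilde n `*` setT) = (z \in field n `*` setT).
      by apply/idP/idP => /set_mem[/= h _]; apply/mem_set; split => //; apply/(window_field n ez).
    by rewrite energy_givenE// => w pw e; apply: Az; rewrite -e; exact: Aphi.
  - by move=> z; rewrite patchE; case: ifP => // _; rewrite lee_fin expR_ge0.
  - by move=> z; rewrite patchE; case: ifP => // _; rewrite lee_fin expR_ge0.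
  rewrite -integral_mkcond.
  have -> : field n `*` [set: M] = \big[setU/set0]_(b <- square n) (box Dtilde b `*` [set: M]).
    rewrite -bigcup_seq; apply/seteqP; split => z; first by move=> [/= zn _]; exists (grid Dtilde z.1).
    by move=> [b /= bn [/= e _]]; split => //; rewrite /field/= (e : grid Dtilde z.1 = b).
  have mb b : measurable (box Dtilde b `*` [set: M]) by apply: measurableX => //; exact: measurable_box.
  rewrite (ge0_integral_bigsetU _ mb (square_uniq n)).
  - rewrite -sumEFin; apply: eq_bigr => b _; exact: cell_energy_box.
  - by move=> b b' _ _ [z [[/= <- _] [/= <- _]]].
  - apply: (@measurable_funS _ _ _ _ setT) => //.
    apply/measurable_EFinP; apply: (measurableT_comp (@measurable_expR R)); apply: measurable_funN.
    by apply: measurable_dot.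
  - by move=> z _; rewrite lee_fin expR_ge0.
rewrite EFinB EFinN; congr (_ - _%:E).
have bF := bounded_windowX (bounded_field n).
have -> : pts (restr (window Dtilde n) phi) = pts phi `&` (field n `*` setT).
  apply/seteqP; split => z [pz [/= h _]]; split => //; split => //; exact/(window_field n (np z pz)).
rewrite fsbig_finite; last exact: finite_pts.
transitivity (\sum_(z <- listing (field n `*` setT) phi) dot theta (stat z (cremove phi z)))%R.
  rewrite [LHS]big_seq [RHS]big_seq; apply: eq_bigr => z.
  rewrite mem_listing// => /andP[/set_mem pz _]; apply: energy_givenE.
    move=> fr; apply: ip; apply: (@sub_finite_set _ _ ([set z] `|` pts (cremove phi z))).
      by move=> w pw; have [->|wz] := pselect (w = z); [left|right].
    by rewrite finite_setU; split.
  by move=> w [pw wz] e; apply: wz; exact: sp.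
rewrite /dot exchange_big/=; apply: eq_bigr => i _; rewrite -mulr_sumr; congr (_ * _)%R.
rewrite (field_sum n (fun u => stat u.1 u.2 ord0 i)); apply: eq_bigr => b _.
rewrite (cell_sum (f := fun u => stat u.1 u.2 ord0 i)); last by move=> z chi; rewrite /= stat_translate.
rewrite /cell_stat /visits -sumrB; apply: eq_bigr => z _.
have tt : tame (cremove (tau b phi) z).
  have sub : pts (cremove (tau b phi) z) `<=` pts (tau b phi) by move=> w [].
  exact: (tame_sub sub (tame_translate (a := to_cell b) tp)).
exact: (esym (tame_part z i tt)).
Qed.

Local Close Scope ereal_scope.

(** * Consistency *)

Hypothesis Theta_compact : compact Theta.
Context (mple : nat -> C -> 'rV[R]_p).
Hypothesis mpleP : {ae P, forall phi, forall n,
  maximizes_lpl lm v Theta D (window Dtilde n) phi (mple n phi)}.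

Lemma Theta_radius : exists2 B : R, 1 <= B &
  forall theta, Theta theta -> forall i, `|(theta - thetastar) ord0 i| <= B.
Proof.
have [B0 [_ hB]] := compact_bounded Theta_compact.
pose B1 := Num.max B0 0 + 1.
have hT theta : Theta theta -> `|theta| <= B1.
  by apply: hB; rewrite /B1 ltr_pwDr// le_max lexx.
exists (Num.max 1 (B1 + B1)); first by rewrite le_max lexx.
move=> theta tT i; rewrite le_max; apply/orP; right.
have coord (a : 'rV[R]_p) : `|a ord0 i| <= `|a|.
  by rewrite [leRHS]mx_normrE; apply: (le_bigmax _ (fun ij => `|a ij.1 ij.2|) (ord0, i)).
by apply: (le_trans (coord _)); apply: (le_trans (ler_normB _ _)); apply: lerD; apply: hT => //; exact: thetastar_Theta.
Qed.

Let N n : R := (size (square n))%:R.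

Let N_gt0 n : 0 < N n. Proof. by rewrite ltr0n size_square. Qed.

Let form_error kl n phi : R :=
  (\sum_(b <- square n) (cell_form kl (tau b phi) - resample (cell_form kl) (tau b phi))) / N n.

Let stat_error i n phi : R :=
  (\sum_(b <- square n) (cell_stat i (tau b phi) - drift i (tau b phi))) / N n.

Lemma stat_error_cvg : {ae P, forall phi, forall i, stat_error i n phi @[n --> \oo] --> (0 : R)}.
Proof.
suff H : {ae P, forall phi, forall j, forall i, choice.unpickle j = Some i ->
    stat_error i n phi @[n --> \oo] --> (0 : R)}.
  by apply: filterS H => phi h i; apply: (h (choice.pickle i)); exact: choice.pickleK.
apply/ae_foralln => j; case: (choice.unpickle j : option 'I_p) => [i|]; last exact: aeW.
apply: filterS2 (innovation_lln 1 i) (innovation_lln (-1) i) => phi c1 c2 _ [<-].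
rewrite -[0 : R](subr0 0).
have -> : (fun n => stat_error i n phi) = fun n =>
   (\sum_(b <- square n) (visits cell0 (part 1 i) (tau b phi) - Acell (part 1 i) (tau b phi))) / N n -
   (\sum_(b <- square n) (visits cell0 (part (-1) i) (tau b phi) - Acell (part (-1) i) (tau b phi))) / N n.
  apply/funext => n; rewrite -mulrBl -sumrB; congr (_ / _); apply: eq_bigr => b _.
  by rewrite /cell_stat /drift; ring.
exact: (cvgB c1 c2).
Qed.

(** At a maximizer, the quadratic term is at most the linear one; both are
    replaced by averages that tend to zero and by the deterministic
    quadratic form. *)
Lemma maximizer_bound (B Z : R) n phi theta : 1 <= B -> 0 < Z -> Theta theta ->
  (forall i, `|(theta - thetastar) ord0 i| <= B) ->
  tame phi -> simple phi -> ~ finite_config phi -> (forall z, pts phi z -> ~ edges z.1) ->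
  (forall b, tame (tau b phi)) ->
  (forall b delta, floor_quad delta <=
     Z * \sum_kl (delta ord0 kl.1 * delta ord0 kl.2) * resample (cell_form kl) (tau b phi)) ->
  (log_pseudolikelihood lm v D (window Dtilde n) phi thetastar <=
   log_pseudolikelihood lm v D (window Dtilde n) phi theta)%E ->
  floor_quad (theta - thetastar) <=
  Z * (\sum_kl B ^+ 2 * `|form_error kl n phi| + 4 * B * \sum_i B * `|stat_error i n phi|).
Proof.
move=> B1 Z0 tT dB tp sp ip np tb fl.
rewrite !lpl_cells//; last exact: thetastar_Theta.
rewrite lee_fin; set delta := theta - thetastar => lpl.
have B0 : 0 < B by exact: lt_le_trans B1.
have cell b := cell_energy_lower B1 tT (tb b) dB.
have low : \sum_(b <- square n) (cell_energy thetastar (tau b phi) -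
      \sum_i delta ord0 i * drift i (tau b phi) + (4 * B)^-1 * Acell (quad delta) (tau b phi)) <=
    \sum_(b <- square n) cell_energy theta (tau b phi) by apply: ler_sum => b _; exact: cell.
pose SQ := \sum_(b <- square n) Acell (quad delta) (tau b phi).
have h1 : (4 * B)^-1 * SQ + \sum_i delta ord0 i * (N n * stat_error i n phi) <= 0.
  move: low; rewrite big_split/= big_split/= sumrN exchange_big/= -mulr_sumr -/SQ => low.
  have -> : \sum_i delta ord0 i * (N n * stat_error i n phi) =
     \sum_i theta ord0 i * \sum_(b <- square n) cell_stat i (tau b phi) -
     \sum_i thetastar ord0 i * \sum_(b <- square n) cell_stat i (tau b phi) -
     \sum_i \sum_(b <- square n) delta ord0 i * drift i (tau b phi).
    rewrite -!sumrB; apply: eq_bigr => i _.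
    rewrite /stat_error [N n * _]mulrC divfK ?gt_eqF// -mulr_sumr sumrB !mxE; ring.
  by lra.
have h2 : N n * floor_quad delta <= Z * (SQ - N n * \sum_kl (delta ord0 kl.1 * delta ord0 kl.2) * form_error kl n phi).
  have -> : SQ - N n * \sum_kl (delta ord0 kl.1 * delta ord0 kl.2) * form_error kl n phi =
      \sum_(b <- square n) \sum_kl (delta ord0 kl.1 * delta ord0 kl.2) * resample (cell_form kl) (tau b phi).
    rewrite /SQ; under eq_bigr do rewrite cell_formE.
    rewrite exchange_big/= [RHS]exchange_big/= mulr_sumr -sumrB; apply: eq_bigr => kl _.
    rewrite -!mulr_sumr /form_error sumrB mulrCA [N n * _]mulrC divfK ?gt_eqF//; ring.
  have -> : N n * floor_quad delta = \sum_(b <- square n) floor_quad delta.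
    by rewrite big_const_seq count_predT iter_addr_0 -mulr_natl.
  rewrite mulr_sumr; apply: ler_sum => b _; exact: fl.
have h3 : - \sum_kl (delta ord0 kl.1 * delta ord0 kl.2) * form_error kl n phi <=
    \sum_kl B ^+ 2 * `|form_error kl n phi|.
  rewrite -sumrN; apply: ler_sum => kl _; apply: (le_trans (ler_norm _)).
  by rewrite normrN normrM normrM ler_wpM2r// expr2 ler_pM.
have h4 : - \sum_i delta ord0 i * stat_error i n phi <= \sum_i B * `|stat_error i n phi|.
  rewrite -sumrN; apply: ler_sum => i _; apply: (le_trans (ler_norm _)).
  by rewrite normrN normrM ler_wpM2r.
have h5 : SQ <= N n * (4 * B * \sum_i B * `|stat_error i n phi|).
  have : SQ <= 4 * B * (N n * - \sum_i delta ord0 i * stat_error i n phi).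
    move: h1; under eq_bigr do rewrite mulrCA; rewrite -mulr_sumr.
    rewrite -lerBrDr sub0r -mulrN ler_pdivrMl ?mulr_gt0//.
  move=> h; apply: (le_trans h); rewrite mulrCA ler_pM2l// ler_pM2l ?mulr_gt0//.
rewrite -(ler_pM2l (N_gt0 n)); apply: (le_trans h2).
rewrite mulrCA ler_pM2l// mulrDr addrC -mulrN; apply: lerD => //.
by rewrite ler_pM2l.
Qed.

Lemma floor_quad_continuous : continuous (fun theta => floor_quad (theta - thetastar)).
Proof.
move=> theta; rewrite /floor_quad.
have co i : (fun t : 'rV[R]_p => (t - thetastar) ord0 i) t @[t --> theta] --> (theta - thetastar) ord0 i.
  rewrite (_ : (fun t => _) = fun t : 'rV[R]_p => t ord0 i - thetastar ord0 i); last by apply/funext => t; rewrite !mxE.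
  rewrite !mxE; exact: (cvgB (@coord_continuous R 1 p ord0 i theta) (cvg_cst _)).
apply: (@cvg_sumr R _ (nbhs theta) _) => kl; apply: cvgM; last exact: cvg_cst.
by apply: cvgM; exact: co.
Qed.

Lemma mple_cvg : {ae P, forall phi, mple n phi @[n --> \oo] --> thetastar}.
Proof.
have [B B1 dB] := Theta_radius; have [Z Z0 fl] := resample_lower.
have good : {ae P, forall phi, tame phi /\ simple phi /\ ~ finite_config phi}.
  by apply: filterS3 P_tame P_simple P_infinite.
have lln : {ae P, forall phi, (forall kl, form_error kl n phi @[n --> \oo] --> (0 : R)) /\
    (forall i, stat_error i n phi @[n --> \oo] --> (0 : R))}.
  by apply: filterS2 cell_form_lln stat_error_cvg.
have tile : {ae P, forall phi, (forall b, tame (tau b phi)) /\ forall b delta, floor_quad delta <=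
     Z * \sum_kl (delta ord0 kl.1 * delta ord0 kl.2) * resample (cell_form kl) (tau b phi)}.
  by apply: filterS2 (ae_tau P_tame) (ae_tau fl).
have {}good : {ae P, forall phi, (tame phi /\ simple phi /\ ~ finite_config phi) /\
    (forall z, pts phi z -> ~ edges z.1) /\
    (forall kl, form_error kl n phi @[n --> \oo] --> (0 : R)) /\
    (forall i, stat_error i n phi @[n --> \oo] --> (0 : R))}.
  by apply: filterS3 good (P_off_null measurable_edges edges_null) lln.
apply: filterS3 mpleP good tile => phi mp [[tp [sp ip]] [np [c1 c2]]] [tb flb].
apply: (compact_cvg_to_zero (A := Theta) (g := fun theta => floor_quad (theta - thetastar))
  (e := fun n => Z * (\sum_kl B ^+ 2 * `|form_error kl n phi| + 4 * B * \sum_i B * `|stat_error i n phi|))).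
- exact: Theta_compact.
- exact: floor_quad_continuous.
- by move=> theta ne; apply: floor_quad_gt0 => /eqP; rewrite subr_eq0 => /eqP.
- by move=> n; case: (mp n).
- move=> n; have [tT mx] := mp n.
  by apply: maximizer_bound => //; [exact: dB|exact: mx thetastar_Theta].
have n0 (f : nat -> R) : f n @[n --> \oo] --> (0 : R) -> `|f n| @[n --> \oo] --> (0 : R).
  by move=> f0; rewrite -(normr0 R); exact: cvg_norm.
have z0 (I : finType) (c : R) (f : I -> nat -> R) : (forall k, f k n @[n --> \oo] --> (0 : R)) ->
    (\sum_k c * `|f k n|) @[n --> \oo] --> (0 : R).
  move=> h; have : (\sum_k c * `|f k n|) @[n --> \oo] --> \sum_(k : I) c * (0 : R).
    by apply: (@cvg_sumr R _ \oo _) => k; apply: cvgMl_tmp; exact: n0.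
  by rewrite big1// => k _; rewrite mulr0.
have s1 := z0 _ (B ^+ 2) _ c1; have s2 := z0 _ B _ c2.
rewrite [X in _ --> X](_ : 0 = Z * (0 + 4 * B * 0)); last by rewrite !mulr0 addr0 mulr0.
apply: cvgMl_tmp; apply: cvgD; first exact: s1.
exact: cvgMl_tmp s2.
Qed.

End mple_consistency.

Theorem theorem1 (R : realType) (dM : measure_display) (M : measurableType dM)
    (lm : probability M R) (p : nat) (v : config R M -> 'rV[R]_p)
    (Theta : set 'rV[R]_p) (thetastar : 'rV[R]_p) (D Dtilde : R)
    (Q : set (plane R) -> probability (config R M) R)
    (P : probability (config R M) R)
    (mple : nat -> config R M -> 'rV[R]_p)
    (v_measurable : forall i,
       measurable_fun finite_config (fun phi => v phi ord0 i : measurableTypeR R))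
    (v_invariant : translation_invariant v Theta)
    (Theta_compact : compact Theta)
    (thetastar_interior : interior Theta thetastar)
    (D_ge0 : 0 <= D) (Dtilde_gt0 : 0 < Dtilde)
    (Q_poisson : forall L, bounded_borel L -> poisson_law lm L (Q L))
    (P_gibbs : gibbs v Q D thetastar P)
    (P_stationary : stationary P)
    (Mod : model_condition v Theta (admissible v Q D thetastar) D)
    (Ident : identifiability lm v (admissible v Q D thetastar) D P)
    (mpleP : {ae P, forall phi, forall n,
       maximizes_lpl lm v Theta D (window Dtilde n) phi (mple n phi)}) :
  {ae P, forall phi, mple n phi @[n --> \oo] --> thetastar}.
Proof.
have [p0|p_gt0] := posnP p.
  apply: aeW => phi; rewrite (_ : (fun n => mple n phi) = fun=> thetastar); first exact: cvg_cst.
  by apply/funext => n; apply/rowP => -[i ip]; have : (i < 0)%N by rewrite -p0.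
have [K [kappa [k [K_ge0 _ mod]]]] := Mod.
have stability theta m phi : Theta theta -> admissible v Q D thetastar phi ->
    finite_config phi -> - K <= local_energy v theta (at_origin m) phi.
  by move=> tT ap fp; case: (mod theta m phi tT ap fp).
have locality theta m phi : Theta theta -> admissible v Q D thetastar phi ->
    finite_config phi -> local_energy v theta (at_origin m) phi =
    local_energy v theta (at_origin m) (restr (eball origin D) phi).
  by move=> tT ap fp; case: (mod theta m phi tT ap fp).
exact: (mple_cvg v_measurable v_invariant thetastar_interior D_ge0 Q_poisson
  P_gibbs P_stationary K_ge0 stability locality Ident p_gt0 Dtilde_gt0
  Theta_compact mpleP).
Qed.
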